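(* Let $\Omega\subset\mathbb{R}^n$ be a bounded open set, $s\in(0,1)$, $\alpha\in(0,1)$, $g\in C^\alpha_{\rm loc}(\Omega\times\mathbb{R})$, and let $u\in X^1$ be a bounded weak solution of $$-\Delta u+(-\Delta)^su=g(x,u)\quad\text{in }\Omega .$$ Let $V$ be an open domain with $\overline V\subset\Omega$. Then $u\in C^{2,\alpha}(\overline V)$. Furthermore, $$\|u\|_{C^{2,\alpha}(\overline V)}\le C\Big(\|u\|_{L^\infty(\mathbb{R}^n)}+\|g\|_{C^\alpha(\overline V_{3\rho/4}\times{\rm I_u})}\Big)\Big(1+\|g\|_{C^\alpha(\overline V_{3\rho/4}\times{\rm I_u})}\Big),$$ where $\rho:=\mathrm{dist}(V,\partial\Omega)$, $V_\delta:=\{x\in\Omega:\mathrm{dist}(x,V)<\delta\}$, ${\rm I_u}:=[-\|u\|_{L^\infty(\Omega)},\|u\|_{L^\infty(\Omega)}]$, and (for the given $\Omega$) the constant $C>0$ depends only on $n,s,\alpha,V$.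
   Context: Set $[u]_s:=\big(\iint_{\mathbb{R}^{2n}}\frac{|u(x)-u(y)|^2}{|x-y|^{n+2s}}\,dx\,dy\big)^{1/2}$. The space $X^1$ consists of Lebesgue measurable $u:\mathbb{R}^n\to\mathbb{R}$ with $u|_\Omega\in H^1(\Omega)$ and $[u]_s<\infty$; no exterior condition is imposed. ''Bounded'' means $u\in L^\infty(\mathbb{R}^n)$. A weak solution in $\Omega$ is $u\in X^1$ with $$\int_\Omega\nabla u\cdot\nabla\varphi\,dx+\iint_{\mathbb{R}^{2n}}\frac{(u(x)-u(y))(\varphi(x)-\varphi(y))}{|x-y|^{n+2s}}\,dx\,dy=\int_\Omega g(x,u(x))\varphi(x)\,dx\quad\forall\varphi\in C_c^\infty(\Omega)$$ (the normalization constant of the fractional term is set to $1$). $C^\alpha_{\rm loc}(\Omega\times\mathbb{R})$ is the space of functions that are $\alpha$-Hölder continuous on every compact subset of $\Omega\times\mathbb{R}$; $\|\cdot\|_{C^\alpha(K)}$ is the sup norm plus the $\alpha$-Hölder seminorm on $K$. *)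

(* Defs.v *)
From HB Require Import structures.
From mathcomp Require Import all_boot all_order all_algebra.
From mathcomp Require Import all_classical all_reals all_analysis.
Set Implicit Arguments. Unset Strict Implicit. Unset Printing Implicit Defensive.
Import Order.TTheory GRing.Theory Num.Theory.
Import numFieldNormedType.Exports.
Local Open Scope classical_set_scope.
Local Open Scope ring_scope.

(* R^n with the sigma-algebra generated by the coordinates, i.e., its Borel
   sigma-algebra. *)
Definition borel_row (R : realType) (n : nat) : Type := 'rV[R]_n.

HB.instance Definition _ (R : realType) (n : nat) :=
  Pointed.copy (borel_row R n) 'rV[R]_n.

Definition borel_row_display : measure_display.
Proof. exact: default_measure_display. Qed.

Section borel_row.
Context {R : realType} {n : nat}.

Definition row_coord (i : 'I_n) (x : 'rV[R]_n) : measurableTypeR R := x 0 i.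

Definition borel_row_measurable : set (set (borel_row R n)) :=
  g_sigma_preimage row_coord.

Let borel_row_set0 : borel_row_measurable set0.
Proof. exact: sigma_algebra0. Qed.

Let borel_row_setC A : borel_row_measurable A -> borel_row_measurable (~` A).
Proof. exact: sigma_algebraC. Qed.

Let borel_row_bigcup (F : (set (borel_row R n))^nat) :
  (forall i, borel_row_measurable (F i)) ->
  borel_row_measurable (\bigcup_i (F i)).
Proof. exact: sigma_algebra_bigcup. Qed.

HB.instance Definition _ := @isMeasurable.Build borel_row_display
  (borel_row R n) borel_row_measurable borel_row_set0 borel_row_setC
  borel_row_bigcup.

Lemma measurable_row_coord (i : 'I_n) :
  measurable_fun [set: borel_row R n] (row_coord i).
Proof.
move=> _ Y mY; rewrite setTI; apply: sub_sigma_algebra => /=.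
rewrite -bigcup_seq/=; exists i => /=; first by rewrite mem_index_enum.
by exists Y => //; rewrite setTI.
Qed.

Lemma measurable_fun_row d (T : measurableType d) (f : T -> borel_row R n) :
  (forall i, measurable_fun [set: T] (row_coord i \o f)) ->
  measurable_fun [set: T] f.
Proof.
move=> mf _ Y mY; rewrite setTI.
suff: borel_row_measurable `<=` [set A | measurable (f @^-1` A)] by exact.
apply: smallest_sub.
  split => [|A mA|F mF] /=.
  - by rewrite preimage_set0.
  - by rewrite setTD preimage_setC; exact: measurableC.
  - by rewrite preimage_bigcup; exact: bigcupT_measurable.
rewrite -bigcup_seq => A [i _ [B mB <-]] /=.
by rewrite setTI -comp_preimage -[X in measurable X]setTI; exact: mf.
Qed.
End borel_row.

Section lebesgue.
Variable R : realType.
Definition cons_row n (p : measurableTypeR R * borel_row R n) :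
    borel_row R n.+1 :=
  \row_i (if unlift ord0 i is Some j then p.2 0 j else p.1).

Definition uncons_row n (x : borel_row R n.+1) :
    measurableTypeR R * borel_row R n :=
  (x 0 ord0, \row_j x 0 (lift ord0 j)).

Lemma cons_rowK n : cancel (@cons_row n) (@uncons_row n).
Proof.
move=> [a x]; rewrite /uncons_row mxE unlift_none; congr (_, _).
by apply/rowP => j; rewrite !mxE liftK.
Qed.

Lemma measurable_cons_row n : measurable_fun setT (@cons_row n).
Proof.
apply: measurable_fun_row => i; case: (unliftP ord0 i) => [j ->|->].
  rewrite (_ : _ \o _ = row_coord j \o snd).
    exact: (measurableT_comp (measurable_row_coord j) measurable_snd).
  by apply/funext => p; rewrite /= /row_coord mxE liftK.
rewrite (_ : _ \o _ = fst) //.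
by apply/funext => p; rewrite /= /row_coord mxE unlift_none.
Qed.

Lemma measurable_uncons_row n : measurable_fun setT (@uncons_row n).
Proof.
apply: measurable_fun_pair; first exact: measurable_row_coord.
apply: measurable_fun_row => i.
rewrite (_ : _ \o _ = row_coord (lift ord0 i)); first exact: measurable_row_coord.
by apply/funext => x; rewrite /= /row_coord mxE.
Qed.

Section step.
Variables (n : nat) (mu : {sigma_finite_measure set (borel_row R n) -> \bar R}).

Definition lebesgue_step : set (borel_row R n.+1) -> \bar R :=
  pushforward (lebesgue_measure \x mu)%E (@cons_row n).

Let lebesgue_step_measure : {measure set (borel_row R n.+1) -> \bar R} :=
  measure_function_pushforward__canonical__measure_function_Measure
   (lebesgue_measure \x mu)%E (@measurable_cons_row n).

HB.instance Definition _ := Measure.copy lebesgue_step lebesgue_step_measure.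

Let lebesgue_step_sigma_finite : sigma_finite setT lebesgue_step.
Proof.
have /sigma_finiteP[F [FT ndF Foo]] := sigma_finiteT (@lebesgue_measure R).
have /sigma_finiteP[G [GT ndG Goo]] := sigma_finiteT mu.
exists (fun k => @uncons_row n @^-1` (F k `*` G k)).
  rewrite -preimage_bigcup -[LHS](preimage_setT (@uncons_row n)).
  congr (_ @^-1` _); rewrite -setXTT FT GT predeqE => -[x y]; split.
    move=> [/= [i _ Fix] [j _ Gjy]]; exists (maxn i j) => //; split.
    - by move: x Fix; exact/subsetPset/ndF/leq_maxl.
    - by move: y Gjy; exact/subsetPset/ndG/leq_maxr.
  by move=> [i _ []/= ? ?]; split; exists i.
move=> k; have [mF Fk] := Foo k; have [mG Gk] := Goo k; split.
  rewrite -[X in measurable X]setTI; apply: measurable_uncons_row => //.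
  exact: measurableX.
rewrite /lebesgue_step /pushforward -comp_preimage.
rewrite (_ : _ \o _ = id) ?preimage_id; last first.
  by apply/funext => p; rewrite /= cons_rowK.
by rewrite product_measure1E// lte_mul_pinfty// ge0_fin_numE.
Qed.

HB.instance Definition _ :=
  Measure_isSigmaFinite.Build _ _ _ lebesgue_step lebesgue_step_sigma_finite.
End step.

(* n-fold product of the one-dimensional Lebesgue measure, on Borel sets. *)
Fixpoint lebesgue_row n : {sigma_finite_measure set (borel_row R n) -> \bar R} :=
  if n is n'.+1 then lebesgue_step (lebesgue_row n')
  else \d_(0 : borel_row R 0).

(* Completion of [lebesgue_row n]: its sigma-algebra consists of all Lebesgue
   measurable subsets of R^n. *)
Definition lebesgue_rV n :=
  @completed_measure_extension _ _ _ (lebesgue_row n).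

HB.instance Definition _ n := Measure.on (@lebesgue_rV n).
HB.instance Definition _ n := Measure_isSigmaFinite.Build _ _ _ (@lebesgue_rV n)
  (completed_measure_extension_sigma_finite (sigma_finiteT (lebesgue_row n))).

End lebesgue.
Arguments lebesgue_rV : clear implicits.

Notation lebesgue_space R n := (caratheodory_type (lebesgue_row R n)^*%mu).

Section euclidean.
Context {R : realType} {n : nat}.
Implicit Types (x y : 'rV[R]_n) (A B : set 'rV[R]_n).

(* The library norm on ['rV_n] is the sup norm. *)
Definition eucl_norm x : R := Num.sqrt (\sum_(i < n) x 0 i ^+ 2).

Definition eucl_dist x y : R := eucl_norm (x - y).

Definition eucl_dist_prod (p q : 'rV[R]_n * R) : R :=
  Num.sqrt (eucl_norm (p.1 - q.1) ^+ 2 + (p.2 - q.2) ^+ 2).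

Definition dist_point_set x A : R := inf [set eucl_dist x y | y in A].

Definition dist_set A B : R := inf [set eucl_dist x y | x in A & y in B].

Definition boundary A : set 'rV[R]_n := closure A `\` A°.

Definition domain A := [/\ open A, connected A & A !=set0].

Definition enlarge Omega V (delta : R) : set 'rV[R]_n :=
  [set x | Omega x /\ dist_point_set x V < delta].

End euclidean.

Section smoothness.
Context {R : realType} {n : nat}.
Implicit Types (f phi : 'rV[R]_n -> R) (U Omega : set 'rV[R]_n) (l : seq 'I_n).

Definition partial (i : 'I_n) f : 'rV[R]_n -> R :=
  fun x => 'D_(delta_mx 0 i) f x.

Definition partials l f : 'rV[R]_n -> R := foldr partial f l.

(* [f] is of class C^k on the open set [U]. *)
Definition class_C (k : nat) U f :=
  forall l, (size l <= k)%N -> forall x, U x ->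
    {for x, continuous (partials l f)} /\
    ((size l < k)%N -> forall i, derivable (partials l f) x (delta_mx 0 i)).

Definition test_function Omega phi :=
  [/\ forall k, class_C k setT phi,
      compact (closure [set x | phi x != 0]) &
      closure [set x | phi x != 0] `<=` Omega].

End smoothness.

Section hoelder.
Context {R : realType}.
Local Open Scope ereal_scope.

Definition sup_norm (T : Type) (K : set T) (f : T -> R) : \bar R :=
  ereal_sup [set `|f p|%:E | p in K].

(* For a distance [d], the pairs [p = q] contribute [0 / 0 = 0]. *)
Definition hoelder_seminorm (T : Type) (d : T -> T -> R) (alpha : R)
    (K : set T) (f : T -> R) : \bar R :=
  ereal_sup [set (`|f p - f q| / d p q `^ alpha)%:E | p in K & q in K].

Definition hoelder_norm (T : Type) (d : T -> T -> R) (alpha : R)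
    (K : set T) (f : T -> R) : \bar R :=
  sup_norm K f + hoelder_seminorm d alpha K f.

Context {n : nat}.
Implicit Types (g : 'rV[R]_n -> R -> R) (v : 'rV[R]_n -> R).
Implicit Types (Omega V : set 'rV[R]_n).

Definition locally_hoelder (alpha : R) Omega g :=
  forall K : set ('rV[R]_n * R), compact K -> K `<=` Omega `*` setT ->
    hoelder_seminorm eucl_dist_prod alpha K (uncurry g) < +oo.

(* [v] is in C^{2,alpha}(closure V), [V] being open: the derivatives of order
   at most 2 extend continuously to [closure V], those of order 2 being
   alpha-Hoelder continuous. *)
Definition class_C2alpha (alpha : R) V v :=
  [/\ class_C 2 V v,
      {within closure V, continuous v},
      forall l : seq 'I_n, (size l <= 2)%N ->
        exists h : 'rV[R]_n -> R, {within closure V, continuous h} /\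
          (forall x, V x -> h x = partials l v x) &
      forall l : seq 'I_n, size l = 2%N ->
        hoelder_seminorm eucl_dist alpha V (partials l v) < +oo].

(* The restriction [i <= j] makes the second-order sum range over the
   multi-indices of length 2. By continuity, the suprema over [V] are those over
   [closure V]. *)
Definition C2alpha_norm (alpha : R) V v : \bar R :=
  sup_norm V v + \sum_(i < n) sup_norm V (partial i v) +
  \sum_(i < n) \sum_(j < n | (i <= j)%N)
    hoelder_norm eucl_dist alpha V (partials [:: i; j] v).

End hoelder.

Section weak_solutions.
Context {R : realType} {n : nat}.
Local Open Scope ereal_scope.
Local Notation leb := (lebesgue_rV R n).
Implicit Types (s : R) (u phi : 'rV[R]_n -> R) (G : 'I_n -> 'rV[R]_n -> R).
Implicit Types (Omega D : set 'rV[R]_n) (g : 'rV[R]_n -> R -> R).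

Definition lebesgue_measurable D u :=
  measurable_fun (D : set (lebesgue_space R n)) (u : lebesgue_space R n -> R).

Definition Linfty_norm D u : \bar R :=
  'N[leb]_+oo[EFin \o (u \* \1_D)%R].

Definition in_L2 Omega u :=
  lebesgue_measurable Omega u /\
  \int[leb]_(x in Omega) (u x ^+ 2)%:E < +oo.

(* [G] is a weak gradient of [u] in L^2(Omega); it is unique up to null sets. *)
Definition weak_gradient Omega u G :=
  forall i, in_L2 Omega (G i) /\
    forall phi, test_function Omega phi ->
      \int[leb]_(x in Omega) (u x * partial i phi x)%:E =
      - \int[leb]_(x in Omega) (G i x * phi x)%:E.

Definition in_H1 Omega u :=
  in_L2 Omega u /\ exists G, weak_gradient Omega u G.

Definition gagliardo_kernel s (x y : 'rV[R]_n) : R :=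
  (eucl_dist x y `^ (n%:R + 2 * s))^-1%R.

Definition gagliardo_seminorm s u : \bar R :=
  (\int[leb \x leb]_p
     ((u p.1 - u p.2) ^+ 2 * gagliardo_kernel s p.1 p.2)%:E) `^ 2^-1.

Definition in_X1 s Omega u :=
  [/\ lebesgue_measurable setT u, in_H1 Omega u & gagliardo_seminorm s u < +oo].

Definition weak_solution s Omega g u :=
  in_X1 s Omega u /\
  exists G, weak_gradient Omega u G /\
    forall phi, test_function Omega phi ->
      \int[leb]_(x in Omega) (\sum_(i < n) G i x * partial i phi x)%:E +
      \int[leb \x leb]_p
        ((u p.1 - u p.2) * (phi p.1 - phi p.2) *
         gagliardo_kernel s p.1 p.2)%:E =
      \int[leb]_(x in Omega) (g x (u x) * phi x)%:E.

End weak_solutions.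

(* Main.v *)
(* Let zeta_e be a radial bump function of mass 1 supported in the ball of radius
   e and u_e(x) = \int u(y) zeta_e(y - x) dy. Testing the weak formulation with
   zeta_e(. - x) and using Fubini's theorem, u_e solves the equation pointwise
   inside Omega, with right-hand side the mollification f_e of g(., u). The
   kernel |z|^{-n-2s} is split at radius r: its far part is integrable, its
   translations are Lipschitz in L^1, and it is moved to the right-hand side.

   Estimates for w = u_e that do not depend on e are proved for finite
   differences. If A_t w is the average of w at scale t against a radial weight
   eta, then d/dt A_t w(x) = t \int (Laplacian w)(x + t z) theta(z) dz with
   grad theta = - z eta. Replacing the Laplacian by the near part of the nonlocal
   operator minus the right-hand side and letting the differences act on theta,
   one gains three differences and a factor tau^q, q = (1 - s)/2, at each step,
   up to the exponent 2 + a allowed by the a-Hoelder regularity of the right-hand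
   side; Marchaud's doubling argument then lowers the order of the differences.

   A bounded right-hand side (a = 0) gives second differences of size tau^{3/2},
   hence a Lipschitz bound L <= C (|u| + |g|). As u_e -> u almost everywhere, u is
   Lipschitz and g(x, u(x)) is alpha-Hoelder with constant at most C |g| (1 + L),
   whence the product in the final constant. With a = alpha, third differences
   are of size tau^{2 + alpha}; they bound the Hessian and its Hoelder
   seminorm, and the resulting Taylor inequalities pass to the limit e -> 0. *)
Require Import Defs.
From HB Require Import structures.
From mathcomp Require Import all_boot all_order all_algebra.
From mathcomp Require Import all_classical all_reals all_analysis.
From mathcomp Require Import measurable_realfun measurable_fun_approximation ess_sup_inf.
From mathcomp Require Import ring lra.
Set Implicit Arguments. Unset Strict Implicit. Unset Printing Implicit Defensive.
Import Order.TTheory GRing.Theory Num.Theory.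
Import numFieldNormedType.Exports.
Local Open Scope classical_set_scope.
Local Open Scope ring_scope.

(** * Invariance of Lebesgue measure *)

Section invariance.
Context {R : realType}.
Implicit Types (c : R).

(** Differences are used because they only involve translations: they commute with mollification and
    with the near part of the operator, so no derivative of a singular integral is ever formed.
    Smoothness of the mollified solution is purely qualitative ([nice]: differences of every order
    are bounded by the product of their steps); it makes the integrals converge, and its constants
    enter no final estimate. The exponents come from the kernel. Its near part has a finite moment
    of order [p = 1 + s], strictly between [2 s] and 2, and [q = (1 - s) / 2] is fixed by
    [p + 2 q = 2]. At scale [t] the second difference inside the operator yields [(|z| / t)^p] and
    the outer differences yield [(tau / t)^q]; with the factor [t] of the derivative of the average
    this leaves [tau^q t^(q - 1)], which is integrable at [t = 0]. The number of steps depends only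
    on [s]. The splitting radius [r] is therefore chosen afterwards, so small that all nested balls
    fit into the margin around [V]. These balls are cubes of the sup norm, and comparison with
    Euclidean distances costs factors depending on [n]. *)

Lemma lebesgue_measure_affine c b (A : set R) : c = 1 \/ c = -1 ->
  measurable (A : set (measurableTypeR R)) ->
  lebesgue_measure ((fun x => c * x + b) @^-1` A) = lebesgue_measure A.
Proof.
move=> c1 mA.
have mf : measurable_fun [set: measurableTypeR R]
    ((fun x => c * x + b) : measurableTypeR R -> measurableTypeR R).
  by apply: measurable_funD => //; apply: mulrl_measurable.
pose m' := measure_function_pushforward__canonical__measure_function_Measure
  (@lebesgue_measure R) mf.
rewrite [LHS](_ : _ = m' A)//; symmetry.
apply: lebesgue_measure_unique => // X [[x y] /= xy <-].
rewrite /= /pushforward /= lebesgue_measure_itv/=.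
case: c1 => ->.
- rewrite (_ : _ @^-1` _ = [set` `](x - b), (y - b)]]); last first.
    by apply/seteqP; split => z /=; rewrite !in_itv/= mul1r ltrBlDr lerBrDr.
  rewrite lebesgue_measure_itv/= !lte_fin ltrD2r -!EFinB.
  by case: ifP => // _; congr EFin; ring.
- rewrite (_ : _ @^-1` _ = [set` `[(b - y), (b - x)[]); last first.
    by apply/seteqP; split => z /=; rewrite !in_itv/= mulN1r => /andP[? ?]; apply/andP; split; lra.
  rewrite lebesgue_measure_itv/= !lte_fin ltrD2l ltrN2 -!EFinB.
  by case: ifP => // _; congr EFin; ring.
Qed.

Definition affine_row n c (a x : 'rV[R]_n) : 'rV[R]_n := c *: x + a.

Lemma affine_rowE n c (a x : 'rV[R]_n) i : affine_row c a x 0 i = c * x 0 i + a 0 i.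
Proof. by rewrite /affine_row !mxE. Qed.

Lemma cons_rowE n (p : measurableTypeR R * borel_row R n) i :
  cons_row p 0 i = if unlift ord0 i is Some j then p.2 0 j else p.1.
Proof. by rewrite mxE. Qed.

Lemma measurable_affine_row n c (a : 'rV[R]_n) :
  measurable_fun [set: borel_row R n] (affine_row c a : borel_row R n -> borel_row R n).
Proof.
apply: measurable_fun_row => i.
rewrite (_ : _ \o _ = fun x : borel_row R n => c * row_coord i x + a 0 i).
  apply: measurable_funD => //; apply: measurable_funM => //.
  exact: measurable_row_coord.
by apply/funext => x /=; rewrite /row_coord !mxE.
Qed.

(** Induction on the dimension: after conjugation by [cons_row], the sections are handled by the
    induction hypothesis and the first coordinate by the one-dimensional case. The factors 1 and -1
    cover translations and the reflection. *)
Lemma lebesgue_row_affine n c (a : 'rV[R]_n) (A : set (borel_row R n)) :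
  c = 1 \/ c = -1 -> measurable A ->
  lebesgue_row R n ((affine_row c a : borel_row R n -> borel_row R n) @^-1` A)
  = lebesgue_row R n A.
Proof.
elim: n a A => [|n IH] a A c1 mA.
  congr (_ _); apply/seteqP; split => x /=;
  by rewrite (_ : affine_row _ _ _ = x)//; apply/rowP => -[].
pose a' := \row_j a 0 (lift ord0 j).
rewrite /= /lebesgue_step /pushforward.
set B := @cons_row R n @^-1` A.
have mB : measurable B.
  by rewrite -[B]setTI; apply: measurable_cons_row.
rewrite (_ : _ @^-1` _ = [set p | B (c * p.1 + a 0 ord0, affine_row c a' p.2)]); last first.
  apply/seteqP; split => -[x y] /=; rewrite /B/=.
    congr A; apply/rowP => i. rewrite affine_rowE !cons_rowE.
    by case: (unliftP ord0 i) => [j ->|->]; rewrite ?liftK ?unlift_none /= ?affine_rowE ?mxE.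
  congr A; apply/rowP => i. rewrite affine_rowE !cons_rowE.
  by case: (unliftP ord0 i) => [j ->|->]; rewrite ?liftK ?unlift_none /= ?affine_rowE ?mxE.
rewrite /product_measure1 /=.
transitivity (\int[@lebesgue_measure R]_x
   (fun y => lebesgue_row R n (xsection B y)) (c * x + a 0 ord0)%R)%E.
  apply: eq_integral => x _ /=.
  rewrite -(IH a' (xsection B (c * x + a 0 ord0)))//; last exact: measurable_xsection.
pose h y := lebesgue_row R n (xsection B y).
have mh : measurable_fun [set: measurableTypeR R] h by have := @measurable_fun_xsection _ _ _ _ R (lebesgue_row R n) B mB.
have mf : measurable_fun [set: measurableTypeR R]
    ((fun x => c * x + a 0 ord0) : measurableTypeR R -> measurableTypeR R).
  by apply: measurable_funD => //; apply: mulrl_measurable.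
have := @ge0_integral_pushforward _ _ _ _ _ _ mf (@lebesgue_measure R) setT h measurableT mh.
rewrite preimage_setT => <-; last by move=> y _; exact: measure_ge0.
apply: eq_measure_integral => X mX _; exact: lebesgue_measure_affine.
Qed.

Local Notation lrow n := (lebesgue_row R n)^*%mu.

Lemma affine_rowK n c (a : 'rV[R]_n) : c = 1 \/ c = -1 ->
  cancel (affine_row c a) (affine_row c (- (c *: a))).
Proof.
move=> c1 x; rewrite /affine_row scalerDr addrK scalerA.
by case: c1 => ->; rewrite ?mulrNN mul1r scale1r.
Qed.

Lemma affine_rowVK n c (a : 'rV[R]_n) : c = 1 \/ c = -1 ->
  cancel (affine_row c (- (c *: a))) (affine_row c a).
Proof.
move=> c1 x; rewrite /affine_row scalerDr scalerN !scalerA.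
by case: c1 => ->; rewrite ?mulrNN mul1r !scale1r subrK.
Qed.

(** Stated for the outer measure of an arbitrary set, so that it passes to the completion. The
    preimage of a cover is a cover of equal total measure, which gives one inequality; the inverse
    map gives the other. *)
Lemma mu_ext_affine n c (a : 'rV[R]_n) (A : set 'rV[R]_n) :
  c = 1 \/ c = -1 -> lrow n (affine_row c a @^-1` A) = lrow n A.
Proof.
move=> c1.
have le b X : (lrow n (affine_row c b @^-1` X) <= lrow n X)%E.
  apply: le_ereal_inf_tmp => _ [F [mF XF] <-].
  apply: ereal_inf_lbound.
  exists (fun k => (affine_row c b : borel_row R n -> borel_row R n) @^-1` F k).
    split => [i|x /= /XF [i _ Fi]]; last by exists i.
    by rewrite -[X in measurable X]setTI; apply: measurable_affine_row => //; exact: mF.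
  apply: eq_eseriesr => i _; apply: lebesgue_row_affine => //; exact: mF.
apply/eqP; rewrite eq_le le /=.
have := le (- (c *: a)) (affine_row c a @^-1` A).
by rewrite -comp_preimage (_ : _ \o _ = id) ?preimage_id//; apply/funext => x /=; exact: affine_rowVK.
Qed.

End invariance.

(** From here on ['rV[R]_n] carries the Lebesgue sigma-algebra, while [borel_row] keeps the Borel
    one. *)
HB.instance Definition _ (R : realType) n :=
  Measurable.copy 'rV[R]_n (lebesgue_space R n).

Section leb.
Context {R : realType}.

Definition leb n : {sigma_finite_measure set 'rV[R]_n -> \bar R} :=
  lebesgue_rV R n.

(** In Caratheodory's criterion the test set is rewritten as the preimage of another set; invariance
    of the outer measure then reduces the identity to the one for [A]. *)
Lemma measurable_affine_row_leb n c (a : 'rV[R]_n) : c = 1 \/ c = -1 ->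
  measurable_fun setT (affine_row c a).
Proof.
move=> c1 _ A mA; rewrite setTI.
have {}mA : (lebesgue_row R n)^*%mu.-caratheodory A by exact: mA.
suff : (lebesgue_row R n)^*%mu.-caratheodory (affine_row c a @^-1` A) by exact.
move=> X.
have E (Y : set 'rV[R]_n) : Y = affine_row c a @^-1` (affine_row c (- (c *: a)) @^-1` Y).
  by rewrite -comp_preimage (_ : _ \o _ = id)//; apply/funext => x /=; exact: affine_rowK.
rewrite (E X); move: (_ @^-1` X) => Y.
have H B : (lebesgue_row R n)^*%mu (affine_row c a @^-1` B) =
  (lebesgue_row R n)^*%mu B by exact: mu_ext_affine.
exact: (etrans (H Y) (etrans (mA Y) (esym (congr2 (fun a b => (a + b)%E)
  (H (Y `&` A)) (H (Y `&` ~` A)))))).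
Qed.

Lemma leb_affine n c (a : 'rV[R]_n) (A : set 'rV[R]_n) :
  c = 1 \/ c = -1 -> leb n (affine_row c a @^-1` A) = leb n A.
Proof. exact: mu_ext_affine. Qed.

Lemma ge0_integral_affine n c (a : 'rV[R]_n) (f : 'rV[R]_n -> \bar R) :
  c = 1 \/ c = -1 -> measurable_fun setT f -> (forall x, 0 <= f x)%E ->
  (\int[leb n]_x f (affine_row c a x) = \int[leb n]_x f x)%E.
Proof.
move=> c1 mf f0.
have mT := measurable_affine_row_leb a c1.
have := ge0_integral_pushforward mT (leb n) measurableT mf.
rewrite preimage_setT => <-; last by move=> y _; exact: f0.
by apply: eq_measure_integral => X mX _; exact: leb_affine.
Qed.

Lemma measurable_leb_borel n (A : set (borel_row R n)) :
  measurable A -> measurable (A : set 'rV[R]_n).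
Proof. exact: caratheodory_measurable_mu_ext. Qed.

Lemma leb_borel n (A : set (borel_row R n)) :
  measurable A -> leb n A = lebesgue_row R n A.
Proof. exact: measurable_mu_extE. Qed.

Lemma measurable_row_coord_leb n (i : 'I_n) :
  measurable_fun setT (fun x : 'rV[R]_n => x 0 i).
Proof.
move=> mT Y mY; rewrite setTI; apply: measurable_leb_borel.
by rewrite -[X in measurable X]setTI; exact: (measurable_row_coord i).
Qed.
End leb.

(** * Measurability and real integrals *)

Section row_norm.
Context {R : realType} {n : nat}.
Implicit Types x : 'rV[R]_n.

Lemma coord_le_norm x i : `|x 0 i| <= `|x|.
Proof.
rewrite [leRHS]mx_normrE.
exact: (le_bigmax _ (fun k : 'I_1 * 'I_n => `|x k.1 k.2|) (0, i)).
Qed.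

Lemma row_norm_le x e : 0 <= e -> (forall i, `|x 0 i| <= e) -> `|x| <= e.
Proof.
move=> e0 xe; rewrite [leLHS]mx_normrE; apply/bigmax_leP; split => // -[i j] _ /=.
by rewrite (ord1 i); exact: xe.
Qed.

Lemma row_norm_lt x e : 0 < e -> (forall i, `|x 0 i| < e) -> `|x| < e.
Proof.
move=> e0 xe; rewrite [ltLHS]mx_normrE; apply/bigmax_ltP; split => // -[i j] _ /=.
by rewrite (ord1 i); exact: xe.
Qed.
End row_norm.

Section measurability.
Context {R : realType} {n : nat} {d : measure_display} {T : measurableType d}.
Implicit Types (D : set T) (F : T -> 'rV[R]_n).

(** An open set is the union of the countably many boxes with rational centre and radius
    [1 / (k + 1)] that it contains, and the preimage of a box involves one coordinate at a time.
    Coordinatewise measurability of [F] is weaker than measurability into the completed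
    sigma-algebra. *)
Lemma measurable_preimage_open D F (h : T -> R) (U : set ('rV[R]_n * R)) :
  measurable D -> (forall i, measurable_fun D (fun y => F y 0 i)) ->
  measurable_fun D h -> open U -> measurable (D `&` [set y | U (F y, h y)]).
Proof.
move=> mD mF mh oU.
pose B (i : 'rV[rat]_n * rat * nat) : set ('rV[R]_n * R) :=
  [set p : 'rV[R]_n * R | (forall j, `|p.1 0 j - ratr (i.1.1 0 j)| < i.2.+1%:R^-1) /\
           `|p.2 - ratr i.1.2| < i.2.+1%:R^-1].
have BU p : U p -> exists i, B i p /\ B i `<=` U.
  move=> Up; have /nbhs_ballP[e /= e0 eU] : nbhs p U by exact: open_nbhs_nbhs.
  have e20 : 0 < e / 2 by rewrite divr_gt0.
  have [k ke] : exists k : nat, k.+1%:R^-1 < e / 2.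
    exists (Num.trunc (e / 2)^-1); rewrite invf_plt ?posrE ?ltr0Sn//.
    exact: truncnS_gt.
  have k0 : 0 < k.+1%:R^-1 :> R by rewrite invr_gt0.
  pose B0 (i : 'rV[rat]_n * rat) (e' : R) : set ('rV[R]_n * R) := [set p : 'rV[R]_n * R |
    (forall j, `|p.1 0 j - ratr (i.1 0 j)| < e') /\ `|p.2 - ratr i.2| < e'].
  suff [i [iB1 iB2]] : exists i, B0 i k.+1%:R^-1 p /\ B0 i k.+1%:R^-1 `<=` U by exists (i, k).
  move: (k.+1%:R^-1 : R) k0 ke => e' e'0 e'e.
  have Q (x : R) : exists q : rat, `|x - ratr q| < e'.
    have : x - e' < x + e' by lra.
    move=> /rat_in_itvoo[q]; rewrite in_itv/= => /andP[? ?].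
    by exists q; rewrite ltr_distl; apply/andP; split; lra.
  have [q2 q2P] := Q p.2.
  have [q1 q1P] := choice (fun i => Q (p.1 0 i)).
  exists (\row_i q1 i, q2); split; first by split => //= j; rewrite mxE.
  move=> z /= [z1 z2]; apply: eU; split => /=.
    rewrite -ball_normE /=; apply: row_norm_lt => // i.
    have := z1 i; have := q1P i; rewrite !mxE !ltr_distl => /andP[? ?] /andP[? ?].
    by apply/andP; split; lra.
  rewrite -ball_normE /=; move: q2P z2; rewrite !ltr_distl => /andP[? ?] /andP[? ?].
  by apply/andP; split; lra.
rewrite (_ : _ `&` _ = \bigcup_i (if `[< B i `<=` U >]
    then D `&` [set y | B i (F y, h y)] else set0)); last first.
  apply/seteqP; split => y /=.
    by move=> [Dy /BU[i [Bi iU]]]; exists i => //; case: asboolP.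
  by move=> [i _]; case: asboolP => // iU [Dy /iU].
apply: countable_bigcupT_measurable; first exact: countableP.
move=> i; case: asboolP => // _.
have M (f : T -> R) q e : measurable_fun D f ->
    measurable (D `&` [set y | `|f y - q| < e]).
  move=> mf; rewrite (_ : [set y | _] = f @^-1` `](q - e), (q + e)[%classic).
    by apply: mf => //; exact: measurable_itv.
  by apply/seteqP; split => y /=; rewrite in_itv/= ltr_distl.
rewrite (_ : D `&` _ = (D `&` \bigcap_(j in [set: 'I_n])
     (D `&` [set y | `|F y 0 j - ratr (i.1.1 0 j)| < i.2.+1%:R^-1])) `&`
     (D `&` [set y | `|h y - ratr i.1.2| < i.2.+1%:R^-1])); last first.
  apply/seteqP; split => y /=.
    move=> [Dy [B1 B2]]; split; last by split.
    by split => // j _; split => //; exact: B1.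
  by move=> [[Dy B1] [_ B2]]; split => //; split => // j; have [] := B1 j I.
apply: measurableI; last exact: M.
apply: measurableI => //; apply: fin_bigcap_measurable => // j _; exact: M.
Qed.

(** Continuity of [g] is asked on the open set [O] only, because the nonlinearity is continuous on
    [Omega] times the real line and arbitrary elsewhere. *)
Lemma measurable_continuous_comp D F (h : T -> R) (O : set ('rV[R]_n * R))
    (g : 'rV[R]_n * R -> R) :
  measurable D -> (forall i, measurable_fun D (fun y => F y 0 i)) ->
  measurable_fun D h -> open O -> (forall y, D y -> O (F y, h y)) ->
  (forall p, O p -> {for p, continuous g}) ->
  measurable_fun D (fun y => g (F y, h y)).
Proof.
move=> mD mF mh oO DO cg; apply: (measurability _ (RGenOInfty.measurableE R)) => //.
move=> _ [_ [a ->] <-].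
rewrite (_ : _ `&` _ = D `&` [set y | (O `&` [set p | a < g p]) (F y, h y)]); last first.
  apply/seteqP; split => y /=; rewrite in_itv/= andbT => -[Dy].
    by move=> ag; split => //; split => //; exact: DO.
  by case.
apply: measurable_preimage_open => //.
rewrite openE => p [Op /= ag]; apply: filterI; first exact: open_nbhs_nbhs.
by have /cg/(_ [set y | a < y]) := Op; apply; apply: open_nbhs_nbhs; split => //; exact: open_gt.
Qed.

Lemma measurable_continuous_row F (g : 'rV[R]_n -> R) :
  (forall i, measurable_fun setT (fun y => F y 0 i)) -> continuous g ->
  measurable_fun setT (g \o F).
Proof.
move=> mF cg.
apply: (@measurable_continuous_comp setT F (cst 0) setT (g \o fst)) => //.
- exact: openT.
- by move=> p _; apply: continuous_comp; [exact: cvg_fst|exact: cg].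
Qed.
End measurability.

Lemma continuous_measurable_row {R : realType} {n} (g : 'rV[R]_n -> R) :
  continuous g -> measurable_fun setT g.
Proof.
move=> cg.
exact: (@measurable_continuous_row R n _ 'rV[R]_n id g (@measurable_row_coord_leb R n) cg).
Qed.

Section real_integral.
Context {R : realType} {d} {T : measurableType d}.
Variable mu : {measure set T -> \bar R}.
Implicit Types f g : T -> R.

Definition integ f : Prop := mu.-integrable setT (EFin \o f).

Lemma integ_measurable f : integ f -> measurable_fun setT f.
Proof. by move=> /integrableP[mf _]; exact/measurable_EFinP. Qed.

Lemma integ_le f g : measurable_fun setT f -> integ g ->
  (forall x, `|f x| <= g x) -> integ f.
Proof.
move=> mf ig fg; apply: le_integrable ig => //; first exact/measurable_EFinP.
by move=> x _ /=; rewrite lee_fin (le_trans (fg x))// ler_norm.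
Qed.

Lemma integ_norm f : integ f -> integ (fun x => `|f x|).
Proof. exact: integrable_norm. Qed.

Lemma integD f g : integ f -> integ g -> integ (fun x => f x + g x).
Proof. by move=> hf hg; apply: (integrableD measurableT hf hg). Qed.

Lemma integZ c f : integ f -> integ (fun x => c * f x).
Proof. by move=> hf; apply: (integrableZl measurableT c hf). Qed.

Lemma integB f g : integ f -> integ g -> integ (fun x => f x - g x).
Proof. by move=> hf hg; apply: (integrableB measurableT hf hg). Qed.

Lemma integ0 : integ (fun=> 0).
Proof. exact: integrable0. Qed.

Lemma integ_sum I (r : seq I) (F : I -> T -> R) : (forall i, integ (F i)) ->
  integ (fun x => \sum_(i <- r) F i x).
Proof.
move=> iF; elim: r => [|i r IH].
  by under eq_fun do rewrite big_nil; exact: integ0.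
by under eq_fun do rewrite big_cons; exact: integD.
Qed.

Lemma intD f g : integ f -> integ g ->
  \int[mu]_x (f x + g x) = \int[mu]_x f x + \int[mu]_x g x.
Proof. by move=> hf hg; rewrite RintegralD. Qed.

Lemma intB f g : integ f -> integ g ->
  \int[mu]_x (f x - g x) = \int[mu]_x f x - \int[mu]_x g x.
Proof. by move=> hf hg; rewrite RintegralB. Qed.

Lemma intZ c f : integ f -> \int[mu]_x (c * f x) = c * \int[mu]_x f x.
Proof. by move=> hf; rewrite RintegralZl. Qed.

Lemma intN f : integ f -> \int[mu]_x (- f x) = - \int[mu]_x f x.
Proof.
move=> hf; rewrite -mulN1r -intZ//; apply: eq_Rintegral => x _.
by rewrite mulN1r.
Qed.

Lemma int_sum I (r : seq I) (F : I -> T -> R) : (forall i, integ (F i)) ->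
  \int[mu]_x (\sum_(i <- r) F i x) = \sum_(i <- r) \int[mu]_x F i x.
Proof.
move=> iF; elim: r => [|i r IH].
  rewrite big_nil -[RHS](Rintegral_set0 mu (fun=> 0)) /Rintegral.
  by rewrite integral0_eq ?integral_set0// => x _; rewrite big_nil.
rewrite big_cons -IH -intD//; last exact: integ_sum.
by apply: eq_Rintegral => x _; rewrite big_cons.
Qed.

Lemma int_le f g : integ f -> integ g -> (forall x, f x <= g x) ->
  \int[mu]_x f x <= \int[mu]_x g x.
Proof. by move=> hf hg fg; apply: le_Rintegral => // x _. Qed.

Lemma int_ge0 f : (forall x, 0 <= f x) -> 0 <= \int[mu]_x f x.
Proof. by move=> f0; apply: Rintegral_ge0. Qed.

Lemma int_abs_le f g : integ g -> integ f -> (forall x, `|f x| <= g x) ->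
  `|\int[mu]_x f x| <= \int[mu]_x g x.
Proof.
move=> ig hf fg; apply: le_trans (le_normr_Rintegral _ hf) _ => //.
by apply: int_le => //; exact: integ_norm.
Qed.

Lemma EFin_int f : integ f -> (\int[mu]_x f x)%:E = (\int[mu]_x (f x)%:E)%E.
Proof. by move=> hf; rewrite /Rintegral fineK//; exact: integrable_fin_num. Qed.

Lemma int_ae_abs_le (u g : T -> R) (M : R) : 0 <= M -> measurable_fun setT u ->
  {ae mu, forall x, `|u x| <= M} -> integ g ->
  integ (fun x => u x * g x) /\
  `|\int[mu]_x (u x * g x)| <= M * \int[mu]_x `|g x|.
Proof.
move=> M0 mu_ uM ig.
have mug : measurable_fun setT (fun x => u x * g x).
  by apply: measurable_funM => //; exact: integ_measurable.
have img := integZ M (integ_norm ig).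
have le : (\int[mu]_x `|(u x * g x)%:E| <= \int[mu]_x (M * `|g x|)%:E)%E.
  apply: ae_ge0_le_integral => //.
  - by apply: measurableT_comp => //; exact/measurable_EFinP.
  - by move=> x _; rewrite lee_fin mulr_ge0.
  - exact: measurable_int img.
  - case: uM => N [mN N0 uN]; exists N; split => // x /= Nx; apply: uN => /= uxM; apply: Nx => _.
    by rewrite lee_fin normrM ler_wpM2r.
have iug : integ (fun x => u x * g x).
  apply/integrableP; split; first exact/measurable_EFinP.
  by apply: le_lt_trans le _; exact: integrable_lty.
split => //; apply: le_trans (le_normr_Rintegral _ iug) _ => //.
by rewrite -intZ; [rewrite -lee_fin !EFin_int//; exact: integ_norm|exact: integ_norm].
Qed.
Lemma integ_indic_set (E : set T) (v : R) : measurable E -> mu E = v%:E ->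
  integ (\1_E) /\ \int[mu]_x (\1_E x) = v.
Proof.
move=> mE Ev; split.
  apply/integrableP; split; first by apply/measurable_EFinP; exact: measurable_indic.
  rewrite (eq_integral (fun x => (\1_E x)%:E)); last first.
    by move=> x _ /=; rewrite ger0_norm// indicE.
  by rewrite integral_indic// setIT Ev ltry.
by rewrite /Rintegral integral_indic// setIT Ev.
Qed.

(** The series of the [c k * \1_(E k)] dominates [f], since at each point a single term already
    does, and its integral is at most a geometric series. *)
Lemma integ_series f (c : nat -> R) (E : nat -> set T) (A q : R) :
  measurable_fun setT f -> 0 < q < 1 -> (forall k, 0 <= c k) ->
  (forall k, measurable (E k)) -> (forall k, integ (\1_(E k))) ->
  (forall k, c k * \int[mu]_x (\1_(E k) x) <= A * q ^+ k) ->
  (forall x, f x <> 0 -> exists k, E k x /\ `|f x| <= c k) ->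
  integ f.
Proof.
move=> mf /andP[q0 q1] c0 mE iE cA fc.
apply/integrableP; split; first exact/measurable_EFinP.
pose F k x := (c k * \1_(E k) x)%:E.
have F0 k x : (0 <= F k x)%E by rewrite lee_fin mulr_ge0// indicE.
have mF k : measurable_fun setT (F k).
  apply/measurable_EFinP; apply: measurable_funM; first exact: measurable_cst.
  exact: measurable_indic.
apply: (@le_lt_trans _ _ (\int[mu]_x \sum_(k <oo) F k x)%E).
  apply: ge0_le_integral => //.
  - by apply: measurableT_comp => //; exact/measurable_EFinP.
  - exact: ge0_emeasurable_sum.
  - move=> x _ /=; have [->|/eqP fx] := eqVneq (f x) 0.
      by rewrite normr0; apply: nneseries_ge0.
    have [k [xk fk]] := fc x fx.
    apply: le_trans (nneseries_lim_ge k.+1 _) => //.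
    rewrite big_nat_recr//= addeC; apply: le_trans (leeDl _ _); last exact: sume_ge0.
    by rewrite /F lee_fin indicE mem_set ?mulr1.
rewrite integral_nneseries//.
apply: (@le_lt_trans _ _ ((A / (1 - q))%:E)); last exact: ltry.
apply: lime_le; first by apply: is_cvg_nneseries => k _ _; exact: integral_ge0.
apply: nearW => N.
apply: (@le_trans _ _ (\sum_(0 <= k < N) (A * q ^+ k)%:E)%E).
  apply: lee_sum => k _.
  rewrite /F -EFin_int; last exact: integZ.
  by rewrite intZ// lee_fin.
have A0 : 0 <= A.
  by have := cA 0; rewrite expr0 mulr1; apply: le_trans; rewrite mulr_ge0// int_ge0.
rewrite sumEFin lee_fin -mulr_sumr ler_wpM2l// -div1r ler_pdivlMr ?subr_gt0//.
rewrite big_mkord mulrC -opprB mulNr -subrX1 opprB lerBlDr lerDl exprn_ge0//; exact: ltW.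
Qed.
End real_integral.

(** * Fubini's theorem for real-valued integrals *)

Section real_fubini.
Context {R : realType} {d1 d2} {T1 : measurableType d1} {T2 : measurableType d2}.
Variables (m1 : {sigma_finite_measure set T1 -> \bar R})
  (m2 : {sigma_finite_measure set T2 -> \bar R}).

Lemma integ_prod (Phi : T1 * T2 -> R) (b : T1 -> R) :
  measurable_fun setT Phi -> (forall x, integ m2 (fun y => Phi (x, y))) ->
  integ m1 b -> (forall x, \int[m2]_y `|Phi (x, y)| <= b x) ->
  integ (m1 \x m2)%E Phi.
Proof.
move=> mP iP ib Pb; apply/integrable12ltyP; first exact/measurable_EFinP.
apply: le_lt_trans (integrable_lty measurableT ib).
apply: ge0_le_integral => //.
- by move=> x _; exact: integral_ge0.
- apply: (measurable_fun_fubini_tonelli_F (abse \o (EFin \o Phi))) => //=.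
  by apply: measurableT_comp => //; exact/measurable_EFinP.
- exact: measurable_int ib.
- move=> x _ /=; rewrite -(EFin_int (integ_norm (iP x))) lee_fin; exact: Pb.
Qed.

(** Integrability of every section makes the real-valued inner integral agree everywhere with the
    extended-valued one of Fubini's theorem. *)
Lemma int_prod (Phi : T1 * T2 -> R) : (forall x, integ m2 (fun y => Phi (x, y))) ->
  integ (m1 \x m2)%E Phi ->
  integ m1 (fun x => \int[m2]_y Phi (x, y)) /\
  \int[(m1 \x m2)%E]_p Phi p = \int[m1]_x \int[m2]_y Phi (x, y).
Proof.
move=> iP iPhi.
have E : (EFin \o (fun x => \int[m2]_y Phi (x, y))) = fubini_F m2 (EFin \o Phi).
  by apply/funext => x /=; rewrite EFin_int.
split; first by rewrite /integ E; exact: integrable_fubini_F.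
rewrite /Rintegral -integral12_prod_meas1//; congr fine.
by rewrite -E.
Qed.

Lemma int_swap (Phi : T1 * T2 -> R) : (forall x, integ m2 (fun y => Phi (x, y))) ->
  (forall y, integ m1 (fun x => Phi (x, y))) -> integ (m1 \x m2)%E Phi ->
  integ m2 (fun y => \int[m1]_x Phi (x, y)) /\
  \int[m1]_x \int[m2]_y Phi (x, y) = \int[m2]_y \int[m1]_x Phi (x, y).
Proof.
move=> iP iP' iPhi.
have E : (EFin \o (fun x => \int[m2]_y Phi (x, y))) = fubini_F m2 (EFin \o Phi).
  by apply/funext => x /=; rewrite EFin_int.
have E' : (EFin \o (fun y => \int[m1]_x Phi (x, y))) = fubini_G m1 (EFin \o Phi).
  by apply/funext => x /=; rewrite EFin_int.
split.
  rewrite /integ E'; apply/integrableP; split; first exact: (measurable_fubini_G iPhi).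
  have := (integrable21ltyP m1 m2 (measurable_int _ iPhi)).1 iPhi.
  apply: le_lt_trans.
  apply: ge0_le_integral => //.
  - by apply: measurableT_comp => //; exact: (measurable_fubini_G iPhi).
  - apply: (measurable_fun_fubini_tonelli_G (abse \o (EFin \o Phi))) => //=.
    by apply: measurableT_comp => //; exact: measurable_int iPhi.
  - move=> y _; apply: le_abse_integral => //; exact: measurable_int (iP' y).
rewrite /Rintegral.
have := integral12_prod_meas1 iPhi; have := integral21_prod_meas1 iPhi.
by rewrite -E -E' => -> ->.
Qed.
End real_fubini.

(** * Volume of cubes and integrals against Lebesgue measure *)

Section cubes.
Context {R : realType}.
Implicit Types r : R.

Definition cube n r : set 'rV[R]_n := [set x | `|x| <= r].
Arguments cube n r _ : clear implicits.

Lemma cubeE n r : 0 <= r -> cube n r = [set x | forall i, `|x 0 i| <= r].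
Proof.
move=> r0; apply/seteqP; split => x /= xr; last exact: row_norm_le.
by move=> i; exact: le_trans (coord_le_norm x i) xr.
Qed.

Lemma borel_cube n r : 0 <= r -> measurable (cube n r : set (borel_row R n)).
Proof.
move=> r0; rewrite cubeE//.
rewrite [X in measurable X](_ : _ =
  \bigcap_(i in [set: 'I_n]) ((@row_coord R n i) @^-1` `[- r, r])); last first.
  apply/seteqP; split => x /= xr i.
    by move=> _; rewrite /= in_itv/= -ler_norml; exact: xr.
  by have := xr i I; rewrite /= in_itv/= -ler_norml.
apply: fin_bigcap_measurable => // i _.
by rewrite -[X in measurable X]setTI; apply: measurable_row_coord => //; exact: measurable_itv.
Qed.

Lemma measurable_cube n r : 0 <= r -> measurable (cube n r).
Proof. by move=> r0; apply: measurable_leb_borel; exact: borel_cube. Qed.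

Lemma lebesgue_row_cube n r : 0 <= r ->
  lebesgue_row R n (cube n r) = ((2 * r) ^+ n)%:E.
Proof.
move=> r0; elim: n => [|n IH].
  have c0 : cube 0 r (0 : 'rV[R]_0) by rewrite /cube/= normr0.
  by rewrite /= diracE expr0 mem_set.
rewrite /= /lebesgue_step /pushforward.
rewrite (_ : _ @^-1` _ = `[- r, r] `*` cube n r); last first.
  rewrite !cubeE//; apply/seteqP; split => -[x y] /=.
    move=> H; split; last by move=> i; have := H (lift ord0 i); rewrite cons_rowE liftK.
    by rewrite in_itv/= -ler_norml; have := H ord0; rewrite cons_rowE unlift_none.
  move=> [xr yr] i; rewrite cons_rowE; case: (unliftP ord0 i) => [j _|_] //=.
  by move: xr; rewrite in_itv/= -ler_norml.
rewrite product_measure1E//; last exact: borel_cube.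
rewrite IH.
rewrite [LHS](_ : _ = lebesgue_measure ([set` `[- r, r]%R] : set R) * ((2 * r) ^+ n)%:E)%E//.
rewrite lebesgue_measure_itv/= lte_fin exprS EFinM -EFinB.
case: ltP => [_|]; first by congr ((_)%:E * _)%E; ring.
move=> rr; have -> : r = 0 by lra.
by rewrite mulr0 mul0e.
Qed.

Lemma leb_cube n r : 0 <= r -> leb n (cube n r) = ((2 * r) ^+ n)%:E.
Proof. by move=> r0; rewrite leb_borel ?lebesgue_row_cube//; exact: borel_cube. Qed.
End cubes.
Arguments cube {R} n r _.

Section leb_integral.
Context {R : realType} {n : nat}.
Implicit Types (f g : 'rV[R]_n -> R).
Local Notation mu := (@leb R n).

Lemma int_affine c (a : 'rV[R]_n) f : c = 1 \/ c = -1 -> integ mu f ->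
  integ mu (fun x => f (affine_row c a x)) /\
  \int[mu]_x f (affine_row c a x) = \int[mu]_x f x.
Proof.
move=> c1 hf.
have mf := measurable_int _ hf.
have mT := measurable_affine_row_leb a c1.
have mfT : measurable_fun setT (fun x => (f (affine_row c a x))%:E).
  exact: (measurableT_comp mf mT).
have mabs : measurable_fun setT (fun x => `|(f x)%:E|%E) by exact: measurableT_comp.
have Eabs := ge0_integral_affine a c1 mabs (fun x => abse_ge0 _).
have Epos := ge0_integral_affine a c1 (measurable_funepos mf) (funepos_ge0 _).
have Eneg := ge0_integral_affine a c1 (measurable_funeneg mf) (funeneg_ge0 _).
split.
  apply/integrableP; split; first exact: mfT.
  by have /integrableP[_] := hf; rewrite -Eabs.
rewrite /Rintegral; congr fine; rewrite integralE [RHS]integralE;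
  congr (_ - _)%E.
  by rewrite -[RHS]Epos; apply: eq_integral => x _; rewrite !funeposE.
by rewrite -[RHS]Eneg; apply: eq_integral => x _; rewrite !funenegE.
Qed.

Lemma int_shift (a : 'rV[R]_n) f : integ mu f ->
  integ mu (fun x => f (x + a)) /\ \int[mu]_x f (x + a) = \int[mu]_x f x.
Proof.
move=> hf; have [] := @int_affine 1 a f (or_introl erefl) hf.
rewrite (_ : (fun x => f (affine_row 1 a x)) = fun x => f (x + a))//.
by apply/funext => x; rewrite /affine_row scale1r.
Qed.

Lemma int_opp f : integ mu f ->
  integ mu (fun x => f (- x)) /\ \int[mu]_x f (- x) = \int[mu]_x f x.
Proof.
move=> hf; have [] := @int_affine (-1) 0 f (or_intror erefl) hf.
rewrite (_ : (fun x => f (affine_row (-1) 0 x)) = fun x => f (- x))//.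
by apply/funext => x; rewrite /affine_row scaleN1r addr0.
Qed.

Lemma integ_cube r : 0 <= r -> integ mu (\1_(cube n r)) /\
  \int[mu]_x (\1_(cube n r) x) = (2 * r) ^+ n.
Proof.
move=> r0; have mc := @measurable_cube R n r r0.
exact: integ_indic_set mc (leb_cube n r0).
Qed.

Lemma integ_bounded_support r C f : 0 <= r -> measurable_fun setT f ->
  (forall x, `|f x| <= C) -> (forall x, r < `|x| -> f x = 0) ->
  integ mu f /\ \int[mu]_x `|f x| <= C * (2 * r) ^+ n.
Proof.
move=> r0 mf fC f0; have [ic Ic] := integ_cube r0.
have le x : `|f x| <= C * \1_(cube n r) x.
  rewrite indicE; have [_|] := boolP (x \in cube n r); first by rewrite mulr1.
  by rewrite notin_setE /cube /= => /negP; rewrite -ltNge => /f0 ->; rewrite normr0 mulr0.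
have hf : integ mu f by exact: integ_le mf (integZ C ic) le.
split => //; rewrite -Ic -intZ//; apply: int_le => //; [exact: integ_norm|exact: integZ].
Qed.

(** For a power of [|x|], [c k] is a bound on a dyadic shell, and the cube containing the shell
    stands for it: the loss is a constant factor, and polar coordinates are avoided. *)
Lemma integ_dyadic f (c rho : nat -> R) (A q : R) : measurable_fun setT f ->
  0 < q < 1 -> (forall k, 0 <= c k) -> (forall k, 0 <= rho k) ->
  (forall k, c k * (2 * rho k) ^+ n <= A * q ^+ k) ->
  (forall x, f x <> 0 -> exists k, `|x| <= rho k /\ `|f x| <= c k) ->
  integ mu f.
Proof.
move=> mf q01 c0 rho0 cA fc.
apply: (@integ_series R _ _ mu f c (fun k => cube n (rho k)) A q mf q01 c0 _ _ _ fc) => k.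
- exact: measurable_cube.
- exact: (integ_cube (rho0 k)).1.
- by rewrite (integ_cube (rho0 k)).2.
Qed.
End leb_integral.

(** * Finite differences *)

Section derivatives_from_estimates.
Context {R : realType} {V : normedModType R}.

Lemma is_derive_eps (f : V -> R) (x v : V) (d : R) :
  (forall e, 0 < e -> exists2 r, 0 < r & forall h, `|h| < r ->
    `|f (x + h *: v) - f x - h * d| <= e * `|h|) ->
  is_derive x v f d.
Proof.
move=> H.
have L : (fun h : R => h^-1 *: (f (h *: v + x) - f x)) @ 0^' --> d.
  apply/cvgrPdist_le => e e0; have [r r0 rH] := H e e0.
  exists r => //= h /=; rewrite sub0r normrN => hr h0.
  rewrite distrC addrC [h *: v + x]addrC.
  have -> : - d + h^-1 *: (f (x + h *: v) - f x) =
      h^-1 * (f (x + h *: v) - f x - h * d).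
    by rewrite mulrBr mulrA mulVf// mul1r addrC.
  rewrite normrM normfV ler_pdivrMl ?normr_gt0//.
  by rewrite [leRHS]mulrC; exact: rH.
by apply: DeriveDef; [exact: (cvgP d)|exact: cvg_lim].
Qed.

Lemma is_derive_quad (f : V -> R) (x v : V) (d C : R) :
  (forall h, `|h| <= 1 -> `|f (x + h *: v) - f x - h * d| <= C * h ^+ 2) ->
  is_derive x v f d.
Proof.
move=> H; apply: is_derive_eps => e e0.
have C0 : 0 < `|C| + 1 by rewrite ltr_wpDl.
exists (Num.min 1 (e / (`|C| + 1))); first by rewrite lt_min ltr01 divr_gt0.
move=> h; rewrite lt_min => /andP[h1 he].
apply: le_trans (H h (ltW h1)) _.
rewrite -real_normK ?num_real// expr2 mulrA ler_wpM2r//.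
apply: le_trans (_ : (`|C| + 1) * `|h| <= _).
  by rewrite ler_wpM2r//; have := ler_norm C; lra.
by rewrite mulrC -ler_pdivlMr// ltW.
Qed.

Lemma is_derive_line (f : V -> R) (x v : V) (d : R) :
  is_derive (0 : R) 1 (fun t => f (x + t *: v)) d -> is_derive x v f d.
Proof.
move=> [df <-].
have E : (fun h : R => h^-1 *: (f (h *: v + x) - f x)) =
    (fun h : R => h^-1 *: (((fun t => f (x + t *: v)) (h *: 1 + 0)) -
      (fun t => f (x + t *: v)) 0)).
  by apply/funext => h; rewrite /= scale0r !addr0 [h *: 1]mulr1 [x + _]addrC.
split; first by rewrite /derivable E.
by rewrite /derive E.
Qed.
End derivatives_from_estimates.

Section mean_value.
Context {R : realType}.

Lemma is_derive_continuous (f : R -> R) (x d : R) :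
  is_derive x 1 f d -> {for x, continuous f}.
Proof. by move=> [df _]; apply: differentiable_continuous; exact/derivable1_diffP. Qed.

Lemma mean_value_bound (f df : R -> R) (a b C : R) : a <= b ->
  (forall t : R, is_derive t 1 f (df t)) -> (forall t, a <= t <= b -> `|df t| <= C) ->
  `|f b - f a| <= C * (b - a).
Proof.
move=> ab fdf dfC.
have cf : {within `[a, b], continuous f}.
  by apply: continuous_subspaceT => t; exact: is_derive_continuous (fdf t).
have [c cab ->] := MVT_segment ab (fun t _ => fdf t) cf.
rewrite normrM [`|b - a|]ger0_norm ?subr_ge0// ler_wpM2r ?subr_ge0//.
by apply: dfC; move: cab; rewrite in_itv.
Qed.

(** Both [G + f] and [G - f] are nondecreasing. An explicit primitive [G] of the bound thus replaces
    integration of the derivative. *)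
Lemma derive_dominated (f df G dG : R -> R) (a b : R) : a <= b ->
  (forall t : R, a <= t <= b -> is_derive t 1 f (df t)) ->
  (forall t : R, a <= t <= b -> is_derive t 1 G (dG t)) ->
  (forall t, a <= t <= b -> `|df t| <= dG t) ->
  `|f b - f a| <= G b - G a.
Proof.
move=> ab fdf GdG le.
have mono (H dH : R -> R) : (forall t : R, a <= t <= b -> is_derive t 1 H (dH t)) ->
    (forall t, a <= t <= b -> 0 <= dH t) -> H a <= H b.
  move=> HdH dH0.
  have cH : {within `[a, b], continuous H}.
    apply: continuous_in_subspaceT => t; rewrite inE/= in_itv/= => tab.
    exact: is_derive_continuous (HdH t tab).
  have HdH' t : t \in `]a, b[ -> is_derive t 1 H (dH t).
    by rewrite in_itv/= => /andP[? ?]; apply: HdH; rewrite !ltW.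
  have [c cab E] := MVT_segment ab HdH' cH.
  rewrite -subr_ge0 E mulr_ge0 ?subr_ge0//.
  by apply: dH0; move: cab; rewrite in_itv.
have := mono (fun t => G t - f t) (fun t => dG t - df t).
have := mono (fun t => G t + f t) (fun t => dG t + df t).
move=> P N; rewrite ler_norml; apply/andP; split.
- suff : G a + f a <= G b + f b by lra.
  apply: P => t tab; first by apply: is_deriveD; [exact: GdG|exact: fdf].
  by have := le t tab; rewrite ler_norml => /andP[]; lra.
- suff : G a - f a <= G b - f b by lra.
  apply: N => t tab; first by apply: is_deriveB; [exact: GdG|exact: fdf].
  by have := le t tab; rewrite ler_norml => /andP[]; lra.
Qed.
End mean_value.

(** * Smooth bump functions *)

Section bump_profile.
Context {R : realType}.

(** [flat 0] is the classical [exp(-1/x)]; the power in front makes the linear span of the family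
    stable under differentiation. *)
Definition flat (j : nat) (x : R) : R :=
  if 0 < x then x ^- j * expR (- x^-1) else 0.

Lemma flat0 j x : x <= 0 -> flat j x = 0.
Proof. by rewrite /flat leNgt => /negbTE ->. Qed.

Lemma flat_ge0 j x : 0 <= flat j x.
Proof.
by rewrite /flat; case: ltP => // x0; rewrite mulr_ge0// ?invr_ge0 ?exprn_ge0 ?expR_ge0// ltW.
Qed.

(** [exp(1/x)] exceeds its Taylor term of degree [j + k]. The case [k = 2] yields the vanishing
    derivative at 0, the case [k = 0] boundedness. *)
Lemma flat_le j k x : flat j x <= (j + k)`!%:R * `|x| ^+ k.
Proof.
rewrite /flat; case: ltP => [x0|_]; last by rewrite mulr_ge0// exprn_ge0.
rewrite gtr0_norm//.
have fp : 0 < (j + k)`!%:R :> R by rewrite ltr0n fact_gt0.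
have e0 : x^-1 ^+ (j + k) / (j + k)`!%:R <= expR x^-1.
  have xV : 0 <= x^-1 by rewrite invr_ge0 ltW.
  case: (j + k)%N => [|m].
    by rewrite expr0 fact0 divr1; apply: le_trans (expR_ge1Dx _); rewrite lerDl.
  by apply: le_trans (expR_ge1Dxn m xV); rewrite lerDr.
rewrite expRN ler_pdivrMr ?expR_gt0//.
apply: le_trans (_ : (j + k)`!%:R * x ^+ k * (x^-1 ^+ (j + k) / (j + k)`!%:R) <= _); last first.
  by rewrite ler_wpM2l// mulr_ge0// exprn_ge0// ltW.
have xk : x ^+ k != 0 by rewrite expf_neq0 ?gt_eqF.
rewrite mulrA ler_pdivlMr// exprVn exprD invfM.
rewrite -mulrA [X in _ <= _ * X]mulrCA mulfV ?mulr1//.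
by rewrite mulrC.
Qed.

Lemma is_derive_flat j (x : R) :
  is_derive x 1 (flat j) (flat j.+2 x - j%:R * flat j.+1 x).
Proof.
have [x0|x0|->] := ltgtP x 0.
- rewrite !flat0 ?ltW// mulr0 subr0.
  apply: (@near_eq_is_derive _ _ _ (cst 0)) => //.
  have : \forall y \near x, y < 0 by exact: lt_nbhsl.
  by apply: filterS => y y0; rewrite flat0// ltW.
- apply: (@near_eq_is_derive _ _ _ (fun y : R => y^-1 ^+ j * expR (- y^-1))).
    have : \forall y \near x, 0 < y by exact: lt_nbhsr.
    by apply: filterS => y y0; rewrite /flat y0 exprVn.
  have dV : is_derive x 1 (fun y : R => y^-1) (- x ^- 2).
    have := @is_deriveV R id x 1 1 _ (is_derive_id _ _).
    rewrite scaler1 => H. apply: H; rewrite gt_eqF//.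
  have dE : is_derive x 1 (fun y : R => expR (- y^-1)) (x ^- 2 * expR (- x^-1)).
    have := @is_derive1_comp R expR (fun y => - y^-1) x _ _ (is_derive_expR _) (is_deriveN dV).
    by rewrite opprK mulrC.
  have E : (fun y : R => y^-1 ^+ j * expR (- y^-1)) =
      (fun y : R => y^-1) ^+ j * (fun y : R => expR (- y^-1)).
    by apply/funext => y; rewrite !fctE.
  rewrite E; apply: (is_derive_eq (is_deriveM (is_deriveX j dV) dE)); rewrite /flat x0 /GRing.scale /= exprVn.
  case: j E => [|j] _; first by rewrite !mul0r !mulr0 addr0 subr0 expr0 !mul1r.
  rewrite [(_ ^+ j.+1) x](_ : _ = x ^- j.+1); last by rewrite -exprVn fctE.
  have xj : x ^+ j != 0 by rewrite expf_neq0 ?gt_eqF.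
  by rewrite /= !exprS; field; rewrite xj gt_eqF.
- rewrite !flat0// mulr0 subr0.
  apply: (@is_derive_quad _ _ _ _ _ _ (j + 2)`!%:R) => h h1.
  rewrite add0r (flat0 j (lexx 0)) mulr0 !subr0 [h *: 1]mulr1 ger0_norm ?flat_ge0//.
  by rewrite -[h ^+ 2]real_normK ?num_real//; exact: flat_le.
Qed.
End bump_profile.

Lemma lipschitz_continuous {R : realType} {U V : normedModType R} (f : U -> V) (C : R) :
  0 <= C -> (forall x y, `|f x - f y| <= C * `|x - y|) -> continuous f.
Proof.
move=> C0 fC x; apply/cvgrPdist_le => e e0.
have C1 : 0 < C + 1 by lra.
apply/nbhs_ballP; exists (e / (C + 1)); first exact: divr_gt0.
move=> y; rewrite -ball_normE /= ltr_pdivlMr// => xy.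
apply: le_trans (fC _ _) _; apply: le_trans (ltW xy).
by rewrite mulrC ler_wpM2l//; lra.
Qed.

(** * Difference operators, and smoothness expressed through them *)

Section differences.
Context {R : realType} {n : nat}.
Implicit Types (f g : 'rV[R]_n -> R) (h k x : 'rV[R]_n) (hs ks : seq 'rV[R]_n).

Definition dl h f x : R := f (x + h) - f x.
Definition dd hs f : 'rV[R]_n -> R := foldr dl f hs.

Lemma dd_cat hs ks f : dd (hs ++ ks) f = dd hs (dd ks f).
Proof. by rewrite /dd foldr_cat. Qed.

Lemma dlC h k f : dl h (dl k f) = dl k (dl h f).
Proof. by apply/funext => x; rewrite /dl [x + h + k]addrAC; ring. Qed.

Lemma dd_dl hs h f : dd hs (dl h f) = dl h (dd hs f).
Proof. by elim: hs => //= k hs ->; rewrite dlC. Qed.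

Lemma ddC hs ks f : dd hs (dd ks f) = dd ks (dd hs f).
Proof. by elim: ks => //= k ks <-; rewrite dd_dl. Qed.

Lemma ddD hs f g x : dd hs (fun y => f y + g y) x = dd hs f x + dd hs g x.
Proof. by elim: hs x => //= h hs IH x; rewrite /dl !IH; ring. Qed.

Lemma ddB hs f g x : dd hs (fun y => f y - g y) x = dd hs f x - dd hs g x.
Proof. by elim: hs x => //= h hs IH x; rewrite /dl !IH; ring. Qed.

Lemma ddZ hs c f x : dd hs (fun y => c * f y) x = c * dd hs f x.
Proof. by elim: hs x => //= h hs IH x; rewrite /dl !IH; ring. Qed.

Lemma dd_sum hs I (r : seq I) (F : I -> 'rV[R]_n -> R) x :
  dd hs (fun y => \sum_(i <- r) F i y) x = \sum_(i <- r) dd hs (F i) x.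
Proof.
elim: hs x => //= h hs IH x.
by rewrite /dl !IH -sumrB.
Qed.

Lemma dd_shift hs f a x : dd hs (fun y => f (y + a)) x = dd hs f (x + a).
Proof. by elim: hs x => //= h hs IH x; rewrite /dl !IH [x + h + a]addrAC. Qed.

Lemma dd_affine hs f a t x :
  dd hs (fun y => f (a + t *: y)) x = dd [seq t *: h | h <- hs] f (a + t *: x).
Proof. by elim: hs x => //= h hs IH x; rewrite /dl !IH scalerDr addrA. Qed.

Lemma dd_bound hs f x (tau C : R) : (forall h, h \in hs -> `|h| <= tau) ->
  (forall y, `|y - x| <= (size hs)%:R * tau -> `|f y| <= C) ->
  `|dd hs f x| <= 2 ^+ size hs * C.
Proof.
elim: hs x => [|h hs IH] x hst fC /=.
  by rewrite mul1r; apply: fC; rewrite subrr normr0 mul0r.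
have ht : `|h| <= tau by apply: hst; rewrite mem_head.
have t0 : 0 <= tau by exact: le_trans ht.
have hst' k : k \in hs -> `|k| <= tau by move=> ?; apply: hst; rewrite inE orbC; apply/orP; left.
rewrite /dl exprS -mulrA mulr_natl mulr2n; apply: le_trans (ler_normB _ _) _.
apply: lerD; apply: IH => // y yx; apply: fC.
- have -> : y - x = (y - (x + h)) + h by rewrite opprD addrA subrK.
  apply: le_trans (ler_normD _ _) _; rewrite -natr1 mulrDl mul1r; exact: lerD.
- by apply: le_trans yx _; rewrite ler_wpM2r// ler_nat.
Qed.

Lemma continuous_dd hs f : continuous f -> continuous (dd hs f).
Proof.
move=> cf; elim: hs => //= h hs IH x; rewrite /dl.
have c : continuous (fun y : 'rV[R]_n => y + h).
  by apply: (@lipschitz_continuous _ _ _ _ 1) => // y z; rewrite mul1r opprD addrACA subrr addr0.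
have c2 : {for x, continuous (dd hs f \o (fun y => y + h))}.
  by apply: continuous_comp (c x) _; exact: IH.
exact: (cvgB c2 (IH x)).
Qed.

(** Stands for boundedness of all derivatives of all orders, in a form that is inherited by
    translates, mollifications and [Lop] without mentioning derivatives. *)
Definition nice f := forall m : nat, exists2 C : R, 0 <= C &
  forall hs x, size hs = m -> `|dd hs f x| <= C * \prod_(h <- hs) `|h|.

(** [f'] is the gradient of [f], with a quadratic remainder that is uniform in the base point; such
    an estimate can be integrated against any integrable weight. *)
Definition tay f (f' : 'I_n -> 'rV[R]_n -> R) := exists2 C : R, 0 <= C &
  forall x v, `|f (x + v) - f x - \sum_i v 0 i * f' i x| <= C * `|v| ^+ 2.

Lemma nice_bounded f : nice f -> exists2 C, 0 <= C & forall x, `|f x| <= C.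
Proof.
move=> /(_ 0) [C C0 H]; exists C => // x.
by have := H [::] x erefl; rewrite big_nil mulr1.
Qed.

Lemma nice_lipschitz f : nice f ->
  exists2 C, 0 <= C & forall x y, `|f x - f y| <= C * `|x - y|.
Proof.
move=> /(_ 1) [C C0 H]; exists C => // x y.
have := H [:: x - y] y erefl.
by rewrite /= /dl big_cons big_nil mulr1 [y + _]addrC subrK.
Qed.

Lemma nice_continuous f : nice f -> continuous f.
Proof. by move=> /nice_lipschitz[C C0]; exact: lipschitz_continuous. Qed.

Lemma nice_dd hs f : nice f -> nice (dd hs f).
Proof.
move=> nf m; have [C C0 H] := nf (m + size hs)%N.
exists (C * \prod_(h <- hs) `|h|); first by rewrite mulr_ge0// prodr_ge0.
move=> ks x ksm; rewrite -dd_cat; apply: le_trans (H _ _ _) _.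
  by rewrite size_cat ksm.
by rewrite big_cat/= -mulrA [X in C * X]mulrC.
Qed.

Lemma niceD f g : nice f -> nice g -> nice (fun x => f x + g x).
Proof.
move=> nf ng m; have [C C0 H] := nf m; have [D D0 K] := ng m.
exists (C + D); first exact: addr_ge0.
move=> hs x hsm; rewrite ddD mulrDl; apply: le_trans (ler_normD _ _) _.
by apply: lerD; [exact: H|exact: K].
Qed.

Lemma niceZ c f : nice f -> nice (fun x => c * f x).
Proof.
move=> nf m; have [C C0 H] := nf m.
exists (`|c| * C); first by rewrite mulr_ge0.
by move=> hs x hsm; rewrite ddZ normrM -mulrA ler_wpM2l// H.
Qed.

Lemma nice0 : nice (fun=> 0).
Proof.
move=> m; exists 0 => // hs x _; rewrite mul0r.
suff -> : dd hs (fun=> 0) x = 0 by rewrite normr0.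
by elim: hs x => //= h hs IH x; rewrite /dl !IH subrr.
Qed.

Lemma nice_sum I (r : seq I) (F : I -> 'rV[R]_n -> R) :
  (forall i, nice (F i)) -> nice (fun x => \sum_(i <- r) F i x).
Proof.
move=> nF; elim: r => [|i r IH].
  by under eq_fun do rewrite big_nil; exact: nice0.
by under eq_fun do rewrite big_cons; exact: niceD.
Qed.
End differences.

Lemma is_derive_bigsum {R : realType} n (F : 'I_n -> R -> R) (dF : 'I_n -> R) (t : R) :
  (forall i, is_derive t 1 (F i) (dF i)) ->
  is_derive t 1 (fun t => \sum_i F i t) (\sum_i dF i).
Proof.
move=> H; have := is_derive_sum H.
by rewrite (_ : \sum_i F i = fun t => \sum_i F i t)//; apply/funext => y; rewrite fct_sumE.
Qed.

Section pointwise_derivatives.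
Context {R : realType}.
Implicit Types (f g : R -> R) (t a b : R).

Lemma is_derive_pD f g t a b : is_derive t 1 f a -> is_derive t 1 g b ->
  is_derive t 1 (fun x => f x + g x) (a + b).
Proof. by move=> *; exact: is_deriveD. Qed.

Lemma is_derive_pB f g t a b : is_derive t 1 f a -> is_derive t 1 g b ->
  is_derive t 1 (fun x => f x - g x) (a - b).
Proof. by move=> *; exact: is_deriveB. Qed.

Lemma is_derive_pM f g t a b : is_derive t 1 f a -> is_derive t 1 g b ->
  is_derive t 1 (fun x => f x * g x) (f t * b + g t * a).
Proof. by move=> *; exact: is_deriveM. Qed.

Lemma is_derive_pZ c f t a : is_derive t 1 f a ->
  is_derive t 1 (fun x => c * f x) (c * a).
Proof. by move=> *; exact: is_deriveZ. Qed.

Lemma is_derive_sqr f t a : is_derive t 1 f a ->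
  is_derive t 1 (fun x => f x ^+ 2) (2 * (f t * a)).
Proof.
move=> fa; rewrite (_ : (fun x => f x ^+ 2) = fun x => f x * f x).
  by apply: is_derive_eq (is_derive_pM fa fa) _; ring.
by apply/funext => x; rewrite expr2.
Qed.
End pointwise_derivatives.

Lemma ex_ex2 T (P Q : T -> Prop) : (exists2 x, P x & Q x) -> exists x, P x /\ Q x.
Proof. by case=> x Px Qx; exists x. Qed.

Section bumpy.
Context {R : realType} {n : nat}.
Variable eps : R.
Hypothesis eps_gt0 : 0 < eps.
Implicit Types (x z v : 'rV[R]_n) (f : 'rV[R]_n -> R).

Definition qform z : R := 1 - eps ^- 2 * \sum_i z 0 i ^+ 2.

(* The span of the monomials times [flat j \o qform]; it is stable under
   partial derivatives. *)
Inductive bumpy : ('rV[R]_n -> R) -> Prop :=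
| bumpy_flat j : bumpy (fun z => flat j (qform z))
| bumpy_coord i f : bumpy f -> bumpy (fun z => z 0 i * f z)
| bumpyD f g : bumpy f -> bumpy g -> bumpy (fun z => f z + g z)
| bumpyZ c f : bumpy f -> bumpy (fun z => c * f z).

(** The Euclidean ball of radius [eps] lies in the cube of the same radius, so supports may be
    measured in the sup norm. *)
Lemma qform_le0 z : eps <= `|z| -> qform z <= 0.
Proof.
move=> ez; rewrite /qform subr_le0.
rewrite mulrC -[1 <= _ / _]/(1 <= _) ler_pdivlMr ?exprn_gt0// mul1r.
have z0 : `|z| != 0 by rewrite gt_eqF// (lt_le_trans eps_gt0).
have [[k i] /= zi] := mx_norm_neq0 z0; move: ez; rewrite [`|z|]zi (ord1 k) => ez.
rewrite (bigD1 i)//=; apply: (@le_trans _ _ (z 0 i ^+ 2)); last first.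
  by rewrite lerDl sumr_ge0// => j _; rewrite sqr_ge0.
by rewrite -[leRHS]real_normK ?num_real// lerXn2r ?nnegrE// ltW.
Qed.

Lemma bumpy_support f z : bumpy f -> eps <= `|z| -> f z = 0.
Proof.
move=> bf /qform_le0 qz; elim: bf => [j|i g _ gz|g h _ gz _ hz|c g _ gz].
- exact: flat0.
- by rewrite gz mulr0.
- by rewrite gz hz addr0.
- by rewrite gz mulr0.
Qed.

Lemma bumpy_bounded f : bumpy f -> exists2 C, 0 <= C & forall z, `|f z| <= C.
Proof.
elim=> [j|i g bg [C C0 gC]|g h _ [C C0 gC] _ [D D0 hD]|c g _ [C C0 gC]].
- exists (j + 0)`!%:R => // z; rewrite ger0_norm ?flat_ge0//.
  by have := flat_le j 0 (qform z); rewrite expr0 mulr1.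
- exists (eps * C); first by rewrite mulr_ge0// ltW.
  move=> z; have [ez|ze] := leP eps `|z|.
    by rewrite (bumpy_support bg ez) mulr0 normr0 mulr_ge0// ltW.
  rewrite normrM ler_pM//; apply: le_trans (coord_le_norm z i) _; exact: ltW.
- exists (C + D); first exact: addr_ge0.
  by move=> z; apply: le_trans (ler_normD _ _) _; apply: lerD.
- exists (`|c| * C); first by rewrite mulr_ge0.
  by move=> z; rewrite normrM ler_wpM2l.
Qed.

Lemma is_derive_coord x v i (t : R) :
  is_derive t 1 (fun t => (x + t *: v) 0 i) (v 0 i).
Proof.
rewrite (_ : (fun t => _) = fun t => x 0 i + t * v 0 i); last first.
  by apply/funext => y; rewrite !mxE.
have := is_derive_pD (is_derive_cst (x 0 i) t 1)
  (is_derive_pM (is_derive_id t 1) (is_derive_cst (v 0 i) t 1)).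
by rewrite /cst mulr0 !add0r mulr1.
Qed.

Definition flat_partial j (i : 'I_n) z : R :=
  - (2 * eps ^- 2) * (z 0 i * (flat j.+2 (qform z) + (- j%:R) * flat j.+1 (qform z))).

Lemma bumpy_flat_partial j i : bumpy (flat_partial j i).
Proof.
apply: bumpyZ; apply: bumpy_coord; apply: bumpyD; last apply: bumpyZ; exact: bumpy_flat.
Qed.

Lemma is_derive_flat_line j x v (t : R) :
  is_derive t 1 (fun t => flat j (qform (x + t *: v)))
    (\sum_i v 0 i * flat_partial j i (x + t *: v)).
Proof.
  have dq : is_derive t 1 (fun t => qform (x + t *: v))
      (- (eps ^- 2 * \sum_i 2 * ((x + t *: v) 0 i * v 0 i))).
    rewrite /qform; rewrite -[X in is_derive _ _ _ X]sub0r; apply: is_derive_pB.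
    apply: is_derive_pZ; apply: is_derive_bigsum => i.
    exact: is_derive_sqr (is_derive_coord x v i t).
  apply: is_derive_eq (is_derive1_comp (is_derive_flat j _) dq) _.
  rewrite mulr_sumr -sumrN mulr_sumr.
  apply: eq_bigr => i _; rewrite /flat_partial; ring.
Qed.

Lemma bumpy_line f : bumpy f -> exists f' : 'I_n -> 'rV[R]_n -> R,
  (forall i, bumpy (f' i)) /\ forall x v (t : R),
  is_derive t 1 (fun t => f (x + t *: v)) (\sum_i v 0 i * f' i (x + t *: v)).
Proof.
elim=> [j|i g bg [g' [bg' dg]]|g h _ [g' [bg' dg]] _ [h' [bh' dh]]|c g _ [g' [bg' dg]]].
- by exists (flat_partial j); split => [i|x v t]; [exact: bumpy_flat_partial|exact: is_derive_flat_line].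
- exists (fun k z => (i == k)%:R * g z + z 0 i * g' k z); split=> [k|x v t].
    by apply: bumpyD; [exact: bumpyZ|exact: bumpy_coord].
  apply: is_derive_eq (is_derive_pM (is_derive_coord x v i t) (dg x v t)) _.
  move: (x + t *: v) => z /=; rewrite addrC.
  under [in RHS]eq_bigr => k _ do rewrite mulrDr.
  rewrite big_split/= [in RHS](bigD1 i)//= eqxx mul1r [in RHS]big1 ?addr0.
    by rewrite mulr_sumr mulrC; congr (_ + _); apply: eq_bigr => k _; rewrite mulrCA.
  by move=> k /negbTE; rewrite eq_sym => ->; rewrite mul0r mulr0.
- exists (fun k z => g' k z + h' k z); split=> [k|x v t]; first exact: bumpyD.
  apply: is_derive_eq (is_derive_pD (dg x v t) (dh x v t)) _.
  by rewrite -big_split/=; apply: eq_bigr => k _; rewrite mulrDr.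
- exists (fun k z => c * g' k z); split=> [k|x v t]; first exact: bumpyZ.
  apply: is_derive_eq (is_derive_pZ c (dg x v t)) _.
  by rewrite mulr_sumr; apply: eq_bigr => k _; rewrite mulrCA.
Qed.

Lemma dd_line hs f (f' : 'I_n -> 'rV[R]_n -> R) :
  (forall x v (t : R), is_derive t 1 (fun t => f (x + t *: v)) (\sum_i v 0 i * f' i (x + t *: v))) ->
  forall x v (t : R), is_derive t 1 (fun t => dd hs f (x + t *: v))
     (\sum_i v 0 i * dd hs (f' i) (x + t *: v)).
Proof.
move=> H; elim: hs => //= h hs IH x v t; rewrite /dl.
have IHh : is_derive t 1 (fun t => dd hs f (x + t *: v + h))
    (\sum_i v 0 i * dd hs (f' i) (x + t *: v + h)).
  have := IH (x + h) v t; rewrite [x + h + _]addrAC; rewrite (_ : (fun t => dd hs f (x + h + t *: v)) = fun t => dd hs f (x + t *: v + h))//.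
  by apply/funext => y; rewrite addrAC.
apply: is_derive_eq (is_derive_pB IHh (IH x v t)) _.
by rewrite -sumrB; apply: eq_bigr => i _; rewrite mulrBr.
Qed.

(** The mean value theorem removes one difference at the cost of its step and of a partial
    derivative, which is bumpy again. *)
Lemma bumpy_nice f : bumpy f -> nice f.
Proof.
move=> bf m; elim: m f bf => [|m IH] f bf.
  have [C C0 fC] := bumpy_bounded bf; exists C => // -[|//] x _.
  by rewrite big_nil mulr1.
have [f' [bf' df]] := bumpy_line bf.
have [C CP] := choice (fun i => ex_ex2 (IH (f' i) (bf' i))).
have C0 i : 0 <= C i.
  by have [//] := CP i.
exists (\sum_i C i); first exact: sumr_ge0.
move=> [//|h hs] x [hsm] /=; rewrite /dl big_cons.
have := @mean_value_bound R (fun t => dd hs f (x + t *: h)) _ 0 1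
   ((\sum_i C i) * (`|h| * \prod_(k <- hs) `|k|)) ler01 (dd_line hs df x h).
rewrite scale1r scale0r addr0 subr0 mulr1; apply=> t _.
apply: le_trans (ler_norm_sum _ _ _) _; rewrite mulr_suml; apply: ler_sum => i _.
rewrite normrM mulrCA; apply: ler_pM => //; first exact: coord_le_norm.
by have [_] := CP i; apply.
Qed.

Lemma bumpy_tay f (f' : 'I_n -> 'rV[R]_n -> R) : (forall i, bumpy (f' i)) ->
  (forall x v (t : R), is_derive t 1 (fun t => f (x + t *: v)) (\sum_i v 0 i * f' i (x + t *: v))) ->
  tay f f'.
Proof.
move=> bf' df.
have [C CP] := choice (fun i => ex_ex2 (nice_lipschitz (bumpy_nice (bf' i)))).
have C0 i : 0 <= C i by have [] := CP i.
exists (\sum_i C i); first exact: sumr_ge0.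
move=> x v.
pose S := \sum_i v 0 i * f' i x.
have dS (t : R) : is_derive t 1 (fun t => f (x + t *: v) - S * t)
    (\sum_i v 0 i * f' i (x + t *: v) - S * 1).
  exact: (is_derive_pB (df x v t) (is_derive_pZ S (is_derive_id t 1))).
have := @mean_value_bound R _ _ 0 1 ((\sum_i C i) * `|v| ^+ 2) ler01 dS.
rewrite scale1r scale0r addr0 subr0 !mulr1 mulr0 subr0 addrAC; apply=> t /andP[t0 t1].
rewrite -sumrB; apply: le_trans (ler_norm_sum _ _ _) _.
rewrite mulr_suml; apply: ler_sum => i _.
rewrite -mulrBr normrM expr2 mulrCA; apply: ler_pM => //; first exact: coord_le_norm.
have [_ /(_ (x + t *: v) x)] := CP i; move=> /le_trans; apply.
rewrite ler_wpM2l// [x + _]addrC addrK normrZ ler_piMl//.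
by rewrite ger0_norm.
Qed.
End bumpy.

(** * L1 bounds for differences of a bump, and transfer of differences to the weight *)

Section difference_integrals.
Context {R : realType} {n : nat}.
Local Notation mu := (@leb R n).
Implicit Types (f psi F : 'rV[R]_n -> R) (hs : seq 'rV[R]_n) (x z : 'rV[R]_n).

Definition csupp (e : R) psi := forall z, e <= `|z| -> psi z = 0.

Lemma continuous_integ psi e : continuous psi -> csupp e psi ->
  (exists C, forall z, `|psi z| <= C) -> 0 <= e -> integ mu psi.
Proof.
move=> cp sp [C pC] e0.
apply: (integ_bounded_support e0 (continuous_measurable_row cp) pC _).1.
by move=> x /ltW; exact: sp.
Qed.

Lemma nice_integ psi e : nice psi -> csupp e psi -> 0 <= e -> integ mu psi.
Proof.
move=> np sp e0; apply: continuous_integ sp _ e0; first exact: nice_continuous.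
by have [C _ pC] := nice_bounded np; exists C.
Qed.

Lemma dd_csupp hs psi e tau : csupp e psi -> (forall h, h \in hs -> `|h| <= tau) ->
  csupp (e + (size hs)%:R * tau) (dd hs psi).
Proof.
move=> sp hst z ez; apply/eqP; rewrite -normr_le0.
apply: le_trans (@dd_bound _ _ hs psi z tau 0 hst _) _; last by rewrite mulr0.
move=> y yz; rewrite sp ?normr0//.
have : `|z| <= `|y| + `|y - z|.
  by have := ler_normB y (y - z); rewrite opprB addrC subrK.
by move=> ?; lra.
Qed.

(** Sum of the indicators of the [2^m] translated cubes on which the differences can be nonzero. The
    translates may lie far apart, so one cube containing them all would have a volume depending on
    the steps; the integral of the sum does not. *)
Fixpoint envelope (e : R) hs (z : 'rV[R]_n) : R :=
  if hs is h :: hs' then envelope e hs' (z + h) + envelope e hs' z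
  else \1_(cube n e) z.

Lemma envelope_ge0 e hs z : 0 <= envelope e hs z.
Proof. by elim: hs z => [|h hs IH] z /=; [rewrite indicE|exact: addr_ge0]. Qed.

Lemma int_envelope e hs : 0 <= e -> integ mu (envelope e hs) /\
  \int[mu]_z envelope e hs z = 2 ^+ size hs * (2 * e) ^+ n.
Proof.
move=> e0; elim: hs => [|h hs [iE IE]] /=.
  by have [iE IE] := @integ_cube R n e e0; split; [exact: iE|rewrite expr0 mul1r; exact: IE].
have [iS IS] := int_shift h iE.
by split; [exact: integD|rewrite intD// IS IE exprS; ring].
Qed.

Lemma dd_envelope e hs psi z : csupp e psi -> dd hs psi z <> 0 -> 1 <= envelope e hs z.
Proof.
move=> sp; elim: hs z => [|h hs IH] z /= H.
  rewrite indicE mem_set//= /cube /= leNgt; apply/negP => /ltW /sp; exact: H.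
have [H1|/eqP/IH] := eqVneq (dd hs psi (z + h)) 0; last first.
  by move=> E; rewrite (le_trans E)// lerDl envelope_ge0.
have [H2|/eqP/IH] := eqVneq (dd hs psi z) 0; last first.
  by move=> E; rewrite (le_trans E)// lerDr envelope_ge0.
by exfalso; apply: H; rewrite /dl H1 H2 subrr.
Qed.

(** A step of length at least 1 gains nothing and costs a factor 2. Such steps do occur: a
    difference of step [h] at scale [t] acts on the weight with step [h / t], which is long when [t]
    is small. *)
Lemma nice_dd_min psi : nice psi -> forall m, exists2 C : R, 0 <= C &
  forall hs z, size hs = m -> `|dd hs psi z| <= C * \prod_(h <- hs) Num.min 1 `|h|.
Proof.
move=> np m.
have [C CP] := choice (fun k => ex_ex2 (np k)).
have C0 k : 0 <= C k by have [] := CP k.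
pose D := \sum_(k < m.+1) C k.
have CD k : (k <= m)%N -> C k <= D.
  move=> km; have km1 : (k < m.+1)%N by [].
  by rewrite /D (bigD1 (Ordinal km1))//= lerDl sumr_ge0.
have D0 : 0 <= D by exact: sumr_ge0.
(* [ks] collects the short steps. A long step is expanded into its two values, which loses a
   difference; hence the inequality between sizes, and [D] sums the constants of all orders up to
   [m]. *)
have key hs ks z : (size ks + size hs <= m)%N ->
    `|dd ks (dd hs psi) z| <= 2 ^+ size hs * (D * (\prod_(k <- ks) `|k| *
      \prod_(h <- hs) Num.min 1 `|h|)).
  elim: hs ks z => [|h hs IH] ks z szm.
    rewrite expr0 mul1r big_nil mulr1; have [_ H] := CP (size ks).
    apply: le_trans (H ks z erefl) _; rewrite ler_wpM2r ?prodr_ge0//.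
    by apply: CD; rewrite addn0 in szm.
  have szm' : (size ks + size hs <= m)%N.
    by apply: leq_trans szm; rewrite leq_add2l /=.
  have X0 l : 0 <= \prod_(k <- l) `|k : 'rV[R]_n| by rewrite prodr_ge0.
  have Y0 l : 0 <= \prod_(k <- l) Num.min 1 `|k : 'rV[R]_n|.
    by rewrite prodr_ge0// => k _; rewrite le_min ler01 normr_ge0.
  rewrite big_cons /=; have [h1|h1] := leP `|h| 1.
    have := IH (h :: ks) z; rewrite /= addSn -addnS => /(_ szm).
    rewrite dd_dl big_cons => /le_trans; apply.
    rewrite exprS -[leRHS]mulrA [leRHS]mulr_natl mulr2n.
    have -> : \prod_(j <- ks) `|j| * (`|h| * \prod_(j <- hs) Num.min 1 `|j|) =
      `|h| * \prod_(j <- ks) `|j| * \prod_(j <- hs) Num.min 1 `|j| by ring.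
    by rewrite lerDl mulr_ge0// mulr_ge0// mulr_ge0// mulr_ge0.
  rewrite mul1r dd_dl /dl; apply: le_trans (ler_normB _ _) _.
  rewrite exprS -mulrA mulr_natl mulr2n.
  by apply: lerD; exact: IH.
exists (2 ^+ m * D); first by rewrite mulr_ge0.
move=> hs z hm; have := key hs [::] z; rewrite hm add0n => /(_ (leqnn _)).
by rewrite /= big_nil mul1r mulrA.
Qed.

Lemma dd_L1 psi e : nice psi -> csupp e psi -> 0 <= e ->
  forall m, exists2 C : R, 0 <= C & forall hs, size hs = m ->
  integ mu (dd hs psi) /\
  \int[mu]_z `|dd hs psi z| <= C * \prod_(h <- hs) Num.min 1 `|h|.
Proof.
move=> np sp e0 m; have [C C0 CP] := nice_dd_min np m.
exists (C * (2 ^+ m * (2 * e) ^+ n)).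
  by rewrite mulr_ge0// mulr_ge0// exprn_ge0// mulr_ge0.
move=> hs hm; have [iE IE] := int_envelope hs e0.
set P := \prod_(h <- hs) _.
have P0 : 0 <= P by rewrite prodr_ge0// => h _; rewrite le_min ler01 normr_ge0.
have le z : `|dd hs psi z| <= C * P * envelope e hs z.
  have [->|/eqP/(dd_envelope sp) E] := eqVneq (dd hs psi z) 0.
    by rewrite normr0 mulr_ge0 ?envelope_ge0// mulr_ge0.
  by apply: le_trans (CP hs z hm) _; rewrite ler_peMr// mulr_ge0.
have iD : integ mu (dd hs psi).
  apply: integ_le (integZ (C * P) iE) le.
  exact/continuous_measurable_row/nice_continuous/nice_dd.
split => //; apply: le_trans (int_le (integ_norm iD) (integZ (C * P) iE) le) _.
by rewrite intZ// IE hm; lra.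
Qed.

(** Discrete integration by parts: the substitution [z -> z - h / t] moves the difference from [F]
    to the weight. *)
Lemma int_dl_move F psi x h (t C : R) : t != 0 -> continuous F ->
  (forall y, `|F y| <= C) -> integ mu psi ->
  \int[mu]_z (dl h F (x + t *: z) * psi z) =
  \int[mu]_z (F (x + t *: z) * dl (- (t^-1 *: h)) psi z).
Proof.
move=> t0 cF FC ip.
have mF (a : 'rV[R]_n) : measurable_fun setT (fun z : 'rV[R]_n => F (a + t *: z)).
  apply: continuous_measurable_row => z.
  apply: (@continuous_comp _ _ _ (fun z : 'rV[R]_n => a + t *: z) F z); last exact: cF.
  apply: (@lipschitz_continuous _ _ _ _ `|t|) => // y y'.
  by rewrite opprD addrACA subrr add0r -scalerBr normrZ.
have iFp a p : integ mu p -> integ mu (fun z => F (a + t *: z) * p z).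
  move=> ip'; apply: (integ_le _ (integZ C (integ_norm ip'))) => [|z].
    by apply: measurable_funM => //; exact: integ_measurable ip'.
  by rewrite normrM ler_wpM2r.
have [ips _] := int_shift (- (t^-1 *: h)) ip.
have E : \int[mu]_z (F (x + t *: z + h) * psi z) =
    \int[mu]_z (F (x + t *: z) * psi (z - t^-1 *: h)).
  have [_] := int_shift (- (t^-1 *: h)) (iFp (x + h) psi ip).
  rewrite (_ : (fun z => F (x + h + t *: (z - t^-1 *: h)) * psi (z - t^-1 *: h)) =
    fun z => F (x + t *: z) * psi (z - t^-1 *: h)); last first.
    apply/funext => z; rewrite scalerBr scalerA divff// scale1r.
    by congr (F _ * _); rewrite addrACA subrr addr0.
  move=> ->; apply: eq_Rintegral => z _; by rewrite addrAC.
transitivity (\int[mu]_z (F (x + t *: z + h) * psi z - F (x + t *: z) * psi z)).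
  by apply: eq_Rintegral => z _; rewrite /dl mulrBl.
have iFh : integ mu (fun z => F (x + t *: z + h) * psi z).
  have := iFp (x + h) psi ip; congr (integ _ _).
  by apply/funext => z; rewrite addrAC.
rewrite intB//; last exact: iFp.
rewrite E -intB; [|exact: iFp|exact: iFp].
by apply: eq_Rintegral => z _; rewrite /dl mulrBr.
Qed.

Lemma integ_dl psi h : integ mu psi -> integ mu (dl h psi).
Proof. by move=> ip; apply: integB => //; exact: (int_shift h ip).1. Qed.

Lemma bounded_dd hs F (C : R) : (forall y, `|F y| <= C) ->
  forall y, `|dd hs F y| <= 2 ^+ size hs * C.
Proof.
move=> FC; elim: hs => [|h hs IH] y /=; first by rewrite mul1r.
rewrite exprS -mulrA mulr_natl mulr2n; apply: le_trans (ler_normB _ _) _.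
by apply: lerD; exact: IH.
Qed.

Lemma int_dd_move hs F psi x (t C : R) : t != 0 -> continuous F ->
  (forall y, `|F y| <= C) -> integ mu psi ->
  \int[mu]_z (dd hs F (x + t *: z) * psi z) =
  \int[mu]_z (F (x + t *: z) * dd [seq - (t^-1 *: h) | h <- hs] psi z).
Proof.
move=> t0 cF FC; elim: hs psi => [//|h hs IH] psi ip /=.
rewrite (int_dl_move _ _ t0 (continuous_dd (hs := hs) cF) (bounded_dd hs FC) ip).
by rewrite IH ?dd_dl//; exact: integ_dl.
Qed.

(** The global bound [C] only ensures integrability. The estimate itself sees [F] through [B], on
    the ball reached by the support of the differenced weight; this keeps all estimates local. *)
Lemma int_avg_bound hs F psi x (e t tau B C r : R) : 0 < t -> continuous F ->
  (forall y, `|F y| <= C) -> csupp e psi -> integ mu psi -> 0 <= e ->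
  (forall h, h \in hs -> `|h| <= tau) ->
  integ mu (dd [seq - (t^-1 *: h) | h <- hs] psi) ->
  t * e + (size hs)%:R * tau <= r ->
  (forall y, `|y - x| <= r -> `|F y| <= B) ->
  `|\int[mu]_z (dd hs F (x + t *: z) * psi z)| <=
  B * \int[mu]_z `|dd [seq - (t^-1 *: h) | h <- hs] psi z|.
Proof.
move=> t0 cF FC sp ip e0 hst id tr FB.
rewrite (int_dd_move hs x (lt0r_neq0 t0) cF FC ip) -intZ; last exact: integ_norm.
have mF : measurable_fun setT (fun z : 'rV[R]_n => F (x + t *: z)).
  apply: continuous_measurable_row => z.
  apply: (@continuous_comp _ _ _ (fun z : 'rV[R]_n => x + t *: z) F z); last exact: cF.
  apply: (@lipschitz_continuous _ _ _ _ `|t|) => // y y'.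
  by rewrite opprD addrACA subrr add0r -scalerBr normrZ.
have le z : `|F (x + t *: z) * dd [seq - (t^-1 *: h) | h <- hs] psi z| <=
    B * `|dd [seq - (t^-1 *: h) | h <- hs] psi z|.
  rewrite normrM; have [ez|ze] := leP (e + (size hs)%:R * (t^-1 * tau)) `|z|.
    suff -> : dd [seq - (t^-1 *: h) | h <- hs] psi z = 0 by rewrite normr0 !mulr0.
    have := @dd_csupp [seq - (t^-1 *: h) | h <- hs] psi e (t^-1 * tau) sp.
    rewrite size_map; apply => // _ /mapP[h hhs ->].
    by rewrite normrN normrZ gtr0_norm ?invr_gt0// ler_pM2l ?invr_gt0//; exact: hst.
  rewrite ler_wpM2r//; apply: FB; rewrite addrAC subrr add0r normrZ gtr0_norm//.
  apply: le_trans tr; move: ze => /ltW ze.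
  apply: le_trans (_ : t * (e + (size hs)%:R * (t^-1 * tau)) <= _).
    by rewrite ler_pM2l.
  by rewrite mulrDr [X in _ + X]mulrCA mulVKf ?gt_eqF.
have iB := integZ B (integ_norm id).
apply: (int_abs_le iB _ le); apply: (integ_le _ iB le).
by apply: measurable_funM; [exact: mF|exact: integ_measurable id].
Qed.
End difference_integrals.

(** * Derivative of a radial average with respect to its scale *)

Section averages.
Context {R : realType} {n : nat}.
Local Notation mu := (@leb R n).
Implicit Types (f psi w : 'rV[R]_n -> R) (x z v : 'rV[R]_n).

Lemma le_small_eq0 (a K : R) : (forall s, 0 < s <= 1 -> `|a| <= K * s) -> a = 0.
Proof.
move=> H; apply/eqP/negPn/negP => a0.
have a1 : 0 < `|a| by rewrite normr_gt0.
have K0 : 0 < K by have := H 1; rewrite mulr1 ltr01 lexx => /(_ isT); exact: lt_le_trans.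
have s0 : 0 < Num.min 1 (`|a| / (2 * K)).
  by rewrite lt_min ltr01 divr_gt0// mulr_gt0.
have := H (Num.min 1 (`|a| / (2 * K))); rewrite s0 ge_min lexx => /(_ isT).
apply/negP; rewrite -ltNge; apply: (@le_lt_trans _ _ (K * (`|a| / (2 * K)))).
  by rewrite ler_pM2l// ge_min lexx orbT.
have -> : K * (`|a| / (2 * K)) = `|a| / 2 by field; rewrite gt_eqF.
lra.
Qed.

Lemma tay_dd hs f (f' : 'I_n -> 'rV[R]_n -> R) :
  tay f f' -> tay (dd hs f) (fun i => dd hs (f' i)).
Proof.
move=> [C C0 fC]; exists (2 ^+ size hs * C); first by rewrite mulr_ge0.
move=> x v; rewrite -mulrA.
rewrite -[X in X - _ - _](dd_shift hs f v) -ddB.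
under eq_bigr do rewrite -ddZ.
rewrite -dd_sum -ddB.
by apply: bounded_dd => y; exact: fC.
Qed.

Lemma tay_affine f (f' : 'I_n -> 'rV[R]_n -> R) (x : 'rV[R]_n) (t : R) : tay f f' ->
  tay (fun z => f (x + t *: z)) (fun i z => t * f' i (x + t *: z)).
Proof.
move=> [C C0 fC]; exists (C * t ^+ 2); first by rewrite mulr_ge0// sqr_ge0.
move=> z v; have := fC (x + t *: z) (t *: v).
rewrite normrZ exprMn real_normK ?num_real// mulrA scalerDr addrA.
rewrite (_ : \sum_i (t *: v) 0 i * f' i (x + t *: z) =
  \sum_i v 0 i * (t * f' i (x + t *: z)))//.
by apply: eq_bigr => i _; rewrite mxE; ring.
Qed.

Lemma continuous_affine f x (t : R) : continuous f -> continuous (fun z => f (x + t *: z)).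
Proof.
move=> cf z.
apply: (@continuous_comp _ _ _ (fun z : 'rV[R]_n => x + t *: z) f z); last exact: cf.
apply: (@lipschitz_continuous _ _ _ _ `|t|) => // y y'.
by rewrite opprD addrACA subrr add0r -scalerBr normrZ.
Qed.

Lemma continuousM_row f psi : continuous f -> continuous psi ->
  continuous (fun z => f z * psi z).
Proof. by move=> cf cp z; exact: (cvgM (cf z) (cp z)). Qed.

(** The integral of [f * psi] does not change when both factors are translated by [s] in the
    direction [i]. Expanding to first order leaves [s] times the sum of the two integrals, up to an
    error of order [s^2], so that sum vanishes. *)
Lemma int_by_parts f psi (f' psi' : 'I_n -> 'rV[R]_n -> R) (e : R) i : 0 <= e ->
  nice f -> nice psi -> nice (f' i) -> nice (psi' i) -> tay f f' -> tay psi psi' ->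
  csupp e psi -> csupp e (psi' i) ->
  \int[mu]_z (f' i z * psi z) = - \int[mu]_z (f z * psi' i z).
Proof.
move=> e0 nf np nf' np' [C C0 fC] [D D0 pD] sp sp'.
have [F F0 fF] := nice_bounded nf; have [P P0 pP] := nice_bounded np.
have [F' F'0 fF'] := nice_bounded nf'; have [L L0 pL] := nice_lipschitz np.
have ibs g h C' : nice g -> (forall z, `|g z| <= C') -> integ mu h -> integ mu (fun z => g z * h z).
  move=> ng gC ih; have ihC := integZ C' (integ_norm ih).
  apply: (integ_le _ ihC) => [|z]; last by rewrite normrM ler_wpM2r.
  apply: measurable_funM; last exact: integ_measurable ih.
  exact/continuous_measurable_row/nice_continuous.
have ip := nice_integ np sp e0; have ip' := nice_integ np' sp' e0.
have i1 : integ mu (fun z => f' i z * psi z) by exact: ibs ip.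
have i2 : integ mu (fun z => f z * psi' i z) by exact: ibs ip'.
have ifp := ibs _ _ _ nf fF ip.
apply/eqP; rewrite -addr_eq0 -intD//; apply/eqP.
(* As [s <= 1], this cube contains the supports of [psi] and of its translates. *)
have [ic Ic] := @integ_cube R n (e + 1) (addr_ge0 e0 ler01).
apply: (@le_small_eq0 _ ((C * P + F' * L + F * D) * (2 * (e + 1)) ^+ n)) => s /andP[s0 s1].
pose v := s *: delta_mx 0 i : 'rV[R]_n.
have vi k : v 0 k = s * (k == i)%:R by rewrite !mxE eqxx.
have nv : `|v| <= s.
  apply: row_norm_le; first exact: ltW.
  by move=> k; rewrite vi; case: eqP; rewrite ?mulr1 ?mulr0 ?normr0 ?ger0_norm// ltW.
have vsum (g : 'I_n -> 'rV[R]_n -> R) z : \sum_k v 0 k * g k z = s * g i z.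
  rewrite (bigD1 i)//= vi eqxx mulr1 big1 ?addr0// => k /negbTE ki.
  by rewrite vi ki mulr0 mul0r.
have [ish Ish] := int_shift v ifp.
pose E z := f (z + v) * psi (z + v) - f z * psi z - s * (f' i z * psi z + f z * psi' i z).
have iE : integ mu E by apply: integB; [exact: integB|apply: integZ; exact: integD].
have Eint : \int[mu]_z E z = - (s * \int[mu]_z (f' i z * psi z + f z * psi' i z)).
  rewrite /E intB ?intZ; [|exact: integD|exact: integB|apply: integZ; exact: integD].
  by rewrite intB// Ish subrr sub0r.
have Ele z : `|E z| <= (C * P + F' * L + F * D) * s ^+ 2 * \1_(cube n (e + 1)) z.
  have K0 : 0 <= (C * P + F' * L + F * D) * s ^+ 2.
    by rewrite mulr_ge0 ?sqr_ge0// !addr_ge0// mulr_ge0.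
  rewrite indicE; have [_|] := boolP (z \in cube n (e + 1)); last first.
    rewrite notin_setE /cube /= => /negP; rewrite -ltNge => ez.
    have ez1 : e <= `|z| by lra.
    have ez2 : e <= `|z + v|.
      by have := ler_normB (z + v) v; rewrite addrK; lra.
    by rewrite /E (sp _ ez1) (sp _ ez2) (sp' _ ez1) !mulr0 addr0 mulr0 !subr0 normr0.
  rewrite mulr1.
  have -> : E z = (f (z + v) - f z - s * f' i z) * psi (z + v) +
     s * f' i z * (psi (z + v) - psi z) + f z * (psi (z + v) - psi z - s * psi' i z).
    by rewrite /E; ring.
  have v2 : `|v| ^+ 2 <= s ^+ 2 by rewrite lerXn2r ?nnegrE// ltW.
  have b1 : `|f (z + v) - f z - s * f' i z| <= C * s ^+ 2.
    by rewrite -vsum; apply: le_trans (fC z v) _; rewrite ler_wpM2l.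
  have b2 : `|psi (z + v) - psi z - s * psi' i z| <= D * s ^+ 2.
    by rewrite -vsum; apply: le_trans (pD z v) _; rewrite ler_wpM2l.
  have b3 : `|psi (z + v) - psi z| <= L * s.
    apply: le_trans (pL _ _) _; rewrite [z + v]addrC addrK; exact: ler_wpM2l.
  rewrite [leRHS]mulrDl [X in _ <= X + _]mulrDl; apply: le_trans (ler_normD _ _) _; apply: lerD.
    apply: le_trans (ler_normD _ _) _; apply: lerD.
      by rewrite normrM mulrAC; apply: ler_pM.
    rewrite !normrM (ger0_norm (ltW s0)) [s * _]mulrC expr2 -!mulrA [L * _]mulrCA.
    by apply: ler_pM => //; [rewrite mulr_ge0// ltW|rewrite ler_pM2l].
  by rewrite normrM -mulrA; apply: ler_pM.
rewrite -(ler_pM2l s0) mulrCA -[X in X * `|_|](ger0_norm (ltW s0)) -normrM -normrN -Eint.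
have iK := integZ ((C * P + F' * L + F * D) * s ^+ 2) ic.
apply: le_trans (int_abs_le iK iE Ele) _.
by rewrite intZ// Ic le_eqVlt; apply/orP; left; apply/eqP; ring.
Qed.

Lemma integ_boundedM (F psi : 'rV[R]_n -> R) (C : R) : continuous F -> (forall z, `|F z| <= C) ->
  integ mu psi -> integ mu (fun z => F z * psi z).
Proof.
move=> cF FC ip; have ipC := integZ C (integ_norm ip).
apply: (integ_le _ ipC) => [|z]; last by rewrite normrM ler_wpM2r.
apply: measurable_funM; last exact: integ_measurable ip.
exact: continuous_measurable_row.
Qed.

Lemma nice_affine f (a : 'rV[R]_n) (t : R) : nice f -> nice (fun z => f (a + t *: z)).
Proof.
move=> nf m; have [C C0 H] := nf m; exists (C * `|t| ^+ m); first by rewrite mulr_ge0// exprn_ge0.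
move=> hs x hm; rewrite dd_affine; apply: le_trans (H _ _ _) _; first by rewrite size_map.
rewrite -mulrA ler_wpM2l// big_map -hm; elim: hs {hm} => [|h hs IH].
  by rewrite !big_nil expr0 mulr1.
by rewrite !big_cons /= exprS normrZ -!mulrA ler_wpM2l// mulrCA ler_wpM2l.
Qed.

Variables theta eta : 'rV[R]_n -> R.
Hypotheses (ntheta : nice theta) (neta : nice eta) (stheta : csupp 1 theta)
  (seta : csupp 1 eta) (ntheta' : forall i, nice (fun z => - (z 0 i * eta z)))
  (tayt : tay theta (fun i z => - (z 0 i * eta z))).
Variables (w : 'rV[R]_n -> R) (w1 : 'I_n -> 'rV[R]_n -> R) (w2 : 'I_n -> 'I_n -> 'rV[R]_n -> R).
Hypotheses (nw : nice w) (nw1 : forall i, nice (w1 i)) (nw2 : forall i j, nice (w2 i j))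
  (tw : tay w w1) (tw1 : forall i, tay (w1 i) (w2 i)).

(** Differentiation under the integral produces the factors [z_i eta], which are minus the partial
    derivatives of [theta]; integrating by parts turns the gradient of [w] into its Laplacian and
    yields the factor [t]. *)
Lemma is_derive_average x (t : R) :
  is_derive t 1 (fun t => \int[mu]_z (w (x + t *: z) * eta z))
    (t * \int[mu]_z ((\sum_i w2 i i (x + t *: z)) * theta z)).
Proof.
have ieta := nice_integ neta seta ler01.
have itheta := nice_integ ntheta stheta ler01.
have cb f t' : nice f -> integ mu (fun z => f (x + t' *: z) * eta z).
  move=> nf; have [C _ fC] := nice_bounded nf.
  by apply: (@integ_boundedM _ _ C) => //; apply: continuous_affine; exact: nice_continuous.
have icb i : integ mu (fun z => w1 i (x + t *: z) * (- (z 0 i * eta z))).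
  have [C _ fC] := nice_bounded (nw1 i); apply: (@integ_boundedM _ _ C) => //.
    by apply: continuous_affine; exact: nice_continuous.
  apply: (@nice_integ _ _ _ 1) => // z z1; by rewrite (seta z1) mulr0 oppr0.
have icb' i : integ mu (fun z => t * w2 i i (x + t *: z) * theta z).
  have [C _ fC] := nice_bounded (nw2 i i).
  apply: (@integ_boundedM _ _ (`|t| * C)) => //.
    apply: nice_continuous; apply: niceZ; exact: nice_affine.
  by move=> z; rewrite normrM ler_wpM2l.
have -> : t * \int[mu]_z ((\sum_i w2 i i (x + t *: z)) * theta z) =
    \int[mu]_z (\sum_i z 0 i * w1 i (x + t *: z) * eta z).
  transitivity (\sum_i \int[mu]_z (t * w2 i i (x + t *: z) * theta z)).
    rewrite -int_sum// -intZ.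
      apply: eq_Rintegral => z _; rewrite mulr_suml mulr_sumr.
      by apply: eq_bigr => i _; rewrite mulrA.
    have := nice_sum (index_enum 'I_n) (fun i => nw2 i i) => ns.
    have [C _ fC] := nice_bounded ns.
    apply: (@integ_boundedM (fun z => \sum_i w2 i i (x + t *: z)) theta C) => //.
    exact: (continuous_affine (nice_continuous ns)).
  rewrite int_sum; last first.
    move=> i; have := integZ (-1) (icb i); congr (integ _ _).
    by apply/funext => z; ring.
  apply: eq_bigr => i _.
  rewrite (@int_by_parts (fun z => w1 i (x + t *: z)) theta
     (fun k z => t * w2 i k (x + t *: z)) (fun k z => - (z 0 k * eta z)) 1 i) //.
  - by rewrite -intN//; apply: eq_Rintegral => z _; ring.
  - exact: nice_affine.
  - by apply: niceZ; exact: nice_affine.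
  - exact: tay_affine.
  - by move=> z z1; rewrite (seta z1) mulr0 oppr0.
have [C C0 wC] := tw.
have iCe := integZ C (integ_norm ieta).
apply: (@is_derive_quad _ _ _ _ _ _ (C * \int[mu]_z `|eta z|)) => h _ /=.
rewrite [h *: 1]mulr1 -intB; [|exact: cb|exact: cb].
have iS : integ mu (fun z => \sum_i z 0 i * w1 i (x + t *: z) * eta z).
  apply: integ_sum => i; have := integZ (-1) (icb i); congr (integ _ _).
  by apply/funext => z; ring.
rewrite -intZ// -intB; [|by apply: integB; exact: cb|exact: integZ].
have ih2 := integZ (h ^+ 2) iCe.
rewrite -intZ; last exact: integ_norm.
rewrite mulrC -intZ//; apply: (int_abs_le ih2).
  by apply: integB; [apply: integB; exact: cb|exact: integZ].
move=> z; have [z1|/ltW z1] := leP 1 `|z|.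
  rewrite (seta z1) !mulr0 subrr sub0r big1 ?mulr0 ?oppr0 ?normr0 ?mulr0//.
  by move=> i _; rewrite mulr0.
have -> : w (x + (t + h) *: z) * eta z - w (x + t *: z) * eta z -
    h * (\sum_i z 0 i * w1 i (x + t *: z) * eta z) =
  (w (x + t *: z + h *: z) - w (x + t *: z) - \sum_i (h *: z) 0 i * w1 i (x + t *: z)) * eta z.
  rewrite scalerDl addrA !mulrBl; congr (_ - _).
  by rewrite mulr_sumr mulr_suml; apply: eq_bigr => i _; rewrite mxE; ring.
rewrite normrM mulrA ler_wpM2r//; apply: le_trans (wC _ _) _.
rewrite normrZ exprMn real_normK ?num_real// mulrC ler_wpM2r//.
by rewrite ler_piMr ?sqr_ge0// expr_le1.
Qed.
End averages.

(** * Bootstrapping differences through radial averages *)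

Section nonlocal.
Context {R : realType} {n : nat}.
Local Notation mu := (@leb R n).
Implicit Types (G w : 'rV[R]_n -> R) (x y z : 'rV[R]_n) (hs : seq 'rV[R]_n).

(** Minus the centred second difference, which is the sign of the fractional Laplacian. *)
Definition sd z G y : R := 2 * G y - G (y + z) - G (y - z).

Lemma continuousB_row (f g : 'rV[R]_n -> R) : continuous f -> continuous g ->
  continuous (fun z => f z - g z).
Proof. by move=> cf cg z; exact: (cvgB (cf z) (cg z)). Qed.

Lemma continuous_sd1 G y : continuous G -> continuous (fun z => sd z G y).
Proof.
move=> cG; apply: continuousB_row; [apply: continuousB_row|].
- exact: cst_continuous.
- rewrite (_ : (fun z => G (y + z)) = fun z => G (y + 1 *: z)); first exact: continuous_affine.
  by apply/funext => z; rewrite scale1r.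
- rewrite (_ : (fun z => G (y - z)) = fun z => G (y + (-1) *: z)); first exact: continuous_affine.
  by apply/funext => z; rewrite scaleN1r.
Qed.

Lemma continuous_sd2 z' G x (t : R) : continuous G ->
  continuous (fun z => sd z' G (x + t *: z)).
Proof.
move=> cG; apply: continuousB_row; [apply: continuousB_row|].
- apply: continuousM_row; first exact: cst_continuous.
  exact: (@continuous_affine R n G x t cG).
- rewrite (_ : (fun z => _) = fun z => G (x + z' + t *: z)); first exact: continuous_affine.
  by apply/funext => z; rewrite addrAC.
- rewrite (_ : (fun z => _) = fun z => G (x - z' + t *: z)); first exact: continuous_affine.
  by apply/funext => z; rewrite addrAC.
Qed.

Lemma sdE z G y : sd z G y = - dd [:: z; z] G (y - z).
Proof. by rewrite /sd /= /dl !subrK; ring. Qed.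

Variables (kappa : 'rV[R]_n -> R) (p r : R).
Hypotheses (mkappa : measurable_fun setT kappa) (kappa_ge0 : forall z, 0 <= kappa z)
  (kappa_supp : forall z, r < `|z| -> kappa z = 0) (r01 : 0 < r <= 1)
  (p02 : 0 < p < 2) (ikappa : integ mu (fun z => kappa z * `|z| `^ p)).

(** Symmetrization makes the integral absolutely convergent on [nice] functions, since [kappa] has a
    finite second moment; no principal value is involved. *)
Definition Lop w y : R := \int[mu]_z (kappa z * sd z w y).

Lemma integ_kappa_sqr : integ mu (fun z => kappa z * `|z| ^+ 2).
Proof.
apply: (integ_le _ ikappa) => [|z].
  apply: measurable_funM; first exact: mkappa.
  apply: measurable_funX; apply: continuous_measurable_row; exact: norm_continuous.
rewrite normrM ger0_norm// ger0_norm ?exprn_ge0//.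
have [rz|zr] := ltP r `|z|; first by rewrite kappa_supp// !mul0r.
rewrite ler_wpM2l//; have z1 : `|z| <= 1 by apply: (le_trans zr); case/andP: r01.
have [->|z0] := eqVneq `|z| 0.
  by rewrite expr0n /= powR0// gt_eqF//; case/andP: p02.
rewrite -(powR_mulrn 2 (normr_ge0 z)); apply: ger_powR.
  by rewrite z1 lt_neqAle eq_sym z0 normr_ge0.
by case/andP: p02 => _ /ltW.
Qed.

Let K2 := \int[mu]_z (kappa z * `|z| ^+ 2).

Lemma sd_bound G : nice G -> exists2 C, 0 <= C & forall z y, `|sd z G y| <= C * `|z| ^+ 2.
Proof.
move=> /(_ 2)[C C0 H]; exists C => // z y.
by rewrite sdE normrN; apply: le_trans (H [:: z; z] _ erefl) _; rewrite !big_cons big_nil mulr1 expr2.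
Qed.

Lemma integ_kappa_sd G y C : continuous G -> (forall z, `|sd z G y| <= C * `|z| ^+ 2) ->
  integ mu (fun z => kappa z * sd z G y) /\ `|Lop G y| <= C * K2.
Proof.
move=> cG GC.
have le z : `|kappa z * sd z G y| <= C * (kappa z * `|z| ^+ 2).
  by rewrite normrM ger0_norm// mulrCA ler_wpM2l.
have iC := integZ C integ_kappa_sqr.
have iG : integ mu (fun z => kappa z * sd z G y).
  apply: (integ_le _ iC le); apply: measurable_funM; first exact: mkappa.
  by apply: continuous_measurable_row; exact: continuous_sd1.
split => //; apply: le_trans (int_abs_le iC iG le) _.
by rewrite intZ//; exact: integ_kappa_sqr.
Qed.

Lemma integ_Lop G y : nice G -> integ mu (fun z => kappa z * sd z G y).
Proof.
move=> nG; have [C C0 H] := sd_bound nG.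
exact: (integ_kappa_sd (nice_continuous nG) (fun z => H z y)).1.
Qed.

Lemma dl_Lop h G y : nice G -> dl h (Lop G) y = Lop (dl h G) y.
Proof.
move=> nG; rewrite /dl /Lop -intB; [|exact: integ_Lop|exact: integ_Lop].
apply: eq_Rintegral => z _; rewrite -mulrBr; congr (_ * _).
by rewrite /sd [y + h + z]addrAC [y + h - z]addrAC; ring.
Qed.

Lemma dd_Lop hs G : nice G -> dd hs (Lop G) = Lop (dd hs G).
Proof.
move=> nG; elim: hs => //= h hs ->; apply/funext => y; apply: dl_Lop; exact: nice_dd.
Qed.

Lemma nice_Lop G : nice G -> nice (Lop G).
Proof.
move=> nG m; have [C C0 H] := nG m.+2; exists (C * K2).
  by rewrite mulr_ge0// int_ge0// => z; rewrite mulr_ge0// exprn_ge0.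
move=> hs x hm; rewrite dd_Lop// mulrAC.
apply: (integ_kappa_sd _ _).2 => [|z].
  by apply: continuous_dd; exact: nice_continuous.
rewrite sdE normrN -dd_cat; apply: le_trans (H _ _ _) _; first by rewrite /= hm.
by rewrite !big_cons -mulrA ler_wpM2l// expr2 mulrA mulrC.
Qed.

(** Exchanging the integrals fixes the jump [z'] first; the two differences of step [z'] can then be
    moved to [theta] along with the others. *)
Lemma average_Lop G theta x (t : R) : nice G -> continuous theta -> integ mu theta ->
  integ mu (fun z' => kappa z' * \int[mu]_z (sd z' G (x + t *: z) * theta z)) /\
  \int[mu]_z (Lop G (x + t *: z) * theta z) =
  \int[mu]_z' (kappa z' * \int[mu]_z (sd z' G (x + t *: z) * theta z)).
Proof.
move=> nG cth ith; have [C C0 H] := sd_bound nG.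
have cG := nice_continuous nG.
pose Phi (q : 'rV[R]_n * 'rV[R]_n) := theta q.1 * (kappa q.2 * sd q.2 G (x + t *: q.1)).
have mcoord1 i : measurable_fun setT (fun q : 'rV[R]_n * 'rV[R]_n => q.1 0 i).
  exact: (measurableT_comp (measurable_row_coord_leb i) measurable_fst).
have mcoord2 i : measurable_fun setT (fun q : 'rV[R]_n * 'rV[R]_n => q.2 0 i).
  exact: (measurableT_comp (measurable_row_coord_leb i) measurable_snd).
have mGa a : measurable_fun setT (fun q : 'rV[R]_n * 'rV[R]_n => G (x + t *: q.1 + a *: q.2)).
  apply: (@measurable_continuous_row R n _ _ (fun q : 'rV[R]_n * 'rV[R]_n => x + t *: q.1 + a *: q.2) G) => // i.
  rewrite (_ : (fun q => _) = fun q : 'rV[R]_n * 'rV[R]_n => x 0 i + t * q.1 0 i + a * q.2 0 i); last first.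
    by apply/funext => q; rewrite !mxE.
  apply: measurable_funD; last by apply: measurable_funM; [exact: measurable_cst|exact: mcoord2].
  apply: measurable_funD; first exact: measurable_cst.
  by apply: measurable_funM; [exact: measurable_cst|exact: mcoord1].
have msd : measurable_fun setT (fun q : 'rV[R]_n * 'rV[R]_n => sd q.2 G (x + t *: q.1)).
  rewrite (_ : (fun q => _) = fun q : 'rV[R]_n * 'rV[R]_n =>
     2 * G (x + t *: q.1 + 0 *: q.2) - G (x + t *: q.1 + 1 *: q.2) - G (x + t *: q.1 + (-1) *: q.2)); last first.
    by apply/funext => q; rewrite /sd scale0r addr0 scale1r scaleN1r.
  apply: measurable_funB; last exact: mGa.
  apply: measurable_funB; last exact: mGa.
  by apply: measurable_funM; [exact: measurable_cst|exact: mGa].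
have mPhi : measurable_fun setT Phi.
  apply: measurable_funM; first exact: (measurableT_comp (continuous_measurable_row cth) measurable_fst).
  apply: measurable_funM; last exact: msd.
  exact: (measurableT_comp mkappa measurable_snd).
have PhiE1 z : (fun z' => Phi (z, z')) = fun z' => theta z * (kappa z' * sd z' G (x + t *: z)).
  by apply/funext.
have iz z : integ mu (fun z' => Phi (z, z')).
  rewrite PhiE1; exact: integZ (integ_Lop _ nG).
have isdt z' : integ mu (fun z => sd z' G (x + t *: z) * theta z).
  by apply: (integ_boundedM _ (fun z => H z' (x + t *: z)) ith); exact: continuous_sd2.
have PhiE z' : (fun z => Phi (z, z')) = fun z => kappa z' * (sd z' G (x + t *: z) * theta z).
  by apply/funext => z; rewrite /Phi /=; ring.
have iz' z' : integ mu (fun z => Phi (z, z')) by rewrite PhiE; exact: integZ.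
have iPhi : integ (mu \x mu)%E Phi.
  apply: (integ_prod mPhi iz (integZ (C * K2) (integ_norm ith))) => z.
  rewrite mulrC /Phi /=.
  under eq_Rintegral do rewrite normrM.
  rewrite intZ; last by apply: integ_norm; exact: integ_Lop.
  rewrite ler_wpM2l//.
  have iC := integZ C integ_kappa_sqr.
  rewrite /K2 -(intZ _ integ_kappa_sqr); apply: int_le => [||z'] //.
    by apply: integ_norm; exact: integ_Lop.
  by rewrite normrM ger0_norm// mulrCA ler_wpM2l.
have [isw sw] := int_swap iz iz' iPhi.
have E : (fun z' => kappa z' * \int[mu]_z (sd z' G (x + t *: z) * theta z)) =
    fun z' => \int[mu]_z Phi (z, z').
  by apply/funext => z'; rewrite PhiE intZ.
rewrite E; split; first exact: isw.
rewrite -sw; apply: eq_Rintegral => z _.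
rewrite PhiE1 (intZ _ (integ_Lop (x + t *: z) nG)) mulrC.
reflexivity.
Qed.
End nonlocal.

Section step.
Context {R : realType} {n : nat}.
Local Notation mu := (@leb R n).
Implicit Types (w : 'rV[R]_n -> R) (x y z h : 'rV[R]_n) (hs : seq 'rV[R]_n).

(** The right-hand side has the primitive [- 8 tau^3 / (t + tau)] on the whole half-line, so the
    scales below and above [tau] need not be separated. *)
Lemma min1_cube (tau t : R) : 0 < tau -> 0 < t ->
  t * Num.min 1 (tau / t) ^+ 3 <= 8 * tau ^+ 3 / (t + tau) ^+ 2.
Proof.
move=> tau0 t0; have tt0 : 0 < t + tau by exact: addr_gt0.
rewrite ler_pdivlMr ?exprn_gt0//.
have [tt|tt] := leP (tau / t) 1.
  have {}tt : tau <= t by rewrite ler_pdivrMr// mul1r in tt.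
  have -> : t * (tau / t) ^+ 3 * (t + tau) ^+ 2 = tau ^+ 3 * ((t + tau) / t) ^+ 2.
    by field; rewrite gt_eqF.
  have t2 : 0 <= (t + tau) / t <= 2.
    by apply/andP; split; [rewrite divr_ge0 ?ltW|rewrite ler_pdivrMr//; lra].
  rewrite [leRHS]mulrC ler_wpM2l ?exprn_ge0 ?(ltW tau0)//; nra.
have {}tt : t <= tau by rewrite ltr_pdivlMr// mul1r in tt; exact: ltW.
rewrite expr1n mulr1; apply: (@le_trans _ _ (tau * (2 * tau) ^+ 2)).
  apply: ler_pM => //; [exact: ltW|exact: sqr_ge0|].
  rewrite lerXn2r ?nnegrE//; lra.
by rewrite exprMn !exprS expr0; have : 0 <= tau * (tau * (tau * 1)); [rewrite !mulr_ge0// ltW|lra].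
Qed.

Lemma min1_powR (a p : R) (k : nat) : 0 <= a -> 0 < p <= k%:R ->
  Num.min 1 a ^+ k <= a `^ p.
Proof.
move=> a0 /andP[p0 pk]; have [a1|a1] := leP 1 a.
  by rewrite expr1n -(powRr0 a) ler_powR// ltW.
have [->|an0] := eqVneq a 0.
  rewrite powR0 ?gt_eqF// expr0n; case: k pk => // /(lt_le_trans p0); rewrite ltxx//.
rewrite -(powR_mulrn k a0); apply: ger_powR => //.
by rewrite lt_neqAle eq_sym an0 a0 ltW.
Qed.

Variables (kappa : 'rV[R]_n -> R) (p q r : R).
Hypotheses (mkappa : measurable_fun setT kappa) (kappa_ge0 : forall z, 0 <= kappa z)
  (kappa_supp : forall z, r < `|z| -> kappa z = 0) (r01 : 0 < r <= 1)
  (q01 : 0 < q < 1) (p_def : p = 2 - 2 * q) (ikappa : integ mu (fun z => kappa z * `|z| `^ p)).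
Variables theta eta : 'rV[R]_n -> R.
Hypotheses (ntheta : nice theta) (neta : nice eta) (stheta : csupp 1 theta)
  (seta : csupp 1 eta) (ntheta' : forall i, nice (fun z => - (z 0 i * eta z)))
  (tayt : tay theta (fun i z => - (z 0 i * eta z))) (eta_gt0 : 0 < \int[mu]_z eta z).

Let p02 : 0 < p < 2. Proof. by rewrite p_def; case/andP: q01 => ? ?; apply/andP; split; lra. Qed.

Lemma prod_min1_le hs (a : R) (m : nat) : size hs = m -> 0 <= a ->
  (forall h, h \in hs -> `|h| <= a) ->
  \prod_(h <- hs) Num.min 1 `|h| <= Num.min 1 a ^+ m.
Proof.
move=> <- a0; elim: hs => [|h hs IH] H; first by rewrite big_nil expr0.
rewrite big_cons exprS; apply: ler_pM.
- by rewrite le_min ler01 normr_ge0.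
- by rewrite prodr_ge0// => k _; rewrite le_min ler01 normr_ge0.
- by rewrite le_min ge_min lexx ge_min H ?orbT// mem_head.
- by apply: IH => k kh; apply: H; rewrite inE kh orbT.
Qed.

(* With [A_t] the average against [eta] at scale [t], [w - A_t w] is controlled
   by integrating [d/dt A_t w = t * average of the Laplacian against theta];
   at scale [t] the differences [hs] fall on [theta], at the cost of a factor
   [tau / t] each. *)
Lemma difference_step : exists2 C : R, 0 <= C &
  forall w (w1 : 'I_n -> 'rV[R]_n -> R) (w2 : 'I_n -> 'I_n -> 'rV[R]_n -> R), nice w -> (forall i, nice (w1 i)) ->
  (forall i j, nice (w2 i j)) -> tay w w1 -> (forall i, tay (w1 i) (w2 i)) ->
  forall x hs hs' (tau M N1 A1 : R), size hs = 3%N -> (forall h, h \in hs -> `|h| <= tau) ->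
  0 < tau <= r -> (forall y, `|w y| <= M) ->
  (forall y, `|y - x| <= 8 * r -> `|dd hs' w y| <= A1) ->
  (forall y, `|y - x| <= 8 * r ->
     `|dd hs' (fun y => Lop kappa w y - \sum_i w2 i i y) y| <= N1) ->
  `|dd (hs ++ hs') w x| <=
    C * (2 ^+ size hs' * M * tau ^+ 3 + N1 * tau ^+ 2 + A1 * tau `^ q).
Proof.
have [r0 r1] := andP r01; have [q0 q1] := andP q01.
have itheta := nice_integ ntheta stheta ler01.
have ieta := nice_integ neta seta ler01.
have [C3 C30 HC3] := dd_L1 ntheta stheta ler01 3.
have [C5 C50 HC5] := dd_L1 ntheta stheta ler01 5.
have [D3 D30 HD3] := dd_L1 neta seta ler01 3.
pose me := \int[mu]_z eta z.
pose CK := \int[mu]_z (kappa z * `|z| `^ p).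
have CK0 : 0 <= CK by rewrite int_ge0// => z; rewrite mulr_ge0 ?powR_ge0.
pose Ct := D3 * r^-1 ^+ 3 + 8 * C3 + C5 * CK / q * r `^ q.
have Ct0 : 0 <= Ct.
  rewrite !addr_ge0// ?mulr_ge0// ?exprn_ge0// ?invr_ge0 ?powR_ge0// ltW//.
exists (me^-1 * Ct); first by rewrite mulr_ge0// invr_ge0 ltW.
move=> w w1 w2 nw nw1 nw2 tw tw1 x hs hs' tau M N1 A1 hs3 hst /andP[tau0 taur] wM wA fN.
pose ft y := Lop kappa w y - \sum_i w2 i i y.
have nft : nice ft.
  have E : ft = fun y => Lop kappa w y + (-1) * \sum_i w2 i i y.
    by apply/funext => y; rewrite mulN1r.
  rewrite E; apply: niceD; first exact: (nice_Lop mkappa kappa_ge0 kappa_supp r01 p02 ikappa).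
  by apply: niceZ; apply: nice_sum => i.
have A10 : 0 <= A1 by apply: le_trans (wA x _); rewrite ?subrr ?normr0// mulr_ge0// ltW.
have N10 : 0 <= N1 by apply: le_trans (fN x _); rewrite ?subrr ?normr0// mulr_ge0// ltW.
have M0 : 0 <= M by exact: le_trans (wM x).
pose L := hs ++ hs'.
pose g (t : R) := \int[mu]_z (dd L w (x + t *: z) * eta z).
pose dg (t : R) := t * \int[mu]_z ((\sum_i dd L (w2 i i) (x + t *: z)) * theta z).
have gdg (t : R) : is_derive t 1 g (dg t).
  apply: (@is_derive_average R n theta eta ntheta neta stheta seta ntheta' tayt
    (dd L w) (fun i => dd L (w1 i)) (fun i j => dd L (w2 i j))) => *.
  - exact: nice_dd.
  - exact: nice_dd.
  - exact: nice_dd.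
  - exact: tay_dd.
  - exact: tay_dd.
have hst' (t : R) : 0 < t -> forall h, h \in [seq - (t^-1 *: h) | h <- hs] -> `|h| <= tau / t.
  move=> t0 _ /mapP[h hhs ->]; rewrite normrN normrZ gtr0_norm ?invr_gt0// mulrC.
  by rewrite ler_pM2r ?invr_gt0//; exact: hst.
have b1 (t : R) : 0 < t <= r ->
    `|\int[mu]_z (dd hs (dd hs' ft) (x + t *: z) * theta z)| <= N1 * (C3 * Num.min 1 (tau / t) ^+ 3).
  move=> /andP[t0 tr].
  have [i3 I3] := HC3 [seq - (t^-1 *: h) | h <- hs] (etrans (size_map _ _) hs3).
  have [B _ HB] := nice_bounded (nice_dd hs' nft).
  apply: le_trans (int_avg_bound t0 (nice_continuous (nice_dd hs' nft)) HB stheta itheta ler01 hst i3 _ fN) _.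
    by rewrite hs3; lra.
  rewrite ler_wpM2l//; apply: le_trans I3 _; rewrite ler_wpM2l//.
  by apply: prod_min1_le; [rewrite size_map|rewrite divr_ge0 ?ltW|exact: hst'].
(* Nonlocal term: the three steps of [hs] and the two jumps [z'] all fall on [theta], whence the
   constant [C5] of order five. *)
have b2 (t : R) : 0 < t <= r ->
    `|\int[mu]_z (dd hs (dd hs' (Lop kappa w)) (x + t *: z) * theta z)| <=
    A1 * C5 * CK * tau `^ q * t `^ (- (p + q)).
  move=> /andP[t0 tr].
  have LE : dd hs (dd hs' (Lop kappa w)) = Lop kappa (dd L w).
    by rewrite -dd_cat (dd_Lop mkappa kappa_ge0 kappa_supp r01 p02 ikappa).
  have nLw : nice (dd L w) by exact: nice_dd.
  rewrite LE.
  have [iav ->] := average_Lop mkappa kappa_ge0 kappa_supp r01 p02 ikappa x t nLw (nice_continuous ntheta) itheta.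
  have in1 z' : `|z'| <= r ->
      `|\int[mu]_z (sd z' (dd L w) (x + t *: z) * theta z)| <=
       A1 * C5 * (tau `^ q * t `^ (- (p + q))) * `|z'| `^ p.
    move=> z'r.
    have -> : \int[mu]_z (sd z' (dd L w) (x + t *: z) * theta z) =
       - \int[mu]_z (dd (hs ++ [:: z'; z']) (dd hs' w) ((x - z') + t *: z) * theta z).
      rewrite -intN.
        apply: eq_Rintegral => z _; rewrite sdE -dd_cat -mulNr; congr (- _ * _).
        by rewrite /L dd_cat dd_cat dd_cat ddC addrAC.
      have [B _ HB] := nice_bounded (nice_dd (hs ++ [:: z'; z']) (nice_dd hs' nw)).
      apply: (integ_boundedM _ (fun z => HB (x - z' + t *: z)) itheta).
      exact/continuous_affine/nice_continuous/nice_dd/nice_dd.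
    rewrite normrN.
    have sz5 : size [seq - (t^-1 *: h) | h <- hs ++ [:: z'; z']] = 5%N.
      by rewrite size_map size_cat hs3.
    have [i5 I5] := HC5 _ sz5.
    have [B _ HB] := nice_bounded (nice_dd hs' nw).
    (* Five steps of length at most [r] and a scale [t <= r] stay within [7 * r] of [x - z'], hence
       within [8 * r] of [x]. *)
    apply: le_trans (@int_avg_bound _ _ _ _ _ _ _ _ r A1 _ (7 * r) t0 (nice_continuous (nice_dd hs' nw)) HB stheta itheta ler01 _ i5 _ _) _.
    - move=> h; rewrite mem_cat !inE => /orP[/hst ht|/orP[]/eqP -> //]; exact: (le_trans ht).
    - by rewrite size_cat hs3 /=; lra.
    - move=> y yx; apply: wA.
      have -> : y - x = (y - (x - z')) - z' by rewrite opprB addrA addrAC addrK.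
      by apply: le_trans (ler_normB _ _) _; lra.
    rewrite -!mulrA ler_wpM2l//; apply: le_trans I5 _; rewrite ler_wpM2l//.
    rewrite map_cat big_cat /=.
    apply: (@le_trans _ _ (Num.min 1 (tau / t) ^+ 3 * Num.min 1 (`|z'| / t) ^+ 2)).
      apply: ler_pM.
      - by rewrite prodr_ge0// => k _; rewrite le_min ler01 normr_ge0.
      - by rewrite prodr_ge0// => k _; rewrite le_min ler01 normr_ge0.
      - by apply: prod_min1_le; [rewrite size_map|rewrite divr_ge0 ?ltW|exact: hst'].
      - apply: prod_min1_le => //; first by rewrite divr_ge0// ltW.
        move=> h; rewrite !inE orbb => /eqP ->.
        by rewrite normrN normrZ gtr0_norm ?invr_gt0// mulrC.
    (* Less than the available powers 3 and 2 is kept: [p] matches the moment of [kappa], and [q]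
       makes [t * t^(-(p + q)) = t^(q - 1)] integrable at 0. *)
    have m1 : Num.min 1 (tau / t) ^+ 3 <= (tau / t) `^ q.
      by apply: min1_powR; [rewrite divr_ge0 ?ltW|rewrite q0 /=; lra].
    have m2 : Num.min 1 (`|z'| / t) ^+ 2 <= (`|z'| / t) `^ p.
      by apply: min1_powR; [rewrite divr_ge0// ltW|case/andP: p02 => -> /ltW].
    have mn (a : R) k : 0 <= a -> 0 <= Num.min 1 a ^+ k.
      by move=> a0; rewrite exprn_ge0// le_min ler01.
    apply: le_trans (ler_pM (mn _ _ _) (mn _ _ _) m1 m2) _; [by rewrite divr_ge0 ?ltW|by rewrite divr_ge0// ltW|].
    rewrite !powRM ?invr_ge0 ?(ltW t0) ?(ltW tau0)// -powR_inv1 ?(ltW t0)// -!powRrM !mulN1r opprD.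
    rewrite powRD; last by rewrite (gt_eqF t0) implybT.
    by rewrite le_eqVlt; apply/orP; left; apply/eqP; ring.
  pose cc := A1 * C5 * (tau `^ q * t `^ (- (p + q))).
  have icc := integZ cc ikappa.
  apply: (@le_trans _ _ (cc * CK)); last first.
    by rewrite le_eqVlt; apply/orP; left; apply/eqP; rewrite /cc; ring.
  rewrite /CK -intZ//; apply: (int_abs_le icc iav) => z'.
  rewrite normrM ger0_norm// mulrCA.
  have [rz|zr] := ltP r `|z'|; first by rewrite kappa_supp// !mul0r.
  by rewrite ler_wpM2l//; exact: in1.
have nDw : nice (dd hs (dd hs' (Lop kappa w))).
  by apply: nice_dd; apply: nice_dd; exact: (nice_Lop mkappa kappa_ge0 kappa_supp r01 p02 ikappa).
have nDf : nice (dd hs (dd hs' ft)) by apply: nice_dd; exact: nice_dd.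
have dgE y : \sum_i dd L (w2 i i) y = dd hs (dd hs' (Lop kappa w)) y - dd hs (dd hs' ft) y.
  rewrite -dd_sum -!dd_cat -ddB; congr (dd L _ y).
  by apply/funext => y'; rewrite /ft; ring.
have iav F (t : R) : nice F -> integ mu (fun z => F (x + t *: z) * theta z).
  move=> nF; have [B _ HB] := nice_bounded nF.
  apply: (integ_boundedM _ (fun z => HB (x + t *: z)) itheta).
  exact/continuous_affine/nice_continuous.
pose c1 := 8 * (N1 * C3) * tau ^+ 3; pose c2 := A1 * C5 * CK * tau `^ q.
have c10 : 0 <= c1.
  by apply: mulr_ge0; [rewrite !mulr_ge0|rewrite exprn_ge0// ltW].
have c20 : 0 <= c2 by rewrite /c2 !mulr_ge0// powR_ge0.
have dgle (t : R) : 0 < t <= r -> `|dg t| <= c1 / (t + tau) ^+ 2 + c2 * t `^ (q - 1).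
  move=> tr; have [t0 _] := andP tr.
  have -> : dg t = t * (\int[mu]_z (dd hs (dd hs' (Lop kappa w)) (x + t *: z) * theta z) -
      \int[mu]_z (dd hs (dd hs' ft) (x + t *: z) * theta z)).
    rewrite /dg -intB; [|exact: iav|exact: iav].
    by congr (_ * _); apply: eq_Rintegral => z _; rewrite dgE mulrBl.
  rewrite mulrBr [leRHS]addrC; apply: le_trans (ler_normB _ _) _.
  rewrite !normrM (gtr0_norm t0); apply: lerD.
    apply: le_trans (ler_wpM2l (ltW t0) (b2 t tr)) _.
    rewrite -/c2 mulrCA ler_wpM2l//.
    have -> : q - 1 = 1 + - (p + q) by rewrite p_def; ring.
    by rewrite [leRHS]powRD; [rewrite powRr1// ltW|rewrite (gt_eqF t0) implybT].
  apply: le_trans (ler_wpM2l (ltW t0) (b1 t tr)) _.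
  have := ler_wpM2l (mulr_ge0 N10 C30) (min1_cube tau0 t0).
  rewrite /c1; lra.
pose G (t : R) := - c1 * (t + tau)^-1 + c2 / q * t `^ q.
have GdG (t : R) : 0 < t -> is_derive t 1 G (c1 / (t + tau) ^+ 2 + c2 * t `^ (q - 1)).
  move=> t0; have tt0 : t + tau != 0 by rewrite gt_eqF// addr_gt0.
  have d1 : is_derive t 1 (fun t => (t + tau)^-1) (- (t + tau) ^- 2).
    have H : is_derive t 1 (fun t => t + tau) (1 + 0).
      exact: (is_derive_pD (is_derive_id t 1) (is_derive_cst tau t 1)).
    have := @is_deriveV R (fun t => t + tau) t (1 + 0) 1 tt0 H.
    by rewrite addr0 scaler1.
  have d2 : is_derive t 1 (fun t => t `^ q) (q * t `^ (q - 1)) by exact: is_derive1_powR.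
  have := is_derive_pD (is_derive_pZ (- c1) d1) (is_derive_pZ (c2 / q) d2).
  rewrite mulrNN; congr (is_derive _ _ _ _); congr (_ + _).
  by rewrite mulrA divfK// gt_eqF.
pose B := 8 * (N1 * C3) * tau ^+ 2 + c2 / q * r `^ q.
have main : `|g r - g 0| <= B.
  (* The bound on [dg] holds for positive [t] and blows up at 0. The comparison with [G] therefore
     starts at a small [dl], and continuity of [g] at 0 absorbs the rest. *)
  apply/ler_addgt0Pr => e e0.
  have /cvgrPdist_lt/(_ e e0)/nbhs_ballP[d /= d0 dg0] := is_derive_continuous (gdg 0).
  pose dl := Num.min r (d / 2).
  have dl0 : 0 < dl by rewrite lt_min r0 divr_gt0.
  have dlr : dl <= r by rewrite ge_min lexx.
  have gdl : `|g 0 - g dl| < e.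
    apply: dg0; rewrite -ball_normE /= sub0r normrN gtr0_norm//.
    by apply: (@le_lt_trans _ _ (d / 2)); [rewrite ge_min lexx orbT|lra].
  have gle : `|g r - g dl| <= G r - G dl.
    apply: (@derive_dominated R g dg G (fun t => c1 / (t + tau) ^+ 2 + c2 * t `^ (q - 1)) dl r dlr) => t /andP[t1 t2].
    - by apply: GdG; exact: lt_le_trans t1.
    - by apply: dgle; rewrite t2 andbT; exact: lt_le_trans t1.
  have GB : G r - G dl <= B.
    rewrite /G /B.
    have h1 : c1 * (dl + tau)^-1 <= 8 * (N1 * C3) * tau ^+ 2.
      rewrite ler_pdivrMr ?addr_gt0// /c1 [tau ^+ 3]exprS mulrCA mulrC.
      rewrite ler_wpM2l ?mulr_ge0 ?sqr_ge0//; lra.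
    have h2 : 0 <= c1 * (r + tau)^-1 by rewrite mulr_ge0// invr_ge0 addr_ge0 ?ltW.
    have h3 : 0 <= c2 / q * dl `^ q by rewrite mulr_ge0 ?powR_ge0// divr_ge0// ltW.
    lra.
  have -> : g r - g 0 = (g r - g dl) - (g 0 - g dl) by ring.
  apply: le_trans (ler_normB _ _) _; lra.
have g0 : g 0 = me * dd L w x.
  rewrite /g (_ : (fun z => _) = fun z => dd L w x * eta z); last first.
    by apply/funext => z; rewrite scale0r addr0.
  by rewrite intZ// mulrC.
have gr : `|g r| <= 2 ^+ size hs' * M * (D3 * (tau / r) ^+ 3).
  have [i3 I3] := HD3 [seq - (r^-1 *: h) | h <- hs] (etrans (size_map _ _) hs3).
  have [B' _ HB'] := nice_bounded (nice_dd hs' nw).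
  rewrite /g /L.
  rewrite (_ : (fun z => _) = fun z => dd hs (dd hs' w) (x + r *: z) * eta z); last first.
    by apply/funext => z; rewrite dd_cat.
  apply: le_trans (@int_avg_bound _ _ _ _ _ _ _ _ tau (2 ^+ size hs' * M) _ (8 * r) r0 (nice_continuous (nice_dd hs' nw)) HB' seta ieta ler01 hst i3 _ _) _.
  - by rewrite hs3; lra.
  - by move=> y _; exact: bounded_dd.
  rewrite ler_wpM2l ?mulr_ge0//; apply: le_trans I3 _; rewrite ler_wpM2l//.
  apply: le_trans (prod_min1_le _ _ (hst' r r0)) _; [by rewrite size_map|by rewrite divr_ge0 ?ltW|].
  have tr0 : 0 <= tau / r by rewrite divr_ge0 ?ltW.
  rewrite hs3; apply: lerXn2r; rewrite ?nnegrE ?le_min ?ler01 ?tr0//.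
  by rewrite ge_min lexx orbT.
rewrite -[leRHS]mulrA [leRHS]mulrC ler_pdivlMr//.
have -> : `|dd (hs ++ hs') w x| * me = `|g 0|.
  by rewrite g0 normrM [`|me|]gtr0_norm// mulrC.
have -> : g 0 = g r - (g r - g 0) by ring.
apply: le_trans (ler_normB _ _) _; apply: le_trans (lerD gr main) _.
rewrite /B /Ct /c2.
have X1 : 0 <= 2 ^+ size hs' * M * tau ^+ 3.
  by apply: mulr_ge0; [rewrite mulr_ge0|rewrite exprn_ge0// ltW].
have X2 : 0 <= N1 * tau ^+ 2 by rewrite mulr_ge0// sqr_ge0.
have X3 : 0 <= A1 * tau `^ q by rewrite mulr_ge0// powR_ge0.
have Y1 : 0 <= D3 * r^-1 ^+ 3 by rewrite mulr_ge0// exprn_ge0// invr_ge0 ltW.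
have Y2 : 0 <= 8 * C3 by rewrite mulr_ge0.
have Y3 : 0 <= C5 * CK / q * r `^ q by rewrite !mulr_ge0// ?powR_ge0// invr_ge0 ltW.
rewrite [(tau / r) ^+ 3]exprMn.
move: X1 X2 X3 Y1 Y2 Y3.
set x1 := _ * tau ^+ 3; set x2 := N1 * _; set x3 := A1 * tau `^ q.
set y1 := D3 * _; set y2 := 8 * C3; set y3 := _ * r `^ q => X1 X2 X3 Y1 Y2 Y3.
have -> : 2 ^+ size hs' * M * (D3 * (tau ^+ 3 * r^-1 ^+ 3)) +
   (8 * (N1 * C3) * tau ^+ 2 + A1 * C5 * CK * tau `^ q / q * r `^ q) = x1 * y1 + x2 * y2 + x3 * y3.
  by rewrite /x1 /x2 /x3 /y1 /y2 /y3; ring.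
have := mulr_ge0 X1 Y2; have := mulr_ge0 X1 Y3; have := mulr_ge0 X2 Y1.
have := mulr_ge0 X2 Y3; have := mulr_ge0 X3 Y1; have := mulr_ge0 X3 Y2.
clear; move: x1 x2 x3 y1 y2 y3 => x1 x2 x3 y1 y2 y3 *.
rewrite !mulrDr !mulrDl; lra.
Qed.
End step.

(** * Marchaud's doubling argument *)

Section marchaud.
Context {R : realType} {n : nat}.
Implicit Types (G w : 'rV[R]_n -> R) (x y h : 'rV[R]_n) (hs : seq 'rV[R]_n).

(** Each doubled step is replaced through [D_2h G = D_h G (. + h) + D_h G]; all resulting terms
    agree up to one additional difference. *)
Lemma dd_double hs G x (tau B : R) : (forall h, h \in hs -> `|h| <= tau) ->
  (forall h y, h \in hs -> `|y - x| <= (size hs)%:R * tau -> `|dl h (dd hs G) y| <= B) ->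
  `|dd [seq 2 *: h | h <- hs] G x - 2 ^+ size hs * dd hs G x| <=
  2 ^+ size hs * (size hs)%:R * B.
Proof.
elim: hs G x => [|h hs IH] G x hst HB /=.
  by rewrite expr0 !mul1r mul0r subrr normr0.
have ht : `|h| <= tau by apply: hst; rewrite mem_head.
have tau0 : 0 <= tau by exact: le_trans ht.
have hst' k : k \in hs -> `|k| <= tau by move=> kh; apply: hst; rewrite inE kh orbT.
rewrite -!dd_dl; set H := dl h G.
have E : dl (2 *: h) G = fun y => H (y + h) + H y.
  by apply/funext => y; rewrite /H /dl scaler_nat mulr2n addrA; ring.
rewrite E ddD (dd_shift _ H h).
have HBy y : `|y - x| <= tau -> `|dd [seq 2 *: h | h <- hs] H y - 2 ^+ size hs * dd hs H y| <=
    2 ^+ size hs * (size hs)%:R * B.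
  move=> yx; apply: IH => // k z kh zy.
  rewrite /H dd_dl; apply: HB; first by rewrite inE kh orbT.
  have -> : z - x = (z - y) + (y - x) by rewrite addrA subrK.
  apply: le_trans (ler_normD _ _) _.
  by rewrite -natr1 mulrDl mul1r; exact: lerD.
have I1 := HBy x; have I2 := HBy (x + h).
rewrite subrr normr0 in I1; rewrite addrAC subrr add0r in I2.
have I3 : `|dd hs H (x + h) - dd hs H x| <= B.
  have := HB h x; rewrite mem_head subrr normr0 => /(_ isT).
  by rewrite /dl /= -dd_dl; apply; rewrite mulr_ge0.
have {}I1 := I1 tau0; have {}I2 := I2 ht.
set P : R := 2 ^+ size hs in I1 I2 *; have P0 : 0 <= P by rewrite /P exprn_ge0.
rewrite exprS -/P -natr1.
have -> : dd [seq 2 *: h | h <- hs] H (x + h) + dd [seq 2 *: h | h <- hs] H x - 2 * P * dd hs H x =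
   (dd [seq 2 *: h | h <- hs] H (x + h) - P * dd hs H (x + h)) +
   (dd [seq 2 *: h | h <- hs] H x - P * dd hs H x) + P * (dd hs H (x + h) - dd hs H x) by ring.
apply: le_trans (ler_normD _ _) _; apply: le_trans (lerD (ler_normD _ _) (lexx _)) _.
rewrite [`|P * _|]normrM (ger0_norm P0).
have B0 : 0 <= B by exact: le_trans I3.
have := ler_wpM2l P0 I3; have := mulr_ge0 P0 B0; lra.
Qed.

(* From [D_{2h} = 2 D_h + D_h D_h] the differences at scale [2 tau] determine those
   at scale [tau] up to differences of order [m + 1]. *)
Lemma marchaud_step (m : nat) (gamma tau0 : R) : gamma < m%:R -> 0 <= gamma -> 0 < tau0 ->
  exists2 C, 0 <= C & forall w x (A M : R), 0 <= A -> (forall y, `|w y| <= M) ->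
  (forall y hs tau, `|y - x| <= m%:R * tau0 -> size hs = m.+1 ->
     (forall h, h \in hs -> `|h| <= tau) -> 0 < tau <= tau0 -> `|dd hs w y| <= A * tau `^ gamma) ->
  forall hs tau, size hs = m -> (forall h, h \in hs -> `|h| <= tau) -> 0 < tau <= tau0 ->
    `|dd hs w x| <= C * (A + M) * tau `^ gamma.
Proof.
move=> gm g0 tau00.
pose th : R := 2 `^ (gamma - m%:R).
have th0 : 0 < th by rewrite powR_gt0.
have th1 : th < 1.
  rewrite /th -[gamma - _]opprB powRN invf_lt1 ?powR_gt0//.
  have := @gt0_ltr_powR R (m%:R - gamma); rewrite subr_gt0 => /(_ gm) H.
  have := H 1 2; rewrite powR1; apply; rewrite ?nnegrE ?ler01 ?ler0n ?ltr1n//.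
(* The first term covers the scales above [tau0 / 2], by the trivial bound. The second closes the
   recursion, whose ratio is [th < 1]: it makes [th * C + m <= C]. *)
pose C := 2 ^+ m * (2 / tau0) `^ gamma + m%:R / (1 - th).
have C1 : 0 <= 2 ^+ m * (2 / tau0) `^ gamma by rewrite mulr_ge0 ?exprn_ge0 ?powR_ge0.
have C2 : 0 <= m%:R / (1 - th) by rewrite divr_ge0 ?subr_ge0// ltW.
have C0 : 0 <= C by exact: addr_ge0.
exists C => // w x A M A0 wM HA.
have M0 : 0 <= M by exact: le_trans (wM x).
have base hs tau : size hs = m -> tau0 < 2 * tau -> 0 < tau ->
    `|dd hs w x| <= C * (A + M) * tau `^ gamma.
  move=> hm tt t0; apply: le_trans (bounded_dd hs wM x) _; rewrite hm.
  have h1 : 1 <= (2 / tau0) `^ gamma * tau `^ gamma.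
    rewrite -powRM ?divr_ge0 ?(ltW t0) ?(ltW tau00)//.
    apply: (@le_trans _ _ ((2 / tau0 * tau) `^ 0)); first by rewrite powRr0.
    by apply: ler_powR => //; rewrite mulrAC ler_pdivlMr// mul1r ltW.
  have E : 2 ^+ m * M <= 2 ^+ m * M * ((2 / tau0) `^ gamma * tau `^ gamma).
    by rewrite ler_peMr// mulr_ge0// exprn_ge0.
  apply: le_trans E _; rewrite /C.
  have t1 : 0 <= tau `^ gamma by exact: powR_ge0.
  have -> : 2 ^+ m * M * ((2 / tau0) `^ gamma * tau `^ gamma) =
    2 ^+ m * (2 / tau0) `^ gamma * M * tau `^ gamma by ring.
  rewrite ler_wpM2r//; apply: ler_pM => //; [by rewrite lerDl|by rewrite lerDr].
have ind (j : nat) hs tau : tau0 < 2 ^+ j.+1 * tau -> 0 < tau <= tau0 -> size hs = m ->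
    (forall h, h \in hs -> `|h| <= tau) -> `|dd hs w x| <= C * (A + M) * tau `^ gamma.
  elim: j hs tau => [|j IH] hs tau.
    by rewrite expr1 => tt /andP[t0 _] hm _; exact: base.
  move=> tt /andP[t0 t1] hm hst; have [t2|t2] := ltP tau0 (2 * tau); first exact: base.
  have I1 : `|dd [seq 2 *: h | h <- hs] w x| <= C * (A + M) * (2 * tau) `^ gamma.
    apply: IH; [by rewrite mulrA -exprSr|by rewrite t2 andbT mulr_gt0|by rewrite size_map|].
    by move=> _ /mapP[h hh ->]; rewrite normrZ ger0_norm// ler_wpM2l// hst.
  have I2 := @dd_double hs w x tau (A * tau `^ gamma) hst.
  have {}I2 : `|dd [seq 2 *: h | h <- hs] w x - 2 ^+ m * dd hs w x| <= 2 ^+ m * m%:R * (A * tau `^ gamma).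
    rewrite -hm; apply: I2 => h y hh yx.
    apply: (HA y (h :: hs)) => //=; [|by rewrite hm|by move=> k; rewrite inE => /orP[/eqP ->|]; apply: hst|by rewrite t0].
    by apply: (le_trans yx); rewrite hm ler_wpM2l.
  have P0 : 0 < 2 ^+ m :> R by rewrite exprn_gt0.
  have t3 : 0 <= tau `^ gamma by exact: powR_ge0.
  rewrite -(ler_pM2l P0) -[X in X * `|_|](gtr0_norm P0) -normrM.
  have -> : 2 ^+ m * dd hs w x = dd [seq 2 *: h | h <- hs] w x -
    (dd [seq 2 *: h | h <- hs] w x - 2 ^+ m * dd hs w x) by ring.
  apply: le_trans (ler_normB _ _) _; apply: le_trans (lerD I1 I2) _.
  have -> : (2 * tau) `^ gamma = 2 ^+ m * th * tau `^ gamma.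
    rewrite powRM ?(ltW t0)// /th powRB ?pnatr_eq0 ?implybT//.
    by rewrite powR_mulrn// [2 ^+ m * _]mulrC divfK ?gt_eqF.
  have key : m%:R * A <= C * (A + M) * (1 - th).
    have s0 : 0 < 1 - th by rewrite subr_gt0.
    have E : m%:R = m%:R / (1 - th) * (1 - th) by rewrite divfK// gt_eqF.
    rewrite [X in X * A]E mulrAC ler_wpM2r ?(ltW s0)//.
    by apply: ler_pM => //; [rewrite /C lerDr|rewrite lerDl].
  have := ler_wpM2r t3 (ler_wpM2l (ltW P0) key); lra.
move=> hs tau hm hst /andP[t0 t1].
apply: (ind (Num.trunc (tau0 / tau))) => //; last by rewrite t0.
rewrite -ltr_pdivrMr//; apply: lt_le_trans (truncnS_gt _) _.
by rewrite -natrX ler_nat ltnW// ltn_expl.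
Qed.
End marchaud.

(** * Iteration of the difference step *)

Section bootstrap.
Context {R : realType} {n : nat}.
Local Notation mu := (@leb R n).
Implicit Types (w lap : 'rV[R]_n -> R) (x y z h : 'rV[R]_n) (hs : seq 'rV[R]_n).

(** The derivatives are bound existentially, since only the trace [lap] occurs in the hypotheses and
    conclusions of the estimates. *)
Definition laplacian w lap := exists (w1 : 'I_n -> 'rV[R]_n -> R)
  (w2 : 'I_n -> 'I_n -> 'rV[R]_n -> R),
  [/\ nice w /\ (forall i, nice (w1 i)), (forall i j, nice (w2 i j)),
      tay w w1 /\ (forall i, tay (w1 i) (w2 i)) &
      lap = fun y => \sum_i w2 i i y].

Variables (kappa : 'rV[R]_n -> R) (p q r : R).
Hypotheses (mkappa : measurable_fun setT kappa) (kappa_ge0 : forall z, 0 <= kappa z)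
  (kappa_supp : forall z, r < `|z| -> kappa z = 0) (r01 : 0 < r <= 1)
  (q01 : 0 < q < 1) (p_def : p = 2 - 2 * q) (ikappa : integ mu (fun z => kappa z * `|z| `^ p)).
Variables theta eta : 'rV[R]_n -> R.
Hypotheses (ntheta : nice theta) (neta : nice eta) (stheta : csupp 1 theta)
  (seta : csupp 1 eta) (ntheta' : forall i, nice (fun z => - (z 0 i * eta z)))
  (tayt : tay theta (fun i z => - (z 0 i * eta z))) (eta_gt0 : 0 < \int[mu]_z eta z).

(** Each pass consumes three differences and a distance [9 r]: [8 r] for the ball in
    [difference_step] and [r] for the remaining differences of the right-hand side. The exponent
    grows by [q] until the right-hand side caps it at [2 + a]; the one difference beyond [3 k] is
    there to exploit its Hölder continuity. *)
Lemma bootstrap (a tau0 : R) (K k : nat) : 0 <= a <= 1 -> 0 < tau0 <= 1 ->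
  (3 * K + 1)%:R * tau0 <= r -> (k <= K)%N ->
  exists2 C : R, 0 <= C & forall w lap x0 (rho M N : R), laplacian w lap ->
  0 <= N -> (forall y, `|w y| <= M) ->
  (forall y h tau, `|y - x0| <= rho -> `|h| <= tau -> 0 < tau <= tau0 ->
     `|dl h (fun y => Lop kappa w y - lap y) y| <= N * tau `^ a) ->
  forall x hs tau, `|x - x0| <= rho - 9 * r * k%:R -> size hs = (3 * k + 1)%N ->
    (forall h, h \in hs -> `|h| <= tau) -> 0 < tau <= tau0 ->
    `|dd hs w x| <= C * (M + N) * tau `^ Num.min (k%:R * q) (2 + a).
Proof.
move=> a01 tau01 Kr; have [r0 r1] := andP r01; have [q0 q1] := andP q01.
have [a0 a1] := andP a01; have [tau00 tau1] := andP tau01.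
have [S S0 step] := difference_step mkappa kappa_ge0 kappa_supp r01 q01 p_def ikappa
  ntheta neta stheta seta ntheta' tayt eta_gt0.
elim: k => [_|k IH kK].
  exists 2 => // w lap x0 rho M N _ N0 wM _ x hs tau _ hs1 _ _.
  rewrite mul0r min_l ?addr_ge0// powRr0 mulr1.
  apply: le_trans (bounded_dd hs wM x) _.
  by rewrite hs1 expr1; rewrite ler_wpM2l// lerDl.
have [C C0 HC] := IH (ltnW kK).
pose P : R := 2 ^+ (3 * k + 1).
have P0 : 0 <= P by rewrite exprn_ge0.
exists (S * (2 * P + C)); first by rewrite mulr_ge0// addr_ge0// mulr_ge0.
move=> w lap x0 rho M N lapw N0 wM Hf x hs tau xx0 hsm hst tau0t.
have M0 : 0 <= M by exact: le_trans (wM x).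
have [t0 t1] := andP tau0t; have t2 : tau <= 1 by exact: (le_trans t1).
have [w1 [w2 [[nw nw1] nw2 [tw tw1] lapE]]] := lapw.
have tk : (3 * k + 1)%:R * tau <= r.
  apply: le_trans Kr; apply: ler_pM => //; first exact: ltW.
  by rewrite ler_nat leq_add2r leq_mul2l ltnW.
have tr : 0 < tau <= r.
  rewrite t0 /=; apply: le_trans tk; rewrite -[leLHS]mul1r ler_wpM2r ?(ltW t0)//.
  by rewrite ler1n addn1.
pose hs1 := take 3 hs; pose hs2 := drop 3 hs.
have hsE : hs1 ++ hs2 = hs by exact: cat_take_drop.
have sz1 : size hs1 = 3%N by rewrite size_takel// hsm mulnS -addnA.
have sz2 : size hs2 = (3 * k + 1)%N by rewrite size_drop hsm mulnS -addnA addKn.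
have hst1 h : h \in hs1 -> `|h| <= tau by move=> hh; apply: hst; rewrite -hsE mem_cat hh.
have hst2 h : h \in hs2 -> `|h| <= tau by move=> hh; apply: hst; rewrite -hsE mem_cat hh orbT.
pose gam := Num.min (k%:R * q) (2 + a).
have kr : rho - 9 * r * k.+1%:R = rho - 9 * r * k%:R - 9 * r by rewrite -natr1; ring.
have wA y : `|y - x| <= 8 * r -> `|dd hs2 w y| <= C * (M + N) * tau `^ gam.
  move=> yx; apply: (HC w lap x0 rho M N) => //.
  have -> : y - x0 = (y - x) + (x - x0) by rewrite addrA subrK.
  apply: le_trans (ler_normD _ _) _; rewrite kr in xx0; lra.
have fN y : `|y - x| <= 8 * r ->
    `|dd hs2 (fun y => Lop kappa w y - \sum_i w2 i i y) y| <= P * (N * tau `^ a).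
  (* One of the [3 k + 1] differences is spent on the Hölder bound; the others contribute a factor 2
     each. *)
  move=> yx; case: hs2 sz2 hst2 {wA hsE} => [|h0 hs2]; first by rewrite addn1.
  rewrite addn1 => -[sz2] hst2 /=.
  rewrite -dd_dl; apply: le_trans (@dd_bound _ _ hs2 _ y tau (N * tau `^ a) _ _) _.
  - by move=> h hh; apply: hst2; rewrite inE hh orbT.
  - move=> y' y'y; have /= := Hf y' h0 tau; rewrite lapE; apply => //.
      have -> : y' - x0 = (y' - y) + (y - x) + (x - x0) by rewrite !subrKA.
      apply: le_trans (ler_normD _ _) _; apply: le_trans (lerD (ler_normD _ _) (lexx _)) _.
      have h1 : `|y' - y| <= r.
        apply: (le_trans y'y); apply: le_trans tk; rewrite sz2 ler_wpM2r ?(ltW t0)//.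
        by rewrite ler_nat addn1.
      have h2 : 0 <= 9 * r * k%:R by rewrite !mulr_ge0 ?(ltW r0).
      rewrite kr in xx0; lra.
    by apply: hst2; rewrite mem_head.
  - rewrite sz2 ler_wpM2r ?mulr_ge0 ?powR_ge0// /P.
    by rewrite exprD expr1 ler_peMr ?exprn_ge0// ler1n.
have := step w w1 w2 nw nw1 nw2 tw tw1 x hs1 hs2 tau M _ _ sz1 hst1 tr wM wA fN.
rewrite hsE sz2 -/P => /le_trans; apply.
set gam' := Num.min _ _.
have tp (e e' : R) : e' <= e -> tau `^ e <= tau `^ e'.
  by move=> ee; apply: ger_powR => //; rewrite t0.
have T0 e : 0 <= tau `^ e by exact: powR_ge0.
have t0n : tau != 0 by rewrite gt_eqF.
have e1 : tau ^+ 3 <= tau `^ gam'.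
  rewrite -(powR_mulrn 3 (ltW t0)); apply: tp.
  by rewrite ge_min; apply/orP; right; lra.
have e2 : tau `^ a * tau ^+ 2 <= tau `^ gam'.
  rewrite -(powR_mulrn 2 (ltW t0)) -powRD ?t0n ?implybT//; apply: tp.
  by rewrite ge_min addrC lexx orbT.
have e3 : tau `^ gam * tau `^ q <= tau `^ gam'.
  rewrite -powRD ?t0n ?implybT//; apply: tp.
  rewrite /gam /gam' -natr1 mulrDl mul1r.
  case: (leP (k%:R * q) (2 + a)) => kq; first by rewrite ge_min lexx.
  by rewrite ge_min; apply/orP; right; rewrite lerDl ltW.
rewrite -!mulrA ler_wpM2l//.
have f1 := ler_wpM2l (mulr_ge0 P0 M0) e1.
have f2 := ler_wpM2l (mulr_ge0 P0 N0) e2.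
have f3 := ler_wpM2l (mulr_ge0 C0 (addr_ge0 M0 N0)) e3.
have f4 := mulr_ge0 (mulr_ge0 P0 M0) (T0 gam').
have f5 := mulr_ge0 (mulr_ge0 P0 N0) (T0 gam').

move: (tau `^ gam') (tau `^ gam) (tau `^ q) (tau `^ a) (tau ^+ 3) (tau ^+ 2) f1 f2 f3 f4 f5.
move=> u1 u2 u3 u4 u5 u6 f1 f2 f3 f4 f5.
lra.
Qed.
End bootstrap.

(** * Descent to differences of low order *)

Section schauder_differences.
Context {R : realType} {n : nat}.
Local Notation mu := (@leb R n).
Implicit Types (w lap : 'rV[R]_n -> R) (x y z h : 'rV[R]_n) (hs : seq 'rV[R]_n).

(** One descent to order [m0 + i] looks a distance [(m0 + i) * tau0] away; the sum of these losses
    is bounded crudely by [j * (m0 + j) * tau0]. *)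
Lemma marchaud_iter (m0 j : nat) (gamma tau0 : R) : gamma < m0%:R -> 0 <= gamma -> 0 < tau0 ->
  exists2 C, 0 <= C & forall w x0 (rho A M : R), 0 <= A -> (forall y, `|w y| <= M) ->
  (forall y hs tau, `|y - x0| <= rho -> size hs = (m0 + j)%N ->
     (forall h, h \in hs -> `|h| <= tau) -> 0 < tau <= tau0 -> `|dd hs w y| <= A * tau `^ gamma) ->
  forall x hs tau, `|x - x0| <= rho - (j * (m0 + j))%:R * tau0 -> size hs = m0 ->
    (forall h, h \in hs -> `|h| <= tau) -> 0 < tau <= tau0 ->
    `|dd hs w x| <= C * (A + M) * tau `^ gamma.
Proof.
move=> gm g0 t00; elim: j => [|j [C C0 IH]].
  exists 1 => // w x0 rho A M A0 wM H x hs tau xx hm hst tt.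
  have M0 : 0 <= M by exact: le_trans (wM x0).
  apply: le_trans (H x hs tau _ _ hst tt) _; first by rewrite mul0n mul0r subr0 in xx.
    by rewrite addn0.
  by rewrite mul1r ler_wpM2r ?powR_ge0// lerDl.
have gmj : gamma < (m0 + j)%:R by apply: lt_le_trans gm _; rewrite ler_nat leq_addr.
have [D D0 HD] := @marchaud_step R n (m0 + j) gamma tau0 gmj g0 t00.
exists (C * (D + 1)); first by rewrite mulr_ge0// addr_ge0.
move=> w x0 rho A M A0 wM H x hs tau xx hm hst tt.
have M0 : 0 <= M by exact: le_trans (wM x0).
have DA : 0 <= D * (A + M) by rewrite mulr_ge0// addr_ge0.
have := IH w x0 (rho - (m0 + j)%:R * tau0) (D * (A + M)) M DA wM _ x hs tau _ hm hst tt.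
have L : forall y (hs0 : seq 'rV_n) (tau1 : R),
 `|y - x0| <= rho - (m0 + j)%:R * tau0 -> size hs0 = (m0 + j)%N ->
 (forall h, h \in hs0 -> `|h| <= tau1) -> 0 < tau1 <= tau0 ->
 `|dd hs0 w y| <= D * (A + M) * tau1 `^ gamma.
  move=> y ks s yx kss ks0 s0; apply: (HD w y A M A0 wM) => // y' ls s' y'y lss ls0 s'0.
  apply: H => //; last by rewrite addnS.
  have -> : y' - x0 = (y' - y) + (y - x0) by rewrite subrKA.
  by apply: le_trans (ler_normD _ _) _; lra.
move=> /(_ L) X; apply: le_trans (X _) _.
  apply: (le_trans xx); rewrite -addrA -opprD lerD2l lerN2 -mulrDl -natrD.
  rewrite ler_wpM2r ?(ltW t00)// ler_nat -mulSn leq_mul2l; apply/orP; right.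
  by rewrite leq_add2l.
rewrite ler_wpM2r ?powR_ge0// -mulrA ler_wpM2l//.
by rewrite [leRHS]mulrDl mul1r lerD2l lerDr.
Qed.

Variables (kappa : 'rV[R]_n -> R) (p q r : R).
Hypotheses (mkappa : measurable_fun setT kappa) (kappa_ge0 : forall z, 0 <= kappa z)
  (kappa_supp : forall z, r < `|z| -> kappa z = 0) (r01 : 0 < r <= 1)
  (q01 : 0 < q < 1) (p_def : p = 2 - 2 * q) (ikappa : integ mu (fun z => kappa z * `|z| `^ p)).
Variables theta eta : 'rV[R]_n -> R.
Hypotheses (ntheta : nice theta) (neta : nice eta) (stheta : csupp 1 theta)
  (seta : csupp 1 eta) (ntheta' : forall i, nice (fun z => - (z 0 i * eta z)))
  (tayt : tay theta (fun i z => - (z 0 i * eta z))) (eta_gt0 : 0 < \int[mu]_z eta z).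

(** [3 <= K * q] ensures that the bootstrap has reached its cap [2 + a], as [a <= 1]; the descent
    then lowers the order from [3 K + 1] to [m0] at the exponent [gamma]. *)
Lemma schauder_differences (a gamma : R) (K m0 : nat) : 0 <= a <= 1 -> 3 <= K%:R * q ->
  0 <= gamma <= 2 + a -> gamma < m0%:R -> (m0 <= 3 * K + 1)%N ->
  exists2 tau0 : R, 0 < tau0 <= r &
  exists2 C : R, 0 <= C & forall w lap x0 (rho M N : R), laplacian w lap ->
  0 <= N -> (forall y, `|w y| <= M) ->
  (forall y h tau, `|y - x0| <= rho -> `|h| <= tau -> 0 < tau <= tau0 ->
     `|dl h (fun y => Lop kappa w y - lap y) y| <= N * tau `^ a) ->
  forall x hs tau, `|x - x0| <= rho - 9 * r * K%:R - r -> size hs = m0 ->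
    (forall h, h \in hs -> `|h| <= tau) -> 0 < tau <= tau0 ->
    `|dd hs w x| <= C * (M + N) * tau `^ gamma.
Proof.
move=> a01 Kq /andP[g0 ga] gm mK; have [r0 r1] := andP r01; have [a0 a1] := andP a01.
pose T := (3 * K + 1)%N.
have T1 : 1 <= T%:R :> R by rewrite ler1n /T addn1.
have T0 : 0 < T%:R :> R by exact: lt_le_trans T1.
(* The square serves both losses of radius: [T * tau0 <= r] in the bootstrap and [T * T * tau0 = r]
   in the descent. *)
pose tau0 : R := r / T%:R ^+ 2.
have tau00 : 0 < tau0 by rewrite divr_gt0// exprn_gt0.
have tT : T%:R * T%:R * tau0 = r by rewrite /tau0 -expr2 mulrC divfK// gt_eqF// exprn_gt0.
have tT1 : T%:R * tau0 <= r.
  by rewrite -tT -mulrA ler_peMl// mulr_ge0// ltW.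
have taur : tau0 <= r by apply: le_trans tT1; rewrite ler_peMl// ltW.
have tau01 : 0 < tau0 <= 1 by rewrite tau00 /=; exact: (le_trans taur).
exists tau0; first by rewrite tau00.
have [C C0 HC] := bootstrap mkappa kappa_ge0 kappa_supp r01 q01 p_def ikappa
  ntheta neta stheta seta ntheta' tayt eta_gt0 a01 tau01 tT1 (leqnn K).
have [D D0 HD] := @marchaud_iter m0 (T - m0) gamma tau0 gm g0 tau00.
exists (D * (C + 1)); first by rewrite mulr_ge0// addr_ge0.
move=> w lap x0 rho M N lapw N0 wM Hf x hs tau xx hm hst tt.
have M0 : 0 <= M by exact: le_trans (wM x0).
have CA : 0 <= C * (M + N) by rewrite mulr_ge0// addr_ge0.
apply: le_trans (HD w x0 (rho - 9 * r * K%:R) (C * (M + N)) M CA wM _ x hs tau _ hm hst tt) _.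
- move=> y ks s yx kss ks0 /andP[s0 s1].
  rewrite subnKC// in kss.
  have ss : 0 < s <= tau0 by rewrite s0.
  apply: le_trans (HC w lap x0 rho M N lapw N0 wM Hf y ks s yx kss ks0 ss) _.
  rewrite ler_wpM2l//; apply: ger_powR.
    by rewrite s0 /=; apply: (le_trans s1); case/andP: tau01.
  by rewrite le_min ga andbT; lra.
- apply: (le_trans xx); rewrite lerD2l lerN2 subnKC// -[leRHS]tT ler_wpM2r ?(ltW tau00)//.
  rewrite -natrM ler_nat leq_mul2r leq_subr orbT//.
- by rewrite ler_wpM2r ?powR_ge0// -mulrA ler_wpM2l// [leRHS]mulrDl mul1r lerD2l lerDl.
Qed.
End schauder_differences.

(** * From differences to derivatives *)

Section pointwise_bounds.
Context {R : realType} {n : nat}.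
Implicit Types (f w : 'rV[R]_n -> R) (x y z h v : 'rV[R]_n) (hs : seq 'rV[R]_n).

Lemma exists_dyadic (c d : R) : 0 < d -> exists j : nat, c < 2 ^+ j * d.
Proof.
move=> d0; exists (Num.trunc (c / d)).+1; rewrite -ltr_pdivrMr//.
by apply: lt_le_trans (truncnS_gt _) _; rewrite -natrX ler_nat ltnW// ltn_expl.
Qed.

(** The exponent [3/2] exceeds the order 1 of the difference sought, so [marchaud_step] does not
    apply. The identity [D_h = (D_2h - D_h D_h) / 2] preserves a bound linear in [tau], and the
    correction [- 2 A tau^(3/2)] carried by the induction absorbs the error of each halving. *)
Lemma lipschitz_from_second (tau0 : R) : 0 < tau0 <= 1 ->
  exists2 C : R, 0 <= C & forall w x (A M : R), 0 <= A -> (forall y, `|w y| <= M) ->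
  (forall h tau, `|h| <= tau -> 0 < tau <= tau0 -> `|dd [:: h; h] w x| <= A * tau `^ (3 / 2)) ->
  forall h tau, `|h| <= tau -> 0 < tau <= tau0 -> `|dl h w x| <= C * (A + M) * tau.
Proof.
move=> /andP[t00 t01].
exists (4 / tau0 + 2); first by rewrite addr_ge0// divr_ge0// ltW.
move=> w x A M A0 wM HA.
have M0 : 0 <= M by exact: le_trans (wM x).
pose L := 4 * M / tau0 + 2 * A.
have c32 : 2 `^ (3 / 2) = 2 * 2 `^ (1 / 2) :> R.
  have -> : 3 / 2 = 1 + 1 / 2 :> R by field.
  by rewrite powRD ?powRr1// ?implybT// pnatr_eq0 implybT.
(* The induction closes as soon as [4 * sqrt 2 >= 5]. *)
have s2 : 7 / 5 <= 2 `^ (1 / 2) :> R.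
  rewrite div1r powR12_sqrt// -[leLHS]ger0_norm; last by lra.
  by rewrite -sqrtr_sqr ler_sqrt//; lra.
have base h tau : tau0 < 2 * tau -> 0 < tau <= tau0 -> `|h| <= tau ->
    `|dl h w x| <= L * tau - 2 * A * tau `^ (3 / 2).
  move=> tt /andP[t0 t1] ht.
  apply: le_trans (bounded_dd [:: h] wM x) _; rewrite /= expr1.
  have p1 : tau `^ (3 / 2) <= tau.
    rewrite -[leRHS](powRr1 (ltW t0)); apply: ger_powR; last by lra.
    by rewrite t0; exact: le_trans t01.
  have p2 : 2 * M <= 4 * M / tau0 * tau.
    rewrite mulrAC ler_pdivlMr//.
    have := ler_wpM2l M0 (ltW tt); lra.
  have p3 : A * tau `^ (3 / 2) <= A * tau by rewrite ler_wpM2l.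
  rewrite /L mulrDl; lra.
have key (j : nat) h tau : tau0 < 2 ^+ j.+1 * tau -> 0 < tau <= tau0 -> `|h| <= tau ->
    `|dl h w x| <= L * tau - 2 * A * tau `^ (3 / 2).
  elim: j h tau => [|j IH] h tau tt /andP[t0 t1] ht.
    by apply: base => //; rewrite t0.
  have [t2|t2] := ltP tau0 (2 * tau); first by apply: base => //; rewrite t0.
  have I1 : `|dl (2 *: h) w x| <= L * (2 * tau) - 2 * A * (2 * tau) `^ (3 / 2).
    apply: IH; [by rewrite mulrA -exprSr|by rewrite t2 andbT mulr_gt0|].
    by rewrite normrZ ger0_norm// ler_wpM2l.
  have I2 : `|dd [:: h; h] w x| <= A * tau `^ (3 / 2) by apply: HA => //; rewrite t0.
  have E : dl h w x = (dl (2 *: h) w x - dd [:: h; h] w x) / 2.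
    by rewrite /= /dl scaler_nat mulr2n addrA; field.
  rewrite E normrM [`|2^-1|]gtr0_norm ?invr_gt0// ler_pdivrMr//.
  apply: le_trans (ler_normB _ _) _; apply: le_trans (lerD I1 I2) _.
  rewrite powRM ?(ltW t0)// c32.
  have p0 : 0 <= A * tau `^ (3 / 2) by rewrite mulr_ge0// powR_ge0.
  have := ler_wpM2r p0 s2; lra.
move=> h tau ht tt; have [t0 t1] := andP tt.
have [j Hj] := exists_dyadic tau0 t0.
apply: le_trans (key j h tau _ tt ht) _.
  apply: lt_le_trans Hj _; rewrite ler_wpM2r ?(ltW t0)// exprS ler_peMl ?exprn_ge0//.
  by rewrite ler1n.
have p0 : 0 <= A * tau `^ (3 / 2) by rewrite mulr_ge0// powR_ge0.
have p1 : 0 <= (4 / tau0 * A + 2 * M) * tau.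
  by rewrite mulr_ge0 ?(ltW t0)// addr_ge0 ?mulr_ge0// invr_ge0 ltW.
rewrite /L; lra.
Qed.

Lemma tay_line f (f' : 'I_n -> 'rV[R]_n -> R) x v (t : R) : tay f f' ->
  is_derive t 1 (fun t => f (x + t *: v)) (\sum_i v 0 i * f' i (x + t *: v)).
Proof.
move=> [C C0 fC]; apply: (@is_derive_quad _ _ _ _ _ _ (C * `|v| ^+ 2)) => h _.
have := fC (x + t *: v) (h *: v).
rewrite (_ : x + t *: v + h *: v = x + (t + h *: 1) *: v); last first.
  by rewrite [h *: 1]mulr1 scalerDl addrA.
rewrite (_ : \sum_i (h *: v) 0 i * f' i (x + t *: v) =
  h * \sum_i v 0 i * f' i (x + t *: v)); last first.
  by rewrite mulr_sumr; apply: eq_bigr => i _; rewrite mxE mulrA.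
by rewrite normrZ exprMn real_normK ?num_real// -mulrA [X in C * X]mulrC.
Qed.

Local Notation e_ i := (delta_mx 0 i : 'rV[R]_n).

Lemma norm_delta_le (i : 'I_n) : `|e_ i| <= 1.
Proof.
by apply: row_norm_le => // j; rewrite mxE eqxx/=; case: eqP; rewrite ?normr1 ?normr0.
Qed.

Lemma sum_delta (i : 'I_n) (F : 'I_n -> R) : \sum_j e_ i 0 j * F j = F i.
Proof.
rewrite (bigD1 i)//= mxE !eqxx mul1r big1 ?addr0// => j /negPf ji.
by rewrite mxE ji andbF mul0r.
Qed.

(** Here [C] depends on [w]. The bound only starts the iteration of [hessian_error], where it is
    multiplied by [2^(-k)] and disappears. *)
Lemma second_difference_cubic w (w1 : 'I_n -> 'rV[R]_n -> R)
    (w2 : 'I_n -> 'I_n -> 'rV[R]_n -> R) (i j : 'I_n) :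
  tay w w1 -> tay (w1 j) (w2 j) -> nice (w2 j i) ->
  exists2 C : R, 0 <= C & forall x (t : R), 0 < t ->
    `|dd [:: t *: e_ j; t *: e_ i] w x - t ^+ 2 * w2 j i x| <= C * t ^+ 3.
Proof.
move=> tw [C1 C10 tw1] /nice_lipschitz[L L0 HL].
exists (C1 + L) => [|x t t0]; first exact: addr_ge0.
have dphi (s : R) : is_derive s 1
    (fun s => dd [:: t *: e_ i] w (x + s *: e_ j) - t * w2 j i x * s)
    (dd [:: t *: e_ i] (w1 j) (x + s *: e_ j) - t * w2 j i x * 1).
  have dc := is_derive_pZ (t * w2 j i x) (is_derive_id s 1).
  apply: (is_derive_pB _ dc).
  have /= := dd_line [:: t *: e_ i] (fun x v t => tay_line x v t tw) x (e_ j) s.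
  by rewrite sum_delta.
have := @mean_value_bound R _ _ 0 t ((C1 + L) * t ^+ 2) (ltW t0) dphi.
rewrite scale0r addr0 !subr0 mulr0 subr0 mulr1 addrAC.
rewrite [t * _ * t]mulrAC -expr2 -mulrA -exprSr; apply=> s /andP[s0 st].
set y := x + s *: e_ j.
have E1 := tw1 y (t *: e_ i).
rewrite (_ : \sum_k (t *: e_ i) 0 k * w2 j k y = t * w2 j i y) in E1; last first.
  rewrite -(sum_delta i (fun k => w2 j k y)) mulr_sumr.
  by apply: eq_bigr => k _; rewrite mxE mulrA.
have t2 : `|t *: e_ i| ^+ 2 <= t ^+ 2.
  rewrite ler_sqr ?nnegrE ?(ltW t0)// normrZ gtr0_norm//.
  by rewrite ler_piMr ?(ltW t0)// norm_delta_le.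
have E2 : `|w2 j i y - w2 j i x| <= L * t.
  apply: le_trans (HL _ _) _; rewrite ler_wpM2l// /y addrAC subrr add0r normrZ ger0_norm//.
  by apply: le_trans st; rewrite ler_piMr// norm_delta_le.
rewrite (_ : _ - _ = (dd [:: t *: e_ i] (w1 j) y - t * w2 j i y) +
  t * (w2 j i y - w2 j i x)); last by ring.
apply: le_trans (ler_normD _ _) _; rewrite mulrDl; apply: lerD.
  by apply: le_trans E1 _; rewrite ler_wpM2l.
by rewrite normrM gtr0_norm// expr2 [L * _]mulrCA ler_pM2l.
Qed.

(* The error [e] satisfies [e(t) <= 4 e(t/2) + 2 A t^(2+a)], by doubling the steps;
   iterating, the qualitative bound [e(t) = O(t^3)] makes the homogeneous part
   disappear. *)
Lemma hessian_error (a : R) : 0 < a -> exists2 K : R, 0 <= K &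
  forall w (w1 : 'I_n -> 'rV[R]_n -> R) (w2 : 'I_n -> 'I_n -> 'rV[R]_n -> R)
    (i j : 'I_n) x (tau0 A : R),
  tay w w1 -> tay (w1 j) (w2 j) -> nice (w2 j i) -> 0 <= A -> 0 < tau0 ->
  (forall y hs tau, `|y - x| <= 2 * tau0 -> size hs = 3%N -> (forall h, h \in hs -> `|h| <= tau) ->
     0 < tau <= tau0 -> `|dd hs w y| <= A * tau `^ (2 + a)) ->
  forall t, 0 < t <= tau0 ->
    `|dd [:: t *: e_ j; t *: e_ i] w x - t ^+ 2 * w2 j i x| <= K * A * t `^ (2 + a).
Proof.
move=> a0; pose th : R := 2 `^ (- a).
have th0 : 0 < th by rewrite powR_gt0.
have th1 : th < 1.
  rewrite /th powRN invf_lt1 ?powR_gt0//.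
  by have := @gt0_ltr_powR R a a0 1 2; rewrite powR1 !nnegrE; apply=> //; lra.
exists (2 / (1 - th)) => [|w w1 w2 i j x tau0 A tw tw1 nw A0 t00 HA].
  by rewrite divr_ge0// subr_ge0 ltW.
have [C C0 HC] := second_difference_cubic tw tw1 nw.
pose B := 2 / (1 - th) * A.
have B0 : 0 <= B by rewrite mulr_ge0// divr_ge0// subr_ge0 ltW.
have BE : th * B + 2 * A = B by rewrite /B; field; rewrite subr_eq0 eq_sym lt_eqF.
(* A halving multiplies the cubic term by [4 / 8] and preserves [B], the fixed point of
   [B = th * B + 2 * A]. *)
have key k t : 0 < t <= tau0 ->
    `|dd [:: t *: e_ j; t *: e_ i] w x - t ^+ 2 * w2 j i x| <=
    B * t `^ (2 + a) + C * t ^+ 3 * 2 ^- k.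
  elim: k t => [|k IH] t /andP[t0 t1].
    rewrite expr0 invr1 mulr1; apply: le_trans (HC x t t0) _.
    by rewrite lerDr mulr_ge0// powR_ge0.
  pose u := t / 2.
  have u0 : 0 < u by rewrite divr_gt0.
  have ut : 0 < u <= tau0 by rewrite u0 /=; rewrite /u; lra.
  have tu : t = 2 * u by rewrite /u mulrC divfK.
  have P : t `^ (2 + a) * th = 4 * u `^ (2 + a).
    have E2 : 2 `^ (2 + a) = 4 * 2 `^ a :> R.
      by rewrite powRD ?pnatr_eq0 ?implybT// (@powR_mulrn _ 2 2)// expr2 -natrM.
    rewrite tu powRM ?(ltW u0)// E2 /th powRN.
    by field; rewrite gt_eqF// powR_gt0.
  have p0 : 0 <= u `^ (2 + a) by rewrite powR_ge0.
  have hu h : h \in [:: u *: e_ j; u *: e_ i] -> `|h| <= u.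
    rewrite !inE => /orP[] /eqP ->; rewrite normrZ gtr0_norm//.
      by rewrite ler_piMr ?(ltW u0)// norm_delta_le.
    by rewrite ler_piMr ?(ltW u0)// norm_delta_le.
  have D := @dd_double _ _ [:: u *: e_ j; u *: e_ i] w x u (A * u `^ (2 + a)) hu.
  have {}D : `|dd [:: 2 *: (u *: e_ j); 2 *: (u *: e_ i)] w x -
      2 ^+ 2 * dd [:: u *: e_ j; u *: e_ i] w x| <= 2 ^+ 2 * 2%:R * (A * u `^ (2 + a)).
    apply: D => h y hh yx; apply: (HA y [:: h; u *: e_ j; u *: e_ i]) => //.
      by apply: le_trans yx _; rewrite ler_wpM2l//; case/andP: ut.
    by move=> h'; rewrite inE => /orP[/eqP ->|]; exact: hu.
  have I := IH u ut.
  rewrite !scalerA -tu in D.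
  have E : dd [:: t *: e_ j; t *: e_ i] w x - t ^+ 2 * w2 j i x =
     (dd [:: t *: e_ j; t *: e_ i] w x - 2 ^+ 2 * dd [:: u *: e_ j; u *: e_ i] w x) +
     4 * (dd [:: u *: e_ j; u *: e_ i] w x - u ^+ 2 * w2 j i x).
    by rewrite tu; ring.
  rewrite E; apply: le_trans (ler_normD _ _) _.
  rewrite [`|4 * _|]normrM [`|4|]ger0_norm//; apply: le_trans (lerD D (ler_wpM2l _ I)) _ => //.
  rewrite [2 ^+ k.+1]exprS [(2 * 2 ^+ k)^-1]invfM.
  have Q : C * t ^+ 3 * (2^-1 * 2 ^- k) = 4 * (C * u ^+ 3 * 2 ^- k).
    by rewrite tu; move: (2 ^- k) => X; field.
  have BP : B * t `^ (2 + a) = 4 * (B * u `^ (2 + a)) + 2 * (A * t `^ (2 + a)).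
    rewrite -{1}BE mulrDl [th * B]mulrC -[B * th * _]mulrA [th * _]mulrC P; ring.
  rewrite Q BP.
  have thp : u `^ (2 + a) * 4 <= t `^ (2 + a).
    by rewrite mulrC -P ler_piMr ?powR_ge0// ltW.
  have := ler_wpM2l A0 thp; lra.
move=> t tt; apply/ler_addgt0Pr => e e0.
have [t0 t1] := andP tt.
have [k Hk] := exists_dyadic (C * t ^+ 3) e0.
apply: le_trans (key k t tt) _; rewrite lerD2l.
by rewrite ler_pdivrMr ?exprn_gt0// [leRHS]mulrC ltW.
Qed.
End pointwise_bounds.

(** * Bounds on the two-jet *)

Section jets.
Context {R : realType} {n : nat}.
Implicit Types (f w : 'rV[R]_n -> R) (x y z h v : 'rV[R]_n) (hs : seq 'rV[R]_n).
Local Notation e_ i := (delta_mx 0 i : 'rV[R]_n).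

Lemma tay_mean f (f' : 'I_n -> 'rV[R]_n -> R) x v (E : R) : tay f f' ->
  (forall t, 0 <= t <= 1 -> `|\sum_i v 0 i * f' i (x + t *: v)| <= E) ->
  `|f (x + v) - f x| <= E.
Proof.
move=> tf H.
have := @mean_value_bound R _ _ 0 1 E ler01 (fun t => tay_line x v t tf) H.
by rewrite scale1r scale0r addr0 subr0 mulr1.
Qed.

Lemma tay_mean2 f (f' : 'I_n -> 'rV[R]_n -> R) x v (E : R) : tay f f' ->
  (forall t, 0 <= t <= 1 -> `|\sum_i v 0 i * (f' i (x + t *: v) - f' i x)| <= E) ->
  `|f (x + v) - f x - \sum_i v 0 i * f' i x| <= E.
Proof.
move=> tf H; pose S := \sum_i v 0 i * f' i x.
have dS (t : R) : is_derive t 1 (fun t => f (x + t *: v) - S * t)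
    (\sum_i v 0 i * f' i (x + t *: v) - S * 1).
  exact: (is_derive_pB (tay_line x v t tf) (is_derive_pZ S (is_derive_id t 1))).
have := @mean_value_bound R _ _ 0 1 E ler01 dS.
rewrite scale1r scale0r addr0 subr0 !mulr1 mulr0 subr0 addrAC; apply=> t t01.
by rewrite -sumrB; under eq_bigr do rewrite -mulrBr; exact: H.
Qed.

Lemma sum_scale_delta (t : R) (i : 'I_n) (F : 'I_n -> R) :
  \sum_j (t *: e_ i) 0 j * F j = t * F i.
Proof.
rewrite -(sum_delta i F) mulr_sumr; apply: eq_bigr => j _.
by rewrite mxE mulrA.
Qed.

Lemma sum_coord_bound v (F : 'I_n -> R) (B : R) : (forall i, `|F i| <= B) ->
  `|\sum_i v 0 i * F i| <= n%:R * B * `|v|.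
Proof.
move=> FB; apply: le_trans (ler_norm_sum _ _ _) _.
apply: le_trans (_ : \sum_(i < n) (B * `|v|) <= _).
  by apply: ler_sum => i _; rewrite normrM mulrC ler_pM// coord_le_norm.
by rewrite sumr_const card_ord mulr_natl mulrnAl.
Qed.

Lemma norm_scale_delta (t : R) (i : 'I_n) : `|t *: e_ i| <= `|t|.
Proof. by rewrite normrZ ler_piMr// norm_delta_le. Qed.

(** The conclusion consists of inequalities between values of [w], [w1] and [w2] at one or two
    points, so that it survives pointwise limits. *)
Lemma jet_estimates (a tau0 : R) : 0 < a < 1 -> 0 < tau0 <= 1 ->
  exists2 C : R, 0 <= C &
  forall w (w1 : 'I_n -> 'rV[R]_n -> R) (w2 : 'I_n -> 'I_n -> 'rV[R]_n -> R) x (A M : R),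
  tay w w1 -> (forall j, tay (w1 j) (w2 j)) -> (forall j i, nice (w2 j i)) ->
  0 <= A -> (forall y, `|w y| <= M) ->
  (forall y hs tau, `|y - x| <= 4 * tau0 -> size hs = 3%N -> (forall h, h \in hs -> `|h| <= tau) ->
     0 < tau <= tau0 -> `|dd hs w y| <= A * tau `^ (2 + a)) ->
  let B := C * (A + M) in
  [/\ forall i, `|w1 i x| <= B, forall j i, `|w2 j i x| <= B,
      forall y, `|y - x| <= tau0 -> [/\ `|w y - w x| <= B * `|y - x| `^ a,
        forall j, `|w1 j y - w1 j x| <= B * `|y - x| `^ a &
        forall j i, `|w2 j i y - w2 j i x| <= B * `|y - x| `^ a] &
      forall (t : R) i, `|t| <= tau0 ->
        `|w (x + t *: e_ i) - w x - t * w1 i x| <= B * `|t| `^ (1 + a) /\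
        forall j, `|w1 j (x + t *: e_ i) - w1 j x - t * w2 j i x| <= B * `|t| `^ (1 + a)].
Proof.
move=> /andP[a0 a1] /andP[t00 t01].
have [K K0 HK] := @hessian_error R n a a0.
(* [c2] bounds the Hessian, through one second difference at scale [tau0]; [c1] the Lipschitz
   constant of the gradient; [c0] the gradient; [c3] the Hölder constant of the Hessian. *)
pose c2 := (4 + K) / tau0 ^+ 2; pose c1 := n%:R * c2.
pose c0 := 2 / tau0 + c1; pose c3 := 2 * K + 1.
have c20 : 0 <= c2 by rewrite divr_ge0// ?exprn_ge0 ?(ltW t00)// addr_ge0.
have c10 : 0 <= c1 by rewrite mulr_ge0.
have c00 : 0 <= c0 by rewrite addr_ge0// divr_ge0// ltW.
have c30 : 0 <= c3 by rewrite addr_ge0// mulr_ge0.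
have nc0 : 0 <= n%:R * c0 by rewrite mulr_ge0.
exists (c2 + c1 + c0 + n%:R * c0 + c3).
  by apply: (addr_ge0 _ c30); apply: (addr_ge0 _ nc0); apply: (addr_ge0 _ c00); exact: addr_ge0.
move=> w w1 w2 x A M tw tw1 nw A0 wM HA B.
have M0 : 0 <= M by exact: le_trans (wM x).
have S0 : 0 <= A + M by exact: addr_ge0.
have cB c : 0 <= c -> c <= c2 + c1 + c0 + n%:R * c0 + c3 -> c * (A + M) <= B.
  by move=> c_0 cc; rewrite /B ler_wpM2r.
have err y j i (t : R) : `|y - x| <= 2 * tau0 -> 0 < t <= tau0 ->
    `|dd [:: t *: e_ j; t *: e_ i] w y - t ^+ 2 * w2 j i y| <= K * A * t `^ (2 + a).
  move=> yx; apply: (HK w w1 w2 i j y tau0 A) => // z hs tau zy.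
  apply: HA; rewrite (_ : z - x = (z - y) + (y - x)); last by rewrite subrKA.
  by apply: le_trans (ler_normD _ _) _; lra.
have powD (t : R) : 0 < t -> t `^ (2 + a) = t ^+ 2 * t `^ a.
  by move=> t0; rewrite powRD ?(gt_eqF t0) ?implybT// (@powR_mulrn _ t 2)// ltW.
have w2B y j i : `|y - x| <= 2 * tau0 -> `|w2 j i y| <= c2 * (A + M).
  move=> yx; have E := err y j i tau0 yx; rewrite t00 lexx in E; have {}E := E isT.
  have D : `|dd [:: tau0 *: e_ j; tau0 *: e_ i] w y| <= 4 * M.
    by apply: le_trans (bounded_dd _ wM y) _; rewrite /= expr2 -natrM.
  rewrite /c2 mulrAC ler_pdivlMr ?exprn_gt0// mulrC -[tau0 ^+ 2]ger0_norm ?exprn_ge0 ?(ltW t00)//.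
  rewrite -normrM.
  have p1 : tau0 `^ (2 + a) <= 1.
    rewrite -[leRHS](powRr0 tau0); apply: ger_powR; first by rewrite t00.
    by apply: addr_ge0 => //; exact: ltW.
  have p2 := ler_wpM2l (mulr_ge0 K0 A0) p1.
  have T := ler_normB (dd [:: tau0 *: e_ j; tau0 *: e_ i] w y)
    (dd [:: tau0 *: e_ j; tau0 *: e_ i] w y - tau0 ^+ 2 * w2 j i y).
  rewrite opprB addrC subrK in T; apply: le_trans T _.
  have := mulr_ge0 K0 M0; have := mulr_ge0 K0 A0; lra.
(* With [t = |y - x|], each Hessian is compared with a second difference of step [t], and the
   difference of these two is a third difference. *)
have w2H y j i : `|y - x| <= tau0 ->
    `|w2 j i y - w2 j i x| <= c3 * (A + M) * `|y - x| `^ a.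
  move=> yx; have [->|yx0] := eqVneq y x.
    by rewrite !subrr !normr0 powR0 ?mulr0// gt_eqF.
  pose t := `|y - x|; have t0 : 0 < t by rewrite normr_gt0 subr_eq0.
  have tt : 0 < t <= tau0 by rewrite t0.
  have E1 : `|dd [:: t *: e_ j; t *: e_ i] w y - t ^+ 2 * w2 j i y| <= K * A * t `^ (2 + a).
    by apply: err => //; apply: (le_trans yx); lra.
  have E2 : `|dd [:: t *: e_ j; t *: e_ i] w x - t ^+ 2 * w2 j i x| <= K * A * t `^ (2 + a).
    by apply: err => //; rewrite subrr normr0; lra.
  have E3 : `|dd [:: t *: e_ j; t *: e_ i] w y - dd [:: t *: e_ j; t *: e_ i] w x| <=
      A * t `^ (2 + a).
    have := HA x [:: y - x; t *: e_ j; t *: e_ i] t.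
    rewrite subrr normr0 /= {1}/dl [x + _]addrC subrK; apply => //; first by lra.
    move=> h; rewrite !inE => /orP[/eqP->//|/orP[]/eqP->].
      by apply: le_trans (norm_scale_delta _ _) _; rewrite gtr0_norm.
    by apply: le_trans (norm_scale_delta _ _) _; rewrite gtr0_norm.
  rewrite -/t -(ler_pM2l (exprn_gt0 2 t0)).
  rewrite -[X in X * `|_ - _|]ger0_norm ?exprn_ge0 ?(ltW t0)// -normrM mulrBr.
  rewrite mulrCA -(powD t t0).
  move: E1 E2 E3; rewrite !ler_norml.
  move: (dd _ _ y) (dd _ _ x) (t `^ (2 + a)) (powR_ge0 t (2 + a)) => X Y P P0 E1 E2 E3.
  have := mulr_ge0 (mulr_ge0 c30 M0) P0.
  rewrite /c3; move: E1 E2 E3 => /andP[? ?] /andP[? ?] /andP[? ?] ?.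
  by apply/andP; split; lra.
have w1L y z j : `|z - x| <= 2 * tau0 -> `|y - x| <= 2 * tau0 ->
    `|w1 j y - w1 j z| <= c1 * (A + M) * `|y - z|.
  move=> zx yx; rewrite -[y](subrKC z); apply: (tay_mean (tw1 j)) => t /andP[t0 t1].
  rewrite [z + _ - z]addrC addKr /c1 -[n%:R * c2 * _]mulrA.
  apply: sum_coord_bound => i; apply: w2B.
  rewrite (_ : _ - x = t *: (y - x) + (1 - t) *: (z - x)); last first.
    by rewrite !scalerBr !scalerBl !scale1r opprB; apply/rowP => k; rewrite !mxE; ring.
  apply: le_trans (ler_normD _ _) _; rewrite !normrZ !ger0_norm ?subr_ge0//.
  have := ler_wpM2l t0 yx; have t2 : 0 <= 1 - t by rewrite subr_ge0.
  have := ler_wpM2l t2 zx; lra.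
have near (y : 'rV[R]_n) (s t : R) i : `|y - x| <= tau0 -> `|t| <= tau0 -> 0 <= s <= 1 ->
    `|y + s *: (t *: e_ i) - x| <= 2 * tau0 /\ `|s *: (t *: e_ i)| <= `|t|.
  move=> yx tt /andP[s0 s1].
  have P : `|s *: (t *: e_ i)| <= `|t|.
    rewrite normrZ ger0_norm//; apply: le_trans (norm_scale_delta t i).
    by rewrite ler_piMl.
  split=> //; rewrite addrAC; apply: le_trans (ler_normD _ _) _; lra.
have wT y (t : R) i : `|y - x| <= tau0 -> `|t| <= tau0 ->
    `|w (y + t *: e_ i) - w y - t * w1 i y| <= c1 * (A + M) * `|t| ^+ 2.
  move=> yx tt; rewrite -(sum_scale_delta t i (fun k => w1 k y)).
  apply: (tay_mean2 tw) => s s01.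
  rewrite (sum_scale_delta t i (fun k => w1 k _ - w1 k y)) normrM expr2 mulrCA.
  rewrite ler_wpM2l//.
  have [P Q] := near y s t i yx tt s01.
  apply: le_trans (w1L _ _ i _ P) _; first by apply: (le_trans yx); lra.
  by rewrite [y + _]addrC addrK ler_wpM2l// mulr_ge0.
have w1B y i : `|y - x| <= tau0 -> `|w1 i y| <= c0 * (A + M).
  move=> yx; have := wT y tau0 i yx; rewrite gtr0_norm// lexx => /(_ isT) T.
  rewrite -(ler_pM2l t00) -[X in X * `|_|](gtr0_norm t00) -normrM.
  have E : tau0 * (c0 * (A + M)) = 2 * (A + M) + c1 * (A + M) * tau0.
    by rewrite /c0; field; rewrite gt_eqF.
  rewrite E.
  have t2 : tau0 ^+ 2 <= tau0 by rewrite expr2 ler_piMr// ltW.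
  have := ler_wpM2l (mulr_ge0 c10 S0) t2.
  have := wM (y + tau0 *: e_ i); have := wM y.
  move: T; rewrite !ler_norml; move: (w _) (w y) (tau0 * w1 i y) (c1 * (A + M)) => P Q W D.
  move=> /andP[? ?] /andP[? ?] /andP[? ?] ?; apply/andP; split; lra.
have tp (t : R) : 0 <= t <= tau0 -> t <= t `^ a.
  move=> /andP[t0 tt]; have [->|tn0] := eqVneq t 0; first exact: powR_ge0.
  rewrite -[leLHS](powRr1 t0); apply: ger_powR; last exact: ltW.
  by rewrite lt_neqAle eq_sym tn0 t0 (le_trans tt).
have tp1 (t : R) : 0 <= t -> t * t `^ a = t `^ (1 + a).
  move=> t0; have [->|tn0] := eqVneq t 0; first by rewrite mul0r powR0// gt_eqF// addr_gt0.
  by rewrite powRD ?tn0 ?implybT// powRr1.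
have xx : `|x - x| <= tau0 by rewrite subrr normr0 ltW.
have xx2 : `|x - x| <= 2 * tau0 by apply: (le_trans xx); lra.
split=> [i|j i|y yx|t i tt].
- apply: le_trans (w1B _ _ xx) _; apply: cB => //; lra.
- apply: le_trans (w2B _ _ _ xx2) _; apply: cB => //; lra.
- have yxa : `|y - x| <= `|y - x| `^ a by apply: tp; rewrite normr_ge0.
  have step c (X : R) : 0 <= c -> c <= c2 + c1 + c0 + n%:R * c0 + c3 ->
      X <= c * (A + M) * `|y - x| -> X <= B * `|y - x| `^ a.
    move=> c_0 cc /le_trans; apply; apply: ler_pM => //; first exact: mulr_ge0.
    exact: cB.
  split=> [|j|j i].
  + apply: (step (n%:R * c0)) => //; first by lra.
    rewrite -{1}[y](subrKC x); apply: (tay_mean tw) => t /andP[t0 t1].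
    rewrite -[n%:R * c0 * _]mulrA; apply: sum_coord_bound => i; apply: w1B.
    rewrite addrAC subrr add0r normrZ ger0_norm//; apply: le_trans yx.
    by rewrite ler_piMl.
  + apply: (step c1) => //; first by lra.
    by apply: w1L => //; apply: (le_trans yx); lra.
  + apply: le_trans (w2H _ _ _ yx) _; rewrite ler_wpM2r ?powR_ge0//.
    by apply: cB => //; lra.
- split=> [|j].
  + apply: le_trans (wT x t i xx tt) _; apply: ler_pM; [exact: mulr_ge0|exact: sqr_ge0| |].
      by apply: cB => //; lra.
    by rewrite -tp1// expr2 ler_wpM2l// tp// normr_ge0.
  + rewrite -(sum_scale_delta t i (fun k => w2 j k x)).
    apply: (tay_mean2 (tw1 j)) => s s01.
    rewrite (sum_scale_delta t i (fun k => w2 j k _ - w2 j k x)) normrM.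
    rewrite -tp1// mulrCA ler_wpM2l//.
    have [P Q] := near x s t i xx tt s01.
    have E : x + s *: (t *: e_ i) - x = s *: (t *: e_ i) by rewrite addrAC subrr add0r.
    apply: le_trans (w2H _ _ _ _) _; first by rewrite E (le_trans Q).
    rewrite E; apply: ler_pM; [exact: mulr_ge0|exact: powR_ge0| |].
      by apply: cB => //; lra.
    by apply: ge0_ler_powR; rewrite ?nnegrE ?(ltW a0).
Qed.
End jets.

(** * The fractional kernel *)

Section euclidean_norm.
Context {R : realType} {n : nat}.
Implicit Types (x y z : 'rV[R]_n).

Lemma eucl_norm_ge0 x : 0 <= eucl_norm x.
Proof. exact: sqrtr_ge0. Qed.

Lemma eucl_norm_sqr x : eucl_norm x ^+ 2 = \sum_(i < n) x 0 i ^+ 2.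
Proof. by rewrite sqr_sqrtr// sumr_ge0// => i _; exact: sqr_ge0. Qed.

Lemma eucl_normN x : eucl_norm (- x) = eucl_norm x.
Proof. by rewrite /eucl_norm; under eq_bigr do rewrite mxE sqrrN. Qed.

Lemma norm_le_eucl x : `|x| <= eucl_norm x.
Proof.
apply: row_norm_le => [|i]; first exact: eucl_norm_ge0.
rewrite -(ger0_norm (eucl_norm_ge0 x)) -ler_sqr ?nnegrE// !real_normK ?num_real//.
by rewrite eucl_norm_sqr (bigD1 i)//= lerDl sumr_ge0// => j _; exact: sqr_ge0.
Qed.

Lemma eucl_le_norm x : eucl_norm x <= n%:R * `|x|.
Proof.
rewrite -ler_sqr ?nnegrE ?eucl_norm_ge0 ?mulr_ge0// eucl_norm_sqr.
apply: le_trans (_ : n%:R * `|x| ^+ 2 <= _).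
  rewrite -[n in n%:R]card_ord mulr_natl -sumr_const; apply: ler_sum => i _.
  by rewrite -real_normK ?num_real// lerXn2r ?nnegrE// coord_le_norm.
rewrite exprMn ler_wpM2r ?sqr_ge0//.
by rewrite -natrX ler_nat; case: (n) => // k; rewrite expnS expn1 leq_pmulr.
Qed.

(** Multiplied by the sum of the norms, the claim becomes one on a difference of squares, estimated
    coordinate by coordinate. *)
Lemma eucl_lipschitz x y : `|eucl_norm x - eucl_norm y| <= n%:R * `|x - y|.
Proof.
pose S := eucl_norm x + eucl_norm y.
have S0 : 0 <= S by rewrite addr_ge0 ?eucl_norm_ge0.
have [S1|Sn0] := eqVneq S 0.
  have x0 := eucl_norm_ge0 x; have y0 := eucl_norm_ge0 y.
  have -> : eucl_norm x = 0 by rewrite /S in S1; lra.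
  have -> : eucl_norm y = 0 by rewrite /S in S1; lra.
  by rewrite subrr normr0 mulr_ge0.
have Sp : 0 < S by rewrite lt_neqAle eq_sym Sn0.
rewrite -(ler_pM2r Sp) -[X in _ * X <= _](ger0_norm S0) -normrM /S -subr_sqr.
rewrite !eucl_norm_sqr -sumrB; apply: le_trans (ler_norm_sum _ _ _) _.
rewrite -[n in n%:R]card_ord mulr_natl -sumr_const mulr_suml; apply: ler_sum => i _.
rewrite subr_sqr normrM; apply: ler_pM => //.
  by have := coord_le_norm (x - y) i; rewrite !mxE.
apply: le_trans (ler_normD _ _) _; apply: lerD.
  by apply: le_trans (coord_le_norm x i) _; exact: norm_le_eucl.
by apply: le_trans (coord_le_norm y i) _; exact: norm_le_eucl.
Qed.

Lemma continuous_eucl : continuous (eucl_norm : 'rV[R]_n -> R).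
Proof. by apply: (@lipschitz_continuous _ _ _ _ n%:R) => // x y; exact: eucl_lipschitz. Qed.
End euclidean_norm.

Section power_integrals.
Context {R : realType} {n : nat}.
Local Notation mu := (@leb R n).

Lemma ler_powRN (x y m : R) : 0 < x -> x <= y -> 0 <= m -> y `^ (- m) <= x `^ (- m).
Proof.
move=> x0 xy m0; have y0 := lt_le_trans x0 xy.
rewrite !powRN lef_pV2 ?posrE ?powR_gt0//.
by apply: ge0_ler_powR; rewrite ?nnegrE ?(ltW x0) ?(ltW y0).
Qed.

(** Common to both ends of the kernel: [X = 2] for infinity, where [m > n], and [X = 1/2] for the
    origin, where [m < n]. The ratio of the series is [X^(n - m)]. *)
Lemma integ_power (f : 'rV[R]_n -> R) (X m r : R) : 0 < X -> 0 < r ->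
  X `^ (n%:R - m) < 1 -> measurable_fun setT f ->
  (forall x, f x <> 0 -> exists k : nat, `|x| <= X ^+ k * r /\ `|f x| <= (X ^+ k * r / 2) `^ (- m)) ->
  integ mu f.
Proof.
move=> X0 r0 q1 mf H.
have P k : 0 < X ^+ k * r by rewrite mulr_gt0// exprn_gt0.
apply: (@integ_dyadic R n f (fun k => (X ^+ k * r / 2) `^ (- m)) (fun k => X ^+ k * r)
  (2 `^ (m + n%:R) * r `^ (n%:R - m)) (X `^ (n%:R - m)) mf _ _ _ _ H) => [|k|k|k].
- by rewrite powR_gt0.
- exact: powR_ge0.
- exact: ltW.
- have e1 : (X `^ (n%:R - m)) ^+ k = (X ^+ k) `^ (n%:R - m).
    by rewrite -powR_mulrn ?powR_ge0// -powRrM mulrC powRrM powR_mulrn// ltW.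
  rewrite e1 -[leRHS]mulrA -powRM ?exprn_ge0 ?(ltW r0) ?(ltW X0)// [r * _]mulrC.
  move: (X ^+ k * r) (P k) => Y Y0.
  have -> : Y / 2 = Y * 2 `^ (- 1) by rewrite powRN powRr1.
  rewrite -powR_mulrn ?mulr_ge0 ?(ltW Y0)// !powRM ?powR_ge0 ?(ltW Y0)//.
  rewrite -powRrM mulrNN mul1r.
  rewrite !powRD ?pnatr_eq0 ?(gt_eqF Y0) ?implybT//.
  by rewrite le_eqVlt; apply/orP; left; apply/eqP; ring.
Qed.

(** Since [a^(-N) = b^(-N) exp(-N (ln a - ln b))], the inequalities [1 + x <= exp x] and
    [ln (1 + x) <= x] suffice. *)
Lemma powRN_diff (a b N : R) : 0 < b -> b <= a -> 0 <= N ->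
  b `^ (- N) - a `^ (- N) <= N * b `^ (- N) * ((a - b) / b).
Proof.
move=> b0 ba N0; have a0 := lt_le_trans b0 ba.
have L : ln a - ln b <= (a - b) / b.
  rewrite -lnV ?posrE// -lnM ?posrE ?invr_gt0//.
  have -> : a / b = 1 + (a - b) / b by rewrite mulrBl divff ?gt_eqF// addrC subrK.
  by apply: le_ln1Dx; apply: (@lt_le_trans _ _ 0) => //; rewrite divr_ge0 ?subr_ge0// ltW.
have E : a `^ (- N) = b `^ (- N) * expR (- (N * (ln a - ln b))).
  by rewrite /powR !gt_eqF// -expRD; congr expR; ring.
have e1 := expR_ge1Dx (- (N * (ln a - ln b))).
rewrite E -[X in X - _]mulr1 -mulrBr -[leRHS]mulrA [leRHS]mulrCA ler_wpM2l ?powR_ge0//.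
have := ler_wpM2l N0 L; lra.
Qed.
End power_integrals.

Section kernels.
Context {R : realType} {n : nat}.
Local Notation mu := (@leb R n).
Implicit Types (x y z h : 'rV[R]_n).
Variables (s r : R).
Hypotheses (n_gt0 : (0 < n)%N) (s01 : 0 < s < 1) (r_gt0 : 0 < r).
Local Notation N := (n%:R + 2 * s).

Definition ker z : R := eucl_norm z `^ (- N).
(** The radius is truncated from below instead of cutting the kernel off: this keeps the far part
    Lipschitz. *)
Definition far z : R := Num.max (eucl_norm z) r `^ (- N).
(** At the origin [ker] takes the value 0, as a nonzero power of 0, while [far] is positive; the
    maximum keeps [near] nonnegative there. Elsewhere it is the plain difference. *)
Definition near z : R := Num.max 0 (ker z - far z).

Let N0 : 0 < N.
Proof. by case/andP: s01 => s0 _; rewrite ltr_wpDl// mulr_gt0. Qed.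

Let emax z : 0 < Num.max (eucl_norm z) r.
Proof. by rewrite lt_max r_gt0 orbT. Qed.

Lemma ker_gagliardo x y : gagliardo_kernel s x y = ker (x - y).
Proof. by rewrite /gagliardo_kernel /ker powRN. Qed.

Lemma ker_ge0 z : 0 <= ker z. Proof. exact: powR_ge0. Qed.
Lemma far_ge0 z : 0 <= far z. Proof. exact: powR_ge0. Qed.
Lemma near_ge0 z : 0 <= near z. Proof. by rewrite le_max lexx. Qed.

Lemma kerN z : ker (- z) = ker z. Proof. by rewrite /ker eucl_normN. Qed.
Lemma farN z : far (- z) = far z. Proof. by rewrite /far eucl_normN. Qed.

Lemma nearN z : near (- z) = near z. Proof. by rewrite /near kerN farN. Qed.

Lemma far_ker z : r <= eucl_norm z -> far z = ker z.
Proof. by move=> rz; rewrite /far max_l. Qed.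

Lemma measurable_eucl : measurable_fun setT (eucl_norm : 'rV[R]_n -> R).
Proof. by apply: continuous_measurable_row; exact: continuous_eucl. Qed.

Lemma measurable_ker : measurable_fun setT ker.
Proof. exact: (measurableT_comp (measurable_powR (- N)) measurable_eucl). Qed.

Lemma measurable_far : measurable_fun setT far.
Proof.
apply: (measurableT_comp (measurable_powR (- N))).
by apply: measurable_maxr; [exact: measurable_eucl|exact: measurable_cst].
Qed.

Lemma measurable_near : measurable_fun setT near.
Proof.
apply: measurable_maxr; first exact: measurable_cst.
by apply: measurable_funB; [exact: measurable_ker|exact: measurable_far].
Qed.

Lemma far_le_ker z : z != 0 -> far z <= ker z.
Proof.
move=> z0; apply: ler_powRN; rewrite ?le_max ?lexx ?(ltW N0)//.
by apply: lt_le_trans (norm_le_eucl z); rewrite normr_gt0.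
Qed.

Lemma near_far z : z != 0 -> near z + far z = ker z.
Proof. by move=> z0; rewrite /near max_r ?subrK// subr_ge0 far_le_ker. Qed.

Lemma near_supp z : r < `|z| -> near z = 0.
Proof.
move=> rz; rewrite /near /far (@max_l _ _ (eucl_norm z) r); first by rewrite subrr maxxx.
by apply: le_trans (norm_le_eucl z); exact: ltW.
Qed.

Lemma integ_far : integ mu far.
Proof.
have [s0 s1] := andP s01.
apply: (@integ_power R n far 2 N r) => //; first last.
- move=> x _.
  have ex : exists k : nat, `|x| <= 2 ^+ k * r.
    have [k kx] := exists_dyadic `|x| r_gt0; by exists k; exact: ltW.
  case: (ex_minnP ex) => k kx kmin; exists k; split=> //.
  rewrite ger0_norm ?far_ge0//; apply: ler_powRN; rewrite ?(ltW N0)//.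
    by rewrite !divr_gt0 ?mulr_gt0 ?exprn_gt0.
  rewrite le_max; case: k kx kmin => [|k] kx kmin.
    apply/orP; right; rewrite expr0 mul1r ler_pdivrMr//.
    by apply: ler_peMr; [exact: ltW|rewrite ler1n].
  apply/orP; left; apply: le_trans (norm_le_eucl x).
  have [/kmin|] := boolP (`|x| <= 2 ^+ k * r); first by rewrite ltnn.
  by rewrite -ltNge => /ltW; apply: le_trans; rewrite exprS le_eqVlt; apply/orP; left; apply/eqP; field.
- exact: measurable_far.
- rewrite (_ : _ - _ = - (2 * s)); last by ring.
  rewrite powRN invf_lt1 ?powR_gt0//.
  have s20 : 0 < 2 * s by rewrite mulr_gt0.
  by have := @gt0_ltr_powR R (2 * s) s20 1 2; rewrite powR1 !nnegrE; apply=> //; lra.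
Qed.

(** [|z|^(-n - 2 s) |z|^(1 + s) = |z|^(-n + (1 - s))] is integrable at the origin, and [1 + s < 2]
    leaves room for the gain [q]. *)
Lemma integ_near : integ mu (fun z => near z * `|z| `^ (1 + s)).
Proof.
have r0 := r_gt0; have [s0 s1] := andP s01; have n1 : 1 <= n%:R :> R by rewrite ler1n.
pose m := n%:R - (1 - s); have m0 : 0 < m by rewrite /m; lra.
have mz : measurable_fun setT (fun z : 'rV[R]_n => `|z| `^ (1 + s)).
  apply: (measurableT_comp (measurable_powR _)).
  by apply: continuous_measurable_row; exact: norm_continuous.
have X1 : 2^-1 `^ (n%:R - m) < 1 :> R.
  rewrite (_ : _ - _ = 1 - s); last by rewrite /m; ring.
  rewrite -[2^-1]powR_inv1// -powRrM mulN1r powRN invf_lt1 ?powR_gt0//.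
  have s20 : 0 < 1 - s by lra.
  by have := @gt0_ltr_powR R (1 - s) s20 1 2; rewrite powR1 !nnegrE; apply=> //; lra.
have mf : measurable_fun setT (fun z => near z * `|z| `^ (1 + s)).
  exact: (measurable_funM measurable_near mz).
have half0 : 0 < 2^-1 :> R by rewrite invr_gt0.
refine (@integ_power R n (fun z => near z * `|z| `^ (1 + s)) 2^-1 m r half0 r_gt0 X1 mf _).
move=> x nx0.
have xr : `|x| <= r.
  by rewrite leNgt; apply/negP => /near_supp E; apply: nx0; rewrite E mul0r.
have x0 : 0 < `|x|.
  rewrite normr_gt0; apply/eqP => E; apply: nx0.
  by rewrite E normr0 powR0 ?mulr0// gt_eqF// addr_gt0.
(* The least such [k] satisfies [|x| <= 2^(-k) r] as well: by minimality if [k > 0], and by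
   [|x| <= r] if [k = 0]. *)
have ex : exists k : nat, 2^-1 ^+ k * r / 2 < `|x|.
  have [k kx] := exists_dyadic r x0; exists k.
  rewrite exprVn -mulrA ltr_pdivrMl ?exprn_gt0//.
  by apply: le_lt_trans kx; rewrite ler_pdivrMr//; lra.
case: (ex_minnP ex) => k kx kmin; exists k; split=> //.
  case: k kx kmin => [|k] kx kmin; first by rewrite expr0 mul1r.
  have [/kmin|] := boolP (2^-1 ^+ k * r / 2 < `|x|); first by rewrite ltnn.
  by rewrite -leNgt exprSr mulrAC.
rewrite ger0_norm ?mulr_ge0 ?powR_ge0 ?near_ge0//.
apply: le_trans (_ : `|x| `^ (- m) <= _); last first.
  by apply: ler_powRN; rewrite ?(ltW kx) ?(ltW m0)// !divr_gt0 ?mulr_gt0 ?exprn_gt0 ?invr_gt0.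
have -> : `|x| `^ (- m) = `|x| `^ (- N) * `|x| `^ (1 + s).
  by rewrite -powRD ?(gt_eqF x0) ?implybT//; congr powR; rewrite /m; ring.
rewrite ler_wpM2r ?powR_ge0//; apply: le_trans (_ : ker x <= _).
  by rewrite ge_max ker_ge0/= gerBl far_ge0.
by apply: ler_powRN; rewrite ?norm_le_eucl ?(ltW N0).
Qed.

(** The bound is relative to [far z], so that integration in [z] makes translations Lipschitz in
    L1. *)
Lemma far_lipschitz : exists2 C : R, 0 <= C & forall z h, n%:R * `|h| <= r / 2 ->
  `|far (z + h) - far z| <= C * `|h| * far z.
Proof.
exists (N * 2 `^ (N + 1) * n%:R / r).
  by rewrite !mulr_ge0 ?powR_ge0 ?invr_ge0 ?(ltW r_gt0) ?(ltW N0).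
have r0 := r_gt0; move=> z h hr; rewrite /far.
have H : `|Num.max (eucl_norm (z + h)) r - Num.max (eucl_norm z) r| <= n%:R * `|h|.
  have := eucl_lipschitz (z + h) z; rewrite [z + h - z]addrC addKr.
  move: (eucl_norm _) (eucl_norm z) => a b; move: (n%:R * _) => c.
  by rewrite !ler_norml => /andP[? ?]; case: (leP a r); case: (leP b r) => ? ?; apply/andP; split; lra.
have rb : r <= Num.max (eucl_norm z) r by rewrite le_max lexx orbT.
move: (emax (z + h)) (emax z) rb H; move: (Num.max _ _) (Num.max (eucl_norm z) r) => a b a0 b0 rb H.
have key (c d : R) : 0 < c -> b / 2 <= c -> c <= d -> d - c <= n%:R * `|h| ->
    `|c `^ (- N) - d `^ (- N)| <= N * 2 `^ (N + 1) * n%:R / r * `|h| * b `^ (- N).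
  move=> c0 bc cd dc; have d0 := lt_le_trans c0 cd.
  rewrite ger0_norm ?subr_ge0; last by apply: ler_powRN => //; exact: ltW.
  apply: le_trans (powRN_diff c0 cd (ltW N0)) _.
  have c1 : c `^ (- N) <= 2 `^ N * b `^ (- N).
    have b2 : 0 < b / 2 by rewrite divr_gt0.
    apply: le_trans (ler_powRN b2 bc (ltW N0)) _.
    have E : b `^ (- N) = (b / 2) `^ (- N) * 2 `^ (- N).
      by rewrite -powRM ?(ltW b2)// divfK.
    by rewrite E mulrCA -powRD ?pnatr_eq0 ?implybT// subrr powRr0 mulr1.
  have c2 : (d - c) / c <= 2 * n%:R / r * `|h|.
    rewrite ler_pdivrMr//; apply: (le_trans dc).
    have -> : 2 * n%:R / r * `|h| * c = n%:R * `|h| * (2 * c / r) by ring.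
    by rewrite ler_peMr ?mulr_ge0// ler_pdivlMr// mul1r; lra.
  apply: le_trans (_ : N * (2 `^ N * b `^ (- N)) * (2 * n%:R / r * `|h|) <= _).
    apply: ler_pM; last exact: c2.
    - by rewrite mulr_ge0 ?powR_ge0// ltW.
    - by rewrite divr_ge0 ?subr_ge0// ltW.
    - by rewrite ler_wpM2l// ltW.
  rewrite [2 `^ (N + 1)]powRD ?pnatr_eq0 ?implybT// powRr1//.
  by rewrite le_eqVlt; apply/orP; left; apply/eqP; ring.
have [ab|ba] := leP a b.
- apply: key => //; last by move: H; rewrite ler_norml => /andP[]; lra.
  by move: H; rewrite ler_norml => /andP[]; lra.
- rewrite distrC; apply: key => //; [by lra|exact: ltW|].
  by move: H; rewrite ler_norml => /andP[]; lra.
Qed.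
End kernels.

(** * The mollified equation *)

Section correlation.
Context {R : realType} {n : nat}.
Local Notation mu := (@leb R n).
Implicit Types (x y z h v : 'rV[R]_n) (hs : seq 'rV[R]_n).

(** A correlation rather than a convolution: [y -> psi (y - x)] is then directly the test function
    centred at [x]. *)
Definition cor (u psi : 'rV[R]_n -> R) x : R := \int[mu]_y (u y * psi (y - x)).

Variables (u : 'rV[R]_n -> R) (M : R).
Hypotheses (mu_ : measurable_fun setT u) (M_ge0 : 0 <= M)
  (uM : {ae mu, forall y, `|u y| <= M}).
Implicit Types psi : 'rV[R]_n -> R.

Lemma integ_cor psi x : integ mu psi -> integ mu (fun y => u y * psi (y - x)).
Proof.
move=> ip; have [ip' _] := int_shift (- x) ip.
exact: (int_ae_abs_le M_ge0 mu_ uM ip').1.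
Qed.

Lemma cor_bound psi x : integ mu psi -> `|cor u psi x| <= M * \int[mu]_z `|psi z|.
Proof.
move=> ip; have [ip' _] := int_shift (- x) ip.
have [_ <-] := int_shift (- x) (integ_norm ip).
exact: (int_ae_abs_le M_ge0 mu_ uM ip').2.
Qed.

Lemma corB psi psi' x : integ mu psi -> integ mu psi' ->
  cor u (fun z => psi z - psi' z) x = cor u psi x - cor u psi' x.
Proof.
move=> ip ip'; rewrite /cor -intB; [|exact: integ_cor|exact: integ_cor].
by apply: eq_Rintegral => y _; rewrite mulrBr.
Qed.

Lemma corZ c psi x : integ mu psi -> cor u (fun z => c * psi z) x = c * cor u psi x.
Proof.
move=> ip; rewrite /cor -intZ; last exact: integ_cor.
by apply: eq_Rintegral => y _; rewrite mulrCA.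
Qed.

Lemma cor_sum psi (I : Type) (r : seq I) (F : I -> 'rV[R]_n -> R) x : (forall i, integ mu (F i)) ->
  cor u (fun z => \sum_(i <- r) F i z) x = \sum_(i <- r) cor u (F i) x.
Proof.
move=> iF; rewrite /cor -int_sum => [|i]; last exact: integ_cor.
by apply: eq_Rintegral => y _; rewrite mulr_sumr.
Qed.

Lemma cor_shift psi x v : cor u psi (x + v) = cor u (fun z => psi (z - v)) x.
Proof. by apply: eq_Rintegral => y _; rewrite opprD addrA. Qed.

Lemma dl_cor h psi x : integ mu psi -> dl h (cor u psi) x = cor u (dl (- h) psi) x.
Proof.
move=> ip; rewrite /dl cor_shift corB//.
exact: (int_shift (- h) ip).1.
Qed.

Lemma dd_cor hs psi x : integ mu psi ->
  dd hs (cor u psi) x = cor u (dd [seq - h | h <- hs] psi) x.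
Proof.
move=> ip; elim: hs x => //= h hs IH x.
rewrite -dl_cor; first by rewrite /dl !IH.
by elim: hs {IH} => //= k hs IH; exact: integ_dl.
Qed.

(** All differences fall on [psi], where they are bounded in L1; of [u] only its bound is used. *)
Lemma nice_cor psi e : nice psi -> csupp e psi -> 0 <= e -> nice (cor u psi).
Proof.
move=> np sp e0 m; have [C C0 H] := dd_L1 np sp e0 m.
exists (M * C) => [|hs x hm]; first exact: mulr_ge0.
rewrite dd_cor; last exact: nice_integ sp e0.
have hm' : size [seq - h | h <- hs] = m by rewrite size_map.
have [i1 i2] := H _ hm'; apply: le_trans (cor_bound x i1) _.
rewrite -mulrA ler_wpM2l//; apply: le_trans i2 _.
rewrite ler_wpM2l// big_map; apply: ler_prod => h _.
by rewrite normrN ge_min lexx orbT le_min ler01 normr_ge0.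
Qed.

Lemma tay_cor psi (psi' : 'I_n -> 'rV[R]_n -> R) e : 0 <= e ->
  nice psi -> csupp e psi -> (forall i, nice (psi' i)) -> (forall i, csupp e (psi' i)) ->
  tay psi psi' -> tay (cor u psi) (fun i => cor u (fun z => - psi' i z)).
Proof.
move=> e0 np sp np' sp' [C C0 HC].
have ip := nice_integ np sp e0; have ip' i := nice_integ (np' i) (sp' i) e0.
have inp' i : integ mu (fun z => - psi' i z).
  by under eq_fun do rewrite -mulN1r; exact: integZ.
pose B := M * \int[mu]_z `|psi z|.
pose B' i := M * \int[mu]_z `|- psi' i z|.
have B0 : 0 <= B by rewrite mulr_ge0// int_ge0.
have B'0 i : 0 <= B' i by rewrite mulr_ge0// int_ge0.
have vol0 : 0 <= M * (C * (2 * (e + 1)) ^+ n).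
  by rewrite !mulr_ge0// exprn_ge0// mulr_ge0// addr_ge0.
have S0 : 0 <= 2 * B + \sum_i B' i.
  by apply: addr_ge0; [exact: mulr_ge0|exact: sumr_ge0].
exists (M * (C * (2 * (e + 1)) ^+ n) + (2 * B + \sum_i B' i)).
  exact: addr_ge0.
move=> x v.
have [v1|v1] := leP `|v| 1.
  pose D z := psi (z - v) - psi z - \sum_i v 0 i * (- psi' i z).
  have DE : cor u psi (x + v) - cor u psi x - \sum_i v 0 i * cor u (fun z => - psi' i z) x =
      cor u D x.
    rewrite cor_shift /D corB; last 2 first.
      by apply: integB => //; exact: (int_shift (- v) ip).1.
      by apply: integ_sum => i; exact: integZ.
    rewrite corB//; last exact: (int_shift (- v) ip).1.
    rewrite (cor_sum psi) => [|i]; last exact: integZ.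
    by congr (_ - _); apply: eq_bigr => i _; rewrite corZ.
  have Db z : `|D z| <= C * `|v| ^+ 2.
    have := HC z (- v); rewrite normrN; congr (_ <= _); congr `|_|.
    by rewrite /D; congr (_ - _); apply: eq_bigr => i _; rewrite mxE mulNr mulrN.
  have Ds z : e + 1 < `|z| -> D z = 0.
    move=> ez; have ez1 : e <= `|z| by apply: ltW; apply: lt_trans ez; rewrite ltrDl.
    have ez2 : e <= `|z - v|.
      rewrite -[e](addrK 1) lerBlDr; apply: le_trans (ltW ez) _.
      rewrite -{1}[z](subrK v); apply: le_trans (ler_normD _ _) _; exact: lerD.
    rewrite /D sp// sp// subrr sub0r big1 ?oppr0// => i _.
    by rewrite sp'// oppr0 mulr0.
  have mD : measurable_fun setT D.
    have iv := (int_shift (- v) ip).1.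
    have iS : integ mu (fun z => \sum_i v 0 i * (- psi' i z)).
      by apply: integ_sum => i; exact: integZ.
    exact: (integ_measurable (integB (integB iv ip) iS)).
  have e10 : 0 <= e + 1 by exact: addr_ge0.
  have [iD bD] := integ_bounded_support e10 mD Db Ds.
  rewrite DE; apply: le_trans (cor_bound x iD) _.
  apply: le_trans (ler_wpM2l M_ge0 bD) _.
  rewrite [leRHS]mulrDl -[leLHS]addr0; apply: lerD.
    by rewrite le_eqVlt; apply/orP; left; apply/eqP; ring.
  by apply: mulr_ge0 => //; exact: sqr_ge0.
(* For [|v| > 1] the remainder is not supported in a fixed cube. Each term is bounded separately,
   using that [|v|^2] dominates both 1 and [|v|]. *)
have v2 : 1 <= `|v| ^+ 2 by rewrite expr_ge1// ltW.
have v3 : `|v| <= `|v| ^+ 2 by rewrite expr2 ler_peMl// ltW.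
apply: le_trans (ler_normB _ _) _.
apply: le_trans (_ : (2 * B + \sum_i B' i) * `|v| ^+ 2 <= _); last first.
  by rewrite ler_wpM2r ?sqr_ge0// lerDr.
rewrite mulrDl; apply: lerD.
  apply: le_trans (ler_normB _ _) _.
  have := cor_bound x ip; have := cor_bound (x + v) ip; rewrite -/B => b1 b2.
  have b3 := ler_wpM2l B0 v2.
  apply: le_trans (lerD b1 b2) _; lra.
apply: le_trans (ler_norm_sum _ _ _) _; rewrite mulr_suml; apply: ler_sum => i _.
rewrite normrM mulrC; apply: ler_pM => //; first exact: cor_bound.
by apply: le_trans v3; exact: coord_le_norm.
Qed.
End correlation.

Section test_functions.
Context {R : realType} {n : nat}.
Implicit Types (x y z h v : 'rV[R]_n).
Variables (eps : R) (eps_gt0 : 0 < eps).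

Lemma bumpy_partials f (x : 'rV[R]_n) l : bumpy eps f ->
  exists2 g, bumpy eps g & partials l (fun y => f (y - x)) = fun y => g (y - x).
Proof.
elim: l f => [|i l IH] f bf /=; first by exists f.
have [g bg ->] := IH f bf; have [g' [bg' dg]] := bumpy_line bg.
exists (g' i) => //; apply/funext => y; rewrite /partial.
suff H : is_derive y (delta_mx 0 i) (fun y => g (y - x)) (g' i (y - x)) by exact: derive_val.
apply: is_derive_line; have := dg (y - x) (delta_mx 0 i) 0.
rewrite sum_delta scale0r addr0.
by rewrite (_ : (fun t => _) = fun t => g (y + t *: delta_mx 0 i - x))//; apply/funext => t; rewrite addrAC.
Qed.

Lemma bumpy_derivable f (x y : 'rV[R]_n) i : bumpy eps f ->
  derivable (fun y => f (y - x)) y (delta_mx 0 i).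
Proof.
move=> bg; have [g' [bg' dg]] := bumpy_line bg.
suff H : is_derive y (delta_mx 0 i) (fun y => f (y - x)) (g' i (y - x)) by exact: ex_derive.
apply: is_derive_line; have := dg (y - x) (delta_mx 0 i) 0.
rewrite sum_delta scale0r addr0.
by rewrite (_ : (fun t => _) = fun t => f (y + t *: delta_mx 0 i - x))//; apply/funext => t; rewrite addrAC.
Qed.

Lemma bumpy_test f x (Omega : set 'rV[R]_n) : bumpy eps f ->
  (forall y, `|y - x| <= eps -> Omega y) -> test_function Omega (fun y => f (y - x)).
Proof.
move=> bf xO.
have cl : closure [set y | f (y - x) != 0] `<=` [set y | `|y - x| <= eps].
  have -> : [set y | `|y - x| <= eps] = closure [set y | `|y - x| <= eps].
    apply/closure_id; rewrite (_ : [set y | _] = (fun y => `|y - x|) @^-1` [set t | t <= eps])//.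
    apply: closed_comp; last exact: closed_le.
    move=> y _; apply: (@lipschitz_continuous _ _ _ _ 1) => // a b.
    rewrite mul1r; apply: le_trans (ler_dist_dist _ _) _.
    by rewrite opprB addrA subrK.
  apply: closure_subset => y /= fy; rewrite leNgt; apply/negP => ey.
  by move: fy; rewrite (bumpy_support eps_gt0 bf (ltW ey)) eqxx.
split.
- move=> k l lk y _; split=> [|lk' i].
    have [g bg ->] := bumpy_partials x l bf.
    have cg := nice_continuous (bumpy_nice eps_gt0 bg).
    have := @continuous_affine R n g (- x) 1 cg y.
    by rewrite (_ : (fun z => _) = fun z => g (z - x))//; apply/funext => z; rewrite scale1r addrC.
  have [g bg ->] := bumpy_partials x l bf; exact: bumpy_derivable.
- apply: bounded_closed_compact; last exact: closed_closure.
  exists (eps + `|x|); split; first exact: num_real.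
  move=> N hN y /cl /= yx; apply: ltW; apply: le_lt_trans hN.
  rewrite -[y](subrK x); apply: le_trans (ler_normD _ _) _; exact: lerD.
- by move=> y /cl; exact: xO.
Qed.
End test_functions.

Section dominated.
Context {R : realType} {d} {T : measurableType d} (mu : {measure set T -> \bar R}).

(** Eventual equality at each point is what truncations of a kernel at radii tending to 0
    provide. *)
Lemma int_cvg (f_ : nat -> T -> R) (f g : T -> R) :
  (forall k, measurable_fun setT (f_ k)) -> measurable_fun setT f -> integ mu g ->
  (forall k x, `|f_ k x| <= g x) ->
  (forall x, exists k0 : nat, forall k, (k0 <= k)%N -> f_ k x = f x) ->
  integ mu f /\ \int[mu]_x f_ k x @[k --> \oo] --> \int[mu]_x f x.
Proof.
move=> mf_ mf ig fg ev.
have mE k : measurable_fun setT (EFin \o f_ k) by exact/measurable_EFinP.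
have mEf : measurable_fun setT (EFin \o f) by exact/measurable_EFinP.
have ae1 : {ae mu, forall x, setT x -> (EFin \o f_ k) x @[k --> \oo] --> (EFin \o f) x}.
  apply: aeW => x _; apply: cvg_near_cst; have [k0 H] := ev x.
  by exists k0 => // k /= k0k; rewrite H.
have ae2 : {ae mu, forall x k, setT x -> (`|(EFin \o f_ k) x| <= (EFin \o g) x)%E}.
  by apply: aeW => x k _; rewrite /= lee_fin.
have [If _ C] := dominated_convergence measurableT mE mEf ae1 ig ae2.
split=> //; apply: fine_cvg; rewrite fineK; first exact: C.
exact: integrable_fin_num.
Qed.

Lemma int_ae_norm_le (u g : T -> R) (M : R) : 0 <= M -> measurable_fun setT u ->
  {ae mu, forall x, `|u x| <= M} -> integ mu g ->
  \int[mu]_x `|u x * g x| <= M * \int[mu]_x `|g x|.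
Proof.
move=> M0 mu_ uM ig; have iug := (int_ae_abs_le M0 mu_ uM ig).1.
have uM' : {ae mu, forall x, `| `|u x| | <= M} by apply: filterS uM => x; rewrite normr_id.
have mu' : measurable_fun setT (fun x => `|u x|) by exact: measurableT_comp.
have [j1 j2] := int_ae_abs_le M0 mu' uM' (integ_norm ig).
under [X in _ <= _ * X]eq_Rintegral do rewrite -normr_id.
apply: le_trans j2; rewrite ger0_norm; last by apply: int_ge0 => x; rewrite mulr_ge0.
apply: int_le => [||x]; [exact: integ_norm|exact: j1|].
by rewrite normrM.
Qed.

Lemma integral_indic_mul (D : set T) (f : T -> R) :
  (\int[mu]_(x in D) (f x)%:E = \int[mu]_x (f x * \1_D x)%:E)%E.
Proof.
rewrite integral_mkcond; apply: eq_integral => x _; rewrite patchE indicE.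
by case: ifP => _; rewrite ?mulr1 ?mulr0.
Qed.
End dominated.

Section swap.
Context {R : realType} {d} {T : measurableType d} (m : {sigma_finite_measure set T -> \bar R}).

Lemma integ_swap (F : T * T -> R) : integ (m \x m)%E F ->
  integ (m \x m)%E (fun p => F (p.2, p.1)) /\ \int[(m \x m)%E]_p F (p.2, p.1) = \int[(m \x m)%E]_p F p.
Proof.
move=> iF; have mF := integ_measurable iF.
have mFs : measurable_fun setT (fun p => F (p.2, p.1)).
  apply: (measurableT_comp mF).
  by apply: measurable_fun_pair; [exact: measurable_snd|exact: measurable_fst].
have mEF : measurable_fun setT (EFin \o F) by exact/measurable_EFinP.
have mEFs : measurable_fun setT (EFin \o (fun p : T * T => F (p.2, p.1))) by exact/measurable_EFinP.
have iFs : integ (m \x m)%E (fun p => F (p.2, p.1)).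
  apply: (integrable12ltyP m m mEFs).2.
  exact: (integrable21ltyP m m mEF).1 iF.
split=> //.
have := integral12_prod_meas1 iFs; have := integral21_prod_meas1 iF.
by rewrite /fubini_F /fubini_G /Rintegral => E1 E2; rewrite -[in RHS]E1 -[in LHS]E2.
Qed.
End swap.

(** * The Gagliardo form tested with a translated bump *)

Section truncated_form.
Context {R : realType} {n : nat}.
Local Notation mu := (@leb R n).
Local Notation mm := (mu \x mu)%E.
Implicit Types (x y z : 'rV[R]_n) (k : 'rV[R]_n -> R).
Variables (u psi : 'rV[R]_n -> R) (M e : R) (x0 : 'rV[R]_n).
Hypotheses (mu_ : measurable_fun setT u) (M_ge0 : 0 <= M)
  (uM : {ae mu, forall y, `|u y| <= M}) (npsi : nice psi) (spsi : csupp e psi) (e_ge0 : 0 <= e).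
Let phi y := psi (y - x0).

Let ipsi : integ mu psi. Proof. exact: nice_integ npsi spsi e_ge0. Qed.
Let iphi : integ mu phi. Proof. exact: (int_shift (- x0) ipsi).1. Qed.
Let nphi : nice phi.
Proof.
move=> m; have [C C0 H] := npsi m; exists C => // hs x hm.
by rewrite /phi (dd_shift hs psi (- x0)); exact: H.
Qed.
Let cphi : continuous phi. Proof. exact: nice_continuous. Qed.

Lemma measurable_fst_row : measurable_fun setT (fun p : 'rV[R]_n * 'rV[R]_n => u p.1).
Proof. exact: (measurableT_comp mu_ measurable_fst). Qed.

Lemma measurable_snd_row : measurable_fun setT (fun p : 'rV[R]_n * 'rV[R]_n => u p.2).
Proof. exact: (measurableT_comp mu_ measurable_snd). Qed.

Lemma measurable_lin_row (g : 'rV[R]_n -> R) (a b : R) : continuous g ->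
  measurable_fun setT (fun p : 'rV[R]_n * 'rV[R]_n => g (a *: p.1 + b *: p.2)).
Proof.
move=> cg; apply: (@measurable_continuous_row R n _ ('rV[R]_n * 'rV[R]_n)%type (fun p => a *: p.1 + b *: p.2) g _ cg) => i.
rewrite (_ : (fun p => _) = fun p : 'rV[R]_n * 'rV[R]_n => a * p.1 0 i + b * p.2 0 i); last first.
  by apply/funext => p; rewrite !mxE.
apply: measurable_funD; apply: measurable_funM; try exact: measurable_cst.
  exact: (measurableT_comp (measurable_row_coord_leb i) measurable_fst).
exact: (measurableT_comp (measurable_row_coord_leb i) measurable_snd).
Qed.

(* The integrand is [A - B - B^swap + A^swap] with [A = u(x) phi(x) k(x-y)] and
   [B = phi(x) u(y) k(x-y)]. Substituting [y + z] in [u] itself would not be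
   measurable for the product of the completed sigma-algebras, so translations
   are only ever moved onto [phi]. *)
Lemma form_truncated k : integ mu k -> (forall z, k (- z) = k z) ->
  measurable_fun setT (fun p : 'rV[R]_n * 'rV[R]_n => k (p.1 - p.2)) ->
  let F p := (u p.1 - u p.2) * (phi p.1 - phi p.2) * k (p.1 - p.2) in
  integ mm F /\ \int[mm]_p F p = \int[mu]_z (k z * sd z (cor u psi) x0).
Proof.
move=> ik kN mk F.
have [Cp Cp0 phiC] := nice_bounded nphi.
have mphi : measurable_fun setT phi by exact: continuous_measurable_row.
have mphi1 : measurable_fun setT (fun p : 'rV[R]_n * 'rV[R]_n => phi p.1).
  exact: (measurableT_comp mphi measurable_fst).
have kE x y : k (x - y) = k (y - x) by rewrite -kN opprB.
have ikx x : integ mu (fun y => k (x - y)).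
  under eq_fun do rewrite kE; exact: (int_shift (- x) ik).1.
have ikx' x : integ mu (fun y => k (y - x)) by exact: (int_shift (- x) ik).1.
have nk x : \int[mu]_y `|k (x - y)| = \int[mu]_z `|k z|.
  rewrite -(int_shift (- x) (integ_norm ik)).2; apply: eq_Rintegral => y _.
  by rewrite kE.
have vk x : \int[mu]_y k (x - y) = \int[mu]_z k z.
  rewrite -(int_shift (- x) ik).2; apply: eq_Rintegral => y _; exact: kE.
pose A p := u p.1 * phi p.1 * k (p.1 - p.2).
have iuphi : integ mu (fun x => u x * phi x) := (int_ae_abs_le M_ge0 mu_ uM iphi).1.
have iA1 x : integ mu (fun y => A (x, y)) by exact: (integZ (u x * phi x) (ikx x)).
have iA : integ mm A.
  apply: (@integ_prod _ _ _ _ _ mu mu A (fun x => \int[mu]_z `|k z| * `|u x * phi x|) _ iA1).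
  - apply: measurable_funM mk; apply: measurable_funM mphi1; exact: measurable_fst_row.
  - by apply: integZ; exact: integ_norm.
  - move=> x; rewrite /A /=; under eq_Rintegral do rewrite normrM.
    by rewrite intZ ?nk 1?mulrC//; exact: integ_norm.
have vA : \int[mm]_p A p = \int[mu]_z k z * cor u psi x0.
  rewrite (int_prod iA1 iA).2 /cor -intZ//; apply: eq_Rintegral => x _.
  by rewrite /A /= intZ// vk mulrC.
pose B p := phi p.1 * (u p.2 * k (p.1 - p.2)).
have iB1 x : integ mu (fun y => B (x, y)).
  exact: (integZ (phi x) (int_ae_abs_le M_ge0 mu_ uM (ikx x)).1).
have iB2 y : integ mu (fun x => B (x, y)).
  exact: (integ_boundedM cphi phiC (integZ (u y) (ikx' y))).
have iB : integ mm B.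
  apply: (@integ_prod _ _ _ _ _ mu mu B (fun x => M * \int[mu]_z `|k z| * `|phi x|) _ iB1).
  - apply: measurable_funM mphi1 _; apply: measurable_funM mk; exact: measurable_snd_row.
  - by apply: integZ; exact: integ_norm.
  - move=> x; rewrite /B /=; have [i1 i2] := int_ae_abs_le M_ge0 mu_ uM (ikx x).
    under eq_Rintegral do rewrite normrM.
    rewrite intZ; last exact: integ_norm.
    rewrite mulrC ler_wpM2r// -(nk x).
    exact: (int_ae_norm_le M_ge0 mu_ uM (ikx x)).
pose H p := k p.1 * (u p.2 * phi (p.2 + p.1)).
have iH1 z : integ mu (fun y => H (z, y)).
  exact: (integZ (k z) (int_ae_abs_le M_ge0 mu_ uM (int_shift z iphi).1).1).
have iH2 y : integ mu (fun z => H (z, y)).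
  rewrite /H /=; under eq_fun do rewrite mulrCA; apply: integZ.
  under eq_fun do rewrite mulrC.
  apply: (@integ_boundedM R n (fun z => phi (y + z)) k Cp _ _ ik) => [|z]; last exact: phiC.
  rewrite (_ : (fun z => _) = fun z => phi (y + 1 *: z)); first exact: continuous_affine.
  by apply/funext => z; rewrite scale1r.
have iH : integ mm H.
  apply: (@integ_prod _ _ _ _ _ mu mu H (fun z => M * \int[mu]_z `|phi z| * `|k z|) _ iH1).
  - apply: measurable_funM.
      exact: (measurableT_comp (integ_measurable ik) measurable_fst).
    apply: measurable_funM; first exact: measurable_snd_row.
    rewrite (_ : (fun p => _) = fun p : 'rV[R]_n * 'rV[R]_n => phi (1 *: p.1 + 1 *: p.2)).
      exact: measurable_lin_row.
    by apply/funext => p; rewrite !scale1r addrC.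
  - by apply: integZ; exact: integ_norm.
  - move=> z; rewrite /H /=; have ip := (int_shift z iphi).1.
    under eq_Rintegral do rewrite normrM.
    have [i1 _] := int_ae_abs_le M_ge0 mu_ uM ip.
    rewrite intZ; last exact: integ_norm.
    rewrite mulrC ler_wpM2r// -(int_shift z (integ_norm iphi)).2.
    exact: (int_ae_norm_le M_ge0 mu_ uM ip).
have vH z : \int[mu]_y H (z, y) = k z * cor u psi (x0 - z).
  rewrite /H /= intZ; last first.
    by apply: (int_ae_abs_le M_ge0 mu_ uM _).1; exact: (int_shift z iphi).1.
  congr (_ * _); apply: eq_Rintegral => y _; congr (_ * psi _).
  by rewrite opprB addrA.
have [iW vW] := int_prod iH1 iH.
have vB : \int[mm]_p B p = \int[mu]_z (k z * cor u psi (x0 - z)).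
  rewrite (int_prod iB1 iB).2 (int_swap iB1 iB2 iB).2.
  under [RHS]eq_Rintegral do rewrite -vH.
  rewrite (int_swap iH1 iH2 iH).2; apply: eq_Rintegral => y _.
  rewrite -(int_shift y (iB2 y)).2; apply: eq_Rintegral => z _.
  by rewrite /B /H /= addrK [y + z]addrC; ring.
have iW1 : integ mu (fun z => k z * cor u psi (x0 - z)).
  by move: iW; rewrite (_ : (fun x => _) = fun z => k z * cor u psi (x0 - z))//; apply/funext.
have [iW2 vW2] := int_opp iW1.
have eW : (fun z => k (- z) * cor u psi (x0 - - z)) = fun z => k z * cor u psi (x0 + z).
  by apply/funext => z; rewrite kN opprK.
rewrite eW in iW2; have {}vW2 : \int[mu]_z (k z * cor u psi (x0 + z)) = \int[mu]_z (k z * cor u psi (x0 - z)).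
  by rewrite -vW2; apply: eq_Rintegral => z _; rewrite kN opprK.
have FE : F = fun p => (A p - B p) - (B (p.2, p.1) - A (p.2, p.1)).
  by apply/funext => -[x y]; rewrite /F /A /B /= [k (y - x)]kE; ring.
have [iAs vAs] := integ_swap iA; have [iBs vBs] := integ_swap iB.
split; first by rewrite FE; exact: (integB (integB iA iB) (integB iBs iAs)).
rewrite FE (intB (integB iA iB) (integB iBs iAs)) (intB iA iB) (intB iBs iAs) vAs vBs vA vB.
have -> : \int[mu]_z (k z * sd z (cor u psi) x0) =
   \int[mu]_z (2 * cor u psi x0 * k z - k z * cor u psi (x0 + z) - k z * cor u psi (x0 - z)).
  by apply: eq_Rintegral => z _; rewrite /sd; ring.
have i0 := integZ (2 * cor u psi x0) ik.
have e1 := intB (integB i0 iW2) iW1; have e2 := intB i0 iW2; have e3 := intZ (2 * cor u psi x0) ik.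
rewrite e1.
rewrite e2 e3 vW2.
move: (\int[mu]_z k z) (cor u psi x0) (\int[mu]_z (k z * cor u psi (x0 - z))) => X Y Z.
ring.
Qed.
End truncated_form.

Section energy_form.
Context {R : realType} {n : nat}.
Local Notation mu := (@leb R n).
Local Notation mm := (mu \x mu)%E.
Implicit Types (x y z : 'rV[R]_n).
Variables (s : R).
Hypotheses (n_gt0 : (0 < n)%N) (s01 : 0 < s < 1).
Local Notation ker := (@ker R n s).
Local Notation far := (@far R n s).
Local Notation near := (@near R n s 1).

Lemma measurable_diff_row (g : 'rV[R]_n -> R) : continuous g ->
  measurable_fun setT (fun p : 'rV[R]_n * 'rV[R]_n => g (p.1 - p.2)).
Proof.
move=> cg; rewrite (_ : (fun p => _) = fun p : 'rV[R]_n * 'rV[R]_n => g (1 *: p.1 + (-1) *: p.2)).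
  exact: measurable_lin_row.
by apply/funext => p; rewrite scale1r scaleN1r.
Qed.

Lemma measurable_ker2 : measurable_fun setT (fun p : 'rV[R]_n * 'rV[R]_n => ker (p.1 - p.2)).
Proof.
exact: (measurableT_comp (measurable_powR _) (measurable_diff_row (@continuous_eucl R n))).
Qed.

Lemma measurable_far2 r : measurable_fun setT (fun p : 'rV[R]_n * 'rV[R]_n => far r (p.1 - p.2)).
Proof.
apply: (measurableT_comp (measurable_powR _)).
apply: measurable_maxr; last exact: measurable_cst.
exact: (measurable_diff_row (@continuous_eucl R n)).
Qed.

Lemma far_near_ker0 z : near z + far 1 z = ker z \/ z = 0.
Proof. by have [->|z0] := eqVneq z 0; [right|left; apply: near_far]. Qed.

Lemma near_sqr z : near z * `|z| ^+ 2 <= near z * `|z| `^ (1 + s).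
Proof.
have [s0 s1] := andP s01.
have [z1|z1] := ltP 1 `|z|; first by rewrite near_supp// !mul0r.
rewrite ler_wpM2l ?near_ge0//.
rewrite -(powR_mulrn 2 (normr_ge0 z)).
have [->|zn0] := eqVneq `|z| 0; first by rewrite !powR0// gt_eqF// addr_gt0.
apply: ger_powR; last by lra.
by rewrite z1 andbT lt_neqAle eq_sym zn0 normr_ge0.
Qed.

(* Dominates [ker z * min (A |z|^2) B] off the origin. *)
Definition ker_majorant (A B : R) z : R := A * (near z * `|z| `^ (1 + s)) + B * far 1 z.

Lemma ker_majorant_ge0 A B z : 0 <= A -> 0 <= B -> 0 <= ker_majorant A B z.
Proof.
move=> A0 B0; apply: addr_ge0; apply: mulr_ge0 => //; last exact: far_ge0.
by apply: mulr_ge0; [exact: near_ge0|exact: powR_ge0].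
Qed.

Lemma integ_majorant A B : integ mu (ker_majorant A B).
Proof.
apply: integD; apply: integZ; first exact: integ_near.
exact: integ_far.
Qed.

(** The quadratic bound is paired with [near], whose moment is finite, and the constant bound with
    the integrable [far]. *)
Lemma majorantP A B z a : 0 <= a -> a <= A * `|z| ^+ 2 -> a <= B -> ker z * a <= ker_majorant A B z.
Proof.
move=> a0 aA aB; have [E|->] := far_near_ker0 z.
  have A0 : 0 <= near z by exact: near_ge0.
  have f0 : 0 <= far 1 z by exact: far_ge0.
  rewrite -E mulrDl; apply: lerD; last by rewrite mulrC ler_wpM2r.
  apply: le_trans (ler_wpM2l A0 aA) _; rewrite mulrCA.
  have [A1|A1] := leP 0 A; first by rewrite ler_wpM2l// near_sqr.
  have -> : near z = 0; last by rewrite !mul0r mulr0.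
  have z0 : `|z| ^+ 2 <= 0.
    by rewrite leNgt; apply/negP => z0; have := le_trans a0 aA; rewrite leNgt nmulr_rlt0 ?z0.
  have : z = 0 by apply/eqP; rewrite -normr_eq0 -sqrf_eq0 eq_le z0 sqr_ge0.
  move=> ->; rewrite /near /ker /far /eucl_norm.
  rewrite big1 ?sqrtr0 => [|i _]; last by rewrite mxE expr0n.
  rewrite powR0; last by rewrite oppr_eq0 gt_eqF// ltr_wpDl// mulr_gt0//; case/andP: s01.
  by rewrite sub0r max_l// oppr_le0 powR_ge0.
have -> : ker 0 = 0.
  rewrite /ker /eucl_norm big1 ?sqrtr0 => [|i _]; last by rewrite mxE expr0n.
  by rewrite powR0// oppr_eq0 gt_eqF// ltr_wpDl// mulr_gt0//; case/andP: s01.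
rewrite mul0r /ker_majorant normr0 powR0; last by case/andP: s01 => s0 _; rewrite gt_eqF// addr_gt0.
by rewrite mulr0 mulr0 add0r mulr_ge0 ?far_ge0//; exact: le_trans aB.
Qed.

Lemma gagliardo_integ (u : 'rV[R]_n -> R) : measurable_fun setT u ->
  (gagliardo_seminorm s u < +oo)%E ->
  integ mm (fun p => (u p.1 - u p.2) ^+ 2 * ker (p.1 - p.2)).
Proof.
move=> mu_ H.
have mF : measurable_fun setT (fun p : 'rV[R]_n * 'rV[R]_n => (u p.1 - u p.2) ^+ 2 * ker (p.1 - p.2)).
  apply: measurable_funM measurable_ker2; apply: measurable_funX.
  by apply: measurable_funB; [exact: measurable_fst_row|exact: measurable_snd_row].
apply/integrableP; split; first exact/measurable_EFinP.
rewrite ltey; apply/eqP => E; move: H; rewrite /gagliardo_seminorm.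
rewrite (_ : (\int[mm]_p _)%E = +oo%E); last first.
  rewrite -[RHS]E; apply: eq_integral => p _ /=.
  by rewrite ger0_norm ?ker_gagliardo// mulr_ge0 ?sqr_ge0 ?ker_ge0.
by rewrite poweRyr ?invr_eq0 ?pnatr_eq0// ltxx.
Qed.

Variables (u psi : 'rV[R]_n -> R) (M e : R) (x0 : 'rV[R]_n).
Hypotheses (mu_ : measurable_fun setT u) (M_ge0 : 0 <= M)
  (uM : {ae mu, forall y, `|u y| <= M}) (npsi : nice psi) (spsi : csupp e psi) (e_ge0 : 0 <= e)
  (ugag : (gagliardo_seminorm s u < +oo)%E).
Let phi y := psi (y - x0).
Let W := cor u psi.

Let nW : nice W. Proof. exact: (nice_cor mu_ M_ge0 uM npsi spsi e_ge0). Qed.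

(** Where the increment of [phi] is nonzero, one of the two points lies in the support cube.
    Integrating first over the other point gives a finite bound; [P] and its swap treat the two
    cases. *)
Lemma phi_form_integ : exists2 b : 'rV[R]_n * 'rV[R]_n -> R, integ mm b &
  forall p, (phi p.1 - phi p.2) ^+ 2 * ker (p.1 - p.2) <= b p.
Proof.
have [C C0 HC] := nice_bounded npsi; have [L L0 HL] := nice_lipschitz npsi.
pose m := ker_majorant (L ^+ 2) (4 * C ^+ 2).
have im : integ mu m := integ_majorant _ _.
have m0 z : 0 <= m z by apply: ker_majorant_ge0; rewrite ?sqr_ge0// mulr_ge0// sqr_ge0.
have mN z : m (- z) = m z by rewrite /m /ker_majorant nearN farN normrN.
pose S x : R := \1_(cube n e) (x - x0).
have iS : integ mu S by exact: (int_shift (- x0) (integ_cube e_ge0).1).1.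
have S0 x : 0 <= S x by rewrite /S indicE.
pose P p := S p.1 * m (p.1 - p.2).
have imx x : integ mu (fun y => m (x - y)).
  rewrite (_ : (fun y => _) = fun y => m (y - x)); first exact: (int_shift (- x) im).1.
  by apply/funext => y; rewrite -mN opprB.
have vm x : \int[mu]_y m (x - y) = \int[mu]_z m z.
  rewrite -(int_shift (- x) im).2; apply: eq_Rintegral => y _.
  by rewrite -mN opprB.
have iP1 x : integ mu (fun y => P (x, y)) by exact: (integZ (S x) (imx x)).
have iP : integ mm P.
  apply: (@integ_prod _ _ _ _ _ mu mu P (fun x => \int[mu]_z m z * S x) _ iP1).
  - apply: measurable_funM; first exact: (measurableT_comp (integ_measurable iS) measurable_fst).
    have mn : measurable_fun setT (fun p : 'rV[R]_n * 'rV[R]_n => near (p.1 - p.2)).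
      apply: measurable_maxr; first exact: measurable_cst.
      by apply: measurable_funB; [exact: measurable_ker2|exact: measurable_far2].
    apply: measurable_funD; apply: measurable_funM; try exact: measurable_cst.
      apply: (measurable_funM mn).
      apply: (measurableT_comp (measurable_powR _)).
      by apply: measurable_diff_row; exact: norm_continuous.
    exact: measurable_far2.
  - exact: integZ.
  - move=> x; have E : (fun y => `|P (x, y)|) = fun y => S x * m (x - y).
      by apply/funext => y; rewrite /P /= ger0_norm// mulr_ge0.
    by rewrite E (intZ _ (imx x)) vm mulrC.
have [iPs _] := integ_swap iP.
exists (fun p => P p + P (p.2, p.1)); first exact: (integD iP iPs).
move=> [x y] /=; rewrite mulrC.
have K : ker (x - y) * (phi x - phi y) ^+ 2 <= m (x - y).
  apply: majorantP; first exact: sqr_ge0.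
    rewrite -real_normK ?num_real// -exprMn lerXn2r ?nnegrE ?mulr_ge0//.
    apply: le_trans (HL _ _) _; rewrite (_ : x - x0 - (y - x0) = x - y)//.
    by rewrite opprB addrA subrK.
  rewrite -real_normK ?num_real// (_ : 4 * C ^+ 2 = (2 * C) ^+ 2); last by ring.
  rewrite lerXn2r ?nnegrE ?mulr_ge0//; apply: le_trans (ler_normB _ _) _.
  have := HC (x - x0); have := HC (y - x0); rewrite /phi; lra.
have P0 a b : 0 <= P (a, b) := mulr_ge0 (S0 a) (m0 (a - b)).
have [xS|xS] := leP `|x - x0| e.
  rewrite -[leLHS]addr0; apply: lerD => //; apply: (le_trans K).
  by rewrite /P /S /= indicE mem_set// mul1r.
have [yS|yS] := leP `|y - x0| e.
  rewrite -[leLHS]add0r; apply: lerD => //; apply: (le_trans K).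
  by rewrite /P /S /= indicE mem_set// mul1r -(mN (y - x)) opprB.
rewrite /phi (spsi (ltW xS)) (spsi (ltW yS)) subrr expr0n/= mulr0.
exact: addr_ge0.
Qed.

Lemma integ_ker_sd : (exists2 g, integ mu g & forall z, ker z * `|sd z W x0| <= g z) /\
  measurable_fun setT (fun z => sd z W x0).
Proof.
have [C C0 HC] := nice_bounded nW; have [D D0 HD] := sd_bound nW.
split; last first.
  by apply: continuous_measurable_row; apply: continuous_sd1; exact: nice_continuous.
exists (ker_majorant D (4 * C)); first exact: integ_majorant.
move=> z; apply: majorantP => //.
have h1 := HC (x0 + z); have h2 := HC (x0 - z); have h3 := HC x0.
rewrite /sd; apply: le_trans (ler_normB _ _) _; apply: le_trans (lerD (ler_normB _ _) (lexx _)) _.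
rewrite normrM ger0_norm//; lra.
Qed.

Lemma far_eventually z : exists k0 : nat, forall k, (k0 <= k)%N -> z != 0 -> far k.+1%:R^-1 z = ker z.
Proof.
have [->|z0] := eqVneq z 0; first by exists 0%N.
have ez : 0 < eucl_norm z by apply: lt_le_trans (norm_le_eucl z); rewrite normr_gt0.
exists (Num.trunc (eucl_norm z)^-1) => k kk _; apply: far_ker.
rewrite -[leRHS]invrK lef_pV2 ?posrE ?invr_gt0//.
apply: le_trans (ltW (truncnS_gt _)) _; first by rewrite ler_nat.
Qed.

(** Limit of [form_truncated] as the truncation radius tends to 0. The double integrals are
    dominated by the energies of [u] and [phi], through [|a c| <= a^2 + c^2], and the single ones by
    [ker_majorant]. *)
Lemma nonlocal_form :
  let F p := (u p.1 - u p.2) * (phi p.1 - phi p.2) * ker (p.1 - p.2) in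
  [/\ integ mm F, integ mu (fun z => ker z * sd z W x0) &
   \int[mm]_p F p = \int[mu]_z (ker z * sd z W x0)].
Proof.
move=> F; pose d k : R := k.+1%:R^-1.
have d0 k : 0 < d k by rewrite invr_gt0.
pose F_ k p := (u p.1 - u p.2) * (phi p.1 - phi p.2) * far (d k) (p.1 - p.2).
have T k : integ mm (F_ k) /\ \int[mm]_p F_ k p = \int[mu]_z (far (d k) z * sd z W x0).
  apply: (form_truncated x0 mu_ M_ge0 uM npsi spsi e_ge0).
  - exact: integ_far.
  - by move=> z; exact: farN.
  - exact: measurable_far2.
have fk k z : z != 0 -> far (d k) z <= ker z by exact: far_le_ker.
have cp : continuous phi.
  have := @continuous_affine R n psi (- x0) 1 (nice_continuous npsi).
  by rewrite (_ : (fun z => _) = phi)//; apply/funext => z; rewrite scale1r addrC.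
have mp : measurable_fun setT phi by exact: continuous_measurable_row.
have mF : measurable_fun setT F.
  apply: measurable_funM measurable_ker2; apply: measurable_funM.
    by apply: measurable_funB; [exact: measurable_fst_row|exact: measurable_snd_row].
  by apply: measurable_funB; [exact: measurable_fst_row|exact: measurable_snd_row].
have [b ib hb] := phi_form_integ.
have ig := gagliardo_integ mu_ ugag.
have [iF cF] : integ mm F /\ \int[mm]_p F_ k p @[k --> \oo] --> \int[mm]_p F p.
  apply: (int_cvg _ mF (integD ig ib)) => [k|k [x y]|[x y]].
  - exact: (integ_measurable (T k).1).
  - rewrite /F_ /=; apply: le_trans (_ : (u x - u y) ^+ 2 * ker (x - y) + (phi x - phi y) ^+ 2 * ker (x - y) <= _); last first.
      by rewrite lerD2l; exact: (hb (x, y)).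
    have [->|xy] := eqVneq x y; first by rewrite !subrr !mul0r normr0 expr0n/= mul0r addr0.
    rewrite normrM [`|far _ _|]ger0_norm ?far_ge0// -mulrDl.
    apply: ler_pM; rewrite ?far_ge0 ?fk ?subr_eq0//.
    rewrite normrM; move: (u x - u y) (phi x - phi y) => a c.
    rewrite -(real_normK (num_real a)) -(real_normK (num_real c)).
    have := sqr_ge0 (`|a| - `|c|); have := sqr_ge0 (`|a| + `|c|).
    rewrite sqrrB sqrrD; lra.
  - have [k0 hk] := far_eventually (x - y); exists k0 => k kk; rewrite /F_ /F /=.
    have [->|xy] := eqVneq x y; first by rewrite !subrr !mul0r.
    by rewrite hk// subr_eq0.
have [[g ig' hg] msd] := integ_ker_sd.
have mG k : measurable_fun setT (fun z => far (d k) z * sd z W x0).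
  by apply: measurable_funM msd; exact: measurable_far.
have mK : measurable_fun setT (fun z => ker z * sd z W x0).
  by apply: measurable_funM msd; exact: measurable_ker.
have sd0 : sd 0 W x0 = 0 by rewrite /sd subr0 addr0; ring.
have [iG cG] : integ mu (fun z => ker z * sd z W x0) /\
    \int[mu]_z (far (d k) z * sd z W x0) @[k --> \oo] --> \int[mu]_z (ker z * sd z W x0).
  apply: (int_cvg mG mK ig') => [k z|z].
  - apply: le_trans (hg z); rewrite normrM ger0_norm ?far_ge0//.
    have [->|z0] := eqVneq z 0; first by rewrite sd0 normr0 !mulr0.
    by rewrite ler_wpM2r// fk.
  - have [k0 hk] := far_eventually z; exists k0 => k kk.
    have [->|z0] := eqVneq z 0; first by rewrite sd0 !mulr0.
    by rewrite hk.
have E : (fun k => \int[mm]_p F_ k p) = fun k => \int[mu]_z (far (d k) z * sd z W x0).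
  by apply/funext => k; exact: (T k).2.
rewrite E in cF; split=> //; exact: (cvg_unique _ cF cG).
Qed.
End energy_form.

(** * From the weak formulation to a pointwise equation *)

Section weak_to_pointwise.
Context {R : realType} {n : nat}.
Local Notation mu := (@leb R n).
Local Notation mm := (mu \x mu)%E.
Implicit Types (x y z : 'rV[R]_n).

Lemma measurable_open_leb (U : set 'rV[R]_n) : open U -> measurable U.
Proof.
move=> oU.
have m1 : measurable_fun [set: 'rV[R]_n] (fun=> 0 : R) by exact: measurable_cst.
have oU2 : open ((@fst 'rV[R]_n R) @^-1` U).
  by apply: open_comp => // p _; exact: cvg_fst.
have := @measurable_preimage_open R n _ 'rV[R]_n setT id (fun=> 0) _ measurableT
   (@measurable_row_coord_leb R n) m1 oU2.
by rewrite setTI.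
Qed.

(** [psi'] is minus the gradient of [psi], because [x] enters through [y - x]. The derivatives of
    the mollification and those of the test function thus come from the same bumps. *)
Lemma bumpy_cor (eps : R) (psi u : 'rV[R]_n -> R) (M : R) : 0 < eps -> bumpy eps psi ->
  measurable_fun setT u -> 0 <= M -> {ae mu, forall y, `|u y| <= M} ->
  exists psi' : 'I_n -> 'rV[R]_n -> R, [/\ forall i, bumpy eps (psi' i),
    tay (cor u psi) (fun i => cor u (psi' i)) &
    forall x i, partial i (fun y => psi (y - x)) = fun y => - psi' i (y - x)].
Proof.
move=> e0 bp mu_ M0 uM; have [f' [bf' df]] := bumpy_line bp.
exists (fun i z => (-1) * f' i z); split=> [i||x i].
- exact: bumpyZ.
- have np := bumpy_nice e0 bp; have np' i := bumpy_nice e0 (bf' i).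
  have sp : csupp eps psi by move=> z; exact: (bumpy_support e0 bp).
  have sp' i : csupp eps (f' i) by move=> z; exact: (bumpy_support e0 (bf' i)).
  have := tay_cor mu_ M0 uM (ltW e0) np sp np' sp' (bumpy_tay e0 bf' df).
  rewrite (_ : (fun i => cor u _) = (fun i : 'I_n => cor u (fun z => -1 * f' i z)))//.
  by apply/funext => i; congr cor; apply/funext => z; rewrite mulN1r.
- apply/funext => y; rewrite mulN1r opprK /partial.
  suff H : is_derive y (delta_mx 0 i) (fun y => psi (y - x)) (f' i (y - x)) by exact: derive_val.
  apply: is_derive_line; have := df (y - x) (delta_mx 0 i) 0.
  rewrite sum_delta scale0r addr0.
  by rewrite (_ : (fun t => _) = fun t => psi (y + t *: delta_mx 0 i - x))//; apply/funext => t; rewrite addrAC.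
Qed.

Lemma integ_L2_test (D : set 'rV[R]_n) (G f : 'rV[R]_n -> R) : measurable D -> in_L2 D G ->
  measurable_fun setT f -> integ mu (fun y => f y ^+ 2) ->
  integ mu (fun y => G y * \1_D y * f y).
Proof.
move=> mD [mG iG] mf if2.
have mG' : measurable_fun setT (fun y => G y * \1_D y).
  rewrite (_ : (fun y => _) = G \_ D).
    exact: (measurable_restrictT G mD).1.
  by apply/funext => y; rewrite patchE indicE; case: ifP => _; rewrite ?mulr1 ?mulr0.
have i2 : integ mu (fun y => (G y * \1_D y) ^+ 2).
  apply/integrableP; split; first by apply/measurable_EFinP; exact: measurable_funX.
  rewrite integral_indic_mul in iG.
  rewrite (_ : (fun y => _) = fun y => (G y ^+ 2 * \1_D y)%:E); first exact: iG.
  apply/funext => y /=; rewrite ger0_norm ?sqr_ge0// exprMn indicE.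
  by case: (y \in D); rewrite ?expr1n// expr0n.
apply: (integ_le _ (integD i2 if2)) => [|y]; first exact: measurable_funM.
rewrite normrM; move: (G y * _) (f y) => a c.
rewrite -(real_normK (num_real a)) -(real_normK (num_real c)).
have := sqr_ge0 (`|a| - `|c|); have := sqr_ge0 (`|a| + `|c|).
rewrite sqrrB sqrrD; lra.
Qed.

Variables (Omega : set 'rV[R]_n) (s : R) (g : 'rV[R]_n -> R -> R) (u : 'rV[R]_n -> R) (M : R).
Hypotheses (n_gt0 : (0 < n)%N) (s01 : 0 < s < 1) (Omega_open : open Omega)
  (mu_ : measurable_fun setT u) (M_ge0 : 0 <= M) (uM : {ae mu, forall y, `|u y| <= M})
  (usol : weak_solution s Omega g u).

(* The right-hand side needs no integrability of [g y (u y)]: its integral equals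
   a finite extended real, so that [fine] loses nothing. *)
Lemma weak_to_pointwise (eps r : R) (zeta : 'rV[R]_n -> R) : 0 < eps -> 0 < r -> bumpy eps zeta ->
  let W := cor u zeta in
  exists w1 : 'I_n -> 'rV[R]_n -> R, exists w2 : 'I_n -> 'I_n -> 'rV[R]_n -> R,
  [/\ nice W /\ (forall i, nice (w1 i)), forall i j, nice (w2 i j),
    tay W w1 /\ (forall i, tay (w1 i) (w2 i)) &
    forall x, (forall y, `|y - x| <= eps -> Omega y) ->
    Lop (near s r) W x - \sum_i w2 i i x =
    cor (fun y => g y (u y) * \1_Omega y) zeta x - \int[mu]_z (far s r z * sd z W x)].
Proof.
move=> e0 r0 bz W; have mO := measurable_open_leb Omega_open.
have supp (f : 'rV[R]_n -> R) : bumpy eps f -> csupp eps f by move=> bf z; exact: (bumpy_support e0 bf).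
have [z1 [bz1 tz1 pz1]] := bumpy_cor e0 bz mu_ M_ge0 uM.
have H i := bumpy_cor e0 (bz1 i) mu_ M_ge0 uM.
have [z2 Hz2] := choice H.
have bz2 i j : bumpy eps (z2 i j) by have [] := Hz2 i.
have niceb (f : 'rV[R]_n -> R) : bumpy eps f -> nice (cor u f).
  move=> bf; exact: (nice_cor mu_ M_ge0 uM (bumpy_nice e0 bf) (supp f bf) (ltW e0)).
exists (fun i => cor u (z1 i)), (fun i j => cor u (z2 i j)); split.
- by split=> [|i]; apply: niceb.
- by move=> i j; exact: niceb.
- by split=> // i; have [] := Hz2 i.
move=> x xO.
have gag : (gagliardo_seminorm s u < +oo)%E by case: usol => -[].
have [iF iK EF] := nonlocal_form n_gt0 s01 x mu_ M_ge0 uM (bumpy_nice e0 bz) (supp _ bz) (ltW e0) gag.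
rewrite -/W in iF iK EF.
have cz1 (f : 'rV[R]_n -> R) : bumpy eps f -> continuous (fun y => f (y - x)).
  move=> bf; have := @continuous_affine R n f (- x) 1 (nice_continuous (bumpy_nice e0 bf)).
  by rewrite (_ : (fun z => _) = fun y => f (y - x))//; apply/funext => z; rewrite scale1r addrC.
have Osupp (f : 'rV[R]_n -> R) y : bumpy eps f -> f (y - x) * \1_Omega y = f (y - x).
  move=> bf; have [yx|yx] := leP `|y - x| eps.
    by rewrite indicE mem_set ?mulr1//; exact: xO.
  by rewrite (supp _ bf _ (ltW yx)) mul0r.
have ibum (f : 'rV[R]_n -> R) : bumpy eps f -> integ mu (fun y => f (y - x)).
  by move=> bf; exact: (int_shift (- x) (nice_integ (bumpy_nice e0 bf) (supp _ bf) (ltW e0))).1.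
have [_ [G [wG sol]]] := usol.
have T0 := bumpy_test e0 bz xO.
have iG i : integ mu (fun y => G i y * \1_Omega y * z1 i (y - x)).
  apply: (integ_L2_test mO (wG i).1).
    by apply: continuous_measurable_row; exact: cz1.
  have [C C0 HC] := bumpy_bounded e0 (bz1 i).
  rewrite (_ : (fun y => _) = fun y => z1 i (y - x) * z1 i (y - x)); last first.
    by apply/funext => y; rewrite expr2.
  by apply: (integ_boundedM (cz1 _ (bz1 i)) (fun y => HC (y - x)) (ibum _ (bz1 i))).
(* The weak gradient is tested once more, with a derivative of the bump as test function; the
   gradient term thereby becomes the trace of the second derivatives of [W]. *)
have vG i : \int[mu]_y (G i y * \1_Omega y * z1 i (y - x)) = cor u (z2 i i) x.
  have T1 := bumpy_test e0 (bz1 i) xO.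
  have := (wG i).2 _ T1; have [_ _ pz2] := Hz2 i; rewrite (pz2 x i) !(integral_indic_mul _ Omega).
  rewrite (_ : (fun y => (G i y * z1 i (y - x) * \1_Omega y)%:E) =
    (fun y => (G i y * \1_Omega y * z1 i (y - x))%:E)); last first.
    by apply/funext => y; rewrite mulrAC.
  rewrite -(EFin_int (iG i)).
  have iu := integ_cor mu_ M_ge0 uM x (nice_integ (bumpy_nice e0 (bz2 i i)) (supp _ (bz2 i i)) (ltW e0)).
  rewrite (_ : (fun y => (u y * - z2 i i (y - x) * \1_Omega y)%:E) =
    (fun y => (-1 * (u y * z2 i i (y - x)))%:E)); last first.
    by apply/funext => y; rewrite mulN1r mulrN mulNr -mulrA (Osupp _ y (bz2 i i)).
  rewrite -(EFin_int (integZ (-1) iu)) intZ//.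
  by rewrite mulN1r => -[]; rewrite /cor => E; apply: oppr_inj.
have := sol _ T0.
have iS : integ mu (fun y => \sum_i -1 * (G i y * \1_Omega y * z1 i (y - x))).
  by apply: integ_sum => i; exact: integZ.
have -> : (\int[mu]_(y in Omega) (\sum_(i < n) G i y * partial i (fun y => zeta (y - x)) y)%:E =
    (- \sum_i cor u (z2 i i) x)%:E)%E.
  rewrite integral_indic_mul.
  rewrite (_ : (fun y => _) = fun y => (\sum_i -1 * (G i y * \1_Omega y * z1 i (y - x)))%:E); last first.
    apply/funext => y; congr EFin; rewrite mulr_suml; apply: eq_bigr => i _.
    by rewrite (pz1 x i); ring.
  rewrite -(EFin_int iS) int_sum => [|i]; last exact: integZ.
  congr EFin; rewrite -sumrN; apply: eq_bigr => i _.
  by rewrite intZ// vG mulN1r.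
have -> : (\int[mm]_p ((u p.1 - u p.2) * (zeta (p.1 - x) - zeta (p.2 - x)) *
     gagliardo_kernel s p.1 p.2)%:E = (\int[mu]_z (ker s z * sd z W x))%:E)%E.
  rewrite -EF (EFin_int iF); apply: eq_integral => p _.
  by rewrite ker_gagliardo.
rewrite integral_indic_mul.
rewrite (_ : (fun y => _) = fun y => (g y (u y) * \1_Omega y * zeta (y - x))%:E); last first.
  by apply/funext => y; rewrite mulrAC.
rewrite -EFinD => Eg.
have Ec : cor (fun y => g y (u y) * \1_Omega y) zeta x =
    - \sum_i cor u (z2 i i) x + \int[mu]_z (ker s z * sd z W x).
  by rewrite /cor /Rintegral -Eg.
have [[gg ig hg] msd] := integ_ker_sd n_gt0 s01 x mu_ M_ge0 uM (bumpy_nice e0 bz) (supp _ bz) (ltW e0).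
have sd0 : sd 0 W x = 0 by rewrite /sd subr0 addr0; ring.
have ifar : integ mu (fun z => far s r z * sd z W x).
  apply: (integ_le _ ig) => [|z].
    by apply: measurable_funM msd; exact: measurable_far.
  apply: le_trans (hg z); rewrite normrM ger0_norm ?far_ge0//.
  have [->|z0] := eqVneq z 0; first by rewrite sd0 normr0 !mulr0.
  by rewrite ler_wpM2r// far_le_ker.
have inear : integ mu (fun z => near s r z * sd z W x).
  rewrite (_ : (fun z => _) = fun z => ker s z * sd z W x - far s r z * sd z W x).
    exact: integB.
  apply/funext => z; have [->|z0] := eqVneq z 0; first by rewrite sd0 !mulr0 subr0.
  by rewrite -mulrBl -(near_far r s01 z0) addrK.
have Ek : \int[mu]_z (ker s z * sd z W x) = Lop (near s r) W x + \int[mu]_z (far s r z * sd z W x).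
  rewrite /Lop -intD//; apply: eq_Rintegral => z _.
  have [->|z0] := eqVneq z 0; first by rewrite sd0 !mulr0 addr0.
  by rewrite -mulrDl near_far.
rewrite Ec Ek; move: (Lop _ _ _) (\sum_i _) (\int[mu]_z _) => a b c; ring.
Qed.
End weak_to_pointwise.

(** * Interior estimates for the mollified solution *)

Section profile.
Context {R : realType} {n : nat}.
Local Notation mu := (@leb R n).
Implicit Types (z : 'rV[R]_n).

Lemma int_gt0_cube (f : 'rV[R]_n -> R) (c r : R) : 0 < c -> 0 < r -> integ mu f ->
  (forall z, 0 <= f z) -> (forall z, `|z| <= r -> c <= f z) -> c * (2 * r) ^+ n <= \int[mu]_z f z.
Proof.
move=> c0 r0 iF f0 fc; have [i1 v1] := @integ_cube R n r (ltW r0).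
rewrite -v1 -intZ//; apply: int_le => // [|z]; first exact: integZ.
rewrite indicE; have [/set_mem zr|_] := boolP (z \in cube n r); last by rewrite mulr0.
by rewrite mulr1 fc.
Qed.

Lemma qform_ge (eps : R) z : 0 < eps -> `|z| <= eps / (2 * n%:R) -> (0 < n)%N -> 3 / 4 <= qform eps z.
Proof.
move=> e0 ze n0; have n1 : 1 <= n%:R :> R by rewrite ler1n.
have n0' : 0 < n%:R :> R by rewrite ltr0n.
have H : \sum_i z 0 i ^+ 2 <= eps ^+ 2 / 4.
  apply: le_trans (_ : n%:R * (eps / (2 * n%:R)) ^+ 2 <= _).
    rewrite -[n in n%:R * _]card_ord mulr_natl -sumr_const; apply: ler_sum => i _.
    rewrite -real_normK ?num_real// lerXn2r ?nnegrE// ?(le_trans (coord_le_norm z i))//.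
    by rewrite divr_ge0 ?mulr_ge0// ltW.
  have -> : n%:R * (eps / (2 * n%:R)) ^+ 2 = eps ^+ 2 / 4 / n%:R by field; rewrite gt_eqF.
  by rewrite ler_pdivrMr// ler_peMr// divr_ge0// sqr_ge0.
rewrite /qform; have e2 : 0 < eps ^+ 2 by rewrite exprn_gt0.
have : eps ^- 2 * (\sum_i z 0 i ^+ 2) <= 1 / 4.
  by rewrite mulrC ler_pdivrMr//; apply: (le_trans H); lra.
lra.
Qed.

Lemma qform_le1 (eps : R) z : qform eps z <= 1.
Proof.
rewrite /qform gerBl mulr_ge0 //; first by rewrite invr_ge0 sqr_ge0.
by apply: sumr_ge0 => i _; exact: sqr_ge0.
Qed.
End profile.

Lemma far_increment_small {R : realDomainType} (a b c t : R) : 0 <= c -> 0 <= b -> 0 <= t -> a * t * c <= (a + b) * c * t.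
Proof. by move=> c0 b0 t0; rewrite mulrAC ler_wpM2r// ler_wpM2r// lerDl. Qed.

Lemma far_increment_large {R : realDomainType} (a b c t : R) : 0 <= a -> 0 <= c -> 0 <= t -> 2 <= b * t ->
  2 * c <= (a + b) * c * t.
Proof.
move=> a0 c0 t0 h2; rewrite [leRHS]mulrAC ler_wpM2r//; apply: (le_trans h2).
by rewrite ler_wpM2r// lerDr.
Qed.

Lemma far_increment_assembly {R : realDomainType} (P P' W W' c B M t : R) : 0 <= c -> `|P - P'| <= M * (B * c * t) ->
  `|2 * (c * W - P) - 2 * (c * W' - P')| <= 2 * c * `|W - W'| + 2 * B * c * M * t.
Proof.
move=> c0 Q'; have -> : 2 * (c * W - P) - 2 * (c * W' - P') = 2 * c * (W - W') - 2 * (P - P') by ring.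
apply: le_trans (ler_normB _ _) _; apply: lerD.
  by rewrite normrM ger0_norm// mulr_ge0.
rewrite normrM ger0_norm//; have := ler_wpM2l (ler0n R 2) Q'.
by move/le_trans; apply; rewrite le_eqVlt; apply/orP; left; apply/eqP; ring.
Qed.

Lemma far_threshold {R : realFieldType} (m r t : R) : 0 < r -> r / 2 < m * t -> 2 <= 4 * m / r * t.
Proof.
move=> r0 h; have -> : 4 * m / r * t = 4 * (m * t) / r by ring.
by rewrite ler_pdivlMr//; lra.
Qed.

(** * The far part of the nonlocal operator *)

Section far_operator.
Context {R : realType} {n : nat}.
Local Notation mu := (@leb R n).
Implicit Types (w f : 'rV[R]_n -> R) (x y z h : 'rV[R]_n).
Variables (s r : R).
Hypotheses (s01 : 0 < s < 1) (r_gt0 : 0 < r).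
Local Notation far := (@far R n s r).
Let cf := \int[mu]_z far z.

Definition Far w x : R := \int[mu]_z (far z * sd z w x).

Let ifar : integ mu far. Proof. exact: integ_far. Qed.
Let cf0 : 0 <= cf. Proof. by apply: int_ge0 => z; exact: far_ge0. Qed.

Lemma integ_far_bounded w M : continuous w -> (forall y, `|w y| <= M) ->
  integ mu (fun z => far z * w z).
Proof.
move=> cw wM; under eq_fun do rewrite mulrC; exact: (integ_boundedM cw wM ifar).
Qed.

Lemma FarE w M x : continuous w -> (forall y, `|w y| <= M) ->
  Far w x = 2 * (cf * w x - \int[mu]_z (far z * w (x + z))).
Proof.
move=> cw wM.
have c1 : continuous (fun z => w (x + z)).
  have := @continuous_affine R n w x 1 cw.
  by rewrite (_ : (fun z => _) = fun z => w (x + z))//; apply/funext => z; rewrite scale1r.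
have i1 := integ_far_bounded c1 (fun z => wM (x + z)).
have [i2 v2] := int_opp i1.
have e2 : (fun z => far (- z) * w (x + - z)) = fun z => far z * w (x - z).
  by apply/funext => z; rewrite farN.
rewrite e2 in i2; have {}v2 : \int[mu]_z (far z * w (x - z)) = \int[mu]_z (far z * w (x + z)).
  by rewrite -v2; apply: eq_Rintegral => z _; rewrite farN.
have -> : Far w x = \int[mu]_z (2 * w x * far z - far z * w (x + z) - far z * w (x - z)).
  by apply: eq_Rintegral => z _; rewrite /sd; ring.
have i0 := integZ (2 * w x) ifar.
have e1 := intB (integB i0 i1) i2; have e3 := intB i0 i1; have e4 := intZ (2 * w x) ifar.
rewrite e1 e3 e4 v2 -/cf; move: (\int[mu]_z _) (w x) cf => P W c; ring.
Qed.

Lemma Far_bound w M x : continuous w -> (forall y, `|w y| <= M) -> `|Far w x| <= 4 * M * cf.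
Proof.
move=> cw wM; have M0 : 0 <= M by exact: le_trans (wM x).
rewrite (FarE x cw wM) normrM ger0_norm//.
have c1 : continuous (fun z => w (x + z)).
  have := @continuous_affine R n w x 1 cw.
  by rewrite (_ : (fun z => _) = fun z => w (x + z))//; apply/funext => z; rewrite scale1r.
have i1 := integ_far_bounded c1 (fun z => wM (x + z)).
have P : `|\int[mu]_z (far z * w (x + z))| <= M * cf.
  rewrite -(intZ M ifar); apply: (int_abs_le (integZ M ifar) i1) => z.
  by rewrite normrM [`|far z|]ger0_norm ?far_ge0// mulrC ler_wpM2r ?far_ge0.
have Q : `|cf * w x| <= M * cf by rewrite normrM [`|cf|]ger0_norm// mulrC ler_wpM2r.
have := le_trans (ler_normB _ _) (lerD Q P); lra.
Qed.

(** In the convolution term a translation moves the increment from [w] to the kernel. Small steps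
    use [far_lipschitz]; for large ones the total mass of the kernel is at most a multiple of
    [|h|]. *)
Lemma dl_Far : exists2 C : R, 0 <= C & forall w M x h, continuous w -> (forall y, `|w y| <= M) ->
  `|dl h (Far w) x| <= 2 * cf * `|dl h w x| + C * M * `|h|.
Proof.
have [C0 C00 HC] := @far_lipschitz R n s r s01 r_gt0.
pose C := 2 * (C0 + 4 * n%:R / r) * cf.
have nr0 : 0 <= 4 * n%:R / r by rewrite divr_ge0 ?mulr_ge0// ltW.
have C'0 : 0 <= (C0 + 4 * n%:R / r) * cf by rewrite mulr_ge0// addr_ge0.
exists C => [|w M x h cw wM]; first by rewrite /C -mulrA mulr_ge0.
have M0 : 0 <= M by exact: le_trans (wM x).
have ct y : continuous (fun z => w (y + z)).
  have := @continuous_affine R n w y 1 cw.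
  by rewrite (_ : (fun z => _) = fun z => w (y + z))//; apply/funext => z; rewrite scale1r.
have iP y := integ_far_bounded (ct y) (fun z => wM (y + z)).
have ifh : integ mu (fun z => far (z - h)) by exact: (int_shift (- h) ifar).1.
have vfh : \int[mu]_z far (z - h) = cf by exact: (int_shift (- h) ifar).2.
have i2 : integ mu (fun z => far (z - h) * w (x + z)).
  under eq_fun do rewrite mulrC; exact: (integ_boundedM (ct x) (fun z => wM (x + z)) ifh).
have E : \int[mu]_z (far z * w (x + h + z)) = \int[mu]_z (far (z - h) * w (x + z)).
  rewrite -(int_shift h i2).2; apply: eq_Rintegral => z _.
  by rewrite addrK addrAC addrA.
have idf : integ mu (fun z => far (z - h) - far z) by exact: integB.
have D : \int[mu]_z `|far (z - h) - far z| <= (C0 + 4 * n%:R / r) * cf * `|h|.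
  have [hr|hr] := leP (n%:R * `|- h|) (r / 2).
    apply: le_trans (far_increment_small C0 cf0 nr0 (normr_ge0 h)).
    rewrite -(intZ (C0 * `|h|) ifar); apply: (int_le (integ_norm idf) (integZ _ ifar)) => z.
    by have := HC z (- h) hr; rewrite normrN.
  apply: le_trans (_ : 2 * cf <= _).
    have e := intD ifh ifar; rewrite vfh -/cf in e.
    rewrite mulr_natl mulr2n -e; apply: (int_le (integ_norm idf) (integD ifh ifar)) => z.
    by apply: le_trans (ler_normB _ _) _; rewrite !ger0_norm ?far_ge0.
  rewrite normrN in hr.
  have h2 := far_threshold r_gt0 hr.
  exact: (far_increment_large C00 cf0 (normr_ge0 h) h2).
have Q : `|\int[mu]_z (far z * w (x + h + z)) - \int[mu]_z (far z * w (x + z))| <=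
    M * ((C0 + 4 * n%:R / r) * cf * `|h|).
  rewrite E -(intB i2 (iP x)); apply: le_trans (ler_wpM2l M0 D).
  rewrite -(intZ M (integ_norm idf)).
  apply: (int_abs_le (integZ M (integ_norm idf)) (integB i2 (iP x))) => z.
  by rewrite -mulrBl normrM mulrC ler_wpM2r.
rewrite {1}/dl (FarE (x + h) cw wM) (FarE x cw wM) /dl.
exact: (far_increment_assembly _ _ cf0 Q).
Qed.
End far_operator.

(** * The Lipschitz stage and the Hölder stage *)

Section stages.
Context {R : realType} {n : nat}.
Local Notation mu := (@leb R n).
Implicit Types (w f lap : 'rV[R]_n -> R) (x y z h : 'rV[R]_n) (hs : seq 'rV[R]_n).
Local Notation e_ i := (delta_mx 0 i : 'rV[R]_n).
Variable s : R.
Hypotheses (n_gt0 : (0 < n)%N) (s01 : 0 < s < 1).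

Lemma int_flat_gt0 : 0 < \int[mu]_z (2 * flat 2 (qform 1 z)).
Proof.
have be : bumpy 1 (fun z : 'rV[R]_n => 2 * flat 2 (qform 1 z)) by apply: bumpyZ; exact: bumpy_flat.
have ie : integ mu (fun z => 2 * flat 2 (qform 1 z)).
  apply: (nice_integ (bumpy_nice ltr01 be) _ ler01) => z; exact: (bumpy_support ltr01 be).
have n0 : 0 < n%:R :> R by rewrite ltr0n.
pose c : R := 2 * expR (- (3 / 4)^-1).
have c0 : 0 < c by rewrite mulr_gt0 ?expR_gt0.
pose r : R := 1 / (2 * n%:R).
have r0 : 0 < r by rewrite divr_gt0// mulr_gt0.
apply: lt_le_trans (int_gt0_cube c0 r0 ie _ _) => [|z|z zr].
- by rewrite mulr_gt0// exprn_gt0// mulr_gt0.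
- by rewrite mulr_ge0// flat_ge0.
- have q1 := qform_ge ltr01 zr n_gt0; have q2 := qform_le1 1 z.
  have q0 : 0 < qform 1 z by lra.
  rewrite /c ler_pM2l// /flat q0 -[leLHS]mul1r.
  apply: ler_pM; rewrite ?expR_ge0//.
    by rewrite invf_ge1 ?exprn_gt0// exprn_ile1// ltW.
  by rewrite ler_expR lerN2 lef_pV2// posrE; lra.
Qed.

(** The order of quantifiers matters: [K] depends on [s] alone, so that [r] can later be taken small
    compared with [rho0 / K]. *)
Lemma schauder_near : exists K : nat, forall r, 0 < r <= 1 ->
  forall (a gamma : R) (m0 : nat), 0 <= a <= 1 -> 0 <= gamma <= 2 + a -> gamma < m0%:R -> (m0 <= 3)%N ->
  exists2 tau0 : R, 0 < tau0 <= r &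
  exists2 C : R, 0 <= C & forall w lap x0 (rho M N : R), laplacian w lap ->
    0 <= N -> (forall y, `|w y| <= M) ->
    (forall y h tau, `|y - x0| <= rho -> `|h| <= tau -> 0 < tau <= tau0 ->
       `|dl h (fun y => Lop (near s r) w y - lap y) y| <= N * tau `^ a) ->
    forall x hs tau, `|x - x0| <= rho - 9 * r * K%:R - r -> size hs = m0 ->
      (forall h, h \in hs -> `|h| <= tau) -> 0 < tau <= tau0 ->
      `|dd hs w x| <= C * (M + N) * tau `^ gamma.
Proof.
have [s0 s1] := andP s01.
pose q := (1 - s) / 2; pose p := 1 + s.
have q01 : 0 < q < 1 by rewrite /q; apply/andP; split; lra.
have pE : p = 2 - 2 * q by rewrite /p /q; field.
have [q0 _] := andP q01.
exists (Num.trunc (3 / q)).+1 => r r01 a gamma m0 a01 ga gm m3; have [r0 r1] := andP r01.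
set K := (Num.trunc (3 / q)).+1.
have Kq : 3 <= K%:R * q.
  by rewrite -ler_pdivrMr//; apply: ltW; exact: truncnS_gt.
have bt : bumpy 1 (fun z : 'rV[R]_n => flat 0 (qform 1 z)) by exact: bumpy_flat.
(* The gradient of [theta = exp(-1 / (1 - |z|^2))], in the Euclidean norm, is
   [- 2 z flat 2 (1 - |z|^2)], that is, [- z eta]. *)
pose eta (z : 'rV[R]_n) : R := 2 * flat 2 (qform 1 z).
have be : bumpy 1 eta by apply: bumpyZ; exact: bumpy_flat.
have bp i : bumpy 1 (fun z => - (z 0 i * eta z)).
  have := bumpyZ (-1) (bumpy_coord i be); congr bumpy.
  by apply/funext => z; rewrite mulN1r.
have tayt : tay (fun z : 'rV[R]_n => flat 0 (qform 1 z)) (fun i z => - (z 0 i * eta z)).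
  have E : (fun i z => - (z 0 i * eta z)) = flat_partial 1 0.
    apply/funext => i; apply/funext => z; rewrite /flat_partial /eta expr1n invr1.
    by rewrite oppr0 mul0r addr0; ring.
  rewrite E; apply: (bumpy_tay ltr01) => [i|x v t]; first exact: bumpy_flat_partial.
  exact: is_derive_flat_line.
have m0K : (m0 <= 3 * K + 1)%N.
  by apply: (leq_trans m3); rewrite /K mulnS addnAC leq_addr.
exact: (@schauder_differences R n (near s r) p q r (@measurable_near R n s r)
  (@near_ge0 R n s r) (fun z => @near_supp R n s r z) r01 q01 pE (integ_near n_gt0 s01 r0)
  _ eta (bumpy_nice ltr01 bt) (bumpy_nice ltr01 be) (fun z => bumpy_support ltr01 bt)
  (fun z => bumpy_support ltr01 be) (fun i => bumpy_nice ltr01 (bp i)) tayt int_flat_gt0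
  a gamma K m0 a01 Kq ga gm m0K).
Qed.

Lemma Far_estimates r : 0 < r -> exists2 C : R, 0 <= C & forall w M x, continuous w ->
  (forall y, `|w y| <= M) -> `|Far s r w x| <= C * M /\
  forall h, `|dl h (Far s r w) x| <= C * (`|dl h w x| + M * `|h|).
Proof.
move=> r0; have [C C0 HC] := @dl_Far R n s r s01 r0.
have c0 : 0 <= \int[mu]_z far s r z by apply: int_ge0 => z; exact: far_ge0.
have HB := @Far_bound R n s r s01 r0.
move: (\int[mu]_z far s r z) c0 HB HC => c c0 HB HC.
exists (4 * c + C) => [|w M x cw wM]; first by rewrite addr_ge0// mulr_ge0.
have M0 : 0 <= M by exact: le_trans (wM x).
have CM := mulr_ge0 C0 M0.
split=> [|h]; first by apply: le_trans (HB w M x cw wM) _; lra.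
apply: le_trans (HC w M x h cw wM) _.
have d0 := normr_ge0 (dl h w x); have h0 := normr_ge0 h.
have p1 := mulr_ge0 c0 d0; have p2 := mulr_ge0 C0 d0.
have p3 := mulr_ge0 c0 (mulr_ge0 M0 h0); lra.
Qed.

Variables (rho0 : R) (rho0_gt0 : 0 < rho0).

Definition eqn_near r w (w2 : 'I_n -> 'I_n -> 'rV[R]_n -> R) f x0 :=
  forall x, `|x - x0| <= 2 * rho0 ->
    Lop (near s r) w x - \sum_i w2 i i x = f x - Far s r w x.

Definition smooth_jet w (w1 : 'I_n -> 'rV[R]_n -> R) (w2 : 'I_n -> 'I_n -> 'rV[R]_n -> R) :=
  [/\ nice w /\ (forall i, nice (w1 i)), forall i j, nice (w2 i j) &
    tay w w1 /\ (forall i, tay (w1 i) (w2 i))].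

Lemma smooth_laplacian w (w1 : 'I_n -> 'rV[R]_n -> R) (w2 : 'I_n -> 'I_n -> 'rV[R]_n -> R) : smooth_jet w w1 w2 -> laplacian w (fun y => \sum_i w2 i i y).
Proof. by move=> [H1 H2 H3]; exists w1, w2; split. Qed.

Lemma near_step r x0 y h : `|y - x0| <= rho0 -> `|h| <= r -> r <= rho0 ->
  `|y + h - x0| <= 2 * rho0 /\ `|y - x0| <= 2 * rho0.
Proof.
move=> yx hr rr; have rp := rho0_gt0; rewrite addrAC; split; last by lra.
by apply: le_trans (ler_normD _ _) _; lra.
Qed.

(** With [a = 0], differences of the right-hand side are bounded by twice its supremum. The exponent
    [3/2] must lie below the order 2 for the Marchaud descent and above 1 for
    [lipschitz_from_second]. *)
Lemma stage_lipschitz : exists2 r1 : R, 0 < r1 <= 1 & forall r, 0 < r <= r1 ->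
  exists2 C : R, 0 <= C & forall w (w1 : 'I_n -> 'rV[R]_n -> R) (w2 : 'I_n -> 'I_n -> 'rV[R]_n -> R) f x0 (M S : R), smooth_jet w w1 w2 -> eqn_near r w w2 f x0 ->
    (forall y, `|w y| <= M) -> 0 <= S ->
    (forall x, `|x - x0| <= 2 * rho0 -> `|f x| <= S) ->
    forall h, `|dl h w x0| <= C * (M + S) * `|h|.
Proof.
have rp := rho0_gt0; have [K HK] := schauder_near.
(* [r * (9 * K + 1) <= rho0] lets the estimate reach the centre [x0]. *)
pose r1 := Num.min 1 (Num.min rho0 (rho0 / (9 * K%:R + 1))).
have K1 : 0 < 9 * K%:R + 1 :> R by rewrite ltr_wpDl// mulr_ge0.
have r10 : 0 < r1 by rewrite !lt_min ltr01 rho0_gt0 divr_gt0.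
exists r1; first by rewrite r10 ge_min lexx.
move=> r /andP[r0 rr1].
have [rl1 rl2 rl3] : [/\ r <= 1, r <= rho0 & r <= rho0 / (9 * K%:R + 1)].
  by move: rr1; rewrite !le_min => /andP[? /andP[? ?]].
have r01 : 0 < r <= 1 by rewrite r0.
have ga : 0 <= (3 / 2 : R) <= 2 + 0 by lra.
have gm : (3 / 2 : R) < 2%:R by lra.
have a01 : 0 <= (0 : R) <= 1 by rewrite lexx ler01.
have [t0 /andP[t00 t0r] [C C0 HC]] := HK r r01 0 (3 / 2) 2 a01 ga gm isT.
have [D D0 HD] := Far_estimates r0.
have t01 : 0 < t0 <= 1 by rewrite t00 (le_trans t0r).
have [L L0 HL] := @lipschitz_from_second R n t0 t01.
exists (L * (C * (1 + 2 * D + 2) + 1) + 2 / t0).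
  have p1 : 0 <= C * (1 + 2 * D + 2) by rewrite mulr_ge0// !addr_ge0// mulr_ge0.
  by rewrite addr_ge0 ?mulr_ge0 ?addr_ge0// ?invr_ge0 ltW.
move=> w w1 w2 f x0 M S sw eqw wM S0 fS h.
have M0 : 0 <= M by exact: le_trans (wM x0).
have cw : continuous w by case: sw => -[/nice_continuous].
have [->|hn0] := eqVneq h 0; first by rewrite /dl addr0 subrr !normr0 mulr0.
have h0 : 0 < `|h| by rewrite normr_gt0.
have [ht|ht] := leP `|h| t0; last first.
  apply: le_trans (bounded_dd [:: h] wM x0) _; rewrite /= expr1.
  apply: le_trans (_ : 2 / t0 * (M + S) * `|h| <= _); last first.
    by rewrite ler_wpM2r// ler_wpM2r ?addr_ge0// lerDr mulr_ge0// addr_ge0// mulr_ge0// !addr_ge0// mulr_ge0.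
  have -> : 2 / t0 * (M + S) * `|h| = 2 * (M + S) * (`|h| / t0) by ring.
  have q1 : 1 <= `|h| / t0 by rewrite ler_pdivlMr// mul1r ltW.
  apply: le_trans (_ : 2 * (M + S) <= _); first by lra.
  by rewrite ler_peMr// mulr_ge0// addr_ge0.
pose N := 2 * (S + D * M).
have N0 : 0 <= N by rewrite mulr_ge0// addr_ge0// mulr_ge0.
have Hdl y k tau : `|y - x0| <= rho0 -> `|k| <= tau -> 0 < tau <= t0 ->
    `|dl k (fun y => Lop (near s r) w y - \sum_i w2 i i y) y| <= N * tau `^ 0.
  move=> yx kt /andP[tau0 taut]; rewrite powRr0 mulr1 /dl.
  have [i1 i2] := near_step yx (le_trans kt (le_trans taut t0r)) rl2.
  rewrite (eqw _ i1) (eqw _ i2).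
  have b1 := fS _ i1; have b2 := fS _ i2.
  have [b3 _] := HD w M (y + k) cw wM; have [b4 _] := HD w M y cw wM.
  have b5 := ler_normB (f (y + k)) (Far s r w (y + k)).
  have b6 := ler_normB (f y) (Far s r w y).
  apply: le_trans (ler_normB _ _) _; apply: le_trans (lerD b5 b6) _.
  rewrite /N; apply: le_trans (lerD (lerD b1 b3) (lerD b2 b4)) _; lra.
have HS := HC w _ x0 rho0 M N (smooth_laplacian sw) N0 wM Hdl.
have xx : `|x0 - x0| <= rho0 - 9 * r * K%:R - r.
  rewrite subrr normr0; have : r * (9 * K%:R + 1) <= rho0 by rewrite -ler_pdivlMr.
  lra.
pose A := C * (M + N).
have A0 : 0 <= A by rewrite mulr_ge0// addr_ge0.
have HA k tau : `|k| <= tau -> 0 < tau <= t0 -> `|dd [:: k; k] w x0| <= A * tau `^ (3 / 2).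
  by move=> kt tt; apply: HS => // k'; rewrite !inE => /orP[] /eqP->.
have hh : 0 < `|h| <= t0 by rewrite h0.
apply: le_trans (HL w x0 A M A0 wM HA h `|h| (lexx _) hh) _.
rewrite ler_wpM2r//; apply: le_trans (_ : L * (C * (1 + 2 * D + 2) + 1) * (M + S) <= _); last first.
  by rewrite ler_wpM2r ?addr_ge0// lerDl divr_ge0// ltW.
rewrite -mulrA ler_wpM2l// mulrDl mul1r; apply: lerD; last by rewrite lerDl.
rewrite /A -mulrA ler_wpM2l// /N.
have := mulr_ge0 D0 S0; lra.
Qed.

(** As [w] is Lipschitz, so is [Far s r w]; at scales below 1 it is then Hölder and joins [f] on the
    right-hand side. Third differences are used because [2 < 2 + a < 3]. *)
Lemma stage_jets (a : R) : 0 < a < 1 -> exists2 r1 : R, 0 < r1 <= 1 & forall r, 0 < r <= r1 ->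
  exists2 t1 : R, 0 < t1 <= 1 &
  exists2 C : R, 0 <= C & forall w (w1 : 'I_n -> 'rV[R]_n -> R) (w2 : 'I_n -> 'I_n -> 'rV[R]_n -> R) f x0 (M N : R), smooth_jet w w1 w2 -> eqn_near r w w2 f x0 ->
    (forall y, `|w y| <= M) -> 0 <= N ->
    (forall x h, `|x - x0| <= rho0 -> `|h| <= rho0 -> `|dl h f x| <= N * `|h| `^ a) ->
    (forall x h, `|x - x0| <= rho0 -> `|dl h w x| <= N * `|h|) ->
  let B := C * (N + M) in
  [/\ forall i, `|w1 i x0| <= B, forall j i, `|w2 j i x0| <= B,
      forall y, `|y - x0| <= t1 -> [/\ `|w y - w x0| <= B * `|y - x0| `^ a,
        forall j, `|w1 j y - w1 j x0| <= B * `|y - x0| `^ a &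
        forall j i, `|w2 j i y - w2 j i x0| <= B * `|y - x0| `^ a] &
      forall (t : R) i, `|t| <= t1 ->
        `|w (x0 + t *: e_ i) - w x0 - t * w1 i x0| <= B * `|t| `^ (1 + a) /\
        forall j, `|w1 j (x0 + t *: e_ i) - w1 j x0 - t * w2 j i x0| <= B * `|t| `^ (1 + a)].
Proof.
move=> a01; have [a0 a1] := andP a01.
have rp := rho0_gt0; have [K HK] := schauder_near.
(* Twice the denominator of the Lipschitz stage: half of [rho0] remains for the ball of radius
   [4 * t1] required by [jet_estimates]. *)
pose r1 := Num.min 1 (Num.min rho0 (rho0 / (18 * K%:R + 2))).
have K1 : 0 < 18 * K%:R + 2 :> R by rewrite ltr_wpDl// mulr_ge0.
have r10 : 0 < r1 by rewrite !lt_min ltr01 rho0_gt0 divr_gt0.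
exists r1; first by rewrite r10 ge_min lexx.
move=> r /andP[r0 rr1].
have [rl1 rl2 rl3] : [/\ r <= 1, r <= rho0 & r <= rho0 / (18 * K%:R + 2)].
  by move: rr1; rewrite !le_min => /andP[? /andP[? ?]].
have r01 : 0 < r <= 1 by rewrite r0.
have ga : 0 <= 2 + a <= 2 + a by rewrite lexx andbT; lra.
have gm : 2 + a < 3%:R by lra.
have a01' : 0 <= a <= 1 by lra.
have [t0 /andP[t00 t0r] [C C0 HC]] := HK r r01 a (2 + a) 3 a01' ga gm isT.
have [D D0 HD] := Far_estimates r0.
pose t1 := Num.min t0 (rho0 / 8).
have t10 : 0 < t1 by rewrite lt_min t00 divr_gt0.
have [tl1 tl2] : t1 <= t0 /\ t1 <= rho0 / 8 by rewrite !ge_min !lexx orbT.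
have t11 : 0 < t1 <= 1 by rewrite t10 (le_trans tl1)// (le_trans t0r).
have [J J0 HJ] := @jet_estimates R n a t1 a01 t11.
exists t1 => //; exists (J * (C * (2 + 2 * D) + 1)).
  by rewrite mulr_ge0// addr_ge0// mulr_ge0// addr_ge0// mulr_ge0.
move=> w w1 w2 f x0 M N sw eqw wM N0 fN wN B.
have M0 : 0 <= M by exact: le_trans (wM x0).
have cw : continuous w by case: sw => -[/nice_continuous].
pose N' := (1 + D) * N + D * M.
have N'0 : 0 <= N' by rewrite addr_ge0 ?mulr_ge0// addr_ge0.
have Hdl y k tau : `|y - x0| <= rho0 -> `|k| <= tau -> 0 < tau <= t0 ->
    `|dl k (fun y => Lop (near s r) w y - \sum_i w2 i i y) y| <= N' * tau `^ a.
  move=> yx kt /andP[tau0 taut].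
  have kr : `|k| <= r by exact: le_trans kt (le_trans taut t0r).
  have [i1 i2] := near_step yx kr rl2.
  have -> : dl k (fun y => Lop (near s r) w y - \sum_i w2 i i y) y = dl k f y - dl k (Far s r w) y.
    by rewrite /dl (eqw _ i1) (eqw _ i2); ring.
  have tau1 : tau <= 1 by apply: (le_trans taut); exact: (le_trans t0r).
  have ta : tau <= tau `^ a.
    rewrite -[leLHS](powRr1 (ltW tau0)); apply: ger_powR; last exact: ltW.
    by rewrite tau0.
  have ka : `|k| `^ a <= tau `^ a.
    by apply: ge0_ler_powR; rewrite ?nnegrE ?(ltW a0) ?(ltW tau0).
  have b1 := fN y k yx (le_trans kr rl2).
  have [_ /(_ k) b2] := HD w M y cw wM.
  have b3 := wN y k yx.
  apply: le_trans (ler_normB _ _) _.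
  move: (tau `^ a) ta ka b1 b2 b3 => T ta ka.
  move: (`|k| `^ a) ka => ka' ka b1 b2 b3.
  have c1 := ler_wpM2l N0 ka.
  have c2 := ler_wpM2l D0 (lerD b3 (lexx (M * `|k|))).
  have c3 := ler_wpM2l (mulr_ge0 D0 (addr_ge0 N0 M0)) (le_trans kt ta).
  rewrite /N'; move: (`|dl k f y|) (`|dl k w y|) (`|dl k (Far s r w) y|) (`|k|) b1 b2 b3 c1 c2 c3.
  move=> X1 X2 X3 X4 b1 b2 b3 c1 c2 c3.
  apply: le_trans (lerD (le_trans b1 c1) (le_trans b2 c2)) _.
  have -> : D * (N * X4 + M * X4) = D * (N + M) * X4 by ring.
  by apply: le_trans (lerD (lexx _) c3) _; rewrite le_eqVlt; apply/orP; left; apply/eqP; ring.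
have HS := HC w _ x0 rho0 M N' (smooth_laplacian sw) N'0 wM Hdl.
pose A := C * (M + N').
have A0 : 0 <= A by rewrite mulr_ge0// addr_ge0.
have HA y hs tau : `|y - x0| <= 4 * t1 -> size hs = 3%N -> (forall h, h \in hs -> `|h| <= tau) ->
    0 < tau <= t1 -> `|dd hs w y| <= A * tau `^ (2 + a).
  move=> yx hm hst /andP[tau0 taut]; apply: HS => //; last by rewrite tau0 (le_trans taut).
  have : r * (18 * K%:R + 2) <= rho0 by rewrite -ler_pdivlMr.
  move=> H; apply: (le_trans yx); lra.
have [_ n2 [tw tw1]] := sw.
have := HJ w w1 w2 x0 A M tw tw1 n2 A0 wM HA.
have BB : J * (A + M) <= B.
  rewrite /B /A /N' -mulrA ler_wpM2l// mulrDl mul1r.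
  have : C * (M + ((1 + D) * N + D * M)) <= C * (2 + 2 * D) * (N + M).
    rewrite -mulrA ler_wpM2l//.
    have := mulr_ge0 D0 M0; have := mulr_ge0 D0 N0; lra.
  lra.
have bb (X Y : R) : 0 <= Y -> X <= J * (A + M) * Y -> X <= B * Y.
  by move=> Y0 /le_trans; apply; rewrite ler_wpM2r.
move=> [j1 j2 j3 j4]; split=> [i|j i|y yx|t i tt].
- exact: le_trans BB.
- exact: le_trans BB.
- have [k1 k2 k3] := j3 y yx; split=> [|j|j i]; apply: bb; rewrite ?powR_ge0//.
- have [k1 k2] := j4 t i tt; split=> [|j]; apply: bb; rewrite ?powR_ge0//.
Qed.
End stages.

(** * Passage to the limit *)

Section mollifiers.
Context {R : realType} {n : nat}.
Local Notation mu := (@leb R n).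
Local Notation mm := (mu \x mu)%E.
Implicit Types (x y z : 'rV[R]_n).
Hypothesis n_gt0 : (0 < n)%N.

(** [qform e] is at least [3/4] on the cube of radius [e / (2 n)], so before normalization the mass
    is at least a constant times [e^n]; hence [A] depends on [n] only. *)
Lemma mollifier : exists2 A : R, 0 <= A & forall e : R, 0 < e ->
  exists zeta : 'rV[R]_n -> R, [/\ bumpy e zeta, forall z, 0 <= zeta z,
    \int[mu]_z zeta z = 1 & forall z, zeta z <= A / e ^+ n].
Proof.
pose c : R := expR (- (3 / 4)^-1); have c0 : 0 < c by exact: expR_gt0.
have nn : 0 < n%:R ^+ n :> R by rewrite exprn_gt0// ltr0n.
exists (c^-1 * n%:R ^+ n) => [|e e0]; first by rewrite mulr_ge0 ?invr_ge0 ?(ltW c0)// ltW.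
have b0 : bumpy e (fun z : 'rV[R]_n => flat 0 (qform e z)) by exact: bumpy_flat.
have i0 : integ mu (fun z => flat 0 (qform e z)).
  by apply: (nice_integ (bumpy_nice e0 b0) _ (ltW e0)) => z; exact: (bumpy_support e0 b0).
pose r := e / (2 * n%:R); have r0 : 0 < r by rewrite divr_gt0// mulr_gt0// ltr0n.
have := int_gt0_cube c0 r0 i0 (fun z => flat_ge0 0 _).
move: (\int[mu]_z flat 0 (qform e z)) (intZ (\int[mu]_z flat 0 (qform e z))^-1 i0) => m vm H.
have {}H : c * (2 * r) ^+ n <= m.
  apply: H => z zr; have q1 := qform_ge e0 zr n_gt0.
  have q0 : 0 < qform e z by apply: lt_le_trans q1; rewrite divr_gt0.
  rewrite /flat q0 expr0 invr1 mul1r ler_expR lerN2 lef_pV2 ?posrE// divr_gt0//.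
have r2 : 2 * r = e / n%:R by rewrite /r; field; rewrite gt_eqF// ltr0n.
have m0 : 0 < m.
  by apply: lt_le_trans H; rewrite mulr_gt0// exprn_gt0// mulr_gt0.
exists (fun z => m^-1 * flat 0 (qform e z)); split.
- exact: bumpyZ.
- by move=> z; rewrite mulr_ge0 ?flat_ge0// invr_ge0 ltW.
- by rewrite vm mulVf// gt_eqF.
- move=> z; have f1 : flat 0 (qform e z) <= 1.
    by have := flat_le 0 0 (qform e z); rewrite addn0 fact0 expr0 mulr1.
  apply: le_trans (_ : m^-1 <= _); first by rewrite ler_piMr// invr_ge0 ltW.
  have -> : c^-1 * n%:R ^+ n / e ^+ n = (c * (2 * r) ^+ n)^-1.
    by rewrite r2 expr_div_n !invfM invrK mulrA [c^-1 * _ * _]mulrAC.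
  by rewrite lef_pV2 ?posrE// mulr_gt0// exprn_gt0// mulr_gt0.
Qed.

Variables (s : R) (u : 'rV[R]_n -> R) (M : R).
Hypotheses (s01 : 0 < s < 1) (mu_ : measurable_fun setT u) (M_ge0 : 0 <= M)
  (uM : {ae mu, forall y, `|u y| <= M}) (ugag : (gagliardo_seminorm s u < +oo)%E).

(* AM-GM with weight [e^(-s)], since the mollifier is at most
   [C e^(2s) ker] on its support: finiteness of the Gagliardo energy gives pointwise
   convergence almost everywhere. *)
Lemma mollify_error (A e : R) (zeta : 'rV[R]_n -> R) x : 0 <= A -> 0 < e -> bumpy e zeta ->
  (forall z, 0 <= zeta z) -> \int[mu]_z zeta z = 1 -> (forall z, zeta z <= A / e ^+ n) ->
  integ mu (fun y => (u x - u y) ^+ 2 * ker s (x - y)) ->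
  `|cor u zeta x - u x| <=
    e `^ s * (A * n%:R `^ (n%:R + 2 * s) * \int[mu]_y ((u x - u y) ^+ 2 * ker s (x - y)) + 1).
Proof.
move=> A0 e0 bz z0 iz1 zA ih; have [s0 s1] := andP s01.
have iz : integ mu zeta.
  by apply: (nice_integ (bumpy_nice e0 bz) _ (ltW e0)) => z; exact: (bumpy_support e0 bz).
have [izx vzx] := int_shift (- x) iz; rewrite iz1 in vzx.
have iu := integ_cor mu_ M_ge0 uM x iz.
pose N := n%:R + 2 * s; pose A' := A * n%:R `^ N.
have A'0 : 0 <= A' by rewrite mulr_ge0// powR_ge0.
have E : cor u zeta x - u x = \int[mu]_y (u y * zeta (y - x) - u x * zeta (y - x)).
  by rewrite (intB iu (integZ (u x) izx)) (intZ (u x) izx) vzx mulr1.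
have F : e `^ s * (A' * \int[mu]_y ((u x - u y) ^+ 2 * ker s (x - y)) + 1) =
    \int[mu]_y (e `^ s * (A' * ((u x - u y) ^+ 2 * ker s (x - y)) + zeta (y - x))).
  have i1 := integZ A' ih.
  by rewrite (intZ _ (integD i1 izx)) (intD i1 izx) (intZ A' ih) vzx.
rewrite -/N -/A' E F; have i2 := integZ (e `^ s) (integD (integZ A' ih) izx).
apply: (int_abs_le i2 (integB iu (integZ (u x) izx))) => y.
rewrite -mulrBl normrM (ger0_norm (z0 _)).
have k0 := @ker_ge0 R n s (x - y).
have es : 0 < e `^ s by exact: powR_gt0.
have rhs0 : 0 <= e `^ s * (A' * ((u x - u y) ^+ 2 * ker s (x - y)) + zeta (y - x)).
  by rewrite mulr_ge0 ?(ltW es)// addr_ge0// mulr_ge0// mulr_ge0// sqr_ge0.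
have [yx|yx] := leP e `|y - x|.
  by rewrite (bumpy_support e0 bz yx) mulr0; move: rhs0; rewrite (bumpy_support e0 bz yx).
have [yE|yn] := eqVneq y x; first by apply: le_trans rhs0; rewrite yE subrr normr0 mul0r.
have zk : zeta (y - x) <= A' * (e `^ s) ^+ 2 * ker s (x - y).
  apply: le_trans (zA _) _; rewrite /A' -!mulrA ler_wpM2l//.
  rewrite -kerN opprB /ker.
  have d0 : 0 < eucl_norm (y - x).
    by apply: lt_le_trans (norm_le_eucl _); rewrite normr_gt0 subr_eq0.
  have N0 : 0 <= N by rewrite /N addr_ge0// mulr_ge0// ltW.
  have n0 : 0 < n%:R :> R by rewrite ltr0n.
  have d1 : eucl_norm (y - x) <= n%:R * e.
    by apply: le_trans (eucl_le_norm _) _; rewrite ler_pM2l// ltW.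
  have p1 := ler_powRN d0 d1 N0.
  apply: le_trans (_ : n%:R `^ N * ((e `^ s) ^+ 2 * (n%:R * e) `^ (- N)) <= _).
    rewrite -(powR_mulrn 2 (ltW es)) -powRrM powRM ?(ltW n0) ?(ltW e0)//.
    have -> (P Q S T : R) : P * (Q * (S * T)) = (P * S) * (Q * T) by ring.
    rewrite -(@powRD _ n%:R); last by rewrite (gt_eqF n0) implybT.
    rewrite subrr powRr0 mul1r -(@powRD _ e); last by rewrite (gt_eqF e0) implybT.
    rewrite (_ : s * 2%:R + - N = - n%:R); last by rewrite /N; ring.
    by rewrite powRN powR_mulrn// ltW.
  by rewrite ler_wpM2l ?powR_ge0// expr2 -mulrA !ler_pM2l.
move: (ker s _) (zeta _) (u y) (u x) k0 zk (z0 (y - x)) => k z a b k0 zk z_ge0.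
rewrite -[(b - a) ^+ 2]real_normK ?num_real// distrC.
move: (`|b - a|) (normr_ge0 (b - a)) => d d0; move: (e `^ s) es zk => t t0 zk.
have sq : 2 * (d * t) <= d ^+ 2 + t ^+ 2 by have := sqr_ge0 (d - t); rewrite sqrrB; lra.
rewrite -(ler_pM2l t0); apply: le_trans (_ : (d ^+ 2 + t ^+ 2) * z <= _).
  apply: le_trans (_ : 2 * (d * t) * z <= _); last by rewrite ler_wpM2r.
  by have := mulr_ge0 (mulr_ge0 d0 (ltW t0)) z_ge0; lra.
have := ler_wpM2l (sqr_ge0 d) zk.
have -> : t * (t * (A' * (d ^+ 2 * k) + z)) = d ^+ 2 * (A' * t ^+ 2 * k) + t ^+ 2 * z by ring.
by rewrite mulrDl lerD2r.
Qed.

(** By Fubini's theorem the inner energy integral is finite for almost every [x]; there the error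
    decays like [(e0 / 2^k)^s]. *)
Lemma mollify_ae (A e0 : R) (zeta : nat -> 'rV[R]_n -> R) : 0 <= A -> 0 < e0 ->
  (forall k, [/\ bumpy (e0 / 2 ^+ k) (zeta k), forall z, 0 <= zeta k z,
    \int[mu]_z zeta k z = 1 & forall z, zeta k z <= A / (e0 / 2 ^+ k) ^+ n]) ->
  {ae mu, forall x, cor u (zeta k) x @[k --> \oo] --> u x}.
Proof.
move=> A0 e00 H; have [s0 s1] := andP s01.
have := ae_integrable1 (gagliardo_integ mu_ ugag).
apply: filterS => x ih.
have ih' : integ mu (fun y => (u x - u y) ^+ 2 * ker s (x - y)) by exact: ih.
have ME k : `|cor u (zeta k) x - u x| <= (e0 / 2 ^+ k) `^ s *
    (A * n%:R `^ (n%:R + 2 * s) * \int[mu]_y ((u x - u y) ^+ 2 * ker s (x - y)) + 1).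
  have [h1 h2 h3 h4] := H k; apply: (mollify_error A0 _ h1 h2 h3 h4 ih').
  by rewrite divr_gt0// exprn_gt0.
move: (A * _ * _ + 1) ME => B ME.
pose q : R := 2 `^ (- s).
have q0 : 0 < q by exact: powR_gt0.
have q1 : q < 1.
  rewrite /q powRN invf_lt1 ?powR_gt0//.
  by have := @gt0_ltr_powR R s s0 1 2; rewrite powR1 !nnegrE; apply=> //; lra.
have ek k : (e0 / 2 ^+ k) `^ s = e0 `^ s * q ^+ k.
  rewrite powRM ?(ltW e00) ?invr_ge0 ?exprn_ge0//; congr (_ * _).
  rewrite /q powRN exprVn -(powR_mulrn k (powR_ge0 _ _)) -powRrM.
  rewrite -[X in _ = X^-1]/(2 `^ (s * k%:R)) -powRN -(powR_mulrn k (ler0n R 2)).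
  by rewrite -powRN -powRrM; congr powR; ring.
have cq : (fun k => e0 `^ s * B * q ^+ k) @ \oo --> (0 : R).
  by have := @cvg_geometric R (e0 `^ s * B) q; rewrite gtr0_norm//; apply.
apply/cvgrPdist_le => d d0; move/cvgrPdist_le : cq => /(_ d d0); apply: filterS => k.
rewrite sub0r normrN => hk; rewrite distrC; apply: le_trans (ME k) _.
rewrite ek mulrAC; exact: le_trans (ler_norm _) hk.
Qed.
End mollifiers.

(** * Convergence of derivatives *)

Section limits.
Context {R : realType}.

Lemma cauchy_cvgn (a : nat -> R) :
  (forall e : R, 0 < e -> exists K : nat, forall k l, (K <= k)%N -> (K <= l)%N -> `|a k - a l| <= e) ->
  cvgn a.
Proof.
move=> H; apply/cauchy_cvgP; apply/cauchy_ballP => e e0.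
have e2 : 0 < e / 2 by rewrite divr_gt0.
have [K HK] := H _ e2.
exists (a @` [set k | (K <= k)%N], a @` [set k | (K <= k)%N]).
  by split; exists K => // k /= Kk; exists k.
move=> _ [/= [k /= kK <-] [l /= lK <-]]; rewrite /ball/=.
by apply: le_lt_trans (HK k l kK lK) _; rewrite ltr_pdivrMr// ltr_pMr// ltr1n.
Qed.

Lemma lim_norm_le (a : nat -> R) (l B : R) : a @ \oo --> l -> (forall k, `|a k| <= B) -> `|l| <= B.
Proof.
by move=> al aB; apply: (cvgr_to_le (cvg_norm al)); apply: nearW.
Qed.

(** The difference quotient at a fixed small [t] converges, and it stays within [B t^b] of [g k]
    uniformly in [k]; so [g] is a Cauchy sequence. The whole sequence converges, without a
    compactness argument. *)
Lemma limit_taylor (F : nat -> R -> R) (f : R -> R) (g : nat -> R) (B b t0 : R) :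
  0 <= B -> 0 < b -> 0 < t0 ->
  (forall t, `|t| <= t0 -> F k t @[k --> \oo] --> f t) ->
  (forall k t, `|t| <= t0 -> `|F k t - F k 0 - t * g k| <= B * `|t| `^ (1 + b)) ->
  cvgn g.
Proof.
move=> B0 b0 t00 Ff H; apply: cauchy_cvgn => e e0.
pose c := e / (4 * (B + 1)).
have B1 : 0 < B + 1 by rewrite ltr_wpDl.
have c0 : 0 < c by rewrite divr_gt0// mulr_gt0.
pose t := Num.min t0 (c `^ b^-1).
have t_gt0 : 0 < t by rewrite lt_min t00 powR_gt0.
have tt0 : `|t| <= t0 by rewrite gtr0_norm// ge_min lexx.
have tb : t `^ b <= c.
  have h : t <= c `^ b^-1 by rewrite ge_min lexx orbT.
  have := @ge0_ler_powR R b (ltW b0) t (c `^ b^-1); rewrite !nnegrE (ltW t_gt0) powR_ge0 => /(_ isT isT h).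
  by rewrite -powRrM mulVf ?gt_eqF// powRr1// ltW.
have z0 : `|0 : R| <= t0 by rewrite normr0 ltW.
have e4 : 0 < e * t / 8 by rewrite divr_gt0// mulr_gt0.
have /cvgrPdist_le/(_ _ e4) [K1 _ HK1] := Ff t tt0.
have /cvgrPdist_le/(_ _ e4) [K2 _ HK2] := Ff 0 z0.
exists (maxn K1 K2) => k l; rewrite !geq_max => /andP[k1 k2] /andP[l1 l2].
have a1 := HK1 k k1; have a2 := HK1 l l1; have a3 := HK2 k k2; have a4 := HK2 l l2.
have h1 := H k t tt0; have h2 := H l t tt0.
have p1 : B * `|t| `^ (1 + b) <= e * t / 4.
  rewrite gtr0_norm// powRD ?(gt_eqF t_gt0) ?implybT// powRr1 ?(ltW t_gt0)//.
  have : (B + 1) * (4 * c) = e by rewrite /c; field; rewrite gt_eqF.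
  move=> E; rewrite -E; have := ler_wpM2l (mulr_ge0 B0 (ltW t_gt0)) tb.
  have := mulr_ge0 (ltW t_gt0) (ltW c0); lra.
have t2 : `|t * (g k - g l)| <= e * t.
  move: a1 a2 a3 a4 (le_trans h1 p1) (le_trans h2 p1); rewrite /= mulrBr !ler_norml.
  move: (F k t) (F l t) (F k 0) (F l 0) (f t) (f 0) (t * g k) (t * g l) => x1 x2 x3 x4 x5 x6 x7 x8.
  move: (e * t) => x9 /andP[? ?] /andP[? ?] /andP[? ?] /andP[? ?] /andP[? ?] /andP[? ?].
  by apply/andP; split; lra.
move: t2; rewrite normrM gtr0_norm// mulrC ler_pM2r//.
Qed.
End limits.

(** * The margin between V and the boundary of Omega *)

Section geometry.
Context {R : realType} {n : nat}.
Local Notation mu := (@leb R n).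
Implicit Types (x y z : 'rV[R]_n) (Omega V A : set 'rV[R]_n).

Lemma bounded_set_norm A : bounded_set A -> exists2 N : R, 0 <= N & forall x, A x -> `|x| <= N.
Proof.
move=> [N0 [N0r H]]; exists (`|N0| + 1) => [|x Ax]; first by rewrite addr_ge0.
apply: H Ax; apply: le_lt_trans (ler_norm _) _; by rewrite ltrDl.
Qed.

Lemma bounded_set_closure A (N : R) : (forall x, A x -> `|x| <= N) -> forall x, closure A x -> `|x| <= N.
Proof.
move=> AN x xA; apply/ler_addgt0Pr => e e0.
have [y [Ay xy]] := xA _ (nbhsx_ballx x e e0).
rewrite -[x](subrK y); apply: le_trans (ler_normD _ _) _; rewrite addrC; apply: lerD; first exact: AN.
by move: xy; rewrite -ball_normE /= => /ltW.
Qed.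

Lemma compact_closure A (N : R) : (forall x, A x -> `|x| <= N) -> compact (closure A).
Proof.
move=> AN; apply: bounded_closed_compact; last exact: closed_closure.
exists N; split; first exact: num_real.
move=> B NB x xA /=; exact: le_trans (bounded_set_closure AN xA) (ltW NB).
Qed.

Lemma open_ball_sub Omega x : open Omega -> Omega x ->
  exists2 e : R, 0 < e & forall y, `|y - x| < e -> Omega y.
Proof.
move=> oO Ox; have : nbhs x Omega by exact: open_nbhs_nbhs.
move=> /nbhs_ballP[e /= e0 H]; exists e => // y yx; apply: H.
by rewrite -ball_normE /= distrC.
Qed.

Lemma compact_margin (K Omega : set 'rV[R]_n) : compact K -> open Omega -> K `<=` Omega ->
  exists2 d : R, 0 < d & forall y x, K y -> `|x - y| < d -> Omega x.
Proof.
move=> /compact_near_coveringP cK oO KO.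
have := cK R (0^'+) (fun d y => forall x, `|x - y| < d -> Omega x) _.
move=> H; have {}H : \forall d \near 0^'+, K `<=` (fun y => forall x, `|x - y| < d -> Omega x).
  apply: H => y Ky.
  have [e e0 H] := open_ball_sub oO (KO y Ky).
  exists (ball y (e / 2), [set d | d < e / 2]) => /=.
    split; first by apply: nbhsx_ballx; rewrite divr_gt0.
    by apply: nbhs_right_lt; rewrite divr_gt0.
  move=> [y' d] /= [yy' de] x xy'; apply: H; rewrite -ball_normE /= in yy'.
  rewrite -(subrKA y'); apply: le_lt_trans (ler_normD _ _) _.
  by rewrite [X in _ + X]distrC; have := ltrD (lt_trans xy' de) yy'; lra.
have [d [d0 Hd]] := filter_ex (filterI (nbhs_right_gt 0) H).
by exists d => // y x Ky; exact: Hd.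
Qed.

(** Guarantees that [dist_set V (boundary Omega)] is an infimum over a nonempty set. With empty
    boundary, [Omega] would be open and closed, and would contain an entire line by
    connectedness. *)
Lemma boundary_neq0 Omega : (0 < n)%N -> open Omega -> bounded_set Omega -> Omega !=set0 ->
  boundary Omega !=set0.
Proof.
move=> n0 oO bO [p Op]; apply/set0P/negP => /eqP B0.
have clO : closed Omega.
  apply/closure_id/seteqP; split; first exact: subset_closure.
  move=> x xO; apply: contrapT => nO.
  have : boundary Omega x by split=> // /interior_subset.
  by rewrite B0.
have [N N0 HN] := bounded_set_norm bO.
pose e : 'rV[R]_n := delta_mx 0 (Ordinal n0).
have ct : continuous (fun t : R => p + t *: e).
  apply: (@lipschitz_continuous _ _ _ _ `|e|) => // a b.
  by rewrite opprD addrACA subrr add0r -scalerBl normrZ mulrC.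
have cT : connected [set: R] by apply/connected_intervalP.
have E : [set t : R | Omega (p + t *: e)] = setT.
  apply: cT; first by exists 0; rewrite /= scale0r addr0.
    exists [set t : R | Omega (p + t *: e)]; last by rewrite setTI.
    by apply: open_comp => // t _; exact: ct.
  exists [set t : R | Omega (p + t *: e)]; last by rewrite setTI.
  by apply: closed_comp => // t _; exact: ct.
have : [set t : R | Omega (p + t *: e)] (N + `|p| + 1) by rewrite E.
move=> /HN; apply/negP; rewrite -ltNge.
have := coord_le_norm (p + (N + `|p| + 1) *: e) (Ordinal n0).
rewrite /e !mxE !eqxx mulr1 => H; apply: lt_le_trans H.
have := coord_le_norm p (Ordinal n0); rewrite ler_norml => /andP[h1 _].
by apply: lt_le_trans (ler_norm _); lra.
Qed.

Lemma geometry Omega V : (0 < n)%N -> open Omega -> bounded_set Omega -> V !=set0 -> closure V `<=` Omega ->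
  exists2 rho0 : R, 0 < rho0 &
    (forall y x, V y -> `|x - y| <= 7 * rho0 -> enlarge Omega V (3 / 4 * dist_set V (boundary Omega)) x) /\
    closure (enlarge Omega V (3 / 4 * dist_set V (boundary Omega))) `<=` Omega.
Proof.
move=> n0 oO bO [v Vv] VO; have VO' y : V y -> Omega y by move=> Vy; apply: VO; exact: subset_closure.
have [N N0 HN] := bounded_set_norm bO.
have cV : compact (closure V) by apply: (@compact_closure _ N) => y Vy; apply: HN; exact: VO'.
have [d d0 Hd] := compact_margin cV oO VO.
have {}Hd y x : V y -> `|x - y| < d -> Omega x by move=> Vy; apply: Hd; exact: subset_closure.
have [b Bb] : boundary Omega !=set0 by apply: boundary_neq0 => //; exists v; exact: VO'.
set rho := dist_set V (boundary Omega).
have nO y : boundary Omega y -> ~ Omega y.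
  by move=> [_ nI] Oy; apply: nI; rewrite (interior_id Omega).1.
have rhod : d <= rho.
  apply: lb_le_inf; first by exists (eucl_dist v b); exists v => //; exists b.
  move=> _ [x Vx [y By <-]]; rewrite leNgt; apply/negP => xy; apply: (nO y By).
  apply: (Hd x) => //; rewrite distrC; apply: le_lt_trans xy; exact: norm_le_eucl.
have rho_le x y : V x -> boundary Omega y -> rho <= eucl_dist x y.
  move=> Vx By; apply: ge_inf; last by exists x => //; exists y.
  by exists 0 => _ [a _ [c _ <-]]; exact: eucl_norm_ge0.
have n1 : 1 <= n%:R :> R by rewrite ler1n.
have np : 0 < n%:R :> R by rewrite ltr0n.
(* Seven layers of sup-norm width [r] stay within Euclidean distance [n * 7 r = d / 2] of [V], which
   is below [3/4 rho] because [d <= rho]. *)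
pose r := d / (14 * n%:R).
have r0 : 0 < r by rewrite divr_gt0// mulr_gt0.
have nr : n%:R * (7 * r) = d / 2 by rewrite /r; field; rewrite gt_eqF.
have rr : 7 * r <= d / 2 by rewrite -nr ler_peMl// mulr_ge0// ltW.
exists r => //; split=> [y x Vy xy|x xE].
  split; first by apply: (Hd y) => //; lra.
  apply: (@le_lt_trans _ _ (eucl_dist x y)).
    apply: ge_inf; last by exists y.
    by exists 0 => _ [a _ <-]; exact: eucl_norm_ge0.
  apply: le_lt_trans (eucl_le_norm _) _; apply: le_lt_trans (ler_wpM2l (ltW np) xy) _.
  rewrite nr; lra.
(* A limit point outside [Omega] is a boundary point, hence at distance at least [rho] from [V].
   Nearby points are closer than [3/4 rho] to [V], and [e] is chosen so that the displacement uses
   less than the missing quarter. *)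
apply: contrapT => nOx.
have Bx : boundary Omega x.
  split; last by move=> /interior_subset.
  by apply: closureS xE => z [].
pose e := rho / (4 * n%:R); have rho0 : 0 < rho by exact: lt_le_trans rhod.
have e0 : 0 < e by rewrite divr_gt0// mulr_gt0.
have [x' [[Ox' dx'] xx']] := xE _ (nbhsx_ballx x e e0).
rewrite -ball_normE /= in xx'.
have [z [y Vy <-] dz] := inf_lt (ex_intro _ (eucl_dist x' v) (ex_intro2 _ _ v Vv erefl)) dx'.
have H := rho_le y x Vy Bx.
have L := eucl_lipschitz (y - x) (y - x').
rewrite (_ : y - x - (y - x') = x' - x) in L; last by rewrite opprB addrC subrKA.
rewrite distrC in xx'; have ne : n%:R * e = rho / 4 by rewrite /e; field; rewrite gt_eqF.
have L2 : n%:R * `|x' - x| < rho / 4 by rewrite -ne ltr_pM2l.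
have dz' : eucl_norm (y - x') < 3 / 4 * rho by rewrite -eucl_normN opprB.
by move: H L; rewrite /eucl_dist ler_norml => H /andP[_ L]; lra.
Qed.
End geometry.

(** * Hölder functions, the composite right-hand side and null sets *)

Section hoelder_facts.
Context {R : realType} {n : nat}.
Local Notation mu := (@leb R n).
Implicit Types (x y z : 'rV[R]_n) (Omega : set 'rV[R]_n).

Lemma eucl_norm_eq0 x : eucl_norm x = 0 -> x = 0.
Proof.
move=> x0; apply/eqP; rewrite -normr_eq0 eq_le normr_ge0 andbT.
by rewrite -x0; exact: norm_le_eucl.
Qed.

Lemma eucl_dist_prod_ge0 (p q : 'rV[R]_n * R) : 0 <= eucl_dist_prod p q.
Proof. exact: sqrtr_ge0. Qed.

Lemma eucl_dist_prod_le (p q : 'rV[R]_n * R) :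
  eucl_dist_prod p q <= n%:R * `|p.1 - q.1| + `|p.2 - q.2|.
Proof.
have h1 := eucl_le_norm (p.1 - q.1); have h0 := eucl_norm_ge0 (p.1 - q.1).
rewrite /eucl_dist_prod -(ger0_norm (_ : 0 <= n%:R * `|p.1 - q.1| + `|p.2 - q.2|)); last first.
  by rewrite addr_ge0// mulr_ge0.
rewrite -sqrtr_sqr ler_sqrt ?sqr_ge0// [leRHS]sqrrD -[(p.2 - q.2) ^+ 2]real_normK ?num_real//.
rewrite -addrA; apply: lerD; first by rewrite lerXn2r ?nnegrE ?mulr_ge0.
by rewrite lerDr mulrn_wge0// !mulr_ge0.
Qed.

Lemma eucl_dist_prod_eq0 (p q : 'rV[R]_n * R) : eucl_dist_prod p q = 0 -> p = q.
Proof.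
move=> /eqP; rewrite sqrtr_eq0 => H.
have h1 := sqr_ge0 (eucl_norm (p.1 - q.1)); have h2 := sqr_ge0 (p.2 - q.2).
have e1 : eucl_norm (p.1 - q.1) ^+ 2 = 0 by lra.
have e2 : (p.2 - q.2) ^+ 2 = 0 by lra.
move/eqP: e1; rewrite sqrf_eq0 => /eqP/eucl_norm_eq0/eqP; rewrite subr_eq0 => /eqP e1.
move/eqP: e2; rewrite sqrf_eq0 subr_eq0 => /eqP e2.
by case: p q e1 e2 {H h1 h2} => [a b] [c d] /= -> ->.
Qed.

Lemma hoelder_le (T : Type) (d : T -> T -> R) (a h : R) (K : set T) (f : T -> R) :
  (forall p q, 0 <= d p q) -> (forall p q, d p q = 0 -> p = q) ->
  (hoelder_seminorm d a K f <= h%:E)%E -> forall p q, K p -> K q -> 0 <= h ->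
  `|f p - f q| <= h * d p q `^ a.
Proof.
move=> d0 d1 H p q Kp Kq h0; have [dE|dn] := eqVneq (d p q) 0.
  by rewrite (d1 _ _ dE) subrr normr0 mulr_ge0// powR_ge0.
have dp : 0 < d p q by rewrite lt_neqAle eq_sym dn d0.
rewrite -ler_pdivrMr ?powR_gt0// -lee_fin; apply: le_trans H.
by apply: ereal_sup_ubound; exists p => //; exists q.
Qed.

Lemma locally_hoelder_continuous (alpha : R) Omega (g : 'rV[R]_n -> R -> R) : 0 < alpha < 1 ->
  open Omega -> locally_hoelder alpha Omega g ->
  forall p, (Omega `*` setT) p -> {for p, continuous (uncurry g)}.
Proof.
move=> /andP[a0 a1] oO hg [x t] [/= Ox _].
have [e e0 He] := open_ball_sub oO Ox.
pose B := [set y : 'rV[R]_n | `|y - x| < e / 2].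
have BN y : B y -> `|y| <= e / 2 + `|x|.
  by move=> By; rewrite -[y](subrK x); apply: le_trans (ler_normD _ _) _; rewrite lerD2r; exact: ltW.
have clB y : closure B y -> `|y - x| < e.
  move=> yB; have [z [Bz yz]] := yB _ (nbhsx_ballx y (e / 2) (divr_gt0 e0 (ltr0Sn R 1))).
  rewrite -ball_normE /= in yz; rewrite -(subrKA z); apply: le_lt_trans (ler_normD _ _) _.
  by have := ltrD yz Bz; lra.
pose K := closure B `*` `[t - 1, t + 1].
have cK : compact K by apply: compact_setX; [exact: compact_closure BN|exact: segment_compact].
have KO : K `<=` Omega `*` setT by move=> [y r] [/= /clB Hy _]; split=> //; exact: He.
have := hg K cK KO; set S := hoelder_seminorm _ _ _ _ => Sy.
have [h h0 Sh] : exists2 h : R, 0 <= h & (S <= h%:E)%E.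
  case: S Sy => [r|//|] _; last by exists 0 => //; rewrite leNye.
  by exists `|r|; rewrite ?lee_fin ?ler_norm.
have HK := hoelder_le eucl_dist_prod_ge0 eucl_dist_prod_eq0 Sh.
have Kp : K (x, t).
  split => /=; first by apply: subset_closure; rewrite /B /= subrr normr0 divr_gt0.
  by rewrite in_itv/=; apply/andP; split; lra.
apply/cvgrPdist_le => d d0.
pose c := (d / (h + 1)) `^ alpha^-1; have h1 : 0 < h + 1 by rewrite ltr_wpDl.
have c0 : 0 < c by rewrite powR_gt0// divr_gt0.
pose m := Num.min (e / 2) (Num.min 1 (c / (n%:R + 1))).
have n1 : 0 < n%:R + 1 :> R by rewrite ltr_wpDl.
have m0 : 0 < m by rewrite !lt_min ltr01 !divr_gt0.
exists (ball x m, ball t m); first by split; exact: nbhsx_ballx.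
move=> [y r] [/= ym rm]; rewrite -!ball_normE /= in ym rm.
have [m1 m2 m3] : [/\ m <= e / 2, m <= 1 & m <= c / (n%:R + 1)].
  by rewrite !ge_min !lexx !orbT.
have Kq : K (y, r).
  split => /=; first by apply: subset_closure; rewrite /B /= distrC (lt_le_trans ym).
  rewrite in_itv/=; move: (lt_le_trans rm m2); rewrite ltr_norml => /andP[? ?].
  by apply/andP; split; lra.
apply: le_trans (HK _ _ Kp Kq h0) _.
have dc : eucl_dist_prod (x, t) (y, r) <= c.
  apply: le_trans (eucl_dist_prod_le _ _) _ => /=.
  apply: le_trans (_ : (n%:R + 1) * m <= _).
    by rewrite mulrDl mul1r; apply: lerD; [rewrite ler_wpM2l// ltW|exact: ltW].
  by rewrite mulrC -ler_pdivlMr.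
apply: le_trans (_ : h * c `^ alpha <= _).
  by rewrite ler_wpM2l//; apply: ge0_ler_powR; rewrite ?nnegrE ?(ltW a0) ?(ltW c0) ?eucl_dist_prod_ge0.
rewrite /c -powRrM mulVf ?gt_eqF// powRr1; last by rewrite ltW// divr_gt0.
by rewrite mulrC mulrAC ler_pdivrMr// ler_wpM2l ?(ltW d0)// lerDl.
Qed.

Lemma measurable_composite (alpha : R) Omega (E : set 'rV[R]_n) (g : 'rV[R]_n -> R -> R) u :
  0 < alpha < 1 -> open Omega -> locally_hoelder alpha Omega g -> measurable_fun setT u ->
  measurable E -> E `<=` Omega -> measurable_fun setT (fun y => g y (u y) * \1_E y).
Proof.
move=> a01 oO hg mu_ mE EO; have mO := measurable_open_leb oO.
have oOT : open (Omega `*` [set: R]).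
  rewrite (_ : _ `*` _ = fst @^-1` Omega); last by apply/seteqP; split => p //= [].
  by apply: open_comp => // p _; exact: cvg_fst.
have mF : measurable_fun Omega (fun y => (uncurry g) (y, u y)).
  refine (@measurable_continuous_comp R n _ 'rV[R]_n Omega id u (Omega `*` setT) (uncurry g) mO _ _ oOT _ _).
  - by move=> i; apply: measurable_funTS; exact: measurable_row_coord_leb.
  - exact: measurable_funTS.
  - by move=> y Oy; split.
  - exact: locally_hoelder_continuous a01 oO hg.
rewrite (_ : (fun y => _) = (fun y => uncurry g (y, u y)) \_ E).
  apply/(measurable_restrictT _ mE); exact: measurable_funS mF.
by apply/funext => y; rewrite patchE indicE; case: ifP => _; rewrite ?mulr1 ?mulr0.
Qed.

Lemma Linfty_ae D (u : 'rV[R]_n -> R) : (Linfty_norm D u < +oo)%E ->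
  {ae mu, forall y, D y -> `|u y| <= fine (Linfty_norm D u)} /\ 0 <= fine (Linfty_norm D u).
Proof.
move=> H; have L0 : (0 <= Linfty_norm D u)%E by exact: Lnorm_ge0.
split; last exact: fine_ge0.
(* The norm of order infinity unfolds to an essential supremum only when the total measure is
   positive. *)
have muT : (0 < mu setT)%E.
  apply: (@lt_le_trans _ _ (mu (cube n 1))); last by apply: le_measure; rewrite ?inE//; exact: measurable_cube.
  by rewrite leb_cube// lte_fin exprn_gt0// mulr1.
have Lfin : (fine (Linfty_norm D u))%:E = Linfty_norm D u by rewrite fineK// ge0_fin_numE.
have E : Linfty_norm D u = ess_sup mu (abse \o (EFin \o (u \* \1_D)%R)).
  by rewrite /Linfty_norm unlock muT.
have := @ess_sup_ge _ _ _ mu (abse \o (EFin \o (u \* \1_D)%R)); rewrite -E -Lfin.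
apply: filterS => y /=; rewrite lee_fin indicE => h Dy.
by rewrite mem_set// mulr1 in h.
Qed.

Lemma Linfty_le D (u : 'rV[R]_n -> R) : (Linfty_norm D u <= Linfty_norm setT u)%E.
Proof.
rewrite /Linfty_norm unlock; case: ifP => // _; apply: le_ess_sup; apply: nearW => y /=.
rewrite lee_fin !indicE in_setT mulr1; case: (y \in D); first by rewrite mulr1.
by rewrite mulr0 normr0.
Qed.

Lemma ae_shift (P : 'rV[R]_n -> Prop) (h : 'rV[R]_n) : {ae mu, forall y, P y} ->
  {ae mu, forall y, P (y + h)}.
Proof.
move=> [N [mN N0 PN]]; exists (affine_row 1 h @^-1` N); split.
- rewrite -[X in measurable X]setTI; apply: (measurable_affine_row_leb h) => //; by left.
- by rewrite leb_affine//; left.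
- move=> y /= nP; apply: PN => /= Py; apply: nP.
  by move: Py; rewrite /affine_row scale1r.
Qed.

Lemma ae_dense (P : 'rV[R]_n -> Prop) x (e : R) : {ae mu, forall y, P y} -> 0 < e ->
  exists2 y, P y & `|y - x| <= e.
Proof.
move=> /(ae_shift x) [N [mN N0 PN]] e0; apply: contrapT => H.
have : (mu (cube n e) <= mu N)%E.
  have mc : measurable (cube n e) by exact: (measurable_cube (ltW e0)).
  apply: le_measure; rewrite ?inE// => z ze; apply: PN => /= Pz; apply: H; exists (z + x) => //.
  by rewrite addrK.
by rewrite N0 leb_cube ?(ltW e0)// lee_fin leNgt exprn_gt0// mulr_gt0.
Qed.
End hoelder_facts.

(** * Estimates uniform in the mollification parameter *)

Section estimates.
Context {R : realType} {n : nat}.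
Local Notation mu := (@leb R n).
Implicit Types (x y z h : 'rV[R]_n) (Omega V E : set 'rV[R]_n).
Local Notation e_ i := (delta_mx 0 i : 'rV[R]_n).

(** Local Hölder continuity bounds only the seminorm; the supremum is finite because [K] is bounded.
    [G] is the exact norm, so that nothing is lost in the final inequality. *)
Lemma hoelder_norm_bounds (alpha : R) (K : set ('rV[R]_n * R)) (f : 'rV[R]_n * R -> R) (p0 : 'rV[R]_n * R) (N : R) :
  0 < alpha -> K p0 -> (forall p, K p -> `|p.1| <= N /\ `|p.2| <= N) ->
  (hoelder_seminorm eucl_dist_prod alpha K f < +oo)%E ->
  exists2 G : R, 0 <= G & [/\ hoelder_norm eucl_dist_prod alpha K f = G%:E,
    forall p, K p -> `|f p| <= G &
    forall p q, K p -> K q -> `|f p - f q| <= G * eucl_dist_prod p q `^ alpha].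
Proof.
move=> a0 Kp0 KN; rewrite /hoelder_norm; set S := hoelder_seminorm _ _ _ _ => Soo.
have S0 : (0 <= S)%E.
  apply: (@le_trans _ _ (`|f p0 - f p0| / eucl_dist_prod p0 p0 `^ alpha)%:E).
    by rewrite lee_fin subrr normr0 mul0r.
  by apply: ereal_sup_ubound; exists p0 => //; exists p0.
have SE : S = (fine S)%:E by rewrite fineK// ge0_fin_numE.
have s0 : 0 <= fine S by exact: fine_ge0.
have HK : forall p q, K p -> K q -> `|f p - f q| <= fine S * eucl_dist_prod p q `^ alpha.
  move=> p q Kp Kq; apply: (hoelder_le eucl_dist_prod_ge0 eucl_dist_prod_eq0 _ Kp Kq s0).
  by rewrite -SE.
have N0 : 0 <= N by have [h _] := KN _ Kp0; exact: le_trans h.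
pose D := n%:R * (N + N) + (N + N).
pose b := `|f p0| + fine S * D `^ alpha.
have fb p : K p -> `|f p| <= b.
  move=> Kp; rewrite -[f p](subrK (f p0)) addrC; apply: le_trans (ler_normD _ _) _.
  rewrite /b lerD2l; apply: le_trans (HK p p0 Kp Kp0) _; rewrite ler_wpM2l//.
  have D0 : 0 <= D by rewrite addr_ge0 ?mulr_ge0 ?addr_ge0.
  apply: ge0_ler_powR; rewrite ?nnegrE ?(ltW a0) ?eucl_dist_prod_ge0//.
  apply: le_trans (eucl_dist_prod_le _ _) _; have [h1 h2] := KN p Kp; have [h3 h4] := KN p0 Kp0.
  apply: lerD; first rewrite ler_wpM2l//; apply: le_trans (ler_normB _ _) _; exact: lerD.
set T := sup_norm K f.
have T0 : (0 <= T)%E.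
  apply: (@le_trans _ _ (`|f p0|)%:E); first by rewrite lee_fin.
  by apply: ereal_sup_ubound; exists p0.
have Tb : (T <= b%:E)%E.
  by apply: ge_ereal_sup => _ [p Kp <-]; rewrite lee_fin; exact: fb.
have TE : T = (fine T)%:E by rewrite fineK// ge0_fin_numE// (le_lt_trans Tb)// ltry.
have t0 : 0 <= fine T by exact: fine_ge0.
exists (fine T + fine S); first exact: addr_ge0.
split=> [|p Kp|p q Kp Kq].
- by rewrite TE SE.
- rewrite -lee_fin; apply: (@le_trans _ _ T); first by apply: ereal_sup_ubound; exists p.
  by rewrite TE lee_fin lerDl.
- apply: le_trans (HK p q Kp Kq) _; rewrite ler_wpM2r ?powR_ge0// lerDr//.
Qed.

Definition fattened V (d : R) x := exists2 y, V y & `|x - y| <= d.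

Lemma fattened_step V (d d' : R) x y : fattened V d x -> `|y - x| <= d' -> fattened V (d + d') y.
Proof.
move=> [v Vv xv] yx; exists v => //; rewrite -(subrKA x).
by apply: le_trans (ler_normD _ _) _; rewrite addrC; exact: lerD.
Qed.

Lemma fattenedW V (d d' : R) x : fattened V d x -> d <= d' -> fattened V d' x.
Proof. by move=> [v Vv xv] dd; exists v => //; exact: le_trans dd. Qed.

(** The product [G * CA * (M + G)], from composing [g] with a function of Lipschitz constant
    [CA * (M + G)], is the only quadratic term; it is the origin of the factor [1 + G]. *)
Lemma constant_assembly (m CA CB M G : R) : 0 <= m -> 0 <= CA -> 0 <= CB -> 0 <= M -> 0 <= G ->
  CB * (G * (m + 1 + CA * (M + G)) + CA * (M + G) + M) <=
  (CA + CB * (m + 2 + CA)) * (M + G) * (1 + G).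
Proof.
move=> m0 CA0 CB0 M0 G0.
rewrite mulrDl mulrDl -[leLHS]add0r; apply: lerD.
  by rewrite !mulr_ge0// addr_ge0.
rewrite -!mulrA ler_wpM2l//.
have p1 := mulr_ge0 (mulr_ge0 m0 G0) (addr_ge0 G0 M0); have p2 := mulr_ge0 m0 M0.
have p3 := mulr_ge0 M0 G0; have p4 := mulr_ge0 G0 G0.
have -> : (m + 2 + CA) * ((M + G) * (1 + G)) =
  G * (m + 1 + CA * (M + G)) + CA * (M + G) + M +
  (m * G * (G + M) + m * M + 2 * (M * G) + 2 * (G * G) + M + G) by ring.
rewrite lerDl; lra.
Qed.

Lemma cor_supp (F F' psi : 'rV[R]_n -> R) (e : R) x : csupp e psi ->
  (forall y, `|y - x| <= e -> F y = F' y) -> cor F psi x = cor F' psi x.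
Proof.
move=> sp FF; apply: eq_Rintegral => y _.
have [yx|yx] := leP `|y - x| e; first by rewrite FF.
by rewrite (sp _ (ltW yx)) !mulr0.
Qed.

(** The weight has mass one, so a bound on the increments of [F] near [x] passes to the
    mollification. The cut-off [D] makes that bound global, as [cor_bound] requires. *)
Lemma dl_cor_bound (F psi : 'rV[R]_n -> R) (e G B : R) x h : nice psi -> csupp e psi -> 0 <= e ->
  (forall z, 0 <= psi z) -> \int[mu]_z psi z = 1 ->
  measurable_fun setT F -> 0 <= G -> {ae mu, forall y, `|F y| <= G} -> 0 <= B ->
  {ae mu, forall y, `|y - x| <= e -> `|F (y + h) - F y| <= B} -> `|dl h (cor F psi) x| <= B.
Proof.
move=> np sp e0 p0 p1 mF G0 FG B0 FB.
have ip := nice_integ np sp e0.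
have i1 := integ_cor mF G0 FG (x + h) ip; have i2 := integ_cor mF G0 FG x ip.
have [j1 v1] := int_shift h i1.
have j1' : integ mu (fun y => F (y + h) * psi (y - x)).
  by move: j1; rewrite (_ : (fun y => _) = fun y => F (y + h) * psi (y - x))//; apply/funext => y; rewrite opprD addrACA subrr addr0.
have v1' : cor F psi (x + h) = \int[mu]_y (F (y + h) * psi (y - x)).
  rewrite /cor -v1; apply: eq_Rintegral => y _.
  by rewrite opprD addrACA subrr addr0.
pose D y := (F (y + h) - F y) * \1_(cube n e) (y - x).
have mcube : measurable_fun setT (fun y : 'rV[R]_n => \1_(cube n e) (y - x) : R).
  exact: (integ_measurable (int_shift (- x) (integ_cube e0).1).1).
have mFh : measurable_fun setT (fun y => F (y + h)).
  rewrite (_ : (fun y => _) = F \o affine_row 1 h); last by apply/funext => y; rewrite /= /affine_row scale1r.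
  by apply: (measurableT_comp mF); apply: measurable_affine_row_leb; left.
have mD : measurable_fun setT D by apply: measurable_funM mcube; exact: measurable_funB.
have DB : {ae mu, forall y, `|D y| <= B}.
  apply: filterS FB => y H; rewrite /D indicE; have [/set_mem yx|_] := boolP (y - x \in cube n e).
    by rewrite mulr1; exact: H.
  by rewrite mulr0 normr0.
have E : dl h (cor F psi) x = cor D psi x.
  rewrite /dl v1' /cor -(intB j1' i2); apply: eq_Rintegral => y _.
  have [yx|yx] := leP `|y - x| e.
    by rewrite /D indicE mem_set// mulr1 mulrBl.
  by rewrite (sp _ (ltW yx)) !mulr0 subr0.
rewrite E; apply: le_trans (cor_bound mD B0 DB x ip) _.
rewrite (_ : \int[mu]_z `|psi z| = 1) ?mulr1// -p1.
by apply: eq_Rintegral => z _; rewrite ger0_norm.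
Qed.

Lemma powR_le1D (a t : R) : 0 <= a <= 1 -> 0 <= t -> t `^ a <= 1 + t.
Proof.
move=> /andP[a0 a1] t0; have [t1|t1] := leP t 1.
  apply: le_trans (_ : 1 `^ a <= _); last by rewrite powR1 lerDl.
  by apply: ge0_ler_powR; rewrite ?nnegrE.
apply: le_trans (_ : t `^ 1 <= _); first by apply: ler_powR => //; exact: ltW.
by rewrite powRr1// lerDr.
Qed.

Definition jet_bounds (t1 a B : R) (w : 'rV[R]_n -> R) (w1 : 'I_n -> 'rV[R]_n -> R)
    (w2 : 'I_n -> 'I_n -> 'rV[R]_n -> R) x0 :=
  [/\ forall i, `|w1 i x0| <= B, forall j i, `|w2 j i x0| <= B,
      forall y, `|y - x0| <= t1 -> [/\ `|w y - w x0| <= B * `|y - x0| `^ a,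
        forall j, `|w1 j y - w1 j x0| <= B * `|y - x0| `^ a &
        forall j i, `|w2 j i y - w2 j i x0| <= B * `|y - x0| `^ a] &
      forall (t : R) i, `|t| <= t1 ->
        `|w (x0 + t *: e_ i) - w x0 - t * w1 i x0| <= B * `|t| `^ (1 + a) /\
        forall j, `|w1 j (x0 + t *: e_ i) - w1 j x0 - t * w2 j i x0| <= B * `|t| `^ (1 + a)].

Lemma jet_boundsW (t1 a B B' : R) w w1 w2 x0 : B <= B' ->
  jet_bounds t1 a B w w1 w2 x0 -> jet_bounds t1 a B' w w1 w2 x0.
Proof.
move=> BB [j1 j2 j3 j4]; have bb (X Y : R) : 0 <= Y -> X <= B * Y -> X <= B' * Y.
  by move=> Y0 /le_trans; apply; rewrite ler_wpM2r.
split=> [i|j i|y yx|t i tt].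
- exact: le_trans BB.
- exact: le_trans BB.
- have [k1 k2 k3] := j3 y yx; split=> [|j|j i]; apply: bb; rewrite ?powR_ge0//.
- have [k1 k2] := j4 t i tt; split=> [|j]; apply: bb; rewrite ?powR_ge0//.
Qed.

Variables (s alpha rho0 : R) (Omega V : set 'rV[R]_n) (E : set 'rV[R]_n).
Hypotheses (n_gt0 : (0 < n)%N) (s01 : 0 < s < 1) (a01 : 0 < alpha < 1) (rho0_gt0 : 0 < rho0)
  (Omega_open : open Omega) (mE : measurable E) (EOmega : E `<=` Omega)
  (fatE : forall x, fattened V (7 * rho0) x -> E x).

(** [M] bounds [u] on the whole space and enters through the mollifications and the far part; [MO]
    bounds it on [Omega] and confines the second argument of [g] to the interval on which [G] is
    measured. The nested radii keep all supports inside [E]. *)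
Lemma approximation_estimates : exists2 t1 : R, 0 < t1 <= 1 & exists2 C : R, 0 <= C &
  forall (g : 'rV[R]_n -> R -> R) (u : 'rV[R]_n -> R) (M MO G : R),
  locally_hoelder alpha Omega g -> weak_solution s Omega g u ->
  0 <= M -> {ae mu, forall y, `|u y| <= M} -> {ae mu, forall y, Omega y -> `|u y| <= MO} -> 0 <= G ->
  (forall y t, E y -> `|t| <= MO -> `|g y t| <= G) ->
  (forall y t y' t', E y -> `|t| <= MO -> E y' -> `|t'| <= MO ->
     `|g y t - g y' t'| <= G * eucl_dist_prod (y, t) (y', t') `^ alpha) ->
  exists (w : nat -> 'rV[R]_n -> R) (w1 : nat -> 'I_n -> 'rV[R]_n -> R)
    (w2 : nat -> 'I_n -> 'I_n -> 'rV[R]_n -> R),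
  [/\ {ae mu, forall x, w k x @[k --> \oo] --> u x}, forall k y, `|w k y| <= M,
      forall k x h, fattened V (4 * rho0) x -> `|dl h (w k) x| <= C * (M + G) * `|h| &
      forall k x, fattened V rho0 x ->
        jet_bounds t1 alpha (C * (M + G) * (1 + G)) (w k) (w1 k) (w2 k) x].
Proof.
have rp := rho0_gt0; have [a0 a1] := andP a01.
have [e7 e6 e2 e3] : [/\ 6 * rho0 + rho0 = 7 * rho0, 4 * rho0 + 2 * rho0 = 6 * rho0,
  rho0 + rho0 = 2 * rho0 & 2 * rho0 + rho0 = 3 * rho0] by split; ring.
have [l26 l36 l34 l47] : [/\ 2 * rho0 <= 6 * rho0, 3 * rho0 <= 6 * rho0, 3 * rho0 <= 4 * rho0 &
  4 * rho0 <= 7 * rho0] by split; lra.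
have [l57 l24 l14] : [/\ 4 * rho0 + rho0 <= 7 * rho0, rho0 + rho0 <= 4 * rho0 & rho0 <= 4 * rho0].
  by split; lra.
have [rA /andP[rA0 rA1] HA] := stage_lipschitz n_gt0 s01 rho0_gt0.
have [rB /andP[rB0 rB1] HB] := stage_jets n_gt0 s01 rho0_gt0 a01.
pose r := Num.min rA rB.
have r0 : 0 < r by rewrite lt_min rA0.
have [rA' rB'] : 0 < r <= rA /\ 0 < r <= rB by rewrite r0 !ge_min !lexx orbT.
have [CA CA0 {}HA] := HA r rA'; have [t1 t11 [CB CB0 {}HB]] := HB r rB'.
have [A A0 HM] := @mollifier R n n_gt0.
exists t1 => //; exists (CA + CB * (n%:R + 2 + CA)).
  by rewrite addr_ge0// mulr_ge0// !addr_ge0.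
move=> g u M MO G hg usol M0 uM uMO G0 gG gH.
have gag : (gagliardo_seminorm s u < +oo)%E by case: usol => -[].
have mu_ : measurable_fun [set: 'rV[R]_n] u by case: usol => -[].
pose ek k := rho0 / 2 ^+ k.
have ek0 k : 0 < ek k by rewrite divr_gt0// exprn_gt0.
have ekr k : ek k <= rho0 by rewrite ler_pdivrMr ?exprn_gt0// ler_peMr ?exprn_ege1 ?ler1n// ltW.
have [zeta Hz] := choice (fun k => HM (ek k) (ek0 k)).
pose w k := cor u (zeta k).
have bz k : bumpy (ek k) (zeta k) by have [] := Hz k.
have sz k : csupp (ek k) (zeta k) by move=> z; exact: (bumpy_support (ek0 k) (bz k)).
have nz k := bumpy_nice (ek0 k) (bz k).
have z0 k z : 0 <= zeta k z by have [_ + _ _] := Hz k; apply.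
have z1 k : \int[mu]_z zeta k z = 1 by have [] := Hz k.
have zn k : \int[mu]_z `|zeta k z| = 1.
  by rewrite -(z1 k); apply: eq_Rintegral => z _; rewrite ger0_norm.
have iz k : integ mu (zeta k) := nice_integ (nz k) (sz k) (ltW (ek0 k)).
have wM k y : `|w k y| <= M.
  by apply: le_trans (cor_bound mu_ M0 uM y (iz k)) _; rewrite zn mulr1.
have wu : {ae mu, forall x, w k x @[k --> \oo] --> u x}.
  exact: (mollify_ae n_gt0 s01 mu_ M0 uM gag A0 rho0_gt0 Hz).
have WP k := weak_to_pointwise n_gt0 s01 Omega_open mu_ M0 uM usol (ek0 k) r0 (bz k).
have [w1 {}WP] := choice WP; have [w2 {}WP] := choice WP.
(* [F] is what the weak formulation yields, but [g] may be unbounded near the boundary. [F1] is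
   bounded almost everywhere and has the same mollification wherever the support of the bump stays
   in [E]. *)
pose F y := g y (u y) * \1_Omega y; pose F1 y := g y (u y) * \1_E y.
pose f k := cor F (zeta k).
have sj k : smooth_jet (w k) (w1 k) (w2 k) by have [? ? ? _] := WP k; split.
have ballE d k x y : fattened V d x -> d <= 6 * rho0 -> `|y - x| <= ek k -> E y.
  move=> xd dd yx; apply: fatE; apply: fattenedW (fattened_step xd yx) _.
  by rewrite -e7; exact: lerD dd (ekr k).
have eqn k d x0 : fattened V d x0 -> d <= 4 * rho0 -> eqn_near s rho0 r (w k) (w2 k) (f k) x0.
  move=> xd dd x xx0; have [_ _ _ H] := WP k; apply: H => y yx.
  apply: EOmega; apply: (ballE (d + 2 * rho0) k x) => //; first exact: fattened_step xd xx0.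
  by rewrite -e6 lerD2r.
have mF1 : measurable_fun setT F1 by exact: measurable_composite a01 Omega_open hg mu_ mE EOmega.
have F1G : {ae mu, forall y, `|F1 y| <= G}.
  apply: filterS uMO => y uy; rewrite /F1 indicE; have [/set_mem Ey|_] := boolP (y \in E).
    by rewrite mulr1; apply: gG => //; apply: uy; exact: EOmega.
  by rewrite mulr0 normr0.
have fF1 k d x : fattened V d x -> d <= 6 * rho0 -> f k x = cor F1 (zeta k) x.
  move=> xd dd; apply: (cor_supp (sz k)) => y yx.
  have Ey := ballE d k x y xd dd yx.
  by rewrite /F /F1 !indicE !mem_set//; exact: EOmega.
have fG k d x : fattened V d x -> d <= 6 * rho0 -> `|f k x| <= G.
  move=> xd dd; rewrite (fF1 k d x xd dd); apply: le_trans (cor_bound mF1 G0 F1G x (iz k)) _.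
  by rewrite zn mulr1.
pose L := CA * (M + G).
have L0 : 0 <= L by rewrite mulr_ge0// addr_ge0.
have Lip k d x h : fattened V d x -> d <= 4 * rho0 -> `|dl h (w k) x| <= L * `|h|.
  move=> xd dd; apply: (HA (w k) (w1 k) (w2 k) (f k) x M G (sj k) (eqn k d x xd dd) (wM k) G0).
  move=> x' x'x; apply: (fG k (d + 2 * rho0)); first exact: fattened_step xd x'x.
  by rewrite -e6 lerD2r.
have MG0 : 0 <= M + G by exact: addr_ge0.
have CM : 0 <= CB * (n%:R + 2 + CA) by rewrite mulr_ge0// !addr_ge0.
exists w, w1, w2; split=> //.
  move=> k x h xd; apply: le_trans (Lip k _ x h xd (lexx _)) _.
  by rewrite ler_wpM2r// /L ler_wpM2r// lerDl.
move=> k x xd.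
have fH y h : `|y - x| <= rho0 -> `|h| <= rho0 -> `|dl h (f k) y| <= G * (n%:R + 1 + L) * `|h| `^ alpha.
  move=> yx hr.
  have yd : fattened V (2 * rho0) y.
    by rewrite -e2; exact: fattened_step xd yx.
  have yhd : fattened V (3 * rho0) (y + h).
    have H : `|y + h - y| <= rho0 by rewrite addrC addKr.
    by rewrite -e3; exact: fattened_step yd H.
  have E1 : dl h (f k) y = dl h (cor F1 (zeta k)) y.
    by rewrite /dl (fF1 k _ _ yd l26) (fF1 k _ _ yhd l36).
  have N0 : 0 <= G * (n%:R + 1 + L) by rewrite mulr_ge0// !addr_ge0.
  rewrite E1; apply: (dl_cor_bound (nz k) (sz k) (ltW (ek0 k)) (z0 k) (z1 k) mF1 G0 F1G).
    by rewrite mulr_ge0// powR_ge0.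
  have good : {ae mu, forall z, w k z @[k --> \oo] --> u z /\ (Omega z -> `|u z| <= MO)}.
    by apply: filterS2 wu uMO.
  apply: filterS2 good (ae_shift h good) => z [c1 b1] [c2 b2] zy.
  have zd : fattened V (4 * rho0) z.
    have H : `|z - y| <= rho0 by exact: le_trans zy (ekr k).
    by apply: fattenedW (fattened_step yd H) _; rewrite e3.
  have Ez : E z by apply: fatE; exact: fattenedW zd l47.
  have Ezh : E (z + h).
    have H : `|z + h - z| <= rho0 by rewrite addrC addKr.
    apply: fatE; exact: fattenedW (fattened_step zd H) l57.
  (* The Lipschitz bound passes from [w] to [u] at pairs of points where both sequences converge,
     which holds for almost every [z]. *)
  have uL : `|u (z + h) - u z| <= L * `|h|.
    apply: (lim_norm_le (cvgB c2 c1)) => j; exact: (Lip j _ z h zd (lexx _)).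
  rewrite /F1 !indicE !mem_set// !mulr1.
  apply: le_trans (gH _ _ _ _ Ezh (b2 (EOmega Ezh)) Ez (b1 (EOmega Ez))) _.
  rewrite -mulrA ler_wpM2l//.
  have nL : 0 <= n%:R + L by rewrite addr_ge0.
  apply: le_trans (_ : ((n%:R + L) * `|h|) `^ alpha <= _).
    apply: ge0_ler_powR; rewrite ?nnegrE ?(ltW a0) ?eucl_dist_prod_ge0 ?mulr_ge0//.
    apply: le_trans (eucl_dist_prod_le _ _) _ => /=.
    by rewrite [z + h - z]addrC addKr mulrDl lerD2l.
  rewrite powRM//; rewrite ler_wpM2r ?powR_ge0//.
  rewrite addrAC [_ + 1]addrC; apply: powR_le1D => //.
  by rewrite !ltW.
pose N := G * (n%:R + 1 + L) + L.
have N0 : 0 <= N by rewrite addr_ge0// mulr_ge0// !addr_ge0.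
have fH' y h : `|y - x| <= rho0 -> `|h| <= rho0 -> `|dl h (f k) y| <= N * `|h| `^ alpha.
  by move=> yx hr; apply: le_trans (fH y h yx hr) _; rewrite ler_wpM2r ?powR_ge0// lerDl.
have wN y h : `|y - x| <= rho0 -> `|dl h (w k) y| <= N * `|h|.
  move=> yx; have yd := fattened_step xd yx; apply: le_trans (Lip k _ y h yd l24) _.
  by rewrite ler_wpM2r// lerDr mulr_ge0// !addr_ge0.
have J := HB (w k) (w1 k) (w2 k) (f k) x M N (sj k) (eqn k _ x xd l14) (wM k) N0 fH' wN.
apply: jet_boundsW J.
exact: constant_assembly.
Qed.
End estimates.

(** * Regularity of the limit *)

Section limit_regularity.
Context {R : realType} {n : nat}.
Local Notation mu := (@leb R n).
Implicit Types (x y z h : 'rV[R]_n) (V : set 'rV[R]_n).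
Local Notation e_ i := (delta_mx 0 i : 'rV[R]_n).

Lemma powR_small (B a e : R) : 0 <= B -> 0 < a -> 0 < e ->
  exists2 r : R, 0 < r & forall t, 0 <= t <= r -> B * t `^ a <= e.
Proof.
move=> B0 a0 e0; have B1 : 0 < B + 1 by rewrite ltr_wpDl.
exists ((e / (B + 1)) `^ a^-1) => [|t /andP[t0 tr]]; first by rewrite powR_gt0// divr_gt0.
have c0 : 0 <= e / (B + 1) by rewrite divr_ge0// ltW.
have h : t `^ a <= e / (B + 1).
  have := ge0_ler_powR (ltW a0) _ _ tr; rewrite !nnegrE t0 powR_ge0 => /(_ isT isT).
  by rewrite -powRrM mulVf ?gt_eqF// powRr1.
apply: le_trans (ler_wpM2l B0 h) _; rewrite mulrCA ler_piMr ?(ltW e0)//.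
by rewrite ler_pdivrMr// mul1r lerDl.
Qed.

Lemma is_derive_powR (f : 'rV[R]_n -> R) x v (d B a t0 : R) : 0 <= B -> 0 < a -> 0 < t0 ->
  (forall t, `|t| <= t0 -> `|f (x + t *: v) - f x - t * d| <= B * `|t| `^ (1 + a)) ->
  is_derive x v f d.
Proof.
move=> B0 a0 t00 H; apply: is_derive_eps => e e0.
have [r r0 Hr] := powR_small B0 a0 e0.
exists (Num.min t0 r) => [|t]; first by rewrite lt_min t00.
rewrite lt_min => /andP[tt0 tr]; apply: le_trans (H t (ltW tt0)) _.
have [->|tn] := eqVneq t 0; first by rewrite normr0 mulr0 powR0 ?mulr0// gt_eqF// addr_gt0.
rewrite powRD ?normr_eq0 ?tn ?implybT// powRr1// mulrCA mulrC ler_wpM2r//.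
by apply: Hr; rewrite normr_ge0 ltW.
Qed.

Lemma modulus_continuous (U : normedModType R) (f : U -> R) (x : U) (B a r : R) : 0 <= B -> 0 < a -> 0 < r ->
  (forall y : U, `|y - x| <= r -> `|f y - f x| <= B * `|y - x| `^ a) -> {for x, continuous f}.
Proof.
move=> B0 a0 r0 H; apply/cvgrPdist_le => e e0.
have [d d0 Hd] := powR_small B0 a0 e0.
apply/nbhs_ballP; exists (Num.min r d) => /=; first by rewrite lt_min r0.
move=> y; rewrite -ball_normE /= distrC lt_min => /andP[yr yd]; rewrite distrC.
apply: le_trans (H y (ltW yr)) _; apply: Hd; by rewrite normr_ge0 ltW.
Qed.

Lemma cvg_minus (f g : nat -> R) (l m : R) : f @ \oo --> l -> g @ \oo --> m ->
  (fun k => f k - g k) @ \oo --> l - m.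
Proof. by move=> fl gm; exact: cvgB. Qed.

Lemma cvg_taylor (f g h : nat -> R) (l m p t : R) : f @ \oo --> l -> g @ \oo --> m -> h @ \oo --> p ->
  (fun k => f k - g k - t * h k) @ \oo --> l - m - t * p.
Proof.
move=> fl gm hp; apply: cvg_minus; first exact: cvg_minus.
by apply: cvgM => //; exact: cvg_cst.
Qed.

Variables (V : set 'rV[R]_n) (rho0 t1 a L M B : R) (u : 'rV[R]_n -> R)
  (w : nat -> 'rV[R]_n -> R) (w1 : nat -> 'I_n -> 'rV[R]_n -> R)
  (w2 : nat -> 'I_n -> 'I_n -> 'rV[R]_n -> R).
Hypotheses (rho0_gt0 : 0 < rho0) (t11 : 0 < t1 <= 1) (a01 : 0 < a < 1) (L_ge0 : 0 <= L) (MB : M <= B)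
  (wu : {ae mu, forall x, w k x @[k --> \oo] --> u x}) (wM : forall k y, `|w k y| <= M)
  (wL : forall k x h, fattened V (4 * rho0) x -> `|dl h (w k) x| <= L * `|h|)
  (wJ : forall k x, fattened V rho0 x -> jet_bounds t1 a B (w k) (w1 k) (w2 k) x).

Let a0 : 0 < a. Proof. by case/andP: a01. Qed.
Let t10 : 0 < t1. Proof. by case/andP: t11. Qed.
Let B0 : 0 <= B. Proof. exact: le_trans (le_trans (normr_ge0 _) (wM 0 0)) MB. Qed.

Definition lim_seq (F : nat -> 'rV[R]_n -> R) x : R := lim (F k x @[k --> \oo]).
Let v := lim_seq w.
Let v1 i := lim_seq (fun k => w1 k i).
Let v2 j i := lim_seq (fun k => w2 k j i).

(** Almost everywhere convergence holds on a dense set, and the uniform Lipschitz bound spreads it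
    to every point. *)
Let cvg0 x : fattened V (4 * rho0) x -> w k x @[k --> \oo] --> v x.
Proof.
move=> xV; suff : cvgn (fun k => w k x) by move=> c; exact: c.
apply: cauchy_cvgn => e e0.
have L1 : 0 < L + 1 by rewrite ltr_wpDl.
have d0 : 0 < e / (4 * (L + 1)) by rewrite divr_gt0// mulr_gt0.
have [y wy yx] := ae_dense x wu d0.
have e4 : 0 < e / 4 by rewrite divr_gt0.
have /cvgrPdist_le/(_ _ e4) [K _ HK] := wy.
exists K => k l kK lK; have h1 := HK k kK; have h2 := HK l lK.
have Lb j : `|w j y - w j x| <= e / 4.
  have := wL j (y - x) xV; rewrite /dl [x + _]addrC subrK => /le_trans; apply.
  apply: le_trans (ler_wpM2l L_ge0 yx) _.
  have -> : L * (e / (4 * (L + 1))) = e / 4 * (L / (L + 1)) by field; rewrite gt_eqF.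
  by rewrite ler_piMr ?(ltW e4)// ler_pdivrMr// mul1r lerDl.
have b1 := Lb k; have b2 := Lb l.
move: h1 h2 b1 b2; rewrite /= !ler_norml => /andP[? ?] /andP[? ?] /andP[? ?] /andP[? ?].
by apply/andP; split; lra.
Qed.

Let fat_le (d d' : R) x : fattened V d x -> d <= d' -> fattened V d' x.
Proof. exact: fattenedW. Qed.

Let step_dir x (t : R) i (d d' : R) : fattened V d x -> `|t| <= d' -> fattened V (d + d') (x + t *: e_ i).
Proof.
move=> xd tt; apply: (fattened_step xd); rewrite addrAC subrr add0r.
exact: le_trans (norm_scale_delta t i) tt.
Qed.

(** Each order of differentiation evaluates the previous one at [x + t e_i], so the region of
    validity shrinks from order to order. *)
Let cvg1 x i : fattened V rho0 x -> w1 k i x @[k --> \oo] --> v1 i x.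
Proof.
move=> xV; suff : cvgn (fun k => w1 k i x) by move=> c; exact: c.
have t0 : 0 < Num.min t1 rho0 by rewrite lt_min t10.
apply: (@limit_taylor R (fun k t => w k (x + t *: e_ i)) (fun t => v (x + t *: e_ i)) _ B a (Num.min t1 rho0)) => //.
  move=> t; rewrite le_min => /andP[_ tr]; apply: cvg0; apply: fat_le (step_dir i xV tr) _.
  by have rp := rho0_gt0; lra.
move=> k t; rewrite le_min => /andP[tt1 _]; have [_ _ _ J4] := wJ k xV.
by rewrite scale0r addr0; exact: (J4 t i tt1).1.
Qed.

Let half : rho0 / 2 + rho0 / 2 = rho0. Proof. by field. Qed.

Let fat_half x : fattened V (rho0 / 2) x -> fattened V rho0 x.
Proof. by move=> /fat_le; apply; have rp := rho0_gt0; lra. Qed.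

Let cvg2 x j i : fattened V (rho0 / 2) x -> w2 k j i x @[k --> \oo] --> v2 j i x.
Proof.
move=> xV; suff : cvgn (fun k => w2 k j i x) by move=> c; exact: c.
have t0 : 0 < Num.min t1 (rho0 / 2) by rewrite lt_min t10 divr_gt0.
apply: (@limit_taylor R (fun k t => w1 k j (x + t *: e_ i)) (fun t => v1 j (x + t *: e_ i)) _ B a (Num.min t1 (rho0 / 2))) => //.
  move=> t; rewrite le_min => /andP[_ tr]; apply: cvg1.
  by have := step_dir i xV tr; rewrite half.
move=> k t; rewrite le_min => /andP[tt1 _]; have [_ _ _ J4] := wJ k (fat_half xV).
by rewrite scale0r addr0; exact: (J4 t i tt1).2.
Qed.

Let fat4 x : fattened V rho0 x -> fattened V (4 * rho0) x.
Proof. by move=> /fat_le; apply; have rp := rho0_gt0; lra. Qed.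

Let der0 x i : fattened V (rho0 / 2) x -> is_derive x (e_ i) v (v1 i x).
Proof.
move=> xV; have t0 : 0 < Num.min t1 (rho0 / 2) by rewrite lt_min t10 divr_gt0.
apply: (is_derive_powR B0 a0 t0) => t; rewrite le_min => /andP[tt1 tr].
have c1 : w k (x + t *: e_ i) @[k --> \oo] --> v (x + t *: e_ i).
  by apply: cvg0; apply: fat4; have := step_dir i xV tr; rewrite half.
have c2 : w k x @[k --> \oo] --> v x by apply: cvg0; apply: fat4; exact: fat_half.
apply: (lim_norm_le (cvg_taylor c1 c2 (@cvg1 _ i (fat_half xV)))) => k.
by have [_ _ _ J4] := wJ k (fat_half xV); exact: (J4 t i tt1).1.
Qed.

Let partial1 x i : fattened V (rho0 / 2) x -> partial i v x = v1 i x.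
Proof. by move=> xV; have H := @der0 _ i xV; exact: derive_val. Qed.

Let quart : rho0 / 4 + rho0 / 4 = rho0 / 2. Proof. by field. Qed.

Let fat_quart x : fattened V (rho0 / 4) x -> fattened V (rho0 / 2) x.
Proof. by move=> /fat_le; apply; have rp := rho0_gt0; lra. Qed.

Let der1 x i j : fattened V (rho0 / 4) x -> is_derive x (e_ i) (partial j v) (v2 j i x).
Proof.
move=> xV; have t0 : 0 < Num.min t1 (rho0 / 4) by rewrite lt_min t10 divr_gt0.
have xh := fat_quart xV.
apply: (is_derive_powR B0 a0 t0) => t; rewrite le_min => /andP[tt1 tr].
have xt : fattened V (rho0 / 2) (x + t *: e_ i) by have := step_dir i xV tr; rewrite quart.
rewrite !partial1//.
have c1 := @cvg1 _ j (fat_half xt); have c2 := @cvg1 _ j (fat_half xh).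
apply: (lim_norm_le (cvg_taylor c1 c2 (@cvg2 _ j i xh))) => k.
by have [_ _ _ J4] := wJ k (fat_half xh); exact: (J4 t i tt1).2.
Qed.

Lemma limit_partials (l : seq 'I_n) x : (size l <= 2)%N -> fattened V (rho0 / 4) x ->
  [/\ `|partials l v x| <= B,
     forall y, fattened V (rho0 / 4) y -> `|y - x| <= t1 ->
       `|partials l v y - partials l v x| <= B * `|y - x| `^ a &
     (size l < 2)%N -> forall i, derivable (partials l v) x (e_ i)].
Proof.
move=> l2 xV; have xh := fat_quart xV; have x1 := fat_half xh.
case: l l2 => [|i [|j [|//]]] _ /=.
- have cx := cvg0 (fat4 x1); split=> [|y yV yx|_ i].
  + by apply: (lim_norm_le cx) => k; exact: le_trans (wM k x) MB.
  + have cy := cvg0 (fat4 (fat_half (fat_quart yV))).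
    apply: (lim_norm_le (cvg_minus cy cx)) => k.
    by have [_ _ J3 _] := wJ k x1; have [] := J3 y yx.
  + by have H := @der0 _ i xh; exact: ex_derive.
- rewrite partial1//; have cx := @cvg1 _ i x1; split=> [|y yV yx|_ k].
  + by apply: (lim_norm_le cx) => k; have [J1 _ _ _] := wJ k x1; exact: J1.
  + have yh := fat_quart yV; rewrite partial1//; have cy := @cvg1 _ i (fat_half yh).
    apply: (lim_norm_le (cvg_minus cy cx)) => k.
    by have [_ _ J3 _] := wJ k x1; have [_ J _] := J3 y yx; exact: J.
  + by have H := @der1 _ k i xV; exact: ex_derive.
- have E y : fattened V (rho0 / 4) y -> partial i (partial j v) y = v2 j i y.
    by move=> yV; have H := @der1 _ i j yV; exact: derive_val.
  rewrite (E x xV); have cx := @cvg2 _ j i xh; split=> [|y yV yx|]; last by rewrite ltnn.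
  + by apply: (lim_norm_le cx) => k; have [_ J2 _ _] := wJ k x1; exact: J2.
  + rewrite (E y yV); have cy := @cvg2 _ j i (fat_quart yV).
    apply: (lim_norm_le (cvg_minus cy cx)) => k.
    by have [_ _ J3 _] := wJ k x1; have [_ _ J] := J3 y yx; exact: J.
Qed.

Let closure_fat x : closure V x -> fattened V (rho0 / 8) x.
Proof.
move=> xV; have r8 : 0 < rho0 / 8 by rewrite divr_gt0.
have [y [Vy xy]] := xV _ (nbhsx_ballx x (rho0 / 8) r8).
by exists y => //; move: xy; rewrite -ball_normE /= => /ltW.
Qed.

Let eighth : rho0 / 8 + rho0 / 8 = rho0 / 4. Proof. by field. Qed.

Let closure_quart x : closure V x -> fattened V (rho0 / 4) x.
Proof. by move=> /closure_fat /fat_le; apply; have rp := rho0_gt0; lra. Qed.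

Let partials_continuous l x : (size l <= 2)%N -> closure V x -> {for x, continuous (partials l v)}.
Proof.
move=> l2 xV; have r0 : 0 < Num.min t1 (rho0 / 8) by rewrite lt_min t10 divr_gt0.
apply: (modulus_continuous B0 a0 r0) => y; rewrite le_min => /andP[yt yr].
have [_ H _] := limit_partials l2 (closure_quart xV); apply: H => //.
by have := fattened_step (closure_fat xV) yr; rewrite eighth.
Qed.

(** The jet bounds cover pairs at sup-norm distance at most [t1]; for the others the bound [2 B] is
    divided by [t1^a]. *)
Lemma limit_hoelder l : size l = 2%N ->
  (hoelder_seminorm eucl_dist a V (partials l v) <= ((1 + 2 / t1 `^ a) * B)%:E)%E.
Proof.
move=> l2; apply: ge_ereal_sup => _ [x Vx [y Vy <-]]; rewrite lee_fin.
have ll : (size l <= 2)%N by rewrite l2.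
have xq := closure_quart (subset_closure Vx); have yq := closure_quart (subset_closure Vy).
have [x1 _ _] := limit_partials ll xq; have [y1 Hy _] := limit_partials ll yq.
have ta : 0 < t1 `^ a by exact: powR_gt0.
have C0 : 0 <= (1 + 2 / t1 `^ a) * B.
  by rewrite mulr_ge0// addr_ge0// divr_ge0// ltW.
have [d0|dn] := eqVneq (eucl_dist x y `^ a) 0; first by rewrite d0 invr0 mulr0.
have dp : 0 < eucl_dist x y `^ a by rewrite lt_neqAle eq_sym dn powR_ge0.
rewrite ler_pdivrMr//.
have nd : `|x - y| <= eucl_dist x y by exact: norm_le_eucl.
have [xy|xy] := leP `|x - y| t1.
  apply: le_trans (Hy x xq xy) _; apply: ler_pM; rewrite ?powR_ge0//.
    by rewrite mulrDl mul1r lerDl mulr_ge0// divr_ge0// ltW.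
  by apply: ge0_ler_powR; rewrite ?nnegrE ?(ltW a0) ?eucl_norm_ge0.
apply: le_trans (ler_normB _ _) _; apply: le_trans (lerD x1 y1) _.
have td : t1 `^ a <= eucl_dist x y `^ a.
  apply: ge0_ler_powR; rewrite ?nnegrE ?(ltW a0) ?(ltW t10) ?eucl_norm_ge0//.
  exact: le_trans (ltW xy) nd.
apply: le_trans (_ : (2 / t1 `^ a) * B * t1 `^ a <= _).
  rewrite mulrAC divfK ?gt_eqF// mulr_natl mulr2n//.
apply: ler_pM => //; [by rewrite mulr_ge0// divr_ge0// ltW|exact: ltW|].
by rewrite ler_wpM2r// lerDr.
Qed.

(** The estimates hold on a neighbourhood of the closure, so the partial derivatives are their own
    continuous extensions. *)
Lemma limit_C2alpha : open V -> class_C2alpha a V v.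
Proof.
move=> oV; split.
- move=> l l2 x Vx; have xc := subset_closure Vx; split; first exact: partials_continuous.
  by have [_ _] := limit_partials l2 (closure_quart xc).
- apply: continuous_in_subspaceT => x /set_mem xV; exact: (@partials_continuous [::]).
- move=> l l2; exists (partials l v); split=> //.
  by apply: continuous_in_subspaceT => x /set_mem xV; exact: partials_continuous.
- by move=> l l2; apply: le_lt_trans (limit_hoelder l2) _; exact: ltry.
Qed.

Lemma limit_norm : (C2alpha_norm a V v <=
  ((1 + \sum_(i < n) 1 + \sum_(i < n) \sum_(j < n | (i <= j)%N) (1 + (1 + 2 / t1 `^ a))) * B)%:E)%E.
Proof.
have sup l : (size l <= 2)%N -> (sup_norm V (partials l v) <= B%:E)%E.
  move=> l2; apply: ge_ereal_sup => _ [x Vx <-]; rewrite lee_fin.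
  by have [] := limit_partials l2 (closure_quart (subset_closure Vx)).
have lh i j : (hoelder_seminorm eucl_dist a V (partials [:: i; j] v) <= ((1 + 2 / t1 `^ a) * B)%:E)%E.
  exact: limit_hoelder.
move: (1 + 2 / t1 `^ a) lh => c lh.
rewrite !mulrDl mul1r !EFinD /C2alpha_norm; apply: leeD; first apply: leeD.
- exact: (sup [::]).
- rewrite mulr_suml -sumEFin; apply: lee_sum => i _; rewrite mul1r; exact: (sup [:: i]).
- rewrite mulr_suml -sumEFin; apply: lee_sum => i _.
  rewrite mulr_suml -sumEFin; apply: lee_sum => j _.
  rewrite mulrDl mul1r EFinD; apply: leeD; first exact: (sup [:: i; j]).
  exact: lh.
Qed.

Lemma limit_ae : {ae mu, forall x, closure V x -> u x = v x}.
Proof.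
apply: filterS wu => x wx xV; apply: cvg_unique wx _ => //.
by apply: cvg0; apply: fat4; apply: fat_half; apply: fat_quart; exact: closure_quart.
Qed.
End limit_regularity.

Theorem theorem1p5 (R : realType) (n : nat) (n_gt0 : (0 < n)%N)
  (Omega : set 'rV[R]_n) (Omega_open : open Omega)
  (Omega_bounded : bounded_set Omega)
  (s : R) (s01 : 0 < s < 1) (alpha : R) (alpha01 : 0 < alpha < 1)
  (V : set 'rV[R]_n) (V_domain : domain V) (V_Omega : closure V `<=` Omega) :
  exists C : R, 0 < C /\
    forall (g : 'rV[R]_n -> R -> R) (u : 'rV[R]_n -> R),
      locally_hoelder alpha Omega g ->
      (Linfty_norm setT u < +oo)%E ->
      weak_solution s Omega g u ->
      exists v : 'rV[R]_n -> R,
        [/\ {ae lebesgue_rV R n, forall x, closure V x -> u x = v x},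
            class_C2alpha alpha V v &
            let rho := dist_set V (boundary Omega) in
            let M := fine (Linfty_norm Omega u) in
            let g_norm := hoelder_norm eucl_dist_prod alpha
              (closure (enlarge Omega V (3 / 4 * rho)) `*` `[- M, M])
              (uncurry g) in
            (C2alpha_norm alpha V v <=
               C%:E * (Linfty_norm setT u + g_norm) * (1 + g_norm))%E].
Proof.
have [Vo _ V0] := V_domain; have [v0 Vv0] := V0.
have [rho0 rho00 [geo1 geo2]] := geometry n_gt0 Omega_open Omega_bounded V0 V_Omega.
(* [E] depends only on [Omega] and [V]; the constants below are fixed before [g] and [u] are
   introduced. *)
move: geo1 geo2; set D := enlarge _ _ _ => geo1 geo2; pose E := closure D.
have mE : measurable (E : set 'rV[R]_n).
  rewrite -[E]setCK; apply: measurableC; apply: measurable_open_leb.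
  by apply: closed_openC; exact: closed_closure.
have fatE x : fattened V (7 * rho0) x -> E x.
  by move=> [y Vy xy]; apply: subset_closure; exact: geo1 xy.
have [t1 t11 [C0 C00 HC]] := approximation_estimates n_gt0 s01 alpha01 rho00 Omega_open mE geo2 fatE.
(* [c] counts the terms of [C2alpha_norm]: each supremum costs [B], each seminorm
   [(1 + 2 / t1^alpha) * B]. *)
pose c : R := 1 + \sum_(i < n) 1 + \sum_(i < n) \sum_(j < n | (i <= j)%N) (1 + (1 + 2 / t1 `^ alpha)).
have c0 : 0 < c.
  rewrite /c -addrA ltr_pwDl// addr_ge0 ?sumr_ge0// => i _; apply: sumr_ge0 => j _.
  by rewrite !addr_ge0// divr_ge0// powR_ge0.
exists (c * (C0 + 1)); split; first by rewrite mulr_gt0// ltr_wpDl.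
move=> g u hg uL usol.
have uLO : (Linfty_norm Omega u < +oo)%E by apply: le_lt_trans uL; exact: Linfty_le.
have [uM M0] := Linfty_ae uL; have [uMO MO0] := Linfty_ae uLO.
have {}uM : {ae @leb R n, forall y, `|u y| <= fine (Linfty_norm setT u)}.
  by apply: filterS uM => y; apply.
have LE : Linfty_norm setT u = (fine (Linfty_norm setT u))%:E.
  by rewrite fineK// ge0_fin_numE//; exact: Lnorm_ge0.
have [N N0 ON] := bounded_set_norm Omega_bounded.
set MO := fine (Linfty_norm Omega u) in MO0 uMO *.
pose K := E `*` `[- MO, MO].
have Kp0 : K (v0, 0).
  split=> /=; last by rewrite in_itv/= oppr_le0 MO0.
  by apply: fatE; exists v0 => //; rewrite subrr normr0 mulr_ge0// ltW.
have KE p : K p -> E p.1 /\ `|p.2| <= MO by move=> [Ep]; rewrite /= in_itv/= -ler_norml.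
have KN p : K p -> `|p.1| <= N + MO /\ `|p.2| <= N + MO.
  move=> /KE[Ep pM]; split; last by apply: (le_trans pM); rewrite lerDr.
  by apply: le_trans (ON _ (geo2 _ Ep)) _; rewrite lerDl.
have cK : compact K.
  apply: compact_setX; last exact: segment_compact.
  by apply: (@compact_closure _ _ _ N) => y /subset_closure/geo2; exact: ON.
have KO : K `<=` Omega `*` setT by move=> p /KE[/geo2].
have [G G0 [GE gG gH]] := hoelder_norm_bounds (proj1 (andP alpha01)) Kp0 KN (hg K cK KO).
set M := fine (Linfty_norm setT u) in M0 uM LE.
have inK y t : E y -> `|t| <= MO -> K (y, t).
  by move=> Ey tM; split=> //=; rewrite in_itv/= -ler_norml.
have gG' y t : E y -> `|t| <= MO -> `|g y t| <= G by move=> Ey tM; exact: gG (inK y t Ey tM).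
have gH' y t y' t' : E y -> `|t| <= MO -> E y' -> `|t'| <= MO ->
    `|g y t - g y' t'| <= G * eucl_dist_prod (y, t) (y', t') `^ alpha.
  by move=> Ey tM Ey' t'M; exact: gH (inK y t Ey tM) (inK y' t' Ey' t'M).
have [w [w1 [w2 [wu wM wL wJ]]]] := HC g u M MO G hg usol M0 uM uMO G0 gG' gH'.
(* [C0 + 1] makes [B] dominate [M] too, which bounds the function itself. *)
pose B := (C0 + 1) * (M + G) * (1 + G).
have MG : M <= B.
  rewrite /B -mulrA; apply: le_trans (_ : (M + G) * (1 + G) <= _).
    by rewrite mulrDr mulr1 -addrA lerDl addr_ge0// mulr_ge0// addr_ge0.
  by rewrite ler_peMl ?lerDr// mulr_ge0// addr_ge0.
have JB k x : fattened V rho0 x -> jet_bounds t1 alpha B (w k) (w1 k) (w2 k) x.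
  move=> xV; apply: jet_boundsW (wJ k x xV).
  by rewrite /B -!mulrA ler_wpM2r ?lerDl// mulr_ge0 ?addr_ge0.
have L0 : 0 <= C0 * (M + G) by rewrite mulr_ge0// addr_ge0.
exists (lim_seq w); split.
- exact: (limit_ae rho00 L0 wu wL).
- exact: (limit_C2alpha rho00 t11 alpha01 L0 MG wu wM wL JB Vo).
- move=> rho M' g_norm; have -> : g_norm = G%:E by exact: GE.
  rewrite LE; apply: (@le_trans _ _ (c * (C0 + 1) * (M + G) * (1 + G))%:E); last by [].
  apply: le_trans (limit_norm rho00 t11 alpha01 L0 MG wu wM wL JB) _.
  by rewrite lee_fin /B -/c !mulrA.
Qed.
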